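(* Let $n\ge 1$ and $a_0,\dots,a_n\in\mathbb{C}(z)$ with $a_0a_n\neq 0$, and consider the $q$-difference equation $$a_n(z)y(q^nz)+a_{n-1}(z)y(q^{n-1}z)+\cdots+a_0(z)y(z)=0 .$$ Let $G$ be the difference Galois group over the $\sigma_q$-field $\mathbb{C}(z)$ of the associated companion system $\sigma_q(Y)=AY$. Assume that the equation admits a nonzero solution $g\in\mathbb{C}((z^* ))$. (i) If $n\geq 2$ and $G^{\circ,der}=\mathrm{SL}_n(\mathbb{C})$, then $g(z),g(qz),\dots,g(q^{n-1}z)$ are $\delta$-algebraically independent over $\mathbb{C}(z)$. (ii) If $n\geq 3$ and $G^{\circ,der}=\mathrm{SO}_n(\mathbb{C})$, then $g(z),g(qz),\dots,g(q^{n-2}z)$ are $\delta$-algebraically independent over $\mathbb{C}(z)$. (iii) If $n$ is even and $G^{\circ,der}=\mathrm{Sp}_n(\mathbb{C})$, then $g(z),g(qz),\dots,g(q^{n-1}z)$ are $\delta$-algebraically independent over $\mathbb{C}(z)$.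
   Context: Let $q\in\mathbb{C}^\times$ with $|q|\neq 1$. Let $\mathbb{C}((z^* ))=\bigcup_{j\ge1}\mathbb{C}((z^{1/j}))$. Fix a sequence $(q_j)_{j\ge 1}$ of complex numbers with $q_j^j=q$ and $q_j^l=q_k$ whenever $j=lk$; $\sigma_q$ is the automorphism of $\mathbb{C}((z^* ))$ with $z^{1/j}\mapsto q_jz^{1/j}$ (identity on $\mathbb{C}$), written $f(z)\mapsto f(qz)$, and $\delta=z\frac{d}{dz}$. Elements $f_1,\dots,f_m$ of $\mathbb{C}((z^* ))$ are $\delta$-algebraically independent over $\mathbb{C}(z)$ if there is no nonzero polynomial with coefficients in $\mathbb{C}(z)$ in indeterminates $\delta^k y_i$ ($k\ge0$, $1\le i\le m$) vanishing at $\delta^ky_i=\delta^k(f_i)$. The companion system is $\sigma_q(Y)=AY$ with $A\in\mathrm{GL}_n(\mathbb{C}(z))$ having $1$'s on the superdiagonal, last row $(-a_0/a_n,-a_1/a_n,\dots,-a_{n-1}/a_n)$, and zeros elsewhere. The difference Galois group of $\sigma_q(Y)=AY$ over $\mathbb{C}(z)$: let $R$ be a Picard-Vessiot ring, i.e. a $\mathbb{C}(z)$-algebra with an automorphism extending $\sigma_q$, of the form $R=\mathbb{C}(z)[U,\det(U)^{-1}]$ with $U\in\mathrm{GL}_n(R)$, $\sigma_q(U)=AU$, and having no $\sigma_q$-stable ideals other than $\{0\}$ and $R$. Let $\mathcal{Q}_R$ be its total ring of quotients. Then $G$ is the group of $\mathbb{C}(z)$-automorphisms of $\mathcal{Q}_R$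 commuting with $\sigma_q$, identified with an algebraic subgroup of $\mathrm{GL}_n(\mathbb{C})$ by $\phi\mapsto C(\phi)$, $\phi(U)=UC(\phi)$. It is defined up to conjugation, and equalities such as $G^{\circ,der}=\mathrm{SL}_n(\mathbb{C})$ are meant for a suitable choice of $U$. $G^{\circ}$ is the neutral component of $G$ and $G^{\circ,der}$ its derived subgroup. $\mathrm{SO}_n(\mathbb{C})=\{C\in\mathrm{SL}_n(\mathbb{C}): C^tC=I_n\}$ and, for $n$ even, $\mathrm{Sp}_n(\mathbb{C})=\{C\in\mathrm{GL}_n(\mathbb{C}): C^tJC=J\}$ with $J=\begin{pmatrix}0&I_{n/2}\\-I_{n/2}&0\end{pmatrix}$. *)

(* Defs.v *)
From HB Require Import structures.
From mathcomp Require Import all_boot all_order all_algebra.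
From mathcomp Require Import complex.
From mathcomp Require Import all_classical all_reals all_analysis.
From mathcomp Require Import ring zify.
From mathcomp Require mpoly.
(* the notations of mpoly clash with those of the analysis library *)
Import (canonicals) mpoly.

Set Implicit Arguments.
Unset Strict Implicit.
Unset Printing Implicit Defensive.

Import Order.TTheory GRing.Theory Num.Theory.
Local Open Scope classical_set_scope.
Local Open Scope ring_scope.

Section Cauchy.
Variable F : fieldType.
Implicit Types f g h : nat -> F.

Definition cauchy_prod f g : nat -> F := fun m => \sum_(i < m.+1) f i * g (m - i)%N.

Lemma cauchy_poly f g m n : (m < n)%N ->
  cauchy_prod f g m = (\poly_(i < n) f i * \poly_(i < n) g i)`_m.
Proof.
move=> mn; rewrite coefM; apply: eq_bigr => i _; rewrite !coef_poly.
by rewrite (leq_ltn_trans (leq_subr _ _) mn) (leq_trans (ltn_ord i) mn).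
Qed.

Lemma cauchyC f g : cauchy_prod f g = cauchy_prod g f.
Proof. by apply/funext => m; rewrite !(@cauchy_poly _ _ m m.+1)// mulrC. Qed.

Lemma cauchyA f g h : cauchy_prod f (cauchy_prod g h) = cauchy_prod (cauchy_prod f g) h.
Proof.
apply/funext => m.
have E (u v w : nat -> F) : cauchy_prod u (cauchy_prod v w) m =
  (\poly_(i < m.+1) u i * (\poly_(i < m.+1) v i * \poly_(i < m.+1) w i))`_m.
  rewrite coefM; apply: eq_bigr => i _.
  by rewrite coef_poly ltn_ord (@cauchy_poly _ _ _ m.+1)// ltnS leq_subr.
by rewrite E cauchyC E mulrA mulrC.
Qed.

Lemma cauchyDl f g h : cauchy_prod (f \+ g) h = cauchy_prod f h \+ cauchy_prod g h.
Proof.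
apply/funext => m /=; rewrite /cauchy_prod -big_split/=.
by apply: eq_bigr => i _; rewrite mulrDl.
Qed.

Definition kron (N : nat) : nat -> F := fun i => (i == N)%:R.

Lemma cauchy_kron N f m :
  cauchy_prod (kron N) f m = if (N <= m)%N then f (m - N)%N else 0.
Proof.
rewrite /cauchy_prod /kron; case: leqP => Nm.
  rewrite (bigD1 (inord N : 'I_m.+1))//= inordK// eqxx mul1r big1 ?addr0//.
  move=> i /eqP iN; case: eqP => [iE|]; last by rewrite mul0r.
  by case: iN; apply: val_inj; rewrite /= inordK.
rewrite big1// => i _; case: eqP => [iE|]; last by rewrite mul0r.
by have := ltn_ord i; rewrite iE; lia.
Qed.

Lemma cauchy1 f : cauchy_prod (kron 0) f = f.
Proof. by apply/funext => m; rewrite cauchy_kron subn0. Qed.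

Fixpoint cauchy_inv_seq f (m : nat) : seq F :=
  if m is m'.+1 then
    let s := cauchy_inv_seq f m' in
    rcons s ((f 0%N)^-1 *
             ((m' == 0%N)%:R - \sum_(i < m') f i.+1 * s`_(m' - i.+1)))
  else [::].

Lemma cauchy_invP f : f 0%N != 0 ->
  exists g, cauchy_prod f g = kron 0.
Proof.
move=> f0; pose s := cauchy_inv_seq f; pose g m := (s m.+1)`_m.
have ss m : size (s m) = m by elim: m => //= m IH; rewrite size_rcons IH.
have sg m i : (i < m)%N -> (s m)`_i = g i.
  elim: m => // m IH; rewrite ltnS leq_eqVlt => /predU1P[->//|im].
  by rewrite /= nth_rcons ss im IH.
exists g; apply/funext => m; rewrite /cauchy_prod big_ord_recl subn0 /=.
rewrite {1}/g /= nth_rcons ss ltnn eqxx mulVKf//.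
rewrite (eq_bigr (fun i : 'I_m => f i.+1 * g (m - i.+1)%N)) ?subrK// => i _.
by rewrite sg// ltn_subrL/=; case: m i => [[]|].
Qed.
End Cauchy.
Arguments kron {F} N.

Section PuiseuxSupport.
Variable F : fieldType.
Implicit Types f g h : rat -> F.

(* f : rat -> F stands for the formal sum of the f r z^r.  It lies in
   F((z^* )) = \bigcup_(j >= 1) F((z^{1/j})) when its exponents belong to
   (1/j)Z for some j >= 1 and are bounded below. *)
Definition puiseux_supp f : Prop :=
  exists2 j : nat, (0 < j)%N &
  exists N : int, forall r, f r != 0 ->
    exists2 k : int, N <= k & r = k%:~R / j%:R.

Definition puiseux_mul f g : rat -> F :=
  fun r => \sum_(s \in [set: rat]) f s * g (r - s).

Definition puiseux_monomial (c : F) (e : rat) : rat -> F :=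
  fun r => if r == e then c else 0.

(* \sum_(a >= 0) u_a z^((a - N) / j) *)
Definition ser (j N : nat) (u : nat -> F) : rat -> F := fun r =>
  let x := r * j%:R + N%:R in
  if x \is a Num.nat then u (Num.truncn x) else 0.

Lemma natj_neq0 (j : nat) : (0 < j)%N -> j%:R != 0 :> rat.
Proof. by rewrite pnatr_eq0 lt0n. Qed.

Lemma serE j N u (a : nat) : (0 < j)%N -> ser j N u ((a%:R - N%:R) / j%:R) = u a.
Proof. by move=> /natj_neq0 j0; rewrite /ser divfK// subrK natr_nat natrK. Qed.

Lemma ser_neq0 j N u r : (0 < j)%N -> ser j N u r != 0 ->
  exists a : nat, r = (a%:R - N%:R) / j%:R.
Proof.
move=> /natj_neq0 j0; rewrite /ser; case: ifP => [/natrP[a aE] _|]; last by rewrite eqxx.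
by exists a; rewrite -aE addrK mulfK.
Qed.

Lemma ser_supp j N u : (0 < j)%N -> puiseux_supp (ser j N u).
Proof.
move=> j0; exists j => //; exists (- N%:Z) => r /(ser_neq0 j0)[a ->].
exists (a%:Z - N%:Z); first lia.
by rewrite intrB.
Qed.

Lemma eq_ser j N u f : (0 < j)%N ->
  (forall r, f r != 0 -> exists a : nat, r = (a%:R - N%:R) / j%:R) ->
  (forall a : nat, f ((a%:R - N%:R) / j%:R) = u a) -> f = ser j N u.
Proof.
move=> j0 fs fE; apply/funext => r.
have [[a ->]|nr] := pselect (exists a : nat, r = (a%:R - N%:R) / j%:R).
  by rewrite serE.
have /eqP-> : f r == 0 by apply: contra_notT nr => /fs.
by symmetry; apply/eqP; apply: contra_notT nr => /(ser_neq0 j0).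
Qed.

Lemma supp_ser f : puiseux_supp f -> exists2 j : nat, (0 < j)%N &
  exists N, forall l M, (0 < l)%N -> (l * N <= M)%N ->
  exists u, f = ser (l * j) M u.
Proof.
move=> [j j0 [N fN]]; exists j => //; exists `|N|%N => l M l0 NM.
exists (fun a => f ((a%:R - M%:R) / (l * j)%:R)).
apply: eq_ser => //; first by rewrite muln_gt0 l0.
move=> r /fN[k Nk ->].
have : (0 <= l%:Z * k + M%:Z) by nia.
case E : (l%:Z * k + M%:Z) => [a|]// _; exists a.
rewrite -[a%:R]/((Posz a)%:~R) -E intrD intrM addrK natrM.
by rewrite -[l%:~R]/(l%:R) -mulf_div divff ?mul1r// natj_neq0.
Qed.

Lemma supp_ser3 f g h : puiseux_supp f -> puiseux_supp g -> puiseux_supp h ->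
  exists2 j : nat, (0 < j)%N & exists N u v w,
  [/\ f = ser j N u, g = ser j N v & h = ser j N w].
Proof.
move=> /supp_ser[j j0 [N fN]] /supp_ser[j' j'0 [N' gN]] /supp_ser[j'' j''0 [N'' hN]].
exists (j' * j'' * j)%N; first by rewrite !muln_gt0 j0 j'0 j''0.
pose M := (j' * j'' * N + j * j'' * N' + j * j' * N'')%N.
have [u uE] : exists u, f = ser (j' * j'' * j) M u.
  apply: fN; rewrite ?muln_gt0 ?j0 ?j'0 ?j''0 // /M; nia.
have [v vE] : exists v, g = ser (j * j'' * j') M v.
  apply: gN; rewrite ?muln_gt0 ?j0 ?j'0 ?j''0 // /M; nia.
have [w wE] : exists w, h = ser (j * j' * j'') M w.
  apply: hN; rewrite ?muln_gt0 ?j0 ?j'0 ?j''0 // /M; nia.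
exists M, u, v, w; split => //; first by rewrite vE; congr ser; lia.
by rewrite wE; congr ser; lia.
Qed.

Lemma mul_ser j N M u v : (0 < j)%N ->
  puiseux_mul (ser j N u) (ser j M v) = ser j (N + M) (cauchy_prod u v).
Proof.
move=> j0; have jn := natj_neq0 j0.
have nz r s : ser j N u s * ser j M v (r - s) != 0 -> exists a b : nat,
    s = (a%:R - N%:R) / j%:R /\ r = ((a + b)%:R - (N + M)%:R) / j%:R.
  rewrite mulf_eq0 negb_or => /andP[/(ser_neq0 j0)[a aE] /(ser_neq0 j0)[b bE]].
  exists a, b; split => //; rewrite -[LHS](subrK s) bE aE !natrD; field.
  by rewrite jn.
apply: eq_ser => // [r|m].
  have [[s /nz[a [b [_ rE]]]] _|no] :=
    pselect (exists s, ser j N u s * ser j M v (r - s) != 0).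
    by exists (a + b)%N.
  rewrite /puiseux_mul fsbig1 ?eqxx// => s _.
  by apply/eqP; apply: contra_notT no => ?; exists s.
pose e (a : nat) : rat := (a%:R - N%:R) / j%:R.
have e_inj : injective e.
  move=> a b /(congr1 (fun x => x * j%:R + N%:R)).
  by rewrite /e !divfK// !subrK => /eqP; rewrite eqr_nat => /eqP.
rewrite /puiseux_mul (fsbigE (map e (iota 0 m.+1))) ?map_inj_uniq ?iota_uniq//.
  rewrite big_map /cauchy_prod -(big_mkord xpredT (fun i => u i * v (m - i)%N)).
  rewrite /index_iota subn0 (eq_bigl xpredT) => [|a]; last by rewrite in_setT.
  rewrite [LHS]big_seq [RHS]big_seq; apply: eq_bigr => a.
  rewrite mem_iota add0n ltnS => /= am; rewrite /e serE//; congr (_ * _).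
  rewrite -(serE M v (m - a) j0); congr ser.
  by rewrite natrD natrB//; field; rewrite jn.
move=> s _; apply: contraNeq => /nz[a [b [-> mE]]].
suff abm : m = (a + b)%N by apply/mapP; exists a => //; rewrite mem_iota; lia.
move: mE => /(congr1 (fun x => x * j%:R + (N + M)%:R)).
by rewrite !divfK// !subrK => /eqP; rewrite eqr_nat => /eqP.
Qed.

Lemma add_ser j N u v : ser j N u \+ ser j N v = ser j N (u \+ v).
Proof. by apply/funext => r; rewrite /ser/=; case: ifP => // _; rewrite addr0. Qed.

Lemma opp_ser j N u : \- ser j N u = ser j N (\- u).
Proof. by apply/funext => r; rewrite /ser/=; case: ifP => // _; rewrite oppr0. Qed.

Lemma monomialE j (k : nat) c : (0 < j)%N ->
  puiseux_monomial c (k%:R / j%:R) = ser j 0 (fun i => if i == k then c else 0).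
Proof.
move=> j0; apply: eq_ser => // [r|a]; rewrite /puiseux_monomial.
  by case: (r =P _) => [-> _|]; [exists k; rewrite subr0 | rewrite eqxx].
by rewrite subr0 (inj_eq (mulIf _)) ?invr_eq0 ?natj_neq0// eqr_nat.
Qed.


Lemma monomial_supp c e : puiseux_supp (puiseux_monomial c e).
Proof.
exists `|denq e|%N; first by rewrite absz_gt0 denq_neq0.
exists (numq e) => r; rewrite /puiseux_monomial.
case: (r =P e) => [-> _|]; last by rewrite eqxx.
exists (numq e) => //.
by rewrite -[`|denq e|%:R]/((Posz `|denq e|)%:~R) absz_denq divq_num_den.
Qed.

Lemma puiseux_mul_supp f g :
  puiseux_supp f -> puiseux_supp g -> puiseux_supp (puiseux_mul f g).
Proof.
move=> fP gP; have [j j0 [N [u [v [_ [-> -> _]]]]]] := supp_ser3 fP gP gP.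
by rewrite mul_ser//; exact: ser_supp.
Qed.

Definition puiseux_pred := [pred f : rat -> F | `[< puiseux_supp f >]].

Lemma puiseux_zmod_closed : zmod_closed puiseux_pred.
Proof.
split=> [|f g]; rewrite !inE.
  by exists 1%N => //; exists 0 => r; rewrite eqxx.
move=> fP gP.
have [j j0 [N [u [v [_ [-> -> _]]]]]] := supp_ser3 fP gP gP.
rewrite -[_ - _]/(ser j N u \+ (\- ser j N v)) opp_ser add_ser.
exact: ser_supp.
Qed.

HB.instance Definition _ :=
  GRing.isZmodClosed.Build (rat -> F) puiseux_pred puiseux_zmod_closed.

Record puiseux := Puiseux {
  pcoef :> rat -> F;
  puiseuxP : pcoef \in puiseux_pred }.

HB.instance Definition _ := [isSub for pcoef].
HB.instance Definition _ := [Choice of puiseux by <:].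
HB.instance Definition _ := [SubChoice_isSubZmodule of puiseux by <:].

Lemma puiseux_suppP (f : puiseux) : puiseux_supp f.
Proof. exact/asboolP/(puiseuxP f). Qed.

Definition mkpuiseux f (fP : puiseux_supp f) : puiseux := Puiseux (asboolT fP).

Definition pmonomial c e : puiseux := mkpuiseux (monomial_supp c e).

Definition pmul (f g : puiseux) : puiseux :=
  mkpuiseux (puiseux_mul_supp (puiseux_suppP f) (puiseux_suppP g)).

Lemma puiseux_ext (f g : puiseux) : f = g :> (rat -> F) -> f = g.
Proof. exact: val_inj. Qed.

Lemma puiseux_ser3 (f g h : puiseux) :
  exists2 j : nat, (0 < j)%N & exists N u v w,
  [/\ f = ser j N u :> (rat -> F), g = ser j N v :> (rat -> F) &
      h = ser j N w :> (rat -> F)].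
Proof. by apply: supp_ser3; exact: puiseux_suppP. Qed.

Lemma pone_ser j N : (0 < j)%N ->
  pmonomial 1 0 = ser j N (kron N) :> (rat -> F).
Proof.
move=> j0; apply: eq_ser => //= [r|a]; rewrite /puiseux_monomial.
  by case: (r =P _) => [-> _|]; [exists N; rewrite subrr mul0r|rewrite eqxx].
rewrite mulf_eq0 invr_eq0 (negbTE (natj_neq0 j0)) orbF subr_eq0 eqr_nat /kron.
by case: eqP.
Qed.

Lemma pmulA : associative pmul.
Proof.
move=> f g h; apply: puiseux_ext => /=.
have [j j0 [N [u [v [w [-> -> ->]]]]]] := puiseux_ser3 f g h.
by rewrite !mul_ser// addnA cauchyA.
Qed.

Lemma pmulC : commutative pmul.
Proof.
move=> f g; apply: puiseux_ext => /=.
have [j j0 [N [u [v [_ [-> -> _]]]]]] := puiseux_ser3 f g g.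
by rewrite !mul_ser// cauchyC.
Qed.

Lemma pmul1 : left_id (pmonomial 1 0) pmul.
Proof.
move=> f; apply: puiseux_ext.
have [j j0 [N [u [_ [_ [fE _ _]]]]]] := puiseux_ser3 f f f.
rewrite [LHS]/= -[puiseux_monomial _ _]/(pmonomial 1 0 : _ -> _).
by rewrite (pone_ser 0 j0) fE mul_ser// cauchy1.
Qed.

Lemma pmulDl : left_distributive pmul +%R.
Proof.
move=> f g h; apply: puiseux_ext => /=.
rewrite -[LHS]/(puiseux_mul (f \+ g) h).
rewrite -[RHS]/(puiseux_mul f h \+ puiseux_mul g h).
have [j j0 [N [u [v [w [-> -> ->]]]]]] := puiseux_ser3 f g h.
by rewrite !add_ser !mul_ser// add_ser cauchyDl.
Qed.

Lemma pone_neq0 : pmonomial 1 0 != 0.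
Proof.
apply/eqP => /(congr1 (fun f : puiseux => f 0)) /=.
by rewrite /puiseux_monomial eqxx => /eqP; rewrite oner_eq0.
Qed.

HB.instance Definition _ := GRing.Zmodule_isComNzRing.Build puiseux
  pmulA pmulC pmul1 pmulDl pone_neq0.

Lemma puiseux_inv_ex (f : puiseux) : f != 0 -> exists g : puiseux, g * f = 1.
Proof.
move=> f0; have [j j0 [N [u [_ [_ [fE _ _]]]]]] := puiseux_ser3 f f f.
have exk : exists k, u k != 0.
  apply/not_existsP => u0; move/eqP: f0; apply; apply: puiseux_ext.
  rewrite fE; apply/funext => r; rewrite /ser; case: ifP => // _.
  by have /negP := u0 (Num.truncn (r * j%:R + N%:R)); rewrite negbK => /eqP.
pose k := ex_minn exk.
have [uk um] : u k != 0 /\ forall i, (i < k)%N -> u i = 0.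
  rewrite /k; case: ex_minnP => k' uk' k'm; split => // i ik; apply/eqP.
  by apply: contraLR ik => /k'm; rewrite -leqNgt.
pose v i := u (k + i)%N.
have [w gE] : exists w, cauchy_prod v w = kron 0.
  by apply: cauchy_invP; rewrite /v addn0.
have uE : u = cauchy_prod (kron k) v.
  apply/funext => m; rewrite cauchy_kron; case: leqP => [km|/um//].
  by rewrite /v subnKC.
exists (mkpuiseux (ser_supp k (cauchy_prod (kron N) w) j0)).
apply: puiseux_ext; rewrite [LHS]/= fE mul_ser// [RHS](pone_ser (k + N) j0).
congr ser; rewrite uE -cauchyA (cauchyC (kron k)) (cauchyA w) (cauchyC w) gE.
rewrite cauchy1; apply/funext => m; rewrite cauchy_kron /kron.
case: leqP => Nm; last by case: eqP => // mE; move: Nm; rewrite mE; lia.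
by congr (_%:R); congr nat_of_bool; lia.
Qed.

Definition puiseux_inv (f : puiseux) : puiseux :=
  if pselect (f != 0) is left f0 then projT1 (cid (puiseux_inv_ex f0)) else 0.

Lemma pmulV (f : puiseux) : f != 0 -> puiseux_inv f * f = 1.
Proof. by rewrite /puiseux_inv; case: pselect => // f0 _; case: cid. Qed.

Lemma puiseux_inv0 : puiseux_inv 0 = 0.
Proof.
by rewrite /puiseux_inv; case: pselect => // a; exfalso; rewrite eqxx in a.
Qed.

HB.instance Definition _ := GRing.ComNzRing_isField.Build puiseux pmulV puiseux_inv0.


Definition puiseux_of_poly (p : {poly F}) : puiseux :=
  mkpuiseux (ser_supp 0 (fun i => p`_i) (ltn0Sn 0)).

Lemma puiseux_of_poly_zmod_morphism : zmod_morphism puiseux_of_poly.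
Proof.
move=> p r; apply: puiseux_ext; rewrite /=.
rewrite -[RHS]/(ser 1 0 (fun i => p`_i) \+ (\- ser 1 0 (fun i => r`_i))).
by rewrite opp_ser add_ser; congr ser; apply/funext => i; rewrite /= coefB.
Qed.

Lemma puiseux_of_poly_monoid_morphism : monoid_morphism puiseux_of_poly.
Proof.
split=> [|p r]; apply: puiseux_ext.
  rewrite [RHS](pone_ser 0 (ltn0Sn 0)) /=; congr ser.
  by apply/funext => i; rewrite coef1.
rewrite [RHS]mul_ser//=; congr ser.
by apply/funext => i; rewrite coefM.
Qed.

HB.instance Definition _ := GRing.isZmodMorphism.Build {poly F} puiseux
  puiseux_of_poly puiseux_of_poly_zmod_morphism.
HB.instance Definition _ := GRing.isMonoidMorphism.Build {poly F} puiseux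
  puiseux_of_poly puiseux_of_poly_monoid_morphism.

Lemma puiseux_of_poly_inj : injective puiseux_of_poly.
Proof.
move=> p r /(congr1 pcoef) pr; apply/polyP => i.
have := congr1 (fun f : rat -> F => f ((i%:R - 0%:R) / 1%:R)) pr.
by rewrite /= !serE.
Qed.

End PuiseuxSupport.

Section FracLift.
Variables (D : idomainType) (E : fieldType).

(* the extension to the field of fractions of an injective ring morphism *)
Definition frac_lift (f : D -> E) (x : {fraction D}) : E :=
  f (repr x).1 / f (repr x).2.

Lemma frac_num_den (x : {fraction D}) :
  x = FracField.tofrac (repr x).1 / FracField.tofrac (repr x).2.
Proof.
have dn0 : FracField.tofrac (repr x).2 != 0 :> {fraction D}.
  by rewrite tofrac_eq0 denom_ratioP.
apply: (mulIf dn0); rewrite divfK//.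
rewrite -[x in x * _]reprK; unlock FracField.tofrac.
rewrite -[LHS]FracField.pi_mul; apply/eqmodP.
rewrite /= FracField.equivfE /FracField.mulf /=.
by rewrite !numden_Ratio ?mulr1 ?denom_ratioP ?oner_neq0// mulrC.
Qed.

End FracLift.

Section FracLiftTheory.
Variables (D : idomainType) (E : fieldType) (f : {rmorphism D -> E}).
Hypothesis f_inj : injective f.
Local Notation tofrac := (@FracField.tofrac D).

Let fneq0 d : d != 0 -> f d != 0.
Proof. by rewrite -(inj_eq f_inj) rmorph0. Qed.

Lemma frac_liftE (a b : D) : b != 0 ->
  frac_lift f (tofrac a / tofrac b) = f a / f b.
Proof.
move=> b0; rewrite /frac_lift; pose x := tofrac a / tofrac b; rewrite -/x.
have d0 : (repr x).2 != 0 by exact: denom_ratioP.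
apply/eqP; rewrite eqr_div ?fneq0// -!rmorphM (inj_eq f_inj).
by rewrite -tofrac_eq !rmorphM -eqr_div ?tofrac_eq0// -frac_num_den.
Qed.

Lemma frac_lift_tofrac (a : D) : frac_lift f (tofrac a) = f a.
Proof.
by rewrite -[tofrac a]divr1 -(rmorph1 tofrac) frac_liftE ?oner_neq0// rmorph1 divr1.
Qed.

Lemma frac_lift_zmod_morphism : zmod_morphism (frac_lift f).
Proof.
move=> x y; rewrite (frac_num_den x) (frac_num_den y).
have x0 := denom_ratioP (repr x); have y0 := denom_ratioP (repr y).
rewrite -mulNr -rmorphN addf_div ?tofrac_eq0// -!rmorphM -rmorphD.
rewrite !frac_liftE ?mulf_neq0// rmorphD !rmorphM rmorphN -addf_div ?fneq0//.
by rewrite mulNr.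
Qed.

Lemma frac_lift_monoid_morphism : monoid_morphism (frac_lift f).
Proof.
split=> [|x y]; first by rewrite -(rmorph1 tofrac) frac_lift_tofrac rmorph1.
rewrite (frac_num_den x) (frac_num_den y).
have x0 := denom_ratioP (repr x); have y0 := denom_ratioP (repr y).
rewrite mulf_div -!rmorphM !frac_liftE ?mulf_neq0// !rmorphM.
by rewrite -mulf_div.
Qed.

End FracLiftTheory.

Section RationalFunctions.
Variable F : fieldType.
Local Notation K := {fraction {poly F}}.
Local Notation tofrac := (@FracField.tofrac {poly F}).

(* the inclusion of F(z) in F((z^* )) *)
Definition puiseux_of_frac : K -> puiseux F := frac_lift (@puiseux_of_poly F).

HB.instance Definition _ := GRing.isZmodMorphism.Build K (puiseux F)
  puiseux_of_frac (frac_lift_zmod_morphism (@puiseux_of_poly_inj F)).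
HB.instance Definition _ := GRing.isMonoidMorphism.Build K (puiseux F)
  puiseux_of_frac (frac_lift_monoid_morphism (@puiseux_of_poly_inj F)).

(* f(z) |-> f(qz) on F(z), for q != 0 *)
Definition frac_sigma (q : F) : K -> K :=
  frac_lift (fun p : {poly F} => tofrac (p \Po (q *: 'X))).

(* f(z) |-> f(qz) on F((z^* )), where qs j is the chosen j-th root of q: the
   monomial z^(k/j) goes to (qs j)^k z^(k/j). Writing the exponent r in lowest
   terms is harmless when (qs (l * k)) ^+ l = qs k for all l, k >= 1. *)
Definition qpow (qs : nat -> F) (r : rat) : F := qs `|denq r|%N ^ numq r.

Lemma puiseux_sigma_supp (qs : nat -> F) (f : puiseux F) :
  puiseux_supp (fun r => qpow qs r * f r).
Proof.
have [j j0 [N fN]] := puiseux_suppP f; exists j => //; exists N => r.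
by rewrite mulf_eq0 negb_or => /andP[_ /fN].
Qed.

Definition puiseux_sigma (qs : nat -> F) (f : puiseux F) : puiseux F :=
  mkpuiseux (puiseux_sigma_supp qs f).

Lemma puiseux_delta_supp (f : puiseux F) :
  puiseux_supp (fun r => ratr r * f r).
Proof.
have [j j0 [N fN]] := puiseux_suppP f; exists j => //; exists N => r.
by rewrite mulf_eq0 negb_or => /andP[_ /fN].
Qed.

(* z d/dz *)
Definition puiseux_delta (f : puiseux F) : puiseux F :=
  mkpuiseux (puiseux_delta_supp f).

(* A differential polynomial involves finitely many of the indeterminates
   delta^k y_i, hence is a polynomial P in those with k < N for some N; these
   are numbered by enum_val. *)
Definition delta_alg_independent (m : nat) (f : 'I_m -> puiseux F) : Prop :=
  forall (N : nat) (P : mpoly.mpoly #|{: 'I_m * 'I_N}| K),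
    mpoly.mmap puiseux_of_frac
      (fun l : 'I_#|{: 'I_m * 'I_N}| =>
         let ik := enum_val l in iter ik.2 puiseux_delta (f ik.1)) P = 0 ->
    P = 0.

End RationalFunctions.

Section SigmaTheory.
Variables (F : fieldType) (q : F) (qs : nat -> F).
Hypothesis q_neq0 : q != 0.
Hypothesis qs_root : forall j, (0 < j)%N -> qs j ^+ j = q.
Hypothesis qs_compat : forall k l, (0 < k)%N -> (0 < l)%N ->
  qs (l * k)%N ^+ l = qs k.

Lemma qs_neq0 j : (0 < j)%N -> qs j != 0.
Proof.
move=> j0; apply: contra_neq q_neq0 => qj; rewrite -(qs_root j0) qj.
by rewrite expr0n gtn_eqF.
Qed.

Lemma qpowE (k : int) (j : nat) : (0 < j)%N ->
  qpow qs (k%:~R / j%:R) = qs j ^ k.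
Proof.
move=> j0; set r := _ / _; rewrite /qpow.
have d0 : (0 < `|denq r|)%N by rewrite absz_gt0 denq_neq0.
have E : k * denq r = numq r * j%:Z.
  apply: (@intr_inj rat); rewrite !intrM.
  apply/eqP; rewrite -eqr_div ?intr_eq0 ?denq_neq0 -?lt0n ?natj_neq0//.
  by rewrite divq_num_den.
have /dvdnP[l jE] : (`|denq r| %| j)%N.
  rewrite -(@Gauss_dvdr _ `|numq r|) 1?coprime_sym ?coprime_num_den//.
  have := congr1 absz E; rewrite !abszM /= => <-; exact: dvdn_mull.
have l0 : (0 < l)%N by case: l jE j0 => // ->.
have kE : k = numq r * l%:Z.
  apply: (@mulIf _ (denq r)); rewrite ?denq_neq0// E jE PoszM absz_denq; ring.
by rewrite jE kE mulrC -exprz_exp -exprnP -(qs_compat d0 l0).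
Qed.

Lemma puiseux_sigma_ser j N u : (0 < j)%N ->
  (fun r => qpow qs r * ser j N u r) =
    ser j N (fun a => qs j ^ (a%:Z - N%:Z) * u a).
Proof.
move=> j0; apply: eq_ser => // [r|a].
  by rewrite mulf_eq0 negb_or => /andP[_ /ser_neq0]; exact.
by rewrite serE// -(qpowE _ j0) intrB.
Qed.

Lemma puiseux_sigma_zmod_morphism : zmod_morphism (puiseux_sigma qs).
Proof.
move=> f g; apply: puiseux_ext; apply/funext => r /=.
by rewrite -mulrBr.
Qed.

Lemma puiseux_sigma_monoid_morphism : monoid_morphism (puiseux_sigma qs).
Proof.
split=> [|f g]; apply: puiseux_ext => /=.
  apply/funext => r; rewrite /puiseux_monomial.
  by case: eqP => [->|]; rewrite ?mulr0// mulr1 /qpow expr0z.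
have [j j0 [N [u [v [_ [-> -> _]]]]]] := puiseux_ser3 f g g.
rewrite mul_ser// !puiseux_sigma_ser// mul_ser//; congr ser.
apply/funext => m; rewrite /cauchy_prod mulr_sumr; apply: eq_bigr => i _.
rewrite mulrACA -expfzDr ?qs_neq0//; congr (_ ^ _ * _).
by have := ltn_ord i; lia.
Qed.

Lemma puiseux_sigma_monomial j : (0 < j)%N ->
  puiseux_sigma qs (pmonomial 1 (j%:R^-1)) = pmonomial (qs j) (j%:R^-1).
Proof.
move=> j0; apply: puiseux_ext; apply/funext => r /=; rewrite /puiseux_monomial.
case: eqP => [->|]; rewrite ?mulr0// mulr1 -[_^-1]mul1r.
by rewrite -[1]/(1%:~R) qpowE// expr1z.
Qed.

Lemma puiseux_sigma_poly (p : {poly F}) :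
  puiseux_sigma qs (puiseux_of_poly p) = puiseux_of_poly (p \Po (q *: 'X)).
Proof.
apply: puiseux_ext; rewrite /= puiseux_sigma_ser//; congr ser.
apply/funext => a; rewrite subr0 -exprnP -[qs 1]expr1 qs_root//.
rewrite comp_polyE coef_sum; under eq_bigr do rewrite exprZn !coefZ coefXn.
have [ap|pa] := ltnP a (size p).
  rewrite (bigD1 (Ordinal ap))//= eqxx mulr1 big1 ?addr0 1?mulrC// => i.
  by rewrite -val_eqE /= eq_sym => /negbTE ->; rewrite !mulr0.
rewrite nth_default// mulr0 big1// => i _.
by rewrite gtn_eqF ?(leq_trans (ltn_ord i))// !mulr0.
Qed.

Lemma scale_comp_inj : injective (fun p : {poly F} => p \Po (q *: 'X)).
Proof.
move=> p r /(congr1 (fun s => s \Po (q^-1 *: 'X))).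
rewrite -!comp_polyA !comp_polyZ !comp_polyX scalerA mulfV// scale1r.
by rewrite !comp_polyXr.
Qed.

Lemma puiseux_sigma_frac (x : {fraction {poly F}}) :
  puiseux_sigma qs (puiseux_of_frac x) = puiseux_of_frac (frac_sigma q x).
Proof.
have [_ sM] := puiseux_sigma_monoid_morphism.
have pE (p : {poly F}) : puiseux_of_frac (FracField.tofrac p) = puiseux_of_poly p.
  by rewrite /puiseux_of_frac frac_lift_tofrac//; exact: puiseux_of_poly_inj.
rewrite [frac_sigma q x]/(_ / _) rmorphM fmorphV /= !pE -!puiseux_sigma_poly.
rewrite {1}/puiseux_of_frac /frac_lift.
have d0 := denom_ratioP (repr x).
have pd0 : puiseux_of_poly (repr x).2 != 0.
  by rewrite -(rmorph0 (@puiseux_of_poly F)) (inj_eq (@puiseux_of_poly_inj F)).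
have sd0 : puiseux_sigma qs (puiseux_of_poly (repr x).2) != 0.
  rewrite puiseux_sigma_poly -(rmorph0 (@puiseux_of_poly F)).
  rewrite (inj_eq (@puiseux_of_poly_inj F)) -(comp_poly0 (q *: 'X)).
  by rewrite (inj_eq scale_comp_inj).
by apply: (mulIf sd0); rewrite -sM !divfK.
Qed.

End SigmaTheory.

Lemma puiseux_deltaM (F : numFieldType) (f g : puiseux F) :
  puiseux_delta (f * g) = puiseux_delta f * g + f * puiseux_delta g.
Proof.
have dser j N (u : nat -> F) : (0 < j)%N -> (fun r => ratr r * ser j N u r) =
    ser j N (fun a => ratr ((a%:R - N%:R) / j%:R) * u a).
  move=> j0; apply: eq_ser => // [r|a]; last by rewrite serE.
  by rewrite mulf_eq0 negb_or => /andP[_ /ser_neq0]; exact.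
apply: puiseux_ext => /=.
rewrite -[RHS]/(puiseux_mul (fun r => ratr r * f r) g \+
                puiseux_mul f (fun r => ratr r * g r)).
have [j j0 [N [u [v [_ [-> -> _]]]]]] := puiseux_ser3 f g g.
rewrite mul_ser// !dser// !mul_ser// add_ser; congr ser; apply/funext => m /=.
rewrite /cauchy_prod mulr_sumr -big_split; apply: eq_bigr => i _ /=.
have -> : (m%:R - (N + N)%:R) / j%:R =
    (i%:R - N%:R) / j%:R + ((m - i)%:R - N%:R) / j%:R :> rat.
  by rewrite -mulrDl natrD natrB -1?ltnS//; congr (_ / _); ring.
by rewrite rmorphD /=; ring.
Qed.

Section Zariski.
Variables (F : fieldType) (n : nat).

(* 'M[F]_n seen as the affine space F^(n * n), with its Zariski topology; the
   topology of the open set GL_n is the induced one. *)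
Definition zariski : Type := 'M[F]_n.

HB.instance Definition _ := Choice.on zariski.

Definition mx_meval (p : mpoly.mpoly (n * n) F) (M : 'M[F]_n) : F :=
  mpoly.meval (fun k => mxvec M 0 k) p.

Definition zariski_open : set_system zariski := [set O |
  exists P : set (mpoly.mpoly (n * n) F),
    O = [set M | exists2 p, P p & mx_meval p M != 0]].

Lemma zariski_openT : zariski_open setT.
Proof.
exists [set 1]; apply/seteqP; split=> // M _.
by exists 1 => //; rewrite /mx_meval mpoly.meval1 oner_neq0.
Qed.

Lemma zariski_openI : setI_closed zariski_open.
Proof.
move=> _ _ [P ->] [Q ->].
exists [set pr | exists p r, [/\ P p, Q r & pr = p * r]].
apply/seteqP; split=> M /=.
  move=> [[p Pp pM] [r Qr rM]]; exists (p * r); first by exists p, r.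
  by rewrite /mx_meval mpoly.mevalM mulf_neq0.
move=> [_ [p [r [Pp Qr ->]]]].
rewrite /mx_meval mpoly.mevalM mulf_eq0 negb_or => /andP[pM rM].
by split; [exists p | exists r].
Qed.

Lemma zariski_open_bigU (I : Type) (f : I -> set zariski) :
  (forall i, zariski_open (f i)) -> zariski_open (\bigcup_i f i).
Proof.
move=> /choice[P fP]; exists (\bigcup_i P i).
apply/seteqP; split=> [M [i _]|M [p [i _ Pp] pM]].
  by rewrite fP => -[p Pp pM]; exists p => //; exists i.
by exists i => //; rewrite fP; exists p.
Qed.

HB.instance Definition _ := isOpenTopological.Build zariski
  zariski_openT zariski_openI zariski_open_bigU.

Lemma zariski_openE : (open : set_system zariski) = zariski_open.
Proof. by []. Qed.

End Zariski.

Section MatrixGroups.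
Variables (F : fieldType) (n : nat).
Implicit Types G H : set 'M[F]_n.

Definition mx_subgroup H : Prop :=
  [/\ H `<=` [set M | M \in unitmx], H 1%:M,
      forall M N, H M -> H N -> H (M *m N) & forall M, H M -> H (invmx M)].

Definition mx_commutator (M N : 'M[F]_n) : 'M[F]_n :=
  M *m N *m invmx M *m invmx N.

Definition derived_subgroup G : set 'M[F]_n :=
  smallest mx_subgroup
    [set C | exists M N, [/\ G M, G N & C = mx_commutator M N]].

Definition neutral_component G : set 'M[F]_n :=
  connected_component (G : set (zariski F n)) 1%:M.

Definition SL : set 'M[F]_n := [set C | \det C = 1].

Definition SO : set 'M[F]_n := [set C | SL C /\ C^T *m C = 1%:M].

(* the block matrix ((0, I), (- I, 0)), for n even *)
Definition symplectic_form : 'M[F]_n :=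
  \matrix_(i, j) ((j == i + n./2 :> nat)%N%:R - (i == j + n./2 :> nat)%N%:R).

Definition Sp : set 'M[F]_n := [set C | C \in unitmx /\
  C^T *m symplectic_form *m C = symplectic_form].

End MatrixGroups.
Arguments SL F n : clear implicits.
Arguments SO F n : clear implicits.
Arguments Sp F n : clear implicits.

Section DifferenceGalois.
Variables (F : fieldType) (q : F).
Local Notation K := {fraction {poly F}}.

Definition companion_mx (n : nat) (a : 'I_n.+1 -> K) : 'M[K]_n :=
  \matrix_(i, j) if i.+1 == n then - (a (widen_ord (leqnSn n) j) / a ord_max)
                 else (j == i.+1 :> nat)%:R.

Record PicardVessiot (n : nat) (A : 'M[K]_n) := {
  pv_ring :> comUnitAlgType K;
  pv_sigma : {rmorphism pv_ring -> pv_ring};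
  pv_sigma_bij : bijective pv_sigma;
  pv_sigma_ext : forall c : K, pv_sigma c%:A = (frac_sigma q c)%:A;
  pv_sol : 'M[pv_ring]_n;
  pv_sol_unit : pv_sol \in unitmx;
  pv_solE : map_mx pv_sigma pv_sol = map_mx (in_alg pv_ring) A *m pv_sol;
  pv_generated : forall S : {pred pv_ring}, subalg_closed S ->
    (forall i j, pv_sol i j \in S) -> (\det pv_sol)^-1 \in S ->
    forall x, x \in S;
  pv_simple : forall I : {pred pv_ring}, zmod_closed I ->
    (forall x y, y \in I -> x * y \in I) ->
    (forall x, x \in I -> pv_sigma x \in I) ->
    I =i pred1 0 \/ I =i predT }.

(* The total ring of quotients is unique up to a unique isomorphism, and
   pv_sigma has a unique extension to it. *)
Record total_quotient_ring (n : nat) (A : 'M[K]_n) (V : PicardVessiot A) := {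
  tq_ring :> comUnitAlgType K;
  tq_in : {lrmorphism V -> tq_ring};
  tq_in_inj : injective tq_in;
  tq_in_unit : forall d : V, GRing.lreg d -> tq_in d \is a GRing.unit;
  tq_frac : forall x : tq_ring,
    exists c d : V, GRing.lreg d /\ x = tq_in c / tq_in d;
  tq_sigma : {rmorphism tq_ring -> tq_ring};
  tq_sigma_ext : forall x : V, tq_sigma (tq_in x) = tq_in (pv_sigma V x) }.

Definition galois_group (n : nat) (A : 'M[K]_n) (V : PicardVessiot A)
    (Q : total_quotient_ring V) : set 'M[F]_n :=
  [set C | C \in unitmx /\ exists phi : {lrmorphism Q -> Q},
    [/\ bijective phi,
        forall x, phi (tq_sigma Q x) = tq_sigma Q (phi x) &
        map_mx (phi \o tq_in Q) (pv_sol V) =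
          map_mx (tq_in Q) (pv_sol V) *m
          map_mx (fun c : F => (FracField.tofrac c%:P)%:A) C]].

End DifferenceGalois.

(* Main.v *)
(* Put K = C(z), L = C((z^* )) and f = (g, sigma g, ..., sigma^(n-1) g), so that
   sigma f = A f. A unipotent one-parameter subgroup exp(tE) of the Galois group
   gives a K-derivation D of the Picard-Vessiot ring with D U = U E; contracting
   the matrices U E U^-1 with K-linear forms yields a Lie algebra T of rational
   matrices, which is sl_n or the Lie algebra of a form J with
   A^T sigma(J) A = kappa J. Its elements act on the relations between f,
   delta f, ..., delta^(N-1) f. Since T f is as large as possible, the leading
   part of a relation of minimal weight vanishes to all orders along the group
   orbit of f, and comparing leading with subleading parts gives a matrix B with
   A^-1 sigma(B) A - B = A^-1 delta(A) - lambda modulo an ideal of T, lambda a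
   scalar. Then delta - B commutes with sigma up to scalars on vectors over L,
   so f, after scaling, spans a finite-dimensional K-space stable under sigma
   and delta. As |q| <> 1, the coefficients of a series in such a space would
   grow incompatibly with its differential equation unless the series is
   rational in some z^(1/j); this contradicts the case N = 1, where the group
   orbit alone gives the independence. *)

From HB Require Import structures.
Require Import Defs.
From mathcomp Require Import all_boot all_order all_algebra.
From mathcomp Require Import complex.
From mathcomp Require Import all_classical all_reals all_analysis.
From mathcomp Require Import ring lra zify.
From mathcomp Require mpoly.
Import -(notations) mpoly.

Set Implicit Arguments.
Unset Strict Implicit.
Unset Printing Implicit Defensive.

Import Order.TTheory GRing.Theory Num.Theory.
Local Open Scope ring_scope.

(** * Spans and fixed vectors *)

(** Two obstacles shape the proof. The group acts on the Picard-Vessiot ring R, whereas f lives in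
    L, and R is never compared with L: each use of the group becomes a statement over K, by descent
    of sigma-stable R-modules to their fixed vectors. And the group says nothing about delta f:
    delta enters only through c = A^-1 delta(A), the first-order term of sigma acting on jets
    filtered by order of derivation. Hence only the leading and subleading parts of a relation are
    kept. The action of Y in T on such pairs carries a correction beta(Y), and beta commutes with
    sigma up to [Y, c]. Contracting beta with the Casimir tensor of T, as in Whitehead's lemma,
    yields B; the Casimir eigenvalue on T must be nonzero, and is 2n for sl_n, n - 2 for so_n, n + 2
    for sp_n. In the orthogonal case f may lie on a quadric, so one coordinate is eliminated; and
    since so_4 is not simple, an ideal may move an isotropic f only within a totally isotropic plane
    spanned by f and some h. There the bivector of f and h replaces f, and a Pluecker-type identity
    gives the contradiction. *)

Section Span.
Variables (R : comNzRingType) (V : lmodType R).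
Implicit Types (G M : V -> Prop) (x y : V).

Inductive span G : V -> Prop :=
| span_zero : span G 0
| span_cons c g x : G g -> span G x -> span G (c *: g + x).

Lemma spanD G x y : span G x -> span G y -> span G (x + y).
Proof.
by elim=> [|c g x' Gg _ IH] Gy; rewrite ?add0r// -addrA; apply: span_cons; auto.
Qed.

Lemma spanZ G c x : span G x -> span G (c *: x).
Proof.
elim=> [|d g x' Gg _ IH]; first by rewrite scaler0; exact: span_zero.
by rewrite scalerDr scalerA; exact: span_cons.
Qed.

Lemma span_gen G x : G x -> span G x.
Proof. by move=> Gx; rewrite -[x]addr0 -[x]scale1r; apply: span_cons => //; exact: span_zero. Qed.

Lemma spanN G x : span G x -> span G (- x).
Proof. by rewrite -scaleN1r; exact: spanZ. Qed.

Lemma spanB G x y : span G x -> span G y -> span G (x - y).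
Proof. by move=> Gx /spanN; exact: spanD. Qed.

Lemma span_sum G (I : Type) (r : seq I) (P : pred I) (F : I -> V) :
  (forall i, P i -> span G (F i)) -> span G (\sum_(i <- r | P i) F i).
Proof. by move=> GF; apply: big_ind => //; [exact: span_zero|exact: spanD]. Qed.

Lemma span_sub G G' x : (forall g, G g -> span G' g) -> span G x -> span G' x.
Proof.
by move=> GG'; elim=> [|c g y Gg _ IH]; [exact: span_zero|apply: spanD => //; apply: spanZ; auto].
Qed.

Lemma span_ind_sub G M x : M 0 -> (forall c y z, M y -> M z -> M (c *: y + z)) ->
  (forall g, G g -> M g) -> span G x -> M x.
Proof. by move=> M0 ML GM; elim=> // c g y /GM Mg _; exact: ML. Qed.

Lemma span_finite G x : span G x ->
  exists2 s : seq V, (forall g, g \in s -> G g) & span (fun g => g \in s) x.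
Proof.
elim=> [|c g y Gg _ [s sG sy]]; first by exists [::] => //; exact: span_zero.
exists (g :: s) => [h|]; first by rewrite inE => /predU1P[->|/sG].
apply: span_cons; first by rewrite inE eqxx.
by apply: span_sub sy => h hs; apply: span_gen; rewrite inE hs orbT.
Qed.

Lemma span_seq_coord (s : seq V) x : span (fun g => g \in s) x ->
  exists c : 'I_(size s) -> R, x = \sum_i c i *: s`_i.
Proof.
elim=> [|c g y gs _ [d ->]].
  by exists (fun=> 0); rewrite big1// => i _; rewrite scale0r.
have gi : (index g s < size s)%N by rewrite index_mem.
exists (fun i => (if i == Ordinal gi then c else 0) + d i).
under [RHS]eq_bigr do rewrite scalerDl.
rewrite big_split /=; congr (_ + _).
rewrite (bigD1 (Ordinal gi))//= eqxx nth_index// big1 ?addr0// => i.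
by move=> /negbTE ->; rewrite scale0r.
Qed.

End Span.

Definition sigma_simple (R : comNzRingType) (sg : R -> R) : Prop :=
  forall I : R -> Prop, I 0 -> (forall x y, I x -> I y -> I (x + y)) ->
    (forall x y, I y -> I (x * y)) -> (forall x, I x -> I (sg x)) ->
    (forall x, I x -> x = 0) \/ I 1.

(** The ideal generated by a fixed element is sigma-stable, so it contains 1 as soon as it is
    nonzero. *)
Lemma sigma_fixed_unit (R : comUnitRingType) (sg : {rmorphism R -> R}) (r : R) :
  sigma_simple sg -> sg r = r -> r != 0 -> r \is a GRing.unit.
Proof.
move=> simp rr r0.
have [||||H|[y H]] := simp (fun x => exists y, y * r = x).
- by exists 0; rewrite mul0r.
- by move=> x y [a <-] [b <-]; exists (a + b); rewrite mulrDl.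
- by move=> x y [a <-]; exists (x * a); rewrite mulrA.
- by move=> x [a <-]; exists (sg a); rewrite rmorphM rr.
- by move: r0; rewrite (H r) ?eqxx//; exists 1; rewrite mul1r.
- by apply/unitrPr; exists y; rewrite mulrC.
Qed.

Section FixedSpan.
Variables (R : comNzRingType) (sg : {rmorphism R -> R}) (V : lmodType R) (I : eqType).
Variables (coef : I -> V -> R) (supp : V -> seq I) (sV : V -> V).
Hypothesis simp : sigma_simple sg.
Hypothesis coefL : forall i c x y, coef i (c *: x + y) = c * coef i x + coef i y.
Hypothesis sV_coef : forall i x, coef i (sV x) = sg (coef i x).
Hypothesis suppP : forall i x, coef i x != 0 -> i \in supp x.
Hypothesis coef_inj : forall x, (forall i, coef i x = 0) -> x = 0.
Variable M : V -> Prop.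
Hypothesis M0 : M 0.
Hypothesis ML : forall c x y, M x -> M y -> M (c *: x + y).
Hypothesis MsV : forall x, M x -> M (sV x).

Let nz v := undup [seq i <- supp v | coef i v != 0].
Let nzP v i : (i \in nz v) = (coef i v != 0).
Proof. by rewrite mem_undup mem_filter; case: eqVneq => //= /suppP. Qed.

Let nz_lt v w i : (forall j, coef j v = 0 -> coef j w = 0) ->
  coef i v != 0 -> coef i w = 0 -> (size (nz w) < size (nz v))%N.
Proof.
move=> vw vi wi; apply: (@uniq_leq_size _ (i :: nz w)) => [|j].
  by rewrite /= undup_uniq andbT nzP wi eqxx.
rewrite inE !nzP => /predU1P[->//|]; apply: contraNneq => /vw ->//.
Qed.

Let coef0 i : coef i 0 = 0.
Proof.
by apply: (addIr (coef i 0)); rewrite add0r -{1}[coef i 0]mul1r -coefL scaler0 addr0.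
Qed.

Let nonzero_coef v : v != 0 -> exists i, coef i v != 0.
Proof.
move=> v0; apply/not_existsP => H; move/eqP: v0; apply; apply: coef_inj => i.
by have /negP := H i; rewrite negbK => /eqP.
Qed.

(** Induction on the size of the support. The i-th coordinates of the members of [M] supported in
    the support of v form a sigma-stable ideal, so one of these members, w, has coordinate 1. If w
    is not fixed, sigma w - w is nonzero with smaller support. *)
Let fixed_exists k v : (size (nz v) <= k)%N -> M v -> v != 0 ->
  exists w i, [/\ M w, sV w = w, forall j, coef j v = 0 -> coef j w = 0,
    coef i v != 0 & coef i w = 1].
Proof.
elim: k v => [|k IH] v vk Mv v0; have [i vi] := nonzero_coef v0.
  by move: vk; rewrite leqn0 size_eq0 => /eqP H; move: vi; rewrite -nzP H.
have [||||H|[w [Mw vw w1]]] := simp (I := fun r => exists w,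
    [/\ M w, forall j, coef j v = 0 -> coef j w = 0 & coef i w = r]).
- by exists 0; split=> // j _; rewrite coef0.
- move=> x y [a [Ma av <-]] [b [Mb bv <-]]; exists (1 *: a + b); split.
  + exact: ML.
  + by move=> j vj; rewrite coefL av// bv// mulr0 addr0.
  + by rewrite coefL mul1r.
- move=> x y [a [Ma av <-]]; exists (x *: a + 0); split.
  + exact: ML.
  + by move=> j vj; rewrite coefL av// coef0 mulr0 addr0.
  + by rewrite coefL coef0 addr0.
- move=> x [a [Ma av <-]]; exists (sV a); split => //; first exact: MsV.
  by move=> j vj; rewrite sV_coef av// rmorph0.
- by move: vi; rewrite (H (coef i v)) ?eqxx//; exists v.
have [wE|wN] := eqVneq (sV w) w; first by exists w, i.
pose u := (-1) *: w + sV w.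
have uv j : coef j v = 0 -> coef j u = 0.
  by move=> vj; rewrite coefL sV_coef vw// rmorph0 mulr0 addr0.
have ui : coef i u = 0 by rewrite coefL sV_coef w1 rmorph1; ring.
have [||| w' [j [Mw' fw' uw' uj w'j]]] := IH u.
- by have := nz_lt uv vi ui; lia.
- by apply: ML => //; exact: MsV.
- by rewrite /u scaleN1r addrC subr_eq0.
exists w', j; split=> // [l vl|]; first by rewrite uw'// uv.
by apply: contraNneq uj => /uv ->.
Qed.

(** Descent: a sigma-stable submodule of a free module over a sigma-simple ring is generated by its
    fixed vectors. Subtracting a multiple of the fixed w kills a coordinate of v without enlarging
    the support. *)
Lemma fixed_span v : M v -> span (fun w => M w /\ sV w = w) v.
Proof.
have [k] := ubnP (size (nz v)); elim: k v => // k IH v vk Mv.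
have [->|v0] := eqVneq v 0; first exact: span_zero.
have [w [i [Mw fw vw vi w1]]] := fixed_exists (leqnn _) Mv v0.
pose u := (- coef i v) *: w + v.
have -> : v = coef i v *: w + u by rewrite /u scaleNr addrA subrr add0r.
apply: span_cons => //; apply: IH; last exact: ML.
have : (size (nz u) < size (nz v))%N; last lia.
apply: (@nz_lt _ _ i) => //; last by rewrite coefL w1; ring.
by move=> j vj; rewrite coefL vw// vj; ring.
Qed.

End FixedSpan.

(** * Derivations of jet polynomials *)

Section MPolyDerivation.
Variables (m : nat) (S : comNzRingType).
Local Notation P := (mpoly m S).
Local Notation X v := (@mpolyX m S (mnm1 v)).

Lemma mpoly_ring_ind (Q : P -> Prop) : (forall c, Q (mpolyC m c)) ->
  (forall v, Q (X v)) -> (forall p q, Q p -> Q q -> Q (p + q)) ->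
  (forall p q, Q p -> Q q -> Q (p * q)) -> forall p, Q p.
Proof.
move=> QC QX QD QM; elim/mpolyind; first by rewrite -mpolyC0.
move=> c k p _ _ Qp; apply: QD => //; rewrite -mul_mpolyC; apply: (QM) => //.
rewrite mpolyXE_id; apply: big_ind => //; first by rewrite -mpolyC1.
move=> v _; elim: (k v) => [|j IH]; first by rewrite expr0 -mpolyC1.
by rewrite exprS; exact: QM.
Qed.

Definition der (phi : 'I_m -> P) (p : P) : P := \sum_v phi v * mderiv v p.

Lemma der_is_linear phi : linear (der phi).
Proof.
move=> c p q; rewrite /der scaler_sumr -big_split /=; apply: eq_bigr => v _.
by rewrite linearP mulrDr scalerAr.
Qed.
HB.instance Definition _ phi := GRing.isLinear.Build S P P *:%R (der phi) (der_is_linear phi).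

Lemma derM phi p q : der phi (p * q) = der phi p * q + p * der phi q.
Proof.
rewrite /der mulr_suml mulr_sumr -big_split; apply: eq_bigr => v _ /=.
by rewrite mderivM; ring.
Qed.

Lemma derC phi c : der phi (mpolyC m c) = 0.
Proof. by rewrite /der big1// => v _; rewrite mderivC mulr0. Qed.

Lemma derX phi v : der phi (X v) = phi v.
Proof.
rewrite /der (bigD1 v)//= mderivX mnm1E eqxx scale1r.
have -> : mnm_sub (mnm1 v) (mnm1 v) = @mnm0 m.
  by apply/mnmP => i; rewrite mnmBE mnm0E subnn.
rewrite mpolyX0 mulr1 big1 ?addr0// => w wv.
by rewrite mderivX mnm1E eq_sym (negbTE wv) scale0r mulr0.
Qed.

End MPolyDerivation.

Lemma ffact_add k a b : k ^_ (a + b) = (k ^_ a * (k - a) ^_ b)%N.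
Proof.
elim: b => [|b IH]; first by rewrite addn0 ffactn0 muln1.
by rewrite addnS !ffactnSr IH subnDA mulnA.
Qed.

Lemma leibniz_rearrange (A : comNzRingType) (a a' b b' p q x y u v : A) :
  (a + a') * q + x * v + (u * y + p * (b + b')) =
  a * q + p * b + (a' * q + u * y + (x * v + p * b')).
Proof. by ring. Qed.

(* Opaque keys: unification must not unfold the operators on polynomials. *)
Fact jder_key : unit. Proof. by []. Qed.
Fact jsub_key : unit. Proof. by []. Qed.

Section Jets.
Variables (n N : nat).
Local Notation m := #|{: 'I_n * 'I_N}|.
Local Notation row v := (enum_val v).1.
Local Notation ord v := (nat_of_ord (enum_val v).2).

Section Operators.
Variable S : comNzRingType.
Local Notation P := (mpoly m S).
Local Notation X v := (@mpolyX m S (mnm1 v)).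

(* The variable standing for the j-th derivative of the i-th unknown; it is 0
   when j >= N. *)
Definition jX (i : 'I_n) (j : nat) : P :=
  if insub j is Some k then X (enum_rank (i, k)) else 0.

Definition jY (Y : 'M[S]_n) i j : P := \sum_k Y i k *: jX k j.

Lemma jX_var v : X v = jX (row v) (ord v).
Proof. by rewrite /jX valK -surjective_pairing enum_valK. Qed.

Lemma jX_ord i (j : 'I_N) : jX i j = X (enum_rank (i, j)).
Proof. by rewrite /jX valK. Qed.

Lemma jY1 i j : jY 1%:M i j = jX i j.
Proof.
rewrite /jY (bigD1 i)//= mxE eqxx scale1r big1 ?addr0// => k ki.
by rewrite mxE eq_sym (negbTE ki) scale0r.
Qed.

Lemma jYD Y Z i j : jY (Y + Z) i j = jY Y i j + jY Z i j.
Proof. by rewrite /jY -big_split; apply: eq_bigr => k _; rewrite mxE scalerDl. Qed.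

Lemma jYZ c Y i j : jY (c *: Y) i j = c *: jY Y i j.
Proof. by rewrite /jY scaler_sumr; apply: eq_bigr => k _; rewrite mxE scalerA. Qed.

Lemma jYM (Y Z : 'M[S]_n) i j : \sum_k Y i k *: jY Z k j = jY (Y *m Z) i j.
Proof.
under eq_bigr do rewrite scaler_sumr; rewrite exchange_big; apply: eq_bigr => k _ /=.
by under eq_bigr do rewrite scalerA; rewrite -scaler_suml mxE.
Qed.

(* X_j |-> j (j - 1) ... (j - h + 1) Y X_(j-h) *)
Definition jder h (Y : 'M[S]_n) : P -> P :=
  locked_with jder_key (der (fun v => jY Y (row v) (ord v - h) *+ (ord v ^_ h))).

Lemma jderE h Y : jder h Y = der (fun v => jY Y (row v) (ord v - h) *+ (ord v ^_ h)).
Proof. exact: locked_withE. Qed.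

Lemma jder_is_linear h Y : linear (jder h Y).
Proof. by rewrite jderE; exact: linearP. Qed.
HB.instance Definition _ h Y := GRing.isLinear.Build S P P *:%R (jder h Y) (jder_is_linear h Y).

Lemma jderM h Y p q : jder h Y (p * q) = jder h Y p * q + p * jder h Y q.
Proof. by rewrite jderE; exact: derM. Qed.

Lemma jderC h Y c : jder h Y (mpolyC m c) = 0.
Proof. by rewrite jderE; exact: derC. Qed.

Lemma jder_jX h Y i j : (j < N)%N -> jder h Y (jX i j) = jY Y i (j - h) *+ (j ^_ h).
Proof.
by move=> jN; rewrite -[j]/(nat_of_ord (Ordinal jN)) jX_ord jderE derX enum_rankK.
Qed.

Lemma jder_jY h Y Z i j : (j < N)%N -> jder h Y (jY Z i j) = jY (Z *m Y) i (j - h) *+ (j ^_ h).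
Proof.
move=> jN; rewrite -jYM -sumrMnl [jY Z i j]/jY raddf_sum /=.
by apply: eq_bigr => k _; rewrite linearZ /= jder_jX// scalerMnr.
Qed.

Lemma jderD h Y Z p : jder h (Y + Z) p = jder h Y p + jder h Z p.
Proof.
rewrite !jderE /der -big_split; apply: eq_bigr => v _ /=.
by rewrite jYD mulrnDl mulrDl.
Qed.

Lemma jderZ h c Y p : jder h (c *: Y) p = c *: jder h Y p.
Proof.
rewrite !jderE /der scaler_sumr; apply: eq_bigr => v _ /=.
by rewrite jYZ scalerMnr scalerAl.
Qed.

Lemma jderN h Y p : jder h (- Y) p = - jder h Y p.
Proof. by rewrite -scaleN1r jderZ scaleN1r. Qed.

Lemma jderB h Y Z p : jder h (Y - Z) p = jder h Y p - jder h Z p.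
Proof. by rewrite jderD jderN. Qed.

Lemma jder0 h p : jder h 0 p = 0.
Proof. by rewrite -(subrr 0) jderB subrr. Qed.

(** If the variables are collected in the series X(t) = sum_j X_j t^j / j!, then [jder h Y] is the
    vector field X |-> t^h Y X. So this is the bracket of the current algebra gl_n[t], reversed as
    usual for linear vector fields. *)
Lemma jder_comm h h' Y Y' p :
  jder h Y (jder h' Y' p) - jder h' Y' (jder h Y p) =
  jder (h + h') (Y' *m Y - Y *m Y') p.
Proof.
elim/mpoly_ring_ind: p => [c|v|p q Ep Eq|p q Ep Eq].
- by rewrite !jderC !linear0 addr0.
- rewrite jX_var !jder_jX//= !linearMn /= !jder_jY ?(leq_ltn_trans (leq_subr _ _))//.
  rewrite jYD -[- (Y *m Y')]scaleN1r jYZ -!mulrnA -!subnDA ![(_ * ord v ^_ _)%N]mulnC -!ffact_add.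
  by rewrite [(h' + h)%N]addnC scaleN1r mulrnBl mulNrn -mulrnA mulnC -ffact_add.
- by rewrite !raddfD /= -Ep -Eq; ring.
- by rewrite !jderM !raddfD /= !jderM -Ep -Eq; ring.
Qed.

End Operators.

Section Substitution.
Variables (S S' : comNzRingType).

Definition jsub (f : {rmorphism S -> S'}) (M : 'M[S']_n) : mpoly m S -> mpoly m S' :=
  locked_with jsub_key (mmap (@mpolyC m S' \o f) (fun v => jY M (row v) (ord v))).

Lemma jsubE f M : jsub f M = mmap (@mpolyC m S' \o f) (fun v => jY M (row v) (ord v)).
Proof. exact: locked_withE. Qed.

Lemma jsub_is_zmod_morphism f M : zmod_morphism (jsub f M).
Proof. by rewrite jsubE; exact: raddfB. Qed.
HB.instance Definition _ f M := GRing.isZmodMorphism.Build _ _ (jsub f M) (jsub_is_zmod_morphism f M).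

Lemma jsub_is_monoid_morphism f M : monoid_morphism (jsub f M).
Proof. by rewrite jsubE; split; [exact: rmorph1|exact: rmorphM]. Qed.
HB.instance Definition _ f M := GRing.isMonoidMorphism.Build _ _ (jsub f M) (jsub_is_monoid_morphism f M).

Lemma jsubC f M c : jsub f M (mpolyC m c) = mpolyC m (f c).
Proof. by rewrite jsubE; exact: mmapC. Qed.

Lemma jsubZ f M c p : jsub f M (c *: p) = f c *: jsub f M p.
Proof. by rewrite -!mul_mpolyC rmorphM /= jsubC. Qed.

Lemma jsub_jX f M i j : jsub f M (jX S i j) = jY M i j.
Proof.
rewrite /jX; case: insubP => [k kN <-|nN].
  by rewrite jsubE mmapX mmap1U enum_rankK.
by rewrite rmorph0 /jY big1// => k _; rewrite /jX insubF ?scaler0//; apply/negbTE.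
Qed.

Lemma jsub_jY f M Z i j : jsub f M (jY Z i j) = jY (map_mx f Z *m M) i j.
Proof.
rewrite -[RHS]jYM [jY Z i j]/jY raddf_sum /=.
by apply: eq_bigr => k _; rewrite jsubZ jsub_jX mxE.
Qed.

Lemma jsub_ext (f f' : {rmorphism S -> S'}) M p : f =1 f' -> jsub f M p = jsub f' M p.
Proof.
move=> ff'; elim/mpoly_ring_ind: p => [c|v|p q Ep Eq|p q Ep Eq].
- by rewrite !jsubC ff'.
- by rewrite jX_var !jsub_jX.
- by rewrite !rmorphD /= Ep Eq.
- by rewrite !rmorphM /= Ep Eq.
Qed.

(** A linear change of variables conjugates a linear vector field: for invertible M, the matrix Z is
    M^-1 f(Y) M. *)
Lemma jsub_jder (f : {rmorphism S -> S'}) (M : 'M[S']_n) h (Y : 'M[S]_n) (Z : 'M[S']_n) p :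
  M *m Z = map_mx f Y *m M ->
  jsub f M (jder h Y p) = jder h Z (jsub f M p).
Proof.
move=> MZ; elim/mpoly_ring_ind: p => [c|v|p q Ep Eq|p q Ep Eq].
- by rewrite jderC jsubC jderC rmorph0.
- by rewrite jX_var jder_jX// rmorphMn /= jsub_jY jsub_jX jder_jY// MZ.
- by rewrite raddfD !rmorphD raddfD /= Ep Eq.
- by rewrite jderM rmorphD !rmorphM jderM /= Ep Eq.
Qed.

End Substitution.

Lemma jsub_comp (S S' S'' : comNzRingType) (f : {rmorphism S -> S'})
    (g : {rmorphism S' -> S''}) M M' p :
  jsub g M' (jsub f M p) = jsub (g \o f) (map_mx g M *m M') p.
Proof.
elim/mpoly_ring_ind: p => [c|v|p q Ep Eq|p q Ep Eq].
- by rewrite !jsubC.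
- by rewrite jX_var !jsub_jX jsub_jY.
- by rewrite !rmorphD /= Ep Eq.
- by rewrite !rmorphM /= Ep Eq.
Qed.

Lemma jsub_id (S : comNzRingType) p : jsub idfun (1%:M : 'M[S]_n) p = p.
Proof.
elim/mpoly_ring_ind: p => [c|v|p q Ep Eq|p q Ep Eq].
- by rewrite jsubC.
- by rewrite jX_var jsub_jX jY1.
- by rewrite rmorphD /= Ep Eq.
- by rewrite rmorphM /= Ep Eq.
Qed.

Lemma jsub_map (S S' : comNzRingType) (f : {rmorphism S -> S'}) k p :
  mcoeff k (jsub f 1%:M p) = f (mcoeff k p).
Proof.
rewrite -mcoeff_map_mpoly; congr mcoeff.
elim/mpoly_ring_ind: p => [c|v|p q Ep Eq|p q Ep Eq].
- by rewrite jsubC map_mpolyC.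
- by rewrite jX_var jsub_jX jY1 -[in RHS]jX_var map_mpolyX jX_var.
- by rewrite !rmorphD /= Ep Eq.
- by rewrite !rmorphM /= Ep Eq.
Qed.

Section CoefficientDerivation.
Variables (S : comNzRingType) (D : {additive S -> S}).
Hypothesis DM : forall x y, D (x * y) = D x * y + x * D y.

Lemma derivation1 : D 1 = 0.
Proof.
by have := DM 1 1; rewrite !mulr1 mul1r -[LHS]addr0 => /addrI.
Qed.

Lemma map_mpoly_derM (p q : mpoly m S) :
  map_mpoly D (p * q) = map_mpoly D p * q + p * map_mpoly D q.
Proof.
apply/mpolyP => k; rewrite mcoeffD mcoeff_map_mpoly !mcoeffM raddf_sum -big_split /=.
by apply: eq_bigr => x _; rewrite DM !mcoeff_map_mpoly.
Qed.

Lemma map_mpoly_derZ c (p : mpoly m S) :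
  map_mpoly D (c *: p) = D c *: p + c *: map_mpoly D p.
Proof.
apply/mpolyP => k; rewrite mcoeffD mcoeff_map_mpoly !mcoeffZ DM.
by rewrite mcoeff_map_mpoly.
Qed.

Lemma map_mpoly_derX (i : 'I_n) j : map_mpoly D (jX S i j) = 0.
Proof.
rewrite /jX; case: insubP => [k _ _|_]; last exact: raddf0.
apply/mpolyP => l; rewrite mcoeff_map_mpoly mcoeffX mcoeff0.
by case: eqP => _; rewrite ?derivation1 ?raddf0.
Qed.

Lemma map_mpoly_der_jY (Y : 'M[S]_n) i j :
  map_mpoly D (jY Y i j) = jY (map_mx D Y) i j.
Proof.
rewrite /jY raddf_sum; apply: eq_bigr => k _ /=.
by rewrite map_mpoly_derZ map_mpoly_derX scaler0 addr0 mxE.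
Qed.

Lemma map_mpoly_der_jder h Y p : map_mpoly D (jder h Y p) =
  jder h (map_mx D Y) p + jder h Y (map_mpoly D p).
Proof.
elim/mpoly_ring_ind: p => [c|v|p q Ep Eq|p q Ep Eq].
- by rewrite map_mpolyC !jderC raddf0 addr0.
- rewrite jX_var map_mpoly_derX raddf0 addr0 !jder_jX// raddfMn /=.
  by rewrite map_mpoly_der_jY.
- by rewrite !raddfD /= Ep Eq addrACA.
- rewrite !jderM map_mpoly_derM !raddfD /= !map_mpoly_derM Ep Eq !jderM.
  exact: leibniz_rearrange.
Qed.

(** Chain rule for p(U X): D falls either on the coefficients of p or on U, and the second
    contribution is the linear field of Z. *)
Lemma map_mpoly_der_jsub (U Z : 'M[S]_n) p : map_mx D U = Z *m U ->
  map_mpoly D (jsub idfun U p) = jsub idfun U (map_mpoly D p + jder 0 Z p).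
Proof.
move=> DU; elim/mpoly_ring_ind: p => [c|v|p q Ep Eq|p q Ep Eq].
- by rewrite jderC addr0 !(map_mpolyC, jsubC).
- rewrite jX_var map_mpoly_derX add0r jder_jX// jsub_jX map_mpoly_der_jY DU.
  by rewrite ffactn0 subn0 jsub_jY map_mx_id.
- by rewrite !raddfD /= Ep Eq addrACA !rmorphD.
- rewrite !rmorphM /= map_mpoly_derM Ep Eq jderM map_mpoly_derM.
  by rewrite !rmorphD !rmorphM /= mulrDl mulrDr addrACA.
Qed.

End CoefficientDerivation.
End Jets.

Lemma map_mx_idfun (S : nzRingType) n m (X : 'M[S]_(n, m)) : map_mx (idfun : {rmorphism S -> S}) X = X.
Proof. by apply/matrixP => i j; rewrite mxE. Qed.

Section Rearrangements.
Variable V : comNzRingType.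
Implicit Types (b c d l p q r s t u v w x y z : V).

Lemma quad_cancel u v x y z : u - (v - x) - (u - y - (v - z)) = y - z + x.
Proof. by ring. Qed.

Lemma addsub_cancel x q b y r c : x - (q - b) + (y - (r - c)) = x + y - (q + r - (b + c)).
Proof. by ring. Qed.

Lemma telescope_cancel u t q b c : u - (t - b) + (t - (q - c)) = u - (q - (b + c)).
Proof. by ring. Qed.

Lemma shift_cancel w x b s t c : w - (x - b) - (w - (s - (t + c))) = s - x - (t + c - b).
Proof. by ring. Qed.

Lemma swap_cancel w q d r s : w - (q - d) - (w - (r - s)) = r - s - (q - d).
Proof. by ring. Qed.

Lemma split_cancel y s b c : y + s + c - (s - b + c) = y + b.
Proof. by ring. Qed.

Lemma der_cancel p q r s t : p + q + r + (s + t) = p + (q + s + (r + t)).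
Proof. by ring. Qed.

Lemma comm_cancel d l u v w : u - v = w -> - d + (l - u) + v = l - (d + w).
Proof. by move=> <-; ring. Qed.

End Rearrangements.

(** * Descent from the Picard-Vessiot ring *)

Section Descent.
Variables (n N : nat) (K : fieldType) (R : comUnitRingType).
Variables (sK : {rmorphism K -> K}) (sR : {rmorphism R -> R}) (inc : {rmorphism K -> R}).
Local Notation m := #|{: 'I_n * 'I_N}|.
Local Notation PK := (mpoly m K).
Local Notation PR := (mpoly m R).
Hypothesis simp : sigma_simple sR.
Hypothesis sR_inc : forall c, sR (inc c) = inc (sK c).
Variables (A Ai : 'M[K]_n) (U Ui : 'M[R]_n).
Hypothesis AAi : A *m Ai = 1%:M.
Hypothesis UUi : U *m Ui = 1%:M.
Hypothesis UiU : Ui *m U = 1%:M.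
Hypothesis sU : map_mx sR U = map_mx inc A *m U.

Local Notation iota := (@jsub n N K R inc 1%:M).
Local Notation tauR := (@jsub n N R R sR (map_mx inc A)).
Local Notation tau := (@jsub n N K K sK A).
Local Notation twist := (@jsub n N R R idfun U).

Definition conj_sigma (X : 'M[R]_n) : 'M[R]_n := map_mx inc Ai *m map_mx sR X *m map_mx inc A.

Lemma conj_sigmaE X : map_mx inc A *m conj_sigma X = map_mx sR X *m map_mx inc A.
Proof. by rewrite /conj_sigma !mulmxA -map_mxM AAi map_mx1 mul1mx. Qed.

Lemma tauR_jder h X p : tauR (jder h X p) = jder h (conj_sigma X) (tauR p).
Proof. by apply: jsub_jder; exact: conj_sigmaE. Qed.

Lemma tauR_iota p : tauR (iota p) = iota (tau p).
Proof.
rewrite !jsub_comp map_mx1 mul1mx mulmx1.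
by apply: jsub_ext => c /=; rewrite sR_inc.
Qed.

Lemma iota_jder h X p : iota (jder h X p) = jder h (map_mx inc X) (iota p).
Proof. by apply: jsub_jder; rewrite mul1mx mulmx1. Qed.

Lemma twist_inj p : twist p = 0 -> p = 0.
Proof.
move=> /(congr1 (@jsub n N R R idfun Ui)); rewrite rmorph0 jsub_comp map_mx_idfun UUi.
by rewrite (jsub_ext _ _ (f' := idfun))// jsub_id.
Qed.

(** Since sigma U = A U, the substitution X := U X turns the twisted operator [tauR] into sigma
    acting on coefficients. This is the coordinate system in which [fixed_span] applies. *)
Lemma twist_coef k p : mcoeff k (twist (tauR p)) = sR (mcoeff k (twist p)).
Proof.
rewrite -jsub_map; congr mcoeff; rewrite !jsub_comp map_mx_idfun mulmx1 sU.
exact: jsub_ext.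
Qed.

Lemma tauRZ c p : tauR (c *: p) = sR c *: tauR p.
Proof. exact: jsubZ. Qed.

(** By descent, a linear statement on a [tauR]-stable module need only be checked on fixed elements.
    Tuples are allowed because several polynomials will have to be handled with the same scalars. *)
Lemma fixed_ind_ffun (I : finType) (M Phi : {ffun I -> PR} -> Prop) :
  M 0 -> (forall c x y, M x -> M y -> M (c *: x + y)) ->
  (forall x, M x -> M [ffun i => tauR (x i)]) ->
  Phi 0 -> (forall c x y, M x -> M y -> Phi x -> Phi y -> Phi (c *: x + y)) ->
  (forall x, M x -> (forall i, tauR (x i) = x i) -> Phi x) ->
  forall x, M x -> Phi x.
Proof.
move=> M0 ML Ms P0 PL Pfix x Mx.
have : span (fun w => M w /\ [ffun i => tauR (w i)] = w) x.
  apply: (@fixed_span R sR {ffun I -> PR} (I * multinom m)%type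
    (fun i x => mcoeff i.2 (twist (x i.1)))
    (fun x => flatten [seq [seq (i, k) | k <- msupp (twist (x i))] | i <- enum I])
    (fun x => [ffun i => tauR (x i)])) => //.
  - move=> [i k] c y z /=; have -> : (c *: y + z) i = c *: y i + z i by rewrite !ffunE.
    by rewrite rmorphD /= jsubZ mcoeffD mcoeffZ.
  - by move=> [i k] y /=; rewrite ffunE twist_coef.
  - move=> [i k] y /= ne; apply/flattenP; exists [seq (i, k) | k <- msupp (twist (y i))].
      by apply/mapP; exists i; rewrite ?mem_enum.
    by apply/mapP; exists k => //; rewrite mcoeff_msupp.
  - move=> y H; apply/ffunP => i; rewrite !ffunE; apply: twist_inj.
    by apply/mpolyP => k; rewrite (H (i, k)) mcoeff0.
suff H y : span (fun w => M w /\ [ffun i => tauR (w i)] = w) y -> M y /\ Phi y by move=> /H[].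
elim=> [//|c g z [Mg fg] _ [Mz Pz]]; split; first exact: ML.
apply: PL => //; apply: Pfix => // i; by rewrite -[in RHS]fg ffunE.
Qed.

Lemma fixed_ind2 (M Phi : PR -> PR -> Prop) :
  M 0 0 -> (forall c x x' y y', M x x' -> M y y' -> M (c *: x + y) (c *: x' + y')) ->
  (forall x x', M x x' -> M (tauR x) (tauR x')) ->
  Phi 0 0 ->
  (forall c x x' y y', M x x' -> M y y' -> Phi x x' -> Phi y y' ->
     Phi (c *: x + y) (c *: x' + y')) ->
  (forall x x', M x x' -> tauR x = x -> tauR x' = x' -> Phi x x') ->
  forall x x', M x x' -> Phi x x'.
Proof.
move=> M0 ML Ms P0 PL Pfix x x' Mx.
have := @fixed_ind_ffun bool (fun w => M (w true) (w false)) (fun w => Phi (w true) (w false)).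
move=> /(_ _ _ _ _ _ _ [ffun b => if b then x else x']); rewrite !ffunE; apply => //.
- by move=> c y z My Mz; rewrite !ffunE; exact: ML.
- by move=> y My; rewrite !ffunE; exact: Ms.
- by move=> c y z My Mz Py Pz; rewrite !ffunE; exact: PL.
- by move=> y My fy; apply: Pfix.
Qed.

Section Derivation.
Variables (D : {additive R -> R}) (E : 'M[R]_n).
Hypothesis DM : forall x y, D (x * y) = D x * y + x * D y.
Hypothesis D_inc : forall c, D (inc c) = 0.
Hypothesis D_fixed : forall x, sR x = x -> D x = 0.
Hypothesis DU : map_mx D U = U *m E.
Let Z := U *m E *m Ui.

(** The coefficients of p(U X) are fixed by sigma, so D kills them; the chain rule rewrites this in
    terms of p. *)
Lemma fixed_der p : tauR p = p -> map_mpoly D p + jder 0 Z p = 0.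
Proof.
move=> fp; apply: twist_inj; rewrite -map_mpoly_der_jsub//; last first.
  by rewrite /Z -(mulmxA _ Ui) UiU mulmx1.
by apply/mpolyP => k; rewrite mcoeff_map_mpoly mcoeff0 D_fixed// -twist_coef fp.
Qed.

Lemma map_mpoly_der_iota p : map_mpoly D (iota p) = 0.
Proof. by apply/mpolyP => k; rewrite mcoeff_map_mpoly jsub_map D_inc mcoeff0. Qed.

End Derivation.

Section Functional.
Variable l : {additive R -> K}.
Hypothesis l_inc : forall c x, l (inc c * x) = c * l x.

Lemma functional_iotaZ r p : map_mpoly l (r *: iota p) = l r *: p.
Proof.
apply/mpolyP => k; rewrite mcoeff_map_mpoly !mcoeffZ jsub_map mulrC l_inc.
by rewrite mulrC.
Qed.

Lemma functional_jder h Y p : map_mpoly l (jder h Y (iota p)) = jder h (map_mx l Y) p.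
Proof.
have E (S : comNzRingType) (X : 'M[S]_n) (q : mpoly m S) :
    jder h X q = \sum_i \sum_j X i j *: jder h (delta_mx i j) q.
  rewrite {1}[X]matrix_sum_delta.
  elim/big_ind2: _ => [|x y z t <- <-|i _]; rewrite ?jder0 ?jderD//.
  by elim/big_ind2: _ => [|x y z t <- <-|j _]; rewrite ?jder0 ?jderD ?jderZ.
rewrite (E _ Y) (E _ (map_mx l Y)) raddf_sum; apply: eq_bigr => i _ /=.
rewrite raddf_sum; apply: eq_bigr => j _ /=.
have -> : jder h (delta_mx i j) (iota p) = iota (jder h (delta_mx i j) p).
  by rewrite iota_jder map_delta_mx.
by rewrite functional_iotaZ mxE.
Qed.

End Functional.

Section Pairs.
Variables (c : 'M[K]_n) (PP : PK -> PK -> Prop).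
Hypothesis PP0 : PP 0 0.
Hypothesis PPL : forall a x x' y y', PP x x' -> PP y y' -> PP (a *: x + y) (a *: x' + y').
Hypothesis PPtau : forall x x', PP x x' -> PP (tau x) (tau x' + jder 1 c (tau x)).
Hypothesis PPfin : exists2 s : seq PK, (forall p, p \in s -> exists p', PP p p') &
  forall p p', PP p p' -> span (fun g => g \in s) p.

Let PPR (x x' : PR) : Prop :=
  @span R (PR * PR)%type (fun g => exists p p', PP p p' /\ g = (iota p, iota p')) (x, x').

Let PPR0 : PPR 0 0. Proof. exact: span_zero. Qed.

Let PPRL a x x' y y' : PPR x x' -> PPR y y' -> PPR (a *: x + y) (a *: x' + y').
Proof. by move=> Px Py; have := spanD (spanZ a Px) Py. Qed.

Let PPRB x x' y y' : PPR x x' -> PPR y y' -> PPR (x - y) (x' - y').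
Proof. by move=> Px Py; have := PPRL (-1) Py Px; rewrite !scaleN1r ![- _ + _]addrC. Qed.

Let PPR_gen p p' : PP p p' -> PPR (iota p) (iota p').
Proof. by move=> Pp; apply: span_gen; exists p, p'. Qed.

Let PPR_ind (Phi : PR -> PR -> Prop) : Phi 0 0 ->
  (forall a p p' y y', PP p p' -> PPR y y' -> Phi y y' -> Phi (a *: iota p + y) (a *: iota p' + y')) ->
  forall x x', PPR x x' -> Phi x x'.
Proof.
move=> P0 PL x x' Pxx; rewrite -[x]/(x, x').1 -[x' in Phi _ x']/(x, x').2.
by elim: Pxx => [//|a g [y y'] [p [p' [Pp ->]]] sy IH] /=; exact: PL.
Qed.

Let c' := map_mx inc c.

Let PPRtau x x' : PPR x x' -> PPR (tauR x) (tauR x' + jder 1 c' (tauR x)).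
Proof.
move: x x'; apply: PPR_ind => [|a p p' y y' Pp _ IH].
  by rewrite !rmorph0 raddf0 addr0.
have E b u v : tauR (b *: iota u + v) = sR b *: iota (tau u) + tauR v.
  by rewrite rmorphD /= tauRZ tauR_iota.
have Ed : iota (tau p') + jder 1 c' (iota (tau p)) = iota (tau p' + jder 1 c (tau p)).
  by rewrite rmorphD /= iota_jder.
rewrite !E (linearP (jder 1 c')) addrACA -scalerDr Ed.
by apply: PPRL => //; apply: PPR_gen; exact: PPtau.
Qed.

Let PPR_l (l : {additive R -> K}) (l_inc : forall c x, l (inc c * x) = c * l x) x x' :
  PPR x x' -> PP (map_mpoly l x) (map_mpoly l x').
Proof.
move: x x'; apply: PPR_ind => [|a p p' y y' Pp _ IH]; first by rewrite !raddf0.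
by rewrite !raddfD /= !functional_iotaZ//; exact: PPL.
Qed.

(** [NN] is the first projection of [PPR] and [QQ] its kernel, so [PPR] is the graph of a linear map
    from [NN] to polynomials modulo [QQ]. Below, [q] is a set-theoretic choice of this map. *)
Let NN x := exists x', PPR x x'.
Let QQ d := PPR 0 d.

Let QQL a d e : QQ d -> QQ e -> QQ (a *: d + e).
Proof. by move=> Qd Qe; have := PPRL a Qd Qe; rewrite scaler0 addr0. Qed.

Let QQD d e : QQ d -> QQ e -> QQ (d + e).
Proof. by rewrite -{2}[d]scale1r; exact: QQL. Qed.

Let QQZ a d : QQ d -> QQ (a *: d).
Proof. by rewrite -[a *: d]addr0 => Qd; exact: QQL. Qed.

Let QQB d e : QQ d -> QQ e -> QQ (d - e).
Proof. by move=> Qd Qe; apply: QQD => //; rewrite -scaleN1r; exact: QQZ. Qed.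

Let QQtau d : QQ d -> QQ (tauR d).
Proof. by move=> /PPRtau; rewrite rmorph0 raddf0 addr0. Qed.

Let fixed_generators : exists t : seq PR, (forall x, x \in t -> NN x /\ tauR x = x) /\
  forall x, NN x -> span (fun g => g \in t) x.
Proof.
have NNfix x : NN x -> span (fun w => NN w /\ tauR w = w) x.
  move=> Nx; apply: (@fixed_ind2 (fun x _ => NN x)
    (fun x _ => span (fun w => NN w /\ tauR w = w) x) _ _ _ _ _ _ x 0) => //.
  - by exists 0.
  - by move=> a y _ z _ [y' Py] [z' Pz]; exists (a *: y' + z'); exact: PPRL.
  - by move=> y _ [y' /PPRtau Py]; exists (tauR y' + jder 1 c' (tauR y)).
  - exact: span_zero.
  - by move=> a y _ z _ _ _ sy sz; apply: spanD => //; exact: spanZ.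
  - by move=> y _ Ny fy _; apply: span_gen.
have [s sN sP] := PPfin.
have [t [tP ts]] : exists t : seq PR, (forall x, x \in t -> NN x /\ tauR x = x) /\
    forall p, p \in s -> span (fun g => g \in t) (iota p).
  elim: s sN {sP} => [|p s IH] sN; first by exists [::].
  have [|t [tP ts]] := IH; first by move=> g gs; apply: sN; rewrite inE gs orbT.
  have [|p' Pp] := sN p; first by rewrite inE eqxx.
  have [|t' t'P pt'] := span_finite (NNfix (iota p) _); first by exists (iota p'); exact: PPR_gen.
  exists (t' ++ t); split=> [x|g]; first by rewrite mem_cat => /orP[/t'P|/tP].
  rewrite inE => /predU1P[->|/ts]; first by apply: span_sub pt' => g' g't; apply: span_gen; rewrite mem_cat g't.
  by apply: span_sub => g' g't; apply: span_gen; rewrite mem_cat g't orbT.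
exists t; split=> // x [x' Pxx].
have : forall x', PPR x x' -> span (fun g => g \in t) x; last by apply; exact: Pxx.
move=> {}x' {}Pxx; move: x x' Pxx; apply: PPR_ind => [|a p p' y y' Pp _ IH]; first exact: span_zero.
apply: spanD => //; apply: spanZ.
elim: (sP _ _ Pp) => [|b g z gs _ sz]; first by rewrite rmorph0; exact: span_zero.
by rewrite rmorphD /= jsubZ; apply: spanD => //; apply: spanZ; exact: ts.
Qed.

(* The extension of NN by the second components is pulled back from a subspace
   of the trivial module PR, so it becomes split after the change of variables
   (x, x') |-> (x, x' - D_b x), up to QQ. *)
Let splitting_exists : exists b : 'M[R]_n,
  forall x, NN x -> QQ (jder 1 (conj_sigma b - b + c') x).
Proof.
have [t [tP ts]] := fixed_generators.
have [q qP] : exists q : PR -> PR, forall x, NN x -> PPR x (q x).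
  have H x : exists y, NN x -> PPR x y.
    by have [[y Py]|nN] := pselect (NN x); [exists y|exists 0 => /nN].
  by exists (fun x => projT1 (cid (H x))) => x; case: cid.
pose e k := t`_k.
have eP (k : 'I_(size t)) : NN (e k) /\ tauR (e k) = e k by apply: tP; rewrite mem_nth.
have tq (k : 'I_(size t)) : QQ (tauR (q (e k)) - (q (e k) - jder 1 c' (e k))).
  have [Ne fe] := eP k; have /PPRtau := qP _ Ne; rewrite fe => H.
  by have := PPRB H (qP _ Ne); rewrite subrr => H'; rewrite /QQ opprB addrA.
suff [b bP] : exists b : 'M[R]_n, forall k : 'I_(size t),
    QQ (tauR (q (e k) - jder 1 b (e k)) - (q (e k) - jder 1 b (e k))).
  exists b => x /ts; elim=> [|a g y gt _ IH]; first by rewrite raddf0.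
  rewrite linearP /=; apply: QQL => //.
  have gi : (index g t < size t)%N by rewrite index_mem.
  pose k := Ordinal gi; have ek : e k = g by rewrite /e /= nth_index.
  have [Ne fe] := eP k; have := QQB (tq k) (bP k).
  rewrite -ek rmorphB /= tauR_jder fe !jderD !jderN.
  by rewrite quad_cancel.
(* Modulo [QQ], these are the combinations of the tuple of the q(e_k) and of the tuples jder 1 beta
   e_k. A fixed one with a invertible, divided by a, gives the splitting. *)
pose M (w : {ffun 'I_(size t) -> PR}) := exists (a : R) (beta : 'M[R]_n), forall k,
  QQ (w k - (a *: q (e k) - jder 1 beta (e k))).
have ML a x y : M x -> M y -> M (a *: x + y).
  move=> [ax [bx Hx]] [ay [by_ Hy]]; exists (a * ax + ay), (a *: bx + by_) => k.
  have := QQL a (Hx k) (Hy k); rewrite !ffunE jderD jderZ scalerDl -scalerA.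
  by rewrite !scalerBr addsub_cancel.
have Mtau a beta (w : PR) (k : 'I_(size t)) : QQ (w - (a *: q (e k) - jder 1 beta (e k))) ->
    QQ (tauR w - (sR a *: q (e k) - jder 1 (conj_sigma beta + sR a *: c') (e k))).
  have [Ne fe] := eP k => /QQtau; rewrite !rmorphB /= tauRZ tauR_jder fe => H.
  have := QQD H (QQZ (sR a) (tq k)).
  by rewrite jderD jderZ !scalerBr telescope_cancel.
have Ms w : M w -> M [ffun k => tauR (w k)].
  move=> [a [beta H]]; exists (sR a), (conj_sigma beta + sR a *: c') => k.
  by rewrite ffunE; exact: Mtau.
(* The ideal of those a for which a q is already of the form jder 1 beta modulo [QQ]. If it contains
   1, then b is at hand; if it is zero, the scalar a of a tuple in [M] is determined by the
   tuple. *)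
have [||||H0|[b Hb]] := simp (I := fun a => exists beta : 'M[R]_n, forall k : 'I_(size t),
   QQ (a *: q (e k) - jder 1 beta (e k))).
- by exists 0 => k; rewrite scale0r jder0 subrr.
- move=> x y [bx Hx] [by_ Hy]; exists (bx + by_) => k.
  by have := QQD (Hx k) (Hy k); rewrite scalerDl jderD opprD addrACA.
- move=> x y [by_ Hy]; exists (x *: by_) => k.
  by have := QQZ x (Hy k); rewrite scalerBr jderZ scalerA.
- move=> x [beta H]; exists (conj_sigma beta + sR x *: c') => k.
  have H1 : QQ (0 - (x *: q (e k) - jder 1 beta (e k))) by rewrite sub0r -scaleN1r; exact: QQZ.
  by have := Mtau _ _ _ _ H1; rewrite rmorph0 sub0r => /(QQZ (-1)); rewrite scaleN1r opprK.
- have [[w [a [beta [Hw fw a0]]]]|nex] := pselect (exists (w : {ffun 'I_(size t) -> PR}) a beta,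
      [/\ forall k, QQ (w k - (a *: q (e k) - jder 1 beta (e k))),
          forall k, tauR (w k) = w k & a != 0]).
    (* Applying sigma to the fixed tuple puts sigma(a) - a in the ideal, which is zero here. *)
    have fa : sR a = a.
      apply/eqP; rewrite -subr_eq0; apply/eqP; apply: H0.
      exists (conj_sigma beta + sR a *: c' - beta) => k.
      have := QQB (Hw k) (Mtau _ _ _ _ (Hw k)); rewrite fw.
      by rewrite scalerBl !jderD !jderN shift_cancel.
    have ua := sigma_fixed_unit simp fa a0.
    have fa1 : sR a^-1 = a^-1 by rewrite rmorphV// fa.
    exists (a^-1 *: beta) => k; have Hk := QQZ a^-1 (Hw k).
    have tw : tauR (a^-1 *: w k) = a^-1 *: w k by rewrite tauRZ fa1 fw.
    have := QQB Hk (QQtau Hk).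
    rewrite !scalerBr scalerA mulVr// scale1r !rmorphB /= tw jderZ.
    by rewrite swap_cancel.
  (* If all fixed tuples had a = 0, the tuple of the q(e_k), a combination of fixed tuples, would be
     some jder 1 beta, which puts 1 in the zero ideal. *)
  exfalso; move/eqP: (oner_neq0 R); apply; apply: H0.
  pose w0 : {ffun 'I_(size t) -> PR} := [ffun k : 'I_(size t) => q (e k)].
  have : exists beta : 'M[R]_n, forall k, QQ (w0 k + jder 1 beta (e k)).
    apply: (@fixed_ind_ffun _ M (fun w => exists beta : 'M[R]_n, forall k, QQ (w k + jder 1 beta (e k)))) => //.
    - by exists 0, 0 => k; rewrite ffunE scale0r jder0 !subrr.
    - by exists 0 => k; rewrite ffunE jder0 addr0.
    - move=> a x y _ _ [bx Hx] [by_ Hy]; exists (a *: bx + by_) => k.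
      by have := QQL a (Hx k) (Hy k); rewrite !ffunE jderD jderZ scalerDr addrACA.
    - move=> w [a [beta Hw]] fw; exists beta => k.
      have [a0|a0] := eqVneq a 0; last by exfalso; apply: nex; exists w, a, beta.
      by have := Hw k; rewrite a0 scale0r sub0r opprK.
    - by exists 1, 0 => k; rewrite ffunE scale1r jder0 subr0 subrr.
  by move=> [beta Hb]; exists (- beta) => k; have := Hb k; rewrite ffunE scale1r jderN opprK.
- by exists b => k; have := Hb k; rewrite scale1r => H; apply: QQB => //; exact: QQtau.
Qed.

(** After the splitting by b, the pairs form a [tauR]-stable module. It is spanned by fixed pairs,
    on which D + jder 0 Z vanishes, so this operator preserves it. Undoing the splitting produces
    the correction D b + [b, Z], and the linear form l brings everything down to K. *)
Lemma connection_lift (D : {additive R -> R}) (E : 'M[R]_n) (l : {additive R -> K}) :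
  (forall x y, D (x * y) = D x * y + x * D y) -> (forall c, D (inc c) = 0) ->
  (forall x, sR x = x -> D x = 0) -> map_mx D U = U *m E ->
  (forall c x, l (inc c * x) = c * l x) ->
  exists B : 'M[K]_n, forall p p', PP p p' ->
    PP (jder 0 (map_mx l (U *m E *m Ui)) p)
       (jder 0 (map_mx l (U *m E *m Ui)) p' - jder 1 B p).
Proof.
move=> DM D_inc D_fixed DU l_inc; set Z := U *m E *m Ui.
have [b bP] := splitting_exists.
pose beta := map_mx D b + (b *m Z - Z *m b); exists (map_mx l beta) => p p' Pp.
pose PB x y := PPR x (y + jder 1 b x).
have PBL a x x' y y' : PB x x' -> PB y y' -> PB (a *: x + y) (a *: x' + y').
  by rewrite /PB linearP /= addrACA -scalerDr; exact: PPRL.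
have PBtau x y : PB x y -> PB (tauR x) (tauR y).
  rewrite /PB => Px; have Nx : NN (tauR x) by have := PPRtau Px; exists (tauR (y + jder 1 b x) + jder 1 c' (tauR x)).
  have := PPRB (PPRtau Px) (bP _ Nx); rewrite subr0 rmorphD /= tauR_jder.
  by rewrite !jderD !jderN split_cancel.
have PBD x y : PB x y -> PB x y /\
    PB (map_mpoly D x + jder 0 Z x) (map_mpoly D y + jder 0 Z y).
  move=> Pxy; split=> //; move: x y Pxy; apply: fixed_ind2 => //.
  - by rewrite /PB raddf0 addr0.
  - by rewrite /PB !raddf0 !addr0 raddf0 addr0.
  - move=> a x x' y y' Px Py Dx Dy; rewrite !raddfD /= !map_mpoly_derZ// !linearZ /=.
    rewrite !der_cancel -!scalerDr; apply: (PBL) => //; exact: PBL.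
  - by move=> x y _ fx fy; rewrite !(fixed_der DM D_fixed DU)// /PB raddf0 addr0.
have [|_] := PBD (iota p) (iota p' - jder 1 b (iota p)).
  by rewrite /PB subrK; exact: PPR_gen.
rewrite /PB !raddfB /= map_mpoly_der_iota// map_mpoly_der_iota// map_mpoly_der_jder//.
rewrite map_mpoly_der_iota// raddf0 addr0 !add0r.
have := jder_comm 0 1 Z b (iota p); rewrite add0n.
move=> /comm_cancel ->; rewrite -jderD => H.
have := PPR_l l_inc H; by rewrite raddfB /= !functional_jder.
Qed.

End Pairs.

End Descent.

(** * Weights and differential relations *)

Section WeightedSupport.
Variables (m : nat) (S : comNzRingType) (om : 'I_m -> nat) (rl : rel nat).
Local Notation P := (mpoly m S).
Local Notation X v := (@mpolyX m S (mnm1 v)).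
Hypothesis rlxx : reflexive rl.
Hypothesis rlD : forall x y z t, rl x y -> rl z t -> rl (x + z)%N (y + t)%N.
Hypothesis rlK : forall x y z, rl (x + z)%N (y + z)%N -> rl x y.

Definition mwt (k : multinom m) : nat := \sum_v k v * om v.

Lemma mwt0 : mwt (@mnm0 m) = 0%N.
Proof. by rewrite /mwt big1// => v _; rewrite mnm0E. Qed.

Lemma mwtD k l : mwt (mnm_add k l) = (mwt k + mwt l)%N.
Proof. by rewrite /mwt -big_split; apply: eq_bigr => v _ /=; rewrite mnmDE mulnDl. Qed.

Lemma mwt1 v : mwt (mnm1 v) = om v.
Proof.
rewrite /mwt (bigD1 v)//= mnm1E eqxx mul1n big1 ?addn0// => w wv.
by rewrite mnm1E eq_sym (negbTE wv).
Qed.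

(* Used with rl := leq and rl := eq_op; the shift a replaces a truncated
   subtraction w - a. *)
Definition wsupp a w (p : P) : Prop := forall k, mcoeff k p != 0 -> rl (mwt k + a)%N w.

Lemma wsupp0 a w : wsupp a w 0.
Proof. by move=> k; rewrite mcoeff0 eqxx. Qed.

Lemma wsuppD a w p q : wsupp a w p -> wsupp a w q -> wsupp a w (p + q).
Proof.
move=> wp wq k; rewrite mcoeffD; have [->|/wp//] := eqVneq (mcoeff k p) 0.
by rewrite add0r; exact: wq.
Qed.

Lemma wsuppZ a w c p : wsupp a w p -> wsupp a w (c *: p).
Proof.
move=> wp k; rewrite mcoeffZ; have [->|/wp//] := eqVneq (mcoeff k p) 0.
by rewrite mulr0 eqxx.
Qed.

Lemma wsuppN a w p : wsupp a w p -> wsupp a w (- p).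
Proof. by rewrite -scaleN1r; exact: wsuppZ. Qed.

Lemma wsupp_sum a w (I : Type) (r : seq I) (Q : pred I) (F : I -> P) :
  (forall i, Q i -> wsupp a w (F i)) -> wsupp a w (\sum_(i <- r | Q i) F i).
Proof. by move=> wF; apply: big_ind => //; [exact: wsupp0|exact: wsuppD]. Qed.

Lemma wsuppMn a w p n : wsupp a w p -> wsupp a w (p *+ n).
Proof. by rewrite -scaler_nat; exact: wsuppZ. Qed.

Lemma wsuppM a w b u p q : wsupp a w p -> wsupp b u q -> wsupp (a + b) (w + u) (p * q).
Proof.
move=> wp wq k; rewrite -mcoeff_msupp => /msuppM_le/allpairsP[[k1 k2] /= [k1p k2q ->]].
by rewrite mwtD addnACA; apply: rlD; [apply: wp|apply: wq]; rewrite -mcoeff_msupp.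
Qed.

Lemma wsuppC c : wsupp 0 0 (mpolyC m c).
Proof.
move=> k; rewrite mcoeffC; have [->|_] := eqVneq k (@mnm0 m); first by rewrite mwt0.
by rewrite mulr0 eqxx.
Qed.

Lemma wsuppX v : wsupp 0 (om v) (X v).
Proof.
move=> k; rewrite mcoeffX; case: (mnm1 v =P k) => [<-|]; last by rewrite eqxx.
by rewrite mwt1 addn0.
Qed.

Lemma wsupp_mono k c : wsupp 0 (mwt k) (c *: @mpolyX m S k).
Proof.
apply: wsuppZ => l; rewrite mcoeffX; case: (k =P l) => [<-|]; last by rewrite eqxx.
by rewrite addn0.
Qed.

Lemma wsupp_der h a w phi p : (forall v, wsupp h (om v) (phi v)) ->
  wsupp a w p -> wsupp (a + h) w (der phi p).
Proof.
move=> wphi wp; apply: wsupp_sum => v _ k.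
rewrite -mcoeff_msupp => /msuppM_le/allpairsP[[k1 k2] /= [k1p k2q ->]].
move: k1p k2q; rewrite !mcoeff_msupp mcoeff_deriv => k1p k2q.
have /wp : mcoeff (mnm_add k2 (mnm1 v)) p != 0.
  by apply: contraNneq k2q => ->; rewrite mul0rn.
have /wphi := k1p; rewrite !mwtD mwt1 => r1 r2; apply: (@rlK _ _ (om v)).
rewrite [(w + _)%N]addnC.
by have := rlD r1 r2; congr (rl _ _); lia.
Qed.


End WeightedSupport.

Arguments wsupp {m S} om rl a w p.

Section WeightedSubstitution.
Variables (m : nat) (S S' : comNzRingType) (om : 'I_m -> nat) (rl : rel nat).
Hypothesis rlxx : reflexive rl.
Hypothesis rl_trans : transitive rl.
Hypothesis rlD : forall x y z t, rl x y -> rl z t -> rl (x + z)%N (y + t)%N.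

Lemma wsupp_subst (f : {rmorphism S -> S'}) (phi : 'I_m -> mpoly m S') a w p :
  (forall v, wsupp om rl 0 (om v) (phi v)) ->
  wsupp om rl a w p -> wsupp om rl a w (mmap (@mpolyC m S' \o f) phi p).
Proof.
move=> wphi wp; apply: wsupp_sum => k _.
have [k0|kp] := eqVneq (mcoeff k p) 0.
  by rewrite k0 /= rmorph0 mpolyC0 mul0r; exact: wsupp0.
have H : wsupp om rl 0 (mwt om k) (mmap1 phi k).
  rewrite /mmap1 /mwt; apply: (@big_ind2 _ _ (fun x y => wsupp om rl 0 y x)).
  - by rewrite -mpolyC1; exact: wsuppC.
  - by move=> x1 y1 x2 y2; exact: (@wsuppM _ _ _ _ rlD 0 _ 0).
  move=> v _; elim: (k v) => [|j IH]; first by rewrite expr0 mul0n -mpolyC1; exact: wsuppC.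
  by rewrite exprS mulSn; exact: (@wsuppM _ _ _ _ rlD 0 _ 0).
move=> l; rewrite /= mul_mpolyC => lp.
have /H : mcoeff l (mmap1 phi k) != 0.
  by apply: contraNneq lp => l0; rewrite mcoeffZ l0 mulr0.
rewrite addn0 => r1; apply: rl_trans (wp k kp).
exact: rlD.
Qed.

End WeightedSubstitution.

Section WeightPart.
Variables (m : nat) (om : 'I_m -> nat).

Definition wpart (S : comNzRingType) w (p : mpoly m S) : mpoly m S :=
  \sum_(k <- msupp p | mwt om k == w) mcoeff k p *: @mpolyX m S k.

Lemma mcoeff_wpart (S : comNzRingType) w (p : mpoly m S) k :
  mcoeff k (wpart w p) = if mwt om k == w then mcoeff k p else 0.
Proof.
rewrite /wpart raddf_sum /=.
under eq_bigr do rewrite mcoeffZ mcoeffX.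
have [kp|kp] := boolP (k \in msupp p).
  rewrite -big_filter; case: eqVneq => kw.
    rewrite (bigD1_seq k) ?mem_filter ?kp ?kw ?eqxx ?filter_uniq ?msupp_uniq//=.
    by rewrite mulr1 big1 ?addr0// => l /negbTE ->; rewrite mulr0.
  rewrite big1_seq// => l /andP[_]; rewrite mem_filter => /andP[lw _].
  by case: (eqVneq l k) lw => [->|]; rewrite ?mulr0// (negbTE kw).
have -> : mcoeff k p = 0 by apply/eqP; rewrite mcoeff_eq0.
rewrite if_same big1_seq// => l /andP[_ lp].
by case: (eqVneq l k) lp kp => [->->|]; rewrite ?mulr0.
Qed.

Lemma wpart_is_linear (S : comNzRingType) w : linear (@wpart S w).
Proof.
move=> c p q; apply/mpolyP => k; rewrite mcoeffD mcoeffZ !mcoeff_wpart mcoeffD mcoeffZ.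
by case: ifP; rewrite // mulr0 addr0.
Qed.
HB.instance Definition _ (S : comNzRingType) w := GRing.isLinear.Build S _ _ *:%R (@wpart S w) (@wpart_is_linear S w).

Lemma wpart_id (S : comNzRingType) w (p : mpoly m S) : wsupp om eq_op 0 w p -> wpart w p = p.
Proof.
move=> wp; apply/mpolyP => k; rewrite mcoeff_wpart; case: ifP => // kw.
by apply/esym/eqP; apply: contraFT kw => /wp; rewrite addn0.
Qed.

Lemma wpart_eq0 (S : comNzRingType) u a w (p : mpoly m S) :
  wsupp om leq a w p -> (w < u + a)%N -> wpart u p = 0.
Proof.
move=> wp wu; apply/mpolyP => k; rewrite mcoeff_wpart mcoeff0; case: eqP => // ku.
by apply/eqP; apply: contraTT wu => /wp; rewrite ku -leqNgt.
Qed.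

Lemma wpart_eq0_hom (S : comNzRingType) u a w (p : mpoly m S) :
  wsupp om eq_op a w p -> w != (u + a)%N -> wpart u p = 0.
Proof.
move=> wp wu; apply/mpolyP => k; rewrite mcoeff_wpart mcoeff0; case: eqP => // ku.
by apply/eqP; apply: contraTT wu => /wp; rewrite ku eq_sym negbK.
Qed.

Lemma wpart_wsupp (S : comNzRingType) w (p : mpoly m S) rl : reflexive rl -> wsupp om rl 0 w (wpart w p).
Proof.
move=> rlxx k; rewrite mcoeff_wpart; case: (mwt om k =P w) => [->|]; last by rewrite eqxx.
by rewrite addn0.
Qed.

Lemma wsupp_lt (S : comNzRingType) w (p : mpoly m S) :
  wsupp om leq 0 w.+1 p -> wpart w.+1 p = 0 -> wsupp om leq 0 w p.
Proof.
move=> wp p0 k kp; have := wp k kp; rewrite addn0 leq_eqVlt => /predU1P[kw|//].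
by move: kp; have := mcoeff_wpart w.+1 p k; rewrite p0 mcoeff0 kw eqxx => <-; rewrite eqxx.
Qed.

(** An operator lowering weights by exactly h commutes with homogeneous parts up to this shift, as
    is seen on monomials. *)
Lemma wpart_commute (S S' : comNzRingType) (T : {additive mpoly m S -> mpoly m S'}) h u p :
  (forall w p, wsupp om eq_op 0 w p -> wsupp om eq_op h w (T p)) ->
  wpart u (T p) = T (wpart (u + h)%N p).
Proof.
move=> Th; elim/mpolyind: p => [|c k p _ _ IH]; first by rewrite !raddf0.
rewrite !raddfD /= IH; congr (_ + _).
have wk : wsupp om eq_op 0 (mwt om k) (c *: @mpolyX m S k).
  by apply: wsupp_mono => x; exact: eqxx.
have [kw|kw] := eqVneq (mwt om k) (u + h)%N.
  rewrite (@wpart_id _ (u + h)); last by rewrite -kw.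
  apply/mpolyP => l; rewrite mcoeff_wpart; case: eqP => // lu.
  apply/esym/eqP; apply/negPn/negP => /(Th _ _ wk); rewrite kw eqn_add2r => /eqP//.
rewrite (@wpart_eq0_hom _ u h (mwt om k))//; last exact: Th.
by rewrite (@wpart_eq0_hom _ (u + h) 0 (mwt om k)) ?addn0// raddf0.
Qed.

End WeightPart.

Lemma subspace_generators (K : fieldType) (V : lmodType K) (s : seq V) (M : V -> Prop) :
  M 0 -> (forall c x y, M x -> M y -> M (c *: x + y)) ->
  (forall x, M x -> span (fun g => g \in s) x) ->
  exists2 t : seq V, (forall x, x \in t -> M x) & forall x, M x -> span (fun g => g \in t) x.
Proof.
elim: s M => [|g s IH] M M0 ML Ms.
  by exists [::] => // x /Ms.
have sg x : span (fun h => h \in g :: s) x -> exists d, span (fun h => h \in s) (x - d *: g).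
  elim=> [|c h y]; first by exists 0; rewrite scale0r subr0; exact: span_zero.
  rewrite inE => /predU1P[->|hs] _ [d sd].
    by exists (c + d); rewrite scalerDl opprD addrACA subrr add0r.
  by exists d; rewrite -addrA; apply: span_cons.
have [|||t tM tP] := IH (fun x => M x /\ span (fun h => h \in s) x).
- by split=> //; exact: span_zero.
- by move=> c x y [Mx sx] [My sy]; split; [exact: ML|apply: spanD => //; exact: spanZ].
- by move=> x [].
have [[x0 [c [Mx0 c0 sx0]]]|nex] := pselect (exists x0 c, [/\ M x0, c != 0 &
    span (fun h => h \in s) (x0 - c *: g)]).
  exists (x0 :: t) => [x|x Mx]; first by rewrite inE => /predU1P[->//|/tM[]].
  have [d sd] := sg x (Ms x Mx).
  have -> : x = (d / c) *: x0 + (x - (d / c) *: x0) by rewrite addrC subrK.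
  apply: span_cons; first by rewrite inE eqxx.
  have : span (fun h => h \in t) (x - (d / c) *: x0).
    apply: tP; split; first by rewrite addrC -scaleNr; exact: ML.
    have -> : x - (d / c) *: x0 = (x - d *: g) - (d / c) *: (x0 - c *: g).
      by rewrite scalerBr scalerA divfK// opprB addrA subrK.
    by apply: spanB => //; exact: spanZ.
  by apply: span_sub => h ht; apply: span_gen; rewrite inE ht orbT.
exists t => [x /tM[]//|x Mx]; apply: tP; split=> //.
have [d sd] := sg x (Ms x Mx).
have [d0|d0] := eqVneq d 0; first by move: sd; rewrite d0 scale0r subr0.
by exfalso; apply: nex; exists x, d.
Qed.

(** Here a is an exact image, b its leading term and e the first-order term. Each summand on the
    right contains an error a - b - e of second order, or two first-order terms. *)
Lemma leading_product (V : comNzRingType) (a1 a2 b1 b2 e1 e2 : V) :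
  a1 * a2 - b1 * b2 - (e1 * b2 + b1 * e2) =
  (a1 - b1 - e1) * ((a2 - b2 - e2) + e2 + b2) + (e1 + b1) * (a2 - b2 - e2) + e1 * e2.
Proof. by ring. Qed.

Lemma add_cancel_mid (V : comNzRingType) (u v w : V) : u + v - u - w = v - w.
Proof. by ring. Qed.

Lemma sub_sub_add (V : comNzRingType) (x y z x' y' z' : V) :
  x + x' - (y + y') - (z + z') = (x - y - z) + (x' - y' - z').
Proof. by ring. Qed.

Section Relations.
Variables (n N : nat) (K L : fieldType) (io : {rmorphism K -> L}).
Variables (sK : {rmorphism K -> K}) (sKi : K -> K) (sL : {rmorphism L -> L}).
Variables (dK : {additive K -> K}) (dL : {additive L -> L}).
Local Notation m := #|{: 'I_n * 'I_N}|.
Local Notation P := (mpoly m K).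
Local Notation row v := (enum_val v).1.
Local Notation ord v := (nat_of_ord (enum_val v).2).
Local Notation jx := (@jX n N K).
Local Notation jy := (@jY n N K).
Local Notation Xv v := (@mpolyX m K (mnm1 v)).
Local Notation om := (fun v : 'I_m => ord v).
Local Notation om1 := (fun v : 'I_m => 1%N).
Hypothesis dLM : forall x y, dL (x * y) = dL x * y + x * dL y.
Hypothesis sKK : forall x, sK (sKi x) = x.
Hypothesis io_s : forall x, sL (io x) = io (sK x).
Hypothesis io_d : forall x, dL (io x) = io (dK x).
Hypothesis sd : forall x, sL (dL x) = dL (sL x).
Variables (A Ai : 'M[K]_n) (f : 'I_n -> L).
Hypothesis AAi : A *m Ai = 1%:M.
Hypothesis AiA : Ai *m A = 1%:M.
Hypothesis sf : forall i, sL (f i) = \sum_j io (A i j) * f j.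
Let c := Ai *m map_mx dK A.

Local Notation tau := (@jsub n N K K sK A).

Definition mtau (Y : 'M[K]_n) := Ai *m map_mx sK Y *m A.

Lemma mtauE Y : A *m mtau Y = map_mx sK Y *m A.
Proof. by rewrite /mtau !mulmxA AAi mul1mx. Qed.

Lemma mtauD Y Z : mtau (Y + Z) = mtau Y + mtau Z.
Proof. by rewrite /mtau map_mxD mulmxDr mulmxDl. Qed.

Lemma mtauZ a Y : mtau (a *: Y) = sK a *: mtau Y.
Proof. by rewrite /mtau map_mxZ -scalemxAr -scalemxAl. Qed.

Lemma mtauB Y Z : mtau (Y - Z) = mtau Y - mtau Z.
Proof. by rewrite /mtau map_mxB mulmxBr mulmxBl. Qed.

Lemma mtauM Y Z : mtau (Y *m Z) = mtau Y *m mtau Z.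
Proof. by rewrite /mtau map_mxM -!mulmxA (mulmxA A) AAi mul1mx. Qed.

Lemma mtau_surj Y : exists Y', mtau Y' = Y.
Proof.
exists (map_mx sKi (A *m Y *m Ai)); rewrite /mtau -map_mx_comp.
have -> : map_mx (sK \o sKi) (A *m Y *m Ai) = A *m Y *m Ai.
  by apply/matrixP => i j; rewrite mxE /= sKK.
by rewrite -!mulmxA AiA mulmx1 mulmxA AiA mul1mx.
Qed.

Lemma tau_jder h Y p : tau (jder h Y p) = jder h (mtau Y) (tau p).
Proof. by apply: jsub_jder; exact: mtauE. Qed.

Definition ev_at (g : 'I_n -> nat -> L) : P -> L :=
  locked_with jsub_key (mmap io (fun v => g (row v) (ord v))).

Lemma ev_atE g : ev_at g = mmap io (fun v => g (row v) (ord v)).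
Proof. exact: locked_withE. Qed.

Lemma ev_at_is_zmod_morphism g : zmod_morphism (ev_at g).
Proof. by rewrite ev_atE; exact: raddfB. Qed.
HB.instance Definition _ g := GRing.isZmodMorphism.Build _ _ (ev_at g) (ev_at_is_zmod_morphism g).

Lemma ev_at_is_monoid_morphism g : monoid_morphism (ev_at g).
Proof. by rewrite ev_atE; split; [exact: rmorph1|exact: rmorphM]. Qed.
HB.instance Definition _ g := GRing.isMonoidMorphism.Build _ _ (ev_at g) (ev_at_is_monoid_morphism g).

Lemma ev_atC g a : ev_at g (mpolyC m a) = io a.
Proof. by rewrite ev_atE mmapC. Qed.

Lemma ev_atZ g a p : ev_at g (a *: p) = io a * ev_at g p.
Proof. by rewrite -mul_mpolyC rmorphM /= ev_atC. Qed.

Lemma ev_at_jX g i j : (j < N)%N -> ev_at g (jx i j) = g i j.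
Proof.
move=> jN; rewrite -[j]/(nat_of_ord (Ordinal jN)) jX_ord ev_atE mmapX mmap1U.
by rewrite enum_rankK.
Qed.

Lemma ev_at_jY g Y i j : (j < N)%N -> ev_at g (jy Y i j) = \sum_k io (Y i k) * g k j.
Proof.
by move=> jN; rewrite /jY raddf_sum; apply: eq_bigr => k _; rewrite /= ev_atZ ev_at_jX.
Qed.

Definition jets i j : L := iter j dL (f i).
Local Notation ev := (ev_at jets).

Lemma iter_derM j x y : iter j dL (x * y) =
  \sum_(h < j.+1) (iter h dL x * iter (j - h) dL y) *+ 'C(j, h).
Proof.
elim: j => [|j IH]; first by rewrite big_ord_recl big_ord0 addr0 bin0 mulr1n.
rewrite iterS IH raddf_sum /=.
under eq_bigr do rewrite raddfMn /= dLM mulrnDl.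
rewrite big_split /= [RHS]big_ord_recl bin0 mulr1n subn0.
pose F h := iter h dL x * iter (j.+1 - h) dL y.
rewrite [X in _ = _ + X](eq_bigr (fun i : 'I_j.+1 => F i.+1 *+ 'C(j, i.+1) + F i.+1 *+ 'C(j, i))); last first.
  by move=> i _; rewrite /F /= /bump /= add1n binS mulrnDr.
have E2 : \sum_(i < j.+1) F i.+1 *+ 'C(j, i) =
    \sum_(i < j.+1) dL (iter i dL x) * iter (j - i) dL y *+ 'C(j, i).
  by apply: eq_bigr => i _; rewrite /F subSS iterS.
rewrite [X in _ = _ + X]big_split /= [X in _ = _ + (_ + X)]E2 addrA [RHS]addrC.
congr (_ + _).
rewrite [LHS]big_ord_recl bin0 mulr1n subn0 [in RHS]big_ord_recr /=.
rewrite bin_small// mulr0n addr0; congr (_ + _); apply: eq_bigr => h _.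
have E : (j - h = (j - h.+1).+1)%N by have := ltn_ord h; lia.
by rewrite /F subSS E.
Qed.

Definition dA h : 'M[K]_n := map_mx (iter h dK) A.

(** The action of sigma on the jets of f, obtained by applying the Leibniz rule to delta^j(A f). *)
Definition stilde : P -> P :=
  locked_with jsub_key (mmap (@mpolyC m K \o sK)
    (fun v => \sum_(h < (ord v).+1) jy (dA h) (row v) (ord v - h) *+ 'C(ord v, h))).

Lemma stildeE : stilde = mmap (@mpolyC m K \o sK)
    (fun v => \sum_(h < (ord v).+1) jy (dA h) (row v) (ord v - h) *+ 'C(ord v, h)).
Proof. exact: locked_withE. Qed.

Lemma stilde_is_zmod_morphism : zmod_morphism stilde.
Proof. by rewrite stildeE; exact: raddfB. Qed.
HB.instance Definition _ := GRing.isZmodMorphism.Build _ _ stilde stilde_is_zmod_morphism.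

Lemma stilde_is_monoid_morphism : monoid_morphism stilde.
Proof. by rewrite stildeE; split; [exact: rmorph1|exact: rmorphM]. Qed.
HB.instance Definition _ := GRing.isMonoidMorphism.Build _ _ stilde stilde_is_monoid_morphism.

Lemma stildeC a : stilde (mpolyC m a) = mpolyC m (sK a).
Proof. by rewrite stildeE mmapC. Qed.

Lemma stildeX v : stilde (Xv v) =
  \sum_(h < (ord v).+1) jy (dA h) (row v) (ord v - h) *+ 'C(ord v, h).
Proof. by rewrite stildeE mmapX mmap1U. Qed.

Lemma iter_sd j x : sL (iter j dL x) = iter j dL (sL x).
Proof. by elim: j => //= j IH; rewrite sd IH. Qed.

Lemma iter_io j x : iter j dL (io x) = io (iter j dK x).
Proof. by elim: j => //= j ->; rewrite io_d. Qed.

Lemma iter_dL_sum j (F : 'I_n -> L) : iter j dL (\sum_i F i) = \sum_i iter j dL (F i).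
Proof. by elim: j => //= j ->; rewrite raddf_sum. Qed.

Lemma ev_stilde p : ev (stilde p) = sL (ev p).
Proof.
elim/mpoly_ring_ind: p => [a|v|p q Ep Eq|p q Ep Eq].
- by rewrite stildeC !ev_atC io_s.
- rewrite stildeX jX_var ev_at_jX// raddf_sum /jets iter_sd sf iter_dL_sum.
  under [RHS]eq_bigr do rewrite iter_derM.
  rewrite exchange_big; apply: eq_bigr => h _ /=.
  rewrite raddfMn /= ev_at_jY ?(leq_ltn_trans (leq_subr _ _))//.
  by rewrite sumrMnl; congr (_ *+ _); apply: eq_bigr => k _; rewrite mxE iter_io.
- by rewrite !rmorphD /= Ep Eq.
- by rewrite !rmorphM /= Ep Eq.
Qed.

Lemma jY_wsupp rl Y i j h w : reflexive rl -> (j + h)%N = w -> wsupp om rl h w (jy Y i j : P).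
Proof.
move=> rlxx jh; apply: wsupp_sum => k _; apply: wsuppZ.
rewrite /jX; case: insubP => [l _ lj|_]; last exact: wsupp0.
move=> x; rewrite mcoeffX; case: (_ =P x) => [<-|]; last by rewrite eqxx.
by rewrite mwt1 enum_rankK /= lj jh.
Qed.

Lemma jY_wsupp1 Y i j : wsupp om1 leq 0 1 (jy Y i j : P).
Proof.
apply: wsupp_sum => k _; apply: wsuppZ.
rewrite /jX; case: insubP => [l _ lj|_]; last exact: wsupp0.
move=> x; rewrite mcoeffX; case: (_ =P x) => [<-|]; last by rewrite eqxx.
by rewrite mwt1.
Qed.

Let eqD x y z t : (x == y :> nat) -> z == t -> (x + z)%N == (y + t)%N.
Proof. by move=> /eqP-> /eqP->. Qed.
Let eqK x y z : (x + z)%N == (y + z)%N -> x == y :> nat.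
Proof. by rewrite eqn_add2r. Qed.
Let leD x y z t : (x <= y)%N -> (z <= t)%N -> (x + z <= y + t)%N.
Proof. exact: leq_add. Qed.
Let leK x y z : (x + z <= y + z)%N -> (x <= y)%N.
Proof. by rewrite leq_add2r. Qed.
Let eq_tr : transitive (@eq_op nat).
Proof. by move=> y x z /eqP->. Qed.

Let jder_image rl h Y (v : 'I_m) : reflexive rl -> 
  wsupp om rl h (ord v) ((jy Y (row v) (ord v - h) : P) *+ (ord v ^_ h)).
Proof.
move=> rlxx; have [vh|hv] := ltnP (ord v) h; first by rewrite ffact_small// mulr0n; exact: wsupp0.
by apply: wsuppMn; apply: jY_wsupp => //; rewrite subnK.
Qed.

Lemma jder_wsupp_eq h Y a w (p : P) : wsupp om eq_op a w p -> wsupp om eq_op (a + h) w (jder h Y p).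
Proof. by rewrite jderE; apply: (wsupp_der eqD eqK) => v; exact: jder_image. Qed.

Lemma jder_wsupp_le h Y a w (p : P) : wsupp om leq a w p -> wsupp om leq (a + h) w (jder h Y p).
Proof. by rewrite jderE; apply: (wsupp_der leD leK) => v; exact: jder_image. Qed.

Lemma tau_wsupp rl a w (p : P) : reflexive rl -> transitive rl ->
  (forall x y z t, rl x y -> rl z t -> rl (x + z)%N (y + t)%N) ->
  wsupp om rl a w p -> wsupp om rl a w (tau p).
Proof.
move=> rlxx rltr rlD; rewrite jsubE; apply: wsupp_subst => // v.
by apply: jY_wsupp => //; rewrite addn0.
Qed.

Lemma stilde_wsupp1 a w (p : P) : wsupp om1 leq a w p -> wsupp om1 leq a w (stilde p).
Proof.
rewrite stildeE; apply: wsupp_subst => //; [exact: leq_trans|move=> v].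
by apply: wsupp_sum => h _; apply: wsuppMn; exact: jY_wsupp1.
Qed.

Lemma stilde_wsupp a w (p : P) : wsupp om leq a w p -> wsupp om leq a w (stilde p).
Proof.
rewrite stildeE; apply: wsupp_subst => //; [exact: leq_trans|move=> v].
apply: wsupp_sum => h _; apply: wsuppMn => k /(jY_wsupp (h := h) (w := ord v) leqnn).
by move=> /(_ (subnK _)) H; apply: leq_trans (H (ltn_ord h)); rewrite addn0 leq_addr.
Qed.

Lemma wsupp_weaken a b w (p : P) : (b <= a)%N -> wsupp om leq a w p -> wsupp om leq b w p.
Proof. by move=> ba wp k /wp; apply: leq_trans; rewrite leq_add2l. Qed.

Let wM a w b u (p q : P) := @wsuppM m K om leq leD a w b u p q.

(** The h-th Leibniz term lowers the order by h. The term h = 0 is [tau]; the term h = 1 is j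
    delta(A) X_(j-1), which equals jder 1 c of A X_j because A c = delta(A). The estimate is
    multiplicative, so it need only be checked on variables. *)
Lemma stilde_leading w p : wsupp om leq 0 w p ->
  wsupp om leq 2 w (stilde p - tau p - jder 1 c (tau p)).
Proof.
pose Q w (p : P) := wsupp om leq 0 w (tau p) /\
  wsupp om leq 2 w (stilde p - tau p - jder 1 c (tau p)).
have QM w1 w2 p1 p2 : Q w1 p1 -> Q w2 p2 -> Q (w1 + w2)%N (p1 * p2).
  move=> [t1 s1] [t2 s2]; rewrite /Q !rmorphM /= jderM; split; first exact: (wM t1 t2).
  have d1 := @jder_wsupp_le 1 c _ _ _ t1; have d2 := @jder_wsupp_le 1 c _ _ _ t2.
  move: t1 s1 d1 t2 s2 d2.
  set a1 := stilde p1; set b1 := tau p1; set e1 := jder 1 c b1.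
  set a2 := stilde p2; set b2 := tau p2; set e2 := jder 1 c b2.
  move=> t1 s1 d1 t2 s2 d2.
  have -> : a1 * a2 - b1 * b2 - (e1 * b2 + b1 * e2) =
      (a1 - b1 - e1) * ((a2 - b2 - e2) + e2 + b2) + (e1 + b1) * (a2 - b2 - e2) + e1 * e2.
    exact: (@leading_product P).
  apply: wsuppD; first apply: wsuppD.
  - rewrite -[2%N]addn0; apply: (wM s1); apply: wsuppD => //.
    by apply: wsuppD; [exact: wsupp_weaken s2|exact: wsupp_weaken d2].
  - rewrite -[2%N]add0n; apply: wM (s2); apply: wsuppD => //.
    exact: wsupp_weaken d1.
  - exact: (wM d1 d2).
have QC a : Q 0%N (mpolyC m a).
  rewrite /Q stildeC jsubC jderC subrr subr0; split; last exact: wsupp0.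
  by apply: wsuppC.
have QX v : Q (ord v) (Xv v).
  rewrite /Q stildeX jX_var jsub_jX; split; first by apply: jY_wsupp; rewrite ?addn0.
  rewrite jder_jY// mulmxA AAi mul1mx ffactn1.
  rewrite big_ord_recl bin0 mulr1n subn0.
  have -> : jy (dA (@ord0 (ord v))) (row v) (ord v) = jy A (row v) (ord v) :> P.
    by congr jY; apply/matrixP => i j; rewrite mxE.
  rewrite (@add_cancel_mid P).
  have [v0|v0] := posnP (ord v).
    by rewrite v0 mulr0n subr0 big_ord0; exact: wsupp0.
  case E : (ord v) v0 => [//|o] _.
  rewrite big_ord_recl /= bin1 subn1 /=.
  have -> : jy (dA 1) (row v) o = jy (map_mx dK A) (row v) o :> P by [].
  rewrite addrAC subrr add0r.
  apply: wsupp_sum => h _; apply: wsuppMn; rewrite /bump /= !add1n.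
  apply: (wsupp_weaken (a := h.+2)) => //; apply: jY_wsupp => //.
  by rewrite subnK// ltnS; exact: ltn_ord.
have Qmono k : Q (mwt om k) (@mpolyX m K k).
  rewrite mpolyXE_id /mwt; apply: (@big_ind2 _ _ (fun x y => Q y x)).
  - by rewrite -mpolyC1; exact: QC.
  - by move=> x1 y1 x2 y2; exact: QM.
  move=> v _; elim: (k v) => [|j IH]; first by rewrite expr0 mul0n -mpolyC1; exact: QC.
  by rewrite exprS mulSn; exact: QM.
elim/mpolyind: p => [|a k p kp a0 IH] wp.
  have -> : stilde 0 = 0 by exact: rmorph0.
  have -> : tau 0 = 0 by exact: rmorph0.
  have -> : jder 1 c (0 : P) = 0 by exact: raddf0.
  by rewrite !subr0; exact: wsupp0.
have wk : (mwt om k <= w)%N.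
  have := wp k; rewrite addn0; apply; rewrite mcoeffD mcoeffZ mcoeffX eqxx mulr1.
  by move: kp; rewrite -mcoeff_eq0 => /eqP ->; rewrite addr0.
have {}IH : wsupp om leq 2 w (stilde p - tau p - jder 1 c (tau p)).
  apply: IH => l lp; apply: wp; rewrite mcoeffD mcoeffZ mcoeffX.
  case: (k =P l) => [kl|_]; last by rewrite mulr0 add0r.
  by exfalso; move: lp kp; rewrite -kl mcoeff_eq0 negbK => ->.
have [_ Hk] := QM _ _ _ _ (QC a) (Qmono k).
rewrite -mul_mpolyC !rmorphD /= (raddfD (jder 1 c)) /=.
have -> : forall x y z x' y' z' : P, x + x' - (y + y') - (z + z') =
   (x - y - z) + (x' - y' - z') by exact: (@sub_sub_add P).
apply: wsuppD => // l /Hk; rewrite add0n => /leq_trans; exact.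
Qed.

Lemma wpart_jder h Y u (p : P) : wpart om u (jder h Y p) = jder h Y (wpart om (u + h)%N p).
Proof. by apply: wpart_commute => w q; exact: jder_wsupp_eq. Qed.

Lemma wpart_tau u (p : P) : wpart om u (tau p) = tau (wpart om u p).
Proof.
rewrite -{2}[u]addn0; apply: wpart_commute => w q; exact: tau_wsupp.
Qed.

Lemma wpart_stilde w p : wsupp om leq 0 w p -> wpart om w (stilde p) = tau (wpart om w p).
Proof.
move=> wp; have H := stilde_leading wp.
have -> : stilde p = (stilde p - tau p - jder 1 c (tau p)) + jder 1 c (tau p) + tau p.
  by rewrite !subrK.
rewrite 2!(raddfD (wpart om w)) /= (wpart_eq0 H) ?addn2// wpart_jder wpart_tau.
rewrite (@wpart_eq0 _ _ _ (w + 1)%N 0 w) ?addn0 ?addn1//.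
by rewrite (raddf0 tau) raddf0 !add0r wpart_tau.
Qed.

Lemma wpart_stildeS w p : wsupp om leq 0 w.+1 p ->
  wpart om w (stilde p) = tau (wpart om w p) + jder 1 c (tau (wpart om w.+1 p)).
Proof.
move=> wp; have H := stilde_leading wp.
have -> : stilde p = (stilde p - tau p - jder 1 c (tau p)) + jder 1 c (tau p) + tau p.
  by rewrite !subrK.
rewrite 2!(raddfD (wpart om w)) /= (wpart_eq0 H) ?addn2// wpart_jder !wpart_tau ?addn1.
by rewrite add0r addrC.
Qed.

End Relations.

(** * Osculating ideals *)

Section Osculation.
Variables (n N : nat) (K L : fieldType) (io : {rmorphism K -> L}).
Variables (sK : {rmorphism K -> K}) (sKi : K -> K) (sL : {rmorphism L -> L}).
Local Notation m := #|{: 'I_n * 'I_N}|.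
Local Notation P := (mpoly m K).
Local Notation row v := (enum_val v).1.
Local Notation ord v := (nat_of_ord (enum_val v).2).
Local Notation jy := (@jY n N K).
Local Notation om1 := (fun v : 'I_m => 1%N).
Hypothesis io_s : forall x, sL (io x) = io (sK x).
Hypothesis char0 : forall k, k.+1%:R != 0 :> K.
Variables (A Ai : 'M[K]_n) (f : 'I_n -> L).
Hypothesis AAi : A *m Ai = 1%:M.
Hypothesis sf : forall i, sL (f i) = \sum_j io (A i j) * f j.
Local Notation tau := (@jsub n N K K sK A).
Local Notation mtau := (@mtau n K sK A Ai).

Variable T : 'M[K]_n -> Prop.
Hypothesis T_tau : forall Y, T Y -> T (mtau Y).
Hypothesis T_tau_surj : forall Y, T Y -> exists2 Y', T Y' & mtau Y' = Y.
Hypothesis T_perfect : forall M : 'M[K]_n -> Prop, M 0 ->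
  (forall a Y Z, M Y -> M Z -> M (a *: Y + Z)) ->
  (forall Y Z, T Y -> T Z -> M (Y *m Z - Z *m Y)) -> forall Y, T Y -> M Y.

Local Notation e0 := (ev_at (N := N) io (fun i j => if j == 0%N then f i else 0)).

(* Through osculating, p belongs to the ideal of the jets at (f, 0, 0, ...) of
   the orbits of the group with Lie algebra T[eps]. *)
Fixpoint osc k (p : P) : Prop :=
  if k is k'.+1 then
    e0 p = 0 /\ forall h Y, (h <= 1)%N -> T Y -> osc k' (jder h Y p)
  else e0 p = 0.

Definition osculating p : Prop := forall k, osc k p.

Lemma osc_e0 k p : osc k p -> e0 p = 0.
Proof. by case: k => // k []. Qed.

Lemma oscS k p : osc k.+1 p -> osc k p.
Proof.
elim: k p => [|k IH] p [p0 Dp]; first by [].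
by split=> // h Y h1 TY; apply: IH; exact: Dp.
Qed.

Lemma osc_lin k a p q : osc k p -> osc k q -> osc k (a *: p + q).
Proof.
elim: k p q => [|k IH] p q; first by rewrite /= raddfD /= ev_atZ => -> ->; rewrite mulr0 addr0.
move=> [p0 Dp] [q0 Dq]; split; first by rewrite raddfD /= ev_atZ p0 q0 mulr0 addr0.
by move=> h Y h1 TY; rewrite linearP; apply: IH; [exact: Dp|exact: Dq].
Qed.

Lemma osc0 k : osc k 0.
Proof.
elim: k => [|k IH] /=; first by rewrite rmorph0.
by split=> [|h Y _ _]; rewrite ?rmorph0 ?raddf0.
Qed.

Lemma oscD k p q : osc k p -> osc k q -> osc k (p + q).
Proof. by rewrite -{2}[p]scale1r; exact: osc_lin. Qed.

Lemma oscM k q p : osc k p -> osc k (q * p).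
Proof.
elim: k p q => [|k IH] p q; first by rewrite /= rmorphM /= => ->; rewrite mulr0.
move=> op; have pk := oscS op; have [p0 Dp] := op.
split; first by rewrite rmorphM /= p0 mulr0.
by move=> h Y h1 TY; rewrite jderM; apply: oscD; [exact: IH|apply: IH; exact: Dp].
Qed.

(** A factor that does not vanish at the base point is invertible there; the product rule passes
    this on from one order to the next. *)
Lemma osc_prime k nu p : e0 nu != 0 -> osc k (nu * p) -> osc k p.
Proof.
move=> nu0.
have H q : e0 (nu * q) = 0 -> e0 q = 0.
  by rewrite rmorphM /= => /eqP; rewrite mulf_eq0 (negbTE nu0) => /eqP.
elim: k p => [|k IH] p; first exact: H.
move=> onp; have op := IH _ (oscS onp); have [np0 Dnp] := onp.
split=> [|h Y h1 TY]; first exact: H.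
apply: IH; have -> : nu * jder h Y p = jder h Y (nu * p) + (- jder h Y nu) * p.
  by rewrite jderM mulNr addrAC subrr add0r.
by apply: oscD; [exact: Dnp|exact: oscM].
Qed.

Lemma osculating_lin a p q : osculating p -> osculating q -> osculating (a *: p + q).
Proof. by move=> op oq k; exact: osc_lin. Qed.

Lemma osculating0 : osculating 0. Proof. by move=> k; exact: osc0. Qed.

Lemma osculatingD p q : osculating p -> osculating q -> osculating (p + q).
Proof. by move=> op oq k; exact: oscD. Qed.

Lemma osculatingM q p : osculating p -> osculating (q * p).
Proof. by move=> op k; exact: oscM. Qed.

Lemma osculatingN p : osculating p -> osculating (- p).
Proof. by move=> op; rewrite -mulN1r; exact: osculatingM. Qed.

Lemma osculatingB p q : osculating p -> osculating q -> osculating (p - q).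
Proof. by move=> op oq; apply: osculatingD => //; exact: osculatingN. Qed.

Lemma osculating_sum (I : Type) (r : seq I) (Q : pred I) (F : I -> P) :
  (forall i, Q i -> osculating (F i)) -> osculating (\sum_(i <- r | Q i) F i).
Proof. by move=> oF; apply: big_ind => //; [exact: osculating0|exact: osculatingD]. Qed.

Lemma osculating_prime nu p : e0 nu != 0 -> osculating (nu * p) -> osculating p.
Proof. by move=> nu0 op k; apply: osc_prime (op k). Qed.

Lemma osculating_jder1 h Y p : (h <= 1)%N -> T Y -> osculating p -> osculating (jder h Y p).
Proof. by move=> h1 TY op k; have [_] := op k.+1; apply. Qed.

(** Only t^0 and t^1 are tested by [osc]. As T = [T, T], the elements of t^(h+1) T are sums of
    brackets of t^h T with t T. *)
Lemma osculating_jder h Y p : T Y -> osculating p -> osculating (jder h Y p).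
Proof.
elim: h Y p => [|h IH] Y p TY op; first exact: osculating_jder1.
move: Y TY p op; apply: T_perfect => [p op|a Y Z MY MZ p op|Y Z TY TZ p op].
- by rewrite jder0; exact: osculating0.
- by rewrite jderD jderZ; apply: osculating_lin; [exact: MY|exact: MZ].
- have := jder_comm h 1 Z Y p; rewrite addn1 => <-.
  apply: osculatingB; first by apply: IH => //; exact: osculating_jder1.
  by apply: osculating_jder1 => //; exact: IH.
Qed.

Lemma e0_tau p : (0 < N)%N -> e0 (tau p) = sL (e0 p).
Proof.
move=> N0; elim/mpoly_ring_ind: p => [a|v|p q Ep Eq|p q Ep Eq].
- by rewrite jsubC !ev_atC io_s.
- rewrite jX_var jsub_jX ev_at_jY// ev_at_jX//; case: eqP => _; first by rewrite sf.
  by rewrite rmorph0 big1// => k _; rewrite mulr0.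
- by rewrite !rmorphD /= Ep Eq.
- by rewrite !rmorphM /= Ep Eq.
Qed.

(** Evaluation at the base point intertwines [tau] with the injective map sigma, and [mtau] maps T
    onto itself. *)
Lemma osculating_tau p : (0 < N)%N -> osculating (tau p) <-> osculating p.
Proof.
move=> N0; suff H k q : osc k (tau q) <-> osc k q by split=> op k; apply/H.
elim: k q => [|k IH] q /=.
  by rewrite e0_tau//; split=> [/eqP|->]; rewrite ?rmorph0// fmorph_eq0 => /eqP.
split=> [[q0 Dq]|[q0 Dq]]; split.
- by move/eqP: q0; rewrite e0_tau// fmorph_eq0 => /eqP.
- move=> h Y h1 TY; apply/IH; rewrite (tau_jder _ AAi).
  by apply: Dq => //; exact: T_tau.
- by rewrite e0_tau// q0 rmorph0.
- move=> h Y h1 /T_tau_surj[Y' TY' <-]; rewrite -(tau_jder _ AAi).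
  by apply/IH; exact: Dq.
Qed.

(** Cramer's rule: the determinant does not vanish at the base point, so it can be cancelled. *)
Lemma osculating_cramer r (w : 'I_r -> 'I_n) (Ys : 'I_r -> 'M[K]_n) (q : 'I_r -> P) :
  (0 < N)%N -> \det (\matrix_(s, i) \sum_k io (Ys s (w i) k) * f k) != 0 ->
  (forall s, osculating (\sum_i jy (Ys s) (w i) 0%N * q i)) -> forall i, osculating (q i).
Proof.
move=> N0 d0 oq i; pose M : 'M[P]_r := \matrix_(s, i) jy (Ys s) (w i) 0%N.
apply: (@osculating_prime (\det M)).
  rewrite -det_map_mx; suff -> : map_mx e0 M = \matrix_(s, i) \sum_k io (Ys s (w i) k) * f k by [].
  by apply/matrixP => s j; rewrite !mxE ev_at_jY//; apply: eq_bigr.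
have -> : \det M * q i = \sum_s (\adj M i s * \sum_j M s j * q j).
  have := congr1 (fun X : 'M[P]_r => (X *m (\col_j q j)) i 0) (mul_adj_mx M).
  rewrite -mulmxA mul_scalar_mx !mxE => <-.
  apply: eq_bigr => s _; congr (_ * _); rewrite mxE; apply: eq_bigr => j _.
  by rewrite !mxE.
apply: osculating_sum => s _; apply: osculatingM.
by under eq_bigr do rewrite mxE; exact: oq.
Qed.

(** Descending induction on the order j. The derivation [jder j] sees only variables of order at
    least j, and its part of order j is j! times the derivative along Y X_0. As Y runs through the
    frame, Cramer's rule recovers each partial derivative. *)
Lemma osculating_gradient r (rn : (r <= n)%N) (Ys : 'I_r -> 'M[K]_n) j0 p :
  \det (\matrix_(s, i) \sum_k io (Ys s (widen_ord rn i) k) * f k) != 0 ->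
  (forall v : 'I_m, (r <= row v)%N -> (j0 <= ord v)%N -> mderiv v p = 0) ->
  (forall h s, (j0 <= h < N)%N -> osculating (jder h (Ys s) p)) ->
  forall v : 'I_m, (j0 <= ord v)%N -> osculating (mderiv v p).
Proof.
move=> d0 ap Dp v; have [k] := ubnP (N - ord v)%N; elim: k v => // k IH v vk j0v.
have [rv|vr] := leqP r (row v); first by rewrite ap//; exact: osculating0.
set j := (enum_val v).2 in vk j0v *.
have N0 : (0 < N)%N by apply: leq_ltn_trans (ltn_ord j).
pose u (i : 'I_n) : 'I_m := enum_rank (i, j).
have -> : v = u (widen_ord rn (Ordinal vr)).
  apply: enum_val_inj; rewrite enum_rankK [LHS]surjective_pairing; congr (_, _).
  exact: val_inj.
apply: (osculating_cramer N0 d0 (q := fun i => mderiv (u (widen_ord rn i)) p)) => s.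
have oD : osculating (jder j (Ys s) p) by apply: Dp; rewrite j0v ltn_ord.
have E : jder j (Ys s) p = j`!%:R *: (\sum_(i < r) jy (Ys s) (widen_ord rn i) 0%N *
      mderiv (u (widen_ord rn i)) p) +
    \sum_(x | ord x != j) jy (Ys s) (row x) (ord x - j) *+ (ord x ^_ j) * mderiv x p.
  rewrite jderE /der (bigID (fun x => ord x == j :> nat)) /=; congr (_ + _).
  rewrite (reindex_onto u (fun x => row x)) /=; last first.
    move=> x /eqP xj; apply: enum_val_inj; rewrite enum_rankK.
    by rewrite [RHS]surjective_pairing; congr (_, _); exact: val_inj.
  rewrite (eq_bigl xpredT) => [|i]; last by rewrite enum_rankK /= !eqxx.
  rewrite scaler_sumr (bigID (fun i : 'I_n => (i < r)%N)) /= addrC big1 ?add0r => [|i]; last first.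
    by rewrite -leqNgt => ri; rewrite ap ?mulr0// enum_rankK.
  rewrite (big_ord_narrow rn); apply: eq_bigr => i _.
  by rewrite enum_rankK /= subnn ffactnn -scaler_nat scalerAl.
have /osculatingB/(_ (oD)) : osculating
    (\sum_(x | ord x != j) jy (Ys s) (row x) (ord x - j) *+ (ord x ^_ j) * mderiv x p).
  apply: osculating_sum => x xj; have [xlt|jx] := ltnP (ord x) j.
    by rewrite ffact_small// mulr0n mul0r; exact: osculating0.
  apply: osculatingM; apply: IH; last exact: leq_trans jx.
  by have := ltn_ord (enum_val x).2; move: xj jx vk; rewrite /=; lia.
rewrite E opprD addrCA subrr addr0 => /osculatingN; rewrite opprK.
rewrite -mul_mpolyC; apply: osculating_prime.
rewrite ev_atC fmorph_eq0; have := fact_gt0 j; case: (j`!) => // x _.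
Qed.

Definition no_rows r (p : P) : Prop :=
  forall k (v : 'I_m), mcoeff k p != 0 -> (r <= row v)%N -> k v = 0%N.

Lemma no_rows_mderiv0 r p (v : 'I_m) : no_rows r p -> (r <= row v)%N -> mderiv v p = 0.
Proof.
move=> rp rv; apply/mpolyP => k; rewrite mcoeff_deriv mcoeff0; apply/eqP.
rewrite -mulr_natl mulf_eq0; apply/orP; right; apply: contraT => /rp /(_ rv).
by rewrite mnmDE mnm1E eqxx addn1.
Qed.

Lemma no_rows_mderiv r p (v : 'I_m) : no_rows r p -> no_rows r (mderiv v p).
Proof.
move=> rp k x; rewrite mcoeff_deriv => kp rx; have := rp (mnm_add k (mnm1 v)) x.
rewrite mnmDE => /(_ _ rx) H; apply/eqP; rewrite -leqn0; rewrite -H ?leq_addr//.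
by apply: contraNneq kp => ->; rewrite mul0rn.
Qed.

Lemma no_rows_wpart r om w p : no_rows r p -> no_rows r (wpart om w p).
Proof.
move=> rp k v; rewrite mcoeff_wpart; case: (_ == w); first exact: rp.
by rewrite eqxx.
Qed.

(** The orbit is dense in the first r coordinates. By induction on the degree all partial
    derivatives of p vanish, so p is a constant, and it is zero at the base point. *)
Lemma osculating_density r (rn : (r <= n)%N) (Ys : 'I_r -> 'M[K]_n) p :
  (forall s, T (Ys s)) ->
  \det (\matrix_(s, i) \sum_k io (Ys s (widen_ord rn i) k) * f k) != 0 ->
  no_rows r p -> osculating p -> p = 0.
Proof.
move=> TYs d0.
have [d] : exists d, wsupp om1 leq 1 d p.
  exists (\max_(k <- msupp p) mwt om1 k).+1 => k kp; rewrite addn1 ltnS.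
  by apply: leq_bigmax_seq => //; rewrite mcoeff_msupp.
elim: d p => [|d IH] p dp rp op.
  apply/mpolyP => k; rewrite mcoeff0; apply/eqP; apply: contraT => /dp.
  by rewrite addn1 ltn0.
have Dp0 (v : 'I_m) : mderiv v p = 0.
  apply: IH; last 1 first.
  - apply: (osculating_gradient (j0 := 0) d0) => // [x rx _|h s _].
      exact: no_rows_mderiv0 rx.
    exact: osculating_jder.
  - move=> k; rewrite mcoeff_deriv => kp.
    have /dp : mcoeff (mnm_add k (mnm1 v)) p != 0.
      by apply: contraNneq kp => ->; rewrite mul0rn.
    by rewrite mwtD mwt1 !addn1.
  - exact: no_rows_mderiv.
have pC : p = mpolyC m (mcoeff (@mnm0 m) p).
  apply/mpolyP => k; rewrite mcoeffC; have [->|k0] := eqVneq k (@mnm0 m).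
    by rewrite mulr1.
  rewrite mulr0; have [v kv] : exists v, k v != 0%N.
    apply/existsP; apply: contraR k0 => /existsPn H; apply/eqP/mnmP => v.
    by rewrite mnm0E; apply/eqP; have := H v; rewrite negbK.
  pose k' := mnm_sub k (mnm1 v).
  have kE : k = mnm_add k' (mnm1 v).
    apply/mnmP => x; rewrite mnmDE mnmBE mnm1E subnK//.
    by case: eqP => // <-; rewrite lt0n.
  have := congr1 (mcoeff k') (Dp0 v); rewrite mcoeff_deriv mcoeff0 -kE => /eqP.
  by rewrite -mulr_natl mulf_eq0 (negbTE (char0 _)) => /eqP.
have /eqP := osc_e0 (op 0%N); rewrite pC ev_atC fmorph_eq0 => /eqP ->.
by rewrite mpolyC0.
Qed.

End Osculation.

(** * The cocycle of a minimal relation *)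

Definition lie (R : comNzRingType) n (X Y : 'M[R]_n) : 'M[R]_n := X *m Y - Y *m X.

Lemma lieDl (R : comNzRingType) n (X Y Z : 'M[R]_n) : lie (X + Y) Z = lie X Z + lie Y Z.
Proof. by rewrite /lie mulmxDl mulmxDr opprD addrACA. Qed.

Lemma lieDr (R : comNzRingType) n (X Y Z : 'M[R]_n) : lie X (Y + Z) = lie X Y + lie X Z.
Proof. by rewrite /lie mulmxDl mulmxDr opprD addrACA. Qed.

Lemma lieZl (R : comNzRingType) n a (X Y : 'M[R]_n) : lie (a *: X) Y = a *: lie X Y.
Proof. by rewrite /lie -scalemxAl -scalemxAr scalerBr. Qed.

Lemma lieZr (R : comNzRingType) n a (X Y : 'M[R]_n) : lie X (a *: Y) = a *: lie X Y.
Proof. by rewrite /lie -scalemxAl -scalemxAr scalerBr. Qed.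

Lemma lieN (R : comNzRingType) n (X Y : 'M[R]_n) : - lie X Y = lie Y X.
Proof. by rewrite /lie opprB. Qed.

Lemma bilinear_delta (R : comNzRingType) (V : lmodType R) n (Psi : 'M[R]_n -> 'M[R]_n -> V) :
  (forall Y, linear (Psi^~ Y)) -> (forall X, linear (Psi X)) -> forall X Y,
  Psi X Y = \sum_i \sum_j \sum_k \sum_l (X i j * Y k l) *: Psi (delta_mx i j) (delta_mx k l).
Proof.
move=> Ll Lr X Y.
have lin (phi : 'M[R]_n -> V) (Lphi : linear phi) Z :
    phi Z = \sum_i \sum_j Z i j *: phi (delta_mx i j).
  have phi0 : phi 0 = 0.
    by have := Lphi 1 0 0; rewrite scale1r addr0 scale1r -[LHS]addr0 => /addrI.
  have phiD x y : phi (x + y) = phi x + phi y by have := Lphi 1 x y; rewrite !scale1r.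
  have phiZ a x : phi (a *: x) = a *: phi x by have := Lphi a x 0; rewrite !addr0 phi0 addr0.
  rewrite {1}[Z]matrix_sum_delta (big_morph phi phiD phi0); apply: eq_bigr => i _.
  by rewrite (big_morph phi phiD phi0); apply: eq_bigr => j _.
rewrite (lin (Psi^~ Y))//; apply: eq_bigr => i _; apply: eq_bigr => j _.
rewrite (lin (Psi (delta_mx i j)))// scaler_sumr; apply: eq_bigr => k _.
by rewrite scaler_sumr; apply: eq_bigr => l _; rewrite scalerA.
Qed.

(** The tensor sum_ab E_ab (x) E_ba is dual to the trace form, hence invariant under conjugation. *)
Lemma casimir_invariant (R : comNzRingType) (V : lmodType R) n (Psi : 'M[R]_n -> 'M[R]_n -> V)
    (A Ai : 'M[R]_n) : Ai *m A = 1%:M ->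
  (forall Y, linear (Psi^~ Y)) -> (forall X, linear (Psi X)) ->
  \sum_a \sum_b Psi (Ai *m delta_mx a b *m A) (Ai *m delta_mx b a *m A) =
  \sum_a \sum_b Psi (delta_mx a b) (delta_mx b a).
Proof.
move=> AiA Ll Lr.
have conjE a b i j : (Ai *m delta_mx a b *m A) i j = Ai i a * A b j.
  rewrite -mulmxA mxE (bigD1 a)//= big1 => [|x xa]; last first.
    rewrite mxE big1 ?mulr0// => y _; rewrite mxE (negbTE xa) mul0r//.
  rewrite addr0 mxE (bigD1 b)//= big1 => [|x xb]; last by rewrite mxE (negbTE xb) andbF mul0r.
  by rewrite mxE !eqxx mul1r addr0.
have E1 i j : \sum_a Ai i a * A a j = (i == j)%:R.
  by have := congr1 (fun M : 'M[R]_n => M i j) AiA; rewrite !mxE.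
have tens (F G : 'I_n -> 'I_n -> 'M[R]_n) :
    (forall i j k l, \sum_a \sum_b F a b i j * G a b k l = ((i == l) && (j == k))%:R) ->
    \sum_a \sum_b Psi (F a b) (G a b) =
    \sum_i \sum_j \sum_k \sum_l ((i == l) && (j == k))%:R *: Psi (delta_mx i j) (delta_mx k l).
  move=> FG; under eq_bigr => a _ do under eq_bigr => b _ do rewrite (bilinear_delta Ll Lr).
  under eq_bigr => a _ do rewrite exchange_big.
  rewrite exchange_big; apply: eq_bigr => i _.
  under eq_bigr => a _ do rewrite exchange_big.
  rewrite exchange_big; apply: eq_bigr => j _.
  under eq_bigr => a _ do rewrite exchange_big.
  rewrite exchange_big; apply: eq_bigr => k _.
  under eq_bigr => a _ do rewrite exchange_big.
  rewrite exchange_big; apply: eq_bigr => l _ /=.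
  rewrite -FG scaler_suml; apply: eq_bigr => a _; rewrite scaler_suml.
  by apply: eq_bigr.
rewrite (tens (fun a b => Ai *m delta_mx a b *m A) (fun a b => Ai *m delta_mx b a *m A)); last first.
  move=> i j k l; under eq_bigr => a _ do under eq_bigr => b _ do
    rewrite !conjE mulrACA [A b j * _]mulrC mulrACA.
  under eq_bigr => a _ do rewrite -mulr_sumr.
  by rewrite -mulr_suml !E1 -natrM mulnb [k == j]eq_sym.
rewrite (tens (fun a b => delta_mx a b) (fun a b => delta_mx b a))// => i j k l.
rewrite (bigD1 i)//= [X in _ + X]big1 ?addr0 => [|a ai]; last first.
  by rewrite big1// => b _; rewrite mxE eq_sym (negbTE ai) mul0r.
rewrite (bigD1 j)//= [X in _ + X]big1 ?addr0 => [|b bj]; last first.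
  by rewrite mxE [j == b]eq_sym (negbTE bj) andbF mul0r.
by rewrite !mxE !eqxx mul1r [k == j]eq_sym [l == i]eq_sym andbC.
Qed.

Lemma cocycle_cancel (V : comNzRingType) (a b w u v e : V) : u - v = e ->
  - (a - b + v) + (a + u - w) = - (w - b - e).
Proof. by move=> <-; ring. Qed.

Lemma cocycle_cancel2 (V : comNzRingType) (b w s t : V) : w + (t - s) - b = w - b - (s - t).
Proof. by ring. Qed.

(** The conclusion of [connection_lift] with R removed: this is the form in which derivations of the
    Picard-Vessiot ring act on leading and subleading parts. *)
Definition connection_lifting n N (K : fieldType) (sK : {rmorphism K -> K}) (A c : 'M[K]_n) (T : 'M[K]_n -> Prop) :=
  forall PP : mpoly #|{: 'I_n * 'I_N}| K -> mpoly #|{: 'I_n * 'I_N}| K -> Prop, PP 0 0 ->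
  (forall a x x' y y', PP x x' -> PP y y' -> PP (a *: x + y) (a *: x' + y')) ->
  (forall x x', PP x x' -> PP (jsub sK A x) (jsub sK A x' + jder 1 c (jsub sK A x))) ->
  (exists2 s : seq (mpoly #|{: 'I_n * 'I_N}| K), (forall p, p \in s -> exists p', PP p p') &
     forall p p', PP p p' -> span (fun g => g \in s) p) ->
  forall Y, T Y -> exists B, forall p p', PP p p' -> PP (jder 0 Y p) (jder 0 Y p' - jder 1 B p).

Section Cocycle.
Variables (n N : nat) (K L : fieldType) (io : {rmorphism K -> L}).
Variables (sK : {rmorphism K -> K}) (sKi : K -> K) (sL : {rmorphism L -> L}).
Variables (dK : {additive K -> K}) (dL : {additive L -> L}).
Local Notation m := #|{: 'I_n * 'I_N}|.
Local Notation P := (mpoly m K).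
Local Notation ord v := (nat_of_ord (enum_val v).2).
Local Notation om := (fun v : 'I_m => ord v).
Local Notation om1 := (fun v : 'I_m => 1%N).
Hypothesis dLM : forall x y, dL (x * y) = dL x * y + x * dL y.
Hypothesis sKK : forall x, sK (sKi x) = x.
Hypothesis io_s : forall x, sL (io x) = io (sK x).
Hypothesis io_d : forall x, dL (io x) = io (dK x).
Hypothesis sd : forall x, sL (dL x) = dL (sL x).
Hypothesis char0 : forall k, k.+1%:R != 0 :> K.
Variables (A Ai : 'M[K]_n) (f : 'I_n -> L).
Hypothesis AAi : A *m Ai = 1%:M.
Hypothesis AiA : Ai *m A = 1%:M.
Hypothesis sf : forall i, sL (f i) = \sum_j io (A i j) * f j.
Local Notation c := (Ai *m map_mx dK A).
Local Notation tau := (@jsub n N K K sK A).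
Local Notation mtau := (@mtau n K sK A Ai).

Variable T : 'M[K]_n -> Prop.
Hypothesis T_tau : forall Y, T Y -> T (mtau Y).
Hypothesis T_tau_surj : forall Y, T Y -> exists2 Y', T Y' & mtau Y' = Y.
Hypothesis T_perfect : forall M : 'M[K]_n -> Prop, M 0 ->
  (forall a Y Z, M Y -> M Z -> M (a *: Y + Z)) ->
  (forall Y Z, T Y -> T Z -> M (Y *m Z - Z *m Y)) -> forall Y, T Y -> M Y.
Hypothesis T_lift : connection_lifting N sK A c T.
Variable pr : {linear 'M[K]_n -> 'M[K]_n}.
Hypothesis T_pr : forall X, T (pr X).
Hypothesis pr_id : forall X, T X -> pr X = X.
Hypothesis pr_tau : forall X, pr (mtau X) = mtau (pr X).

Local Notation ev := (ev_at (N := N) io (jets dL f)).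
Local Notation e0 := (ev_at (N := N) io (fun i j => if j == 0%N then f i else 0)).
Local Notation osculating := (@osculating n N K L io f T).

(** The Casimir operator of T acting by brackets on all matrices. Projecting the invariant tensor of
    gl_n by the equivariant [pr] avoids choosing dual bases of T. *)
Definition casimir (X : 'M[K]_n) : 'M[K]_n :=
  \sum_a \sum_b lie (pr (delta_mx a b)) (lie (pr (delta_mx b a)) X).

Lemma e0_weight0 p : wsupp om leq 0 0 p -> e0 p = ev p.
Proof.
move=> wp; rewrite !ev_atE /mmap big_seq [RHS]big_seq; apply: eq_bigr => k.
rewrite mcoeff_msupp => /wp; rewrite addn0 leqn0 sum_nat_eq0 => /forallP k0.
congr (_ * _); rewrite /mmap1; apply: eq_bigr => v _.
have := k0 v; rewrite muln_eq0 => /orP[/eqP ->|/eqP ->]; first by rewrite !expr0.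
by rewrite eqxx.
Qed.

Lemma e0_weightS w p : wsupp om eq_op 0 w.+1 p -> e0 p = 0.
Proof.
move=> wp; rewrite ev_atE /mmap big_seq big1// => k.
rewrite mcoeff_msupp => /wp; rewrite addn0 => /eqP kw.
have [v] : exists v : 'I_m, (k v * ord v != 0)%N.
  apply/existsP; apply: contra_eqT kw => /existsPn H; rewrite /mwt big1// => v _.
  by apply/eqP; have := H v; rewrite negbK.
rewrite muln_eq0 negb_or => /andP[kv /negbTE ov].
by rewrite /mmap1 (bigD1 v)//= ov expr0n (negbTE kv) mul0r mulr0.
Qed.

(** [Np] is the space of leading parts of relations, at the first weight where some leading part
    does not osculate; [kk] consists of the matrices whose first-order action on [Np] is
    invisible. *)
Theorem relation_cocycle r (rn : (r <= n)%N) (Ys : 'I_r -> 'M[K]_n) (p1 : P) : (0 < N)%N ->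
  (forall s, T (Ys s)) ->
  \det (\matrix_(s, i) \sum_k io (Ys s (widen_ord rn i) k) * f k) != 0 ->
  ev p1 = 0 -> no_rows r p1 -> p1 != 0 ->
  exists Np : P -> Prop, let kk B := forall p, Np p -> osculating (jder 1 B p) in
  [/\ exists2 Y, T Y & ~ kk Y,
      forall Y B, T Y -> kk B -> kk (lie Y B),
      forall B, kk (mtau B) -> kk B &
      exists B, kk (mtau B - B - casimir c)].
Proof.
move=> N0 TYs d0 p10 rp1 np1.
have [d dp1] : exists d, wsupp om1 leq 1 d p1.
  exists (\max_(k <- msupp p1) mwt om1 k).+1 => k kp; rewrite addn1 ltnS.
  by apply: leq_bigmax_seq => //; rewrite mcoeff_msupp.
(* The weight counts orders of derivation. Total degrees are kept below d, which makes the space of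
   leading parts finite-dimensional, as the lifting requires. *)
pose GR w p := exists Q, [/\ ev Q = 0, wsupp om1 leq 1 d Q, wsupp om leq 0 w Q & p = wpart om w Q].
pose good w := forall p, GR w p -> osculating p.
have [w [nw gw]] : exists w, ~ good w /\ forall w', (w' < w)%N -> good w'.
  have ex : exists w, `[< ~ good w >].
    (* If leading parts of every weight osculated, density would remove the homogeneous parts of p1
       from the top down and give p1 = 0. *)
    apply: contrapT => /forallNP all_good.
    have {}all_good w : good w by apply: contrapT => /asboolP; exact: all_good.
    have [W] : exists w, wsupp om leq 0 w p1.
      exists (\max_(k <- msupp p1) mwt om k) => k kp; rewrite addn0.
      by apply: leq_bigmax_seq => //; rewrite mcoeff_msupp.
    have z w : wsupp om leq 0 w p1 -> wpart om w p1 = 0.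
      move=> wp; apply: (osculating_density char0 T_perfect TYs d0) => //.
        exact: no_rows_wpart.
      by apply: (all_good w); exists p1.
    elim: W => [|W IH] wp; last by apply: IH; apply: wsupp_lt => //; exact: z.
    move/eqP: np1; apply; rewrite -(z 0%N)// wpart_id// => k /wp.
    by rewrite leqn0.
  exists (ex_minn ex); case: ex_minnP => w /asboolP nw wmin; split=> // w' ww' p Gp.
  apply: contrapT => np; have : (w <= w')%N by apply: wmin; apply/asboolP => H; exact/np/H.
  by rewrite leqNgt ww'.
pose PP p p' := exists Q, [/\ ev Q = 0, wsupp om1 leq 1 d Q, wsupp om leq 0 w Q,
  p = wpart om w Q & p' = if w is w'.+1 then wpart om w' Q else 0].
have PP0 : PP 0 0.
  exists 0; split; rewrite ?rmorph0 ?raddf0//; try exact: wsupp0.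
  by case: (w) => // w'; rewrite raddf0.
have PPL a x x' y y' : PP x x' -> PP y y' -> PP (a *: x + y) (a *: x' + y').
  move=> [Q [Q0 Q1 Qw -> ->]] [Q' [Q'0 Q'1 Q'w -> ->]]; exists (a *: Q + Q'); split.
  - by rewrite raddfD /= ev_atZ Q0 Q'0 mulr0 addr0.
  - by apply: wsuppD => //; exact: wsuppZ.
  - by apply: wsuppD => //; exact: wsuppZ.
  - by rewrite linearP.
  - by case: (w) => [|w']; [rewrite scaler0 addr0|rewrite linearP].
have PPtau x x' : PP x x' -> PP (tau x) (tau x' + jder 1 c (tau x)).
  move=> [Q [Q0 Q1 Qw -> ->]]; exists (stilde sK dK A Q); split.
  - by rewrite (ev_stilde dLM io_s io_d sd sf) Q0 rmorph0.
  - exact: stilde_wsupp1.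
  - exact: stilde_wsupp.
  - by rewrite (wpart_stilde _ _ AAi).
  - case: (w) Qw => [|w'] Qw; last by rewrite (wpart_stildeS _ _ AAi).
    rewrite rmorph0 add0r; apply/mpolyP => k; rewrite mcoeff0; apply/eqP.
    have : wsupp om eq_op 1 0 (jder 1 c (tau (wpart om 0 Q))).
      apply: (@jder_wsupp_eq _ _ _ 1 _ 0); apply: tau_wsupp => //; first by move=> ? ? ? /eqP->.
        by move=> ? ? ? ? /eqP-> /eqP->.
      exact: wpart_wsupp.
    by move=> H; apply/negPn/negP => /H; rewrite addn1.
pose Np p := exists p', PP p p'.
have PPfin : exists2 s : seq P, (forall p, p \in s -> exists p', PP p p') &
     forall p p', PP p p' -> span (fun g => g \in s) p.
  have [|||s sN sP] := @subspace_generators K P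
    [seq @mpolyX m K (bmnm k) | k <- enum {: bmultinom m d}] Np.
  - by exists 0.
  - by move=> a x y [x' Px] [y' Py]; exists (a *: x' + y'); exact: PPL.
  - move=> x [x' [Q [_ Q1 _ -> _]]].
    have sz : (mmeasure mdeg (wpart om w Q) <= d)%N.
      rewrite msizeE; apply/bigmax_leqP_seq => k; rewrite mcoeff_msupp mcoeff_wpart => kp _.
      have : mcoeff k Q != 0 by case: ifP kp => //; rewrite eqxx.
      by move=> /Q1; rewrite addn1 mdegE /mwt; under eq_bigr do rewrite muln1.
    rewrite (mpolywE sz); apply: span_sum => k _; apply: spanZ; apply: span_gen; apply/mapP.
    by exists k => //; rewrite mem_enum.
  by exists s => // p p' Pp; apply: sP; exists p'.
(* A relation whose part of weight w vanishes has dd as its leading part in weight w - 1, and w is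
   minimal. *)
have Qosc dd : PP 0 dd -> osculating dd.
  move=> [Q [Q0 Q1 Qw /esym wQ ->]]; case: (w) Qw wQ gw => [|w'] Qw wQ gw'.
    exact: osculating0.
  by apply: (gw' w') => //; exists Q; split=> //; exact: wsupp_lt.
exists Np => kk.
have kkL a B B' : kk B -> kk B' -> kk (a *: B + B').
  by move=> kB kB' p Pp; rewrite jderD jderZ; apply: osculating_lin; [exact: kB|exact: kB'].
have kk0 : kk 0 by move=> p _; rewrite jder0; exact: osculating0.
have NpT p Y : Np p -> T Y -> Np (jder 0 Y p).
  by move=> [p' Pp] TY; have [B HB] := T_lift PP0 PPL PPtau PPfin TY; exists (jder 0 Y p' - jder 1 B p); exact: HB.
have kkT Y B : T Y -> kk B -> kk (lie Y B).
  move=> TY kB p Pp; have := jder_comm 0 1 Y B p; rewrite add0n => E.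
  rewrite -lieN jderN; apply: osculatingN; rewrite /lie -E.
  apply: osculatingB; first by apply: osculating_jder1 => //; exact: kB.
  by apply: kB; exact: NpT.
split=> //.
(* If T were contained in [kk], every p in [Np] would osculate: jder 0 stays in [Np], jder 1 lands
   among the osculating polynomials, and e0 vanishes on [Np]. This contradicts the choice of w. *)
- apply: contrapT => /forall2NP H; apply: nw => p [Q [Q0 Q1 Qw pE]].
  have {}Pp : Np p by exists (if w is w'.+1 then wpart om w' Q else 0); exists Q.
  have kT Y : T Y -> kk Y by move=> TY; have [|/contrapT] := H Y.
  have e0p q : Np q -> e0 q = 0.
    move=> [_ [Q' [Q'0 _ Q'w -> _]]]; case: (w) Q'w => [|w'] Q'w.
      rewrite wpart_id ?e0_weight0// => k /Q'w; by rewrite leqn0.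
    by apply: (@e0_weightS w'); exact: wpart_wsupp.
  move=> k; elim: k p Pp {pE} => [|k IH] p Pp; first exact: e0p.
  split; first exact: e0p.
  move=> h Y; case: h => [|[|//]] _ TY; first by apply: IH; exact: NpT.
  exact: kT.
- move=> B kB p Pp; apply/(osculating_tau io_s AAi sf T_tau T_tau_surj _ N0).
  rewrite (tau_jder _ AAi); apply: kB; case: Pp => p' /PPtau Pp.
  by exists (tau p' + jder 1 c (tau p)).
pose W Y B := forall p p', PP p p' -> PP (jder 0 Y p) (jder 0 Y p' - jder 1 B p).
have WL a Y Y' B B' : W Y B -> W Y' B' -> W (a *: Y + Y') (a *: B + B').
  move=> WY WY' p p' Pp; rewrite !jderD !jderZ.
  have := PPL a _ _ _ _ (WY _ _ Pp) (WY' _ _ Pp).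
  by rewrite scalerBr opprD addrACA.
have W0 : W 0 0.
  move=> p p' Pp; rewrite !jder0 subrr; exact: PP0.
have [b0 b0P] : exists b0 : 'I_n -> 'I_n -> 'M[K]_n, forall i j, W (pr (delta_mx i j)) (b0 i j).
  have H i j : exists B, W (pr (delta_mx i j)) B by exact: T_lift.
  by exists (fun i j => projT1 (cid (H i j))) => i j; case: cid.
pose beta (X : 'M[K]_n) : 'M[K]_n := \sum_i \sum_j X i j *: b0 i j.
have betaL : linear beta.
  move=> a X Y; rewrite /beta scaler_sumr -big_split; apply: eq_bigr => i _ /=.
  rewrite scaler_sumr -big_split; apply: eq_bigr => j _ /=.
  by rewrite !mxE scalerDl scalerA.
have WD Y Y' B B' : W Y B -> W Y' B' -> W (Y + Y') (B + B').
  by move=> WY WY'; have := WL 1 _ _ _ _ WY WY'; rewrite !scale1r.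
have Wbeta X : T X -> W X (beta X).
  move=> TX; rewrite -{1}(pr_id TX) {1}[X]matrix_sum_delta raddf_sum /beta.
  apply: (big_ind2 (fun Y B => W Y B)) => [|? ? ? ?|i _]; [exact: W0|exact: WD|rewrite raddf_sum /=].
  apply: (big_ind2 (fun Y B => W Y B)) => [|? ? ? ?|j _]; [exact: W0|exact: WD|rewrite linearZ /=].
  by have := WL (X i j) _ _ _ _ (b0P i j) W0; rewrite !addr0.
(* Acting by Y and then sigma, or by sigma and then [mtau Y], gives two pairs with the same leading
   part. Their difference osculates, so the lift commutes with sigma up to the bracket with c and up
   to [kk]. *)
have Wtau Y B B' : W Y B -> W (mtau Y) B' ->
    exists2 ka, kk ka & mtau (B + ka) = B' + lie (mtau Y) c.
  move=> WY WtY; have [X XE] := mtau_surj sKK AiA (B' + lie (mtau Y) c).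
  exists (X - B); last by rewrite addrC subrK.
  move=> p [p' Pp]; apply/(osculating_tau io_s AAi sf T_tau T_tau_surj _ N0).
  have P1 := PPtau _ _ (WY _ _ Pp); have P2 := WtY _ _ (PPtau _ _ Pp).
  have P3 := PPL (-1) _ _ _ _ P1 P2.
  move: P3; rewrite !scaleN1r (tau_jder _ AAi) addNr => /Qosc.
  have E := jder_comm 0 1 (mtau Y) c (tau p); rewrite add0n in E.
  rewrite (rmorphB tau) /= !(tau_jder _ AAi) (raddfD (jder 0 (mtau Y))) /=.
  rewrite (cocycle_cancel _ _ _ E).
  move=> /osculatingN; rewrite opprK.
  rewrite mtauB XE /lie !jderD !jderN.
  by rewrite [in X in _ -> X]cocycle_cancel2.
pose F a b := pr (delta_mx a b : 'M[K]_n).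
have [ka kaP kaE] : exists2 ka : 'I_n -> 'I_n -> 'M[K]_n, forall a b, kk (ka a b) &
    forall a b, mtau (beta (F b a) + ka a b) = beta (mtau (F b a)) + lie (mtau (F b a)) c.
  have H a b : exists k, kk k /\ mtau (beta (F b a) + k) = beta (mtau (F b a)) + lie (mtau (F b a)) c.
    have [|k kk1 kE] := @Wtau (F b a) (beta (F b a)) (beta (mtau (F b a))) (Wbeta _ (T_pr _)).
      by apply: Wbeta; apply: T_tau; exact: T_pr.
    by exists k.
  exists (fun a b => projT1 (cid (H a b))) => a b; by case: cid => x [].
(* Whitehead's contraction of the lift with the Casimir tensor. By invariance of the tensor, [mtau]
   changes it only by the Casimir of c, and by brackets of T with [kk]. *)
exists (\sum_a \sum_b lie (F a b) (beta (F b a) + ka a b)).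
have mtau_sum (I : finType) (G : I -> 'M[K]_n) : mtau (\sum_i G i) = \sum_i mtau (G i).
  apply: (big_morph mtau); first by move=> x y; exact: mtauD.
  by rewrite /mtau map_mx0 mulmx0 mul0mx.
have -> : mtau (\sum_a \sum_b lie (F a b) (beta (F b a) + ka a b)) =
    \sum_a \sum_b lie (F a b) (beta (F b a) + lie (F b a) c).
  rewrite mtau_sum; under eq_bigr do rewrite mtau_sum.
  pose Psi X Y := lie (pr X) (beta (pr Y) + lie (pr Y) c).
  rewrite -[RHS](@casimir_invariant _ _ _ Psi A Ai AiA).
  - apply: eq_bigr => a _; apply: eq_bigr => b _; rewrite /Psi.
    have dE i j : Ai *m delta_mx i j *m A = mtau (delta_mx i j) by rewrite /mtau map_delta_mx.
    by rewrite !dE !pr_tau -kaE /lie mtauB !(mtauM _ AAi).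
  - by move=> Y a X X'; rewrite /Psi linearP lieDl lieZl.
  - move=> X a Y Y'; rewrite /Psi linearP betaL lieDl lieZl addrACA -scalerDr.
    by rewrite lieDr lieZr.
rewrite /casimir.
suff -> : \sum_a \sum_b lie (F a b) (beta (F b a) + lie (F b a) c) -
    \sum_a \sum_b lie (F a b) (beta (F b a) + ka a b) -
    \sum_a \sum_b lie (F a b) (lie (F b a) c) = - \sum_a \sum_b lie (F a b) (ka a b).
  rewrite -scaleN1r -[X in kk X]addr0; apply: (kkL) => //.
  have kkD X Y : kk X -> kk Y -> kk (X + Y) by rewrite -{2}[X]scale1r; exact: kkL.
  apply: big_ind => // a _; apply: big_ind => // b _.
  by apply: kkT; [exact: T_pr|exact: kaP].
rewrite -!sumrB -sumrN; apply: eq_bigr => a _; rewrite -!sumrB -sumrN; apply: eq_bigr => b _.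
by rewrite !lieDr opprD addrACA subrr add0r addrAC subrr add0r.
Qed.

End Cocycle.

Lemma reduce_add (V : comNzRingType) (x y p q r s : V) :
  x * y * (p + q) - (y * r + x * s) = y * (x * p - r) + x * (y * q - s).
Proof. by ring. Qed.

Lemma reduce_mul (V : comNzRingType) (x y p q r s : V) :
  x * y * (p * q) - r * s = y * q * (x * p - r) + r * (y * q - s).
Proof. by ring. Qed.

(** * Elimination of one coordinate of the jets on a quadric *)

Section OrthogonalReduction.
Variables (n' N : nat) (K L : fieldType) (io : {rmorphism K -> L}).
Local Notation n := n'.+1.
Local Notation m := #|{: 'I_n * 'I_N}|.
Local Notation P := (mpoly m K).
Local Notation row v := (enum_val v).1.
Local Notation ord v := (nat_of_ord (enum_val v).2).
Local Notation jx := (@jX n N K).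
Local Notation jy := (@jY n N K).
Hypothesis char0 : forall k, k.+1%:R != 0 :> K.
Variable f : 'I_n -> L.
Variable T : 'M[K]_n -> Prop.
Hypothesis T_perfect : forall M : 'M[K]_n -> Prop, M 0 ->
  (forall a Y Z, M Y -> M Z -> M (a *: Y + Z)) ->
  (forall Y Z, T Y -> T Z -> M (Y *m Z - Z *m Y)) -> forall Y, T Y -> M Y.
Variable J : 'M[K]_n.
Hypothesis J_sym : J^T = J.
Hypothesis TJ : forall Y, T Y -> Y^T *m J + J *m Y = 0.
Local Notation e0 := (ev_at (N := N) io (fun i j => if j == 0%N then f i else 0)).
Local Notation osculating := (@osculating n N K L io f T).
Local Notation last := (@ord_max n').
Hypothesis Jf_last : \sum_k io (J last k) * f k != 0.
Hypothesis N0 : (0 < N)%N.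

Definition jform (B : 'M[K]_n) i j : P := \sum_a jx a i * jy B a j.

Lemma jform_swap (Y B : 'M[K]_n) i j : \sum_a jy Y a i * jy B a j = jform (Y^T *m B) i j.
Proof.
rewrite /jform /jY; under eq_bigr do rewrite big_distrlr /=.
rewrite exchange_big; apply: eq_bigr => a _ /=.
rewrite exchange_big mulr_sumr; apply: eq_bigr => b _ /=.
rewrite mxE scaler_suml mulr_sumr; apply: eq_bigr => k _.
by rewrite -scalerAl -scalerAr -scalerAr scalerA mxE.
Qed.

Lemma jformD B C i j : jform (B + C) i j = jform B i j + jform C i j.
Proof. by rewrite /jform -big_split; apply: eq_bigr => a _; rewrite jYD mulrDr. Qed.

Lemma jform0 i j : jform 0 i j = 0.
Proof.
rewrite /jform big1// => a _; rewrite /jY big1 ?mulr0// => b _.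
by rewrite mxE scale0r.
Qed.

Lemma jder_jform h Y B i j : (i < N)%N -> (j < N)%N -> jder h Y (jform B i j) =
  jform (Y^T *m B) (i - h) j *+ i ^_ h + jform (B *m Y) i (j - h) *+ j ^_ h.
Proof.
move=> iN jN; rewrite [jform B i j]/jform raddf_sum /=.
under eq_bigr do rewrite jderM jder_jX// jder_jY//.
rewrite big_split /= -jform_swap -!sumrMnl; congr (_ + _); apply: eq_bigr => a _.
  by rewrite mulrnAl.
by rewrite mulrnAr.
Qed.

(* The k-th derivative of the quadratic form J along the jet, with J treated
   as a constant. *)
Definition qjet k : P := \sum_(j < k.+1) jform J j (k - j) *+ 'C(k, j).

Lemma jder0_qjet Y k : T Y -> (k < N)%N -> jder 0 Y (qjet k) = 0.
Proof.
move=> TY kN; rewrite /qjet raddf_sum big1// => j _ /=.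
rewrite raddfMn /= jder_jform; first last.
- by rewrite (leq_ltn_trans (leq_subr _ _)).
- by apply: leq_ltn_trans kN; rewrite -ltnS.
by rewrite !subn0 !ffactn0 !mulr1n -jformD TJ// jform0 mul0rn.
Qed.

Lemma jder1_qjet Y k : T Y -> (k < N)%N -> jder 1 Y (qjet k) = 0.
Proof.
move=> TY kN; rewrite /qjet raddf_sum /=.
have E (j : 'I_k.+1) : jder 1 Y (jform J j (k - j) *+ 'C(k, j)) =
    jform (Y^T *m J) (j - 1) (k - j) *+ (j * 'C(k, j)) +
    jform (J *m Y) j (k - j - 1) *+ ((k - j) * 'C(k, j)).
  rewrite raddfMn /= jder_jform; first last.
  - by rewrite (leq_ltn_trans (leq_subr _ _)).
  - by apply: leq_ltn_trans kN; rewrite -ltnS.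
  by rewrite !ffactn1 mulrnDl -!mulrnA.
rewrite (eq_bigr _ (fun j _ => E j)) big_split /=.
rewrite big_ord_recl mul0n mulr0n add0r [X in _ + X]big_ord_recr /= subnn mul0n mulr0n addr0.
rewrite -big_split big1// => j _ /=.
have -> : bump 0 j = j.+1 by [].
have -> : (j.+1 - 1 = j)%N by lia.
have -> : (k - j - 1 = k - j.+1)%N by lia.
rewrite mul_bin_left.
by rewrite -mulrnDl -jformD TJ// jform0 mul0rn.
Qed.

(** The form J is infinitesimally invariant, so jder 0 and jder 1 annihilate its derivatives. At the
    base point each product contains a variable of positive order, since k > 0. *)
Lemma osculating_qjet k : (0 < k < N)%N -> osculating (qjet k).
Proof.
move=> /andP[k0 kN].
have e : e0 (qjet k) = 0.
  rewrite /qjet raddf_sum big1// => j _ /=; rewrite rmorphMn /= /jform rmorph_sum /=.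
  rewrite big1 ?mul0rn// => a _; rewrite rmorphM /=.
  have jN : (j < N)%N by apply: leq_ltn_trans kN; rewrite -ltnS.
  rewrite ev_at_jX// ev_at_jY ?(leq_ltn_trans (leq_subr _ _))//.
  case: eqP => [->|_]; last by rewrite mul0r.
  by rewrite subn0 gtn_eqF// big1 ?mulr0// => b _; rewrite mulr0.
elim=> [|i _] //=; split=> // h Y.
by case: h => [|[|//]] _ TY; rewrite ?jder0_qjet ?jder1_qjet//; exact: osc0.
Qed.

Local Notation omD := (fun v : 'I_m => ((row v == last) && (0 < ord v)%N : nat)).
Local Notation red := (wsupp omD leq 0 0).

Let leD x y z t : (x <= y)%N -> (z <= t)%N -> (x + z <= y + t)%N.
Proof. exact: leq_add. Qed.

Let redM (p q : P) : red p -> red q -> red (p * q).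
Proof. exact: (@wsuppM m K omD leq leD 0 0 0 0). Qed.

Let redC c : red (mpolyC m c : P).
Proof. by apply: wsuppC. Qed.

Let red_jx a j : ((a == last) && (0 < j))%N = false -> red (jx a j).
Proof.
rewrite /jX; case: insubP => [l _ lj|_ _]; last exact: wsupp0.
move=> al k; rewrite mcoeffX; case: (_ =P k) => [<- _|]; last by rewrite eqxx.
by rewrite mwt1 enum_rankK /= lj al.
Qed.

Let nu : P := jy J last 0.

Let red_nu : red nu.
Proof. by apply: wsupp_sum => k _; apply: wsuppZ; apply: red_jx; rewrite andbF. Qed.

Let redX (c : P) i : red c -> red (c ^+ i).
Proof.
by move=> rc; elim: i => [|i IH]; [rewrite expr0 -mpolyC1|rewrite exprS; exact: redM].
Qed.

(** [nu] is the denominator that appears when the last coordinate is solved from the quadric; it is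
    nonzero at f. [red] excludes only the variables of positive order in the last row. *)
Let reducible p := exists i r, red r /\ osculating (nu ^+ i * p - r).

Let reducible_red p : red p -> reducible p.
Proof. by move=> rp; exists 0%N, p; rewrite expr0 mul1r subrr; split=> //; exact: osculating0. Qed.

Let reducible_osc p : osculating p -> reducible p.
Proof. by move=> op; exists 0%N, 0; rewrite expr0 mul1r subr0; split=> //; exact: wsupp0. Qed.

Let reducibleD p q : reducible p -> reducible q -> reducible (p + q).
Proof.
move=> [i [r [rr op]]] [j [s [rs oq]]]; exists (i + j)%N, (nu ^+ j * r + nu ^+ i * s); split.
  by apply: wsuppD; apply: redM => //; exact: redX.
rewrite exprD reduce_add; apply: osculatingD; exact: osculatingM.
Qed.

Let reducibleM p q : reducible p -> reducible q -> reducible (p * q).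
Proof.
move=> [i [r [rr op]]] [j [s [rs oq]]]; exists (i + j)%N, (r * s); split; first exact: redM.
rewrite exprD reduce_mul; apply: osculatingD; exact: osculatingM.
Qed.

Let reducible_nu p : reducible (nu * p) -> reducible p.
Proof. by move=> [i [r [rr op]]]; exists i.+1, r; rewrite exprSr -mulrA. Qed.

Let reducible_sum (I : Type) (r : seq I) (Q : pred I) (F : I -> P) :
  (forall i, Q i -> reducible (F i)) -> reducible (\sum_(i <- r | Q i) F i).
Proof.
by move=> rF; apply: big_ind => //; apply: reducible_red; exact: wsupp0.
Qed.

Let reducibleZ c p : reducible p -> reducible (c *: p).
Proof. by rewrite -mul_mpolyC => rp; apply: reducibleM => //; exact: reducible_red. Qed.

Let reducibleMn p k : reducible p -> reducible (p *+ k).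
Proof. by rewrite -scaler_nat; exact: reducibleZ. Qed.

Let two_neq0 : (2 : K) != 0. Proof. exact: (char0 1). Qed.

(** The osculating polynomial [qjet j] equals 2 nu X_(last, j) plus terms in other rows or of
    smaller order, so it is solved for X_(last, j) by induction on j. *)
Let reducible_jx a j : reducible (jx a j).
Proof.
have [k] := ubnP j; elim: k a j => // k IH a j jk.
case E : ((a == last) && (0 < j))%N; last by apply: reducible_red; exact: red_jx.
move: E => /andP[/eqP -> j0] {a}.
have [jN|Nj] := ltnP j N; last first.
  by rewrite /jX insubF ?ltnNge ?Nj//; apply: reducible_red; exact: wsupp0.
apply: reducible_nu.
pose rest := \sum_(a | a != last) jy J a 0%N * jx a j.
pose mid := \sum_(i < j.+1 | (i != 0 :> nat) && (i != j :> nat)) jform J i (j - i) *+ 'C(j, i).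
have jformC i l : jform J i l = jform J l i.
  have -> : jform J i l = \sum_a jy 1%:M a i * jy J a l by apply: eq_bigr => a _; rewrite jY1.
  rewrite /jform [RHS](eq_bigr (fun a => jy J a i * jy 1%:M a l)); last first.
    by move=> a _; rewrite jY1 mulrC.
  by rewrite !jform_swap trmx1 mul1mx J_sym mulmx1.
have qE : qjet j = (nu * jx last j + rest) *+ 2 + mid.
  rewrite /qjet (bigD1 ord0)//= subn0 bin0 mulr1n.
  rewrite (bigD1 ord_max) /=; last by rewrite -val_eqE /= -lt0n.
  rewrite subnn binn mulr1n addrA; congr (_ + _).
  rewrite jformC -mulr2n; congr (_ *+ 2).
  rewrite /jform (bigD1 last)//= mulrC; congr (_ + _).
  by apply: eq_bigr => a _; rewrite mulrC.
have E : nu * jx last j = (2^-1 : K) *: (qjet j - mid) - rest.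
  rewrite qE addrK -scaler_nat scalerA mulVf// scale1r addrK//.
rewrite E -[- rest]scaleN1r; apply: reducibleD; apply: reducibleZ; last first.
  apply: reducible_sum => a al; apply: reducibleM; apply: reducible_red.
    by apply: wsupp_sum => b _; apply: wsuppZ; apply: red_jx; rewrite andbF.
  by apply: red_jx; rewrite (negbTE al).
rewrite -[- mid]scaleN1r; apply: reducibleD; first by apply: reducible_osc; apply: osculating_qjet; rewrite j0.
apply: reducibleZ; apply: reducible_sum => i /andP[i0 ij]; apply: reducibleMn.
have ilt : (i < j)%N by rewrite ltn_neqAle ij -ltnS ltn_ord.
apply: reducible_sum => a _; apply: reducibleM; first by apply: IH; lia.
by apply: reducible_sum => b _; apply: reducibleZ; apply: IH; lia.
Qed.

Lemma reducible_all p : reducible p.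
Proof.
elim/mpoly_ring_ind: p => [a|v|p q rp rq|p q rp rq].
- exact: reducible_red.
- by rewrite jX_var; exact: reducible_jx.
- exact: reducibleD.
- exact: reducibleM.
Qed.

(** Pass to the reduced form r of p. Powers of [nu] have order 0, so derivations with h > 0 pass
    through them. As r has no positive-order variable in the last row, a frame of n - 1 directions
    controls its positive-order gradient. *)
Theorem orthogonal_gradient (Ys : 'I_n' -> 'M[K]_n) p :
  (forall s, T (Ys s)) ->
  \det (\matrix_(s, i) \sum_k io (Ys s (widen_ord (leqnSn n') i) k) * f k) != 0 ->
  (forall h s, (0 < h)%N -> osculating (jder h (Ys s) p)) ->
  forall Z, T Z -> osculating (jder 1 Z p).
Proof.
move=> TYs d0 oY Z TZ; have [i [r [rr or]]] := reducible_all p.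
have nu0 h Y : (0 < h)%N -> jder h Y (nu ^+ i) = 0.
  move=> h0; elim: i {or} => [|i IH]; first by rewrite expr0 -mpolyC1 jderC.
  rewrite exprS jderM IH mulr0 addr0 jder_jY// ffact_small// mulr0n mul0r//.
have jr h Y : (0 < h)%N -> nu ^+ i * jder h Y p = jder h Y r + jder h Y (nu ^+ i * p - r).
  by move=> h0; rewrite -raddfD /= addrC subrK jderM nu0// mul0r add0r.
have or1 (v : 'I_m) : (0 < ord v)%N -> osculating (mderiv v r).
  apply: (osculating_gradient char0 d0) => [x rx ox|h s /andP[h0 _]].
    apply/mpolyP => k; rewrite mcoeff_deriv mcoeff0; apply/eqP.
    rewrite -mulr_natl mulf_eq0; apply/orP; right; apply: contraT => /rr.
    rewrite mwtD mwt1 ox andbT addn0.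
    have -> : row x == last by rewrite -val_eqE eqn_leq /= rx -ltnS ltn_ord.
    by rewrite addn1.
  have := osculatingM (nu ^+ i) (oY h s h0); rewrite jr// => H.
  rewrite -[jder h _ r](addrK (jder h (Ys s) (nu ^+ i * p - r))).
  by apply: osculatingB => //; exact: osculating_jder.
apply: (@osculating_prime _ _ _ _ _ _ _ (nu ^+ i)).
  rewrite rmorphXn /= expf_neq0// ev_at_jY//=.
rewrite jr//; apply: osculatingD; last exact: osculating_jder.
rewrite jderE /der; apply: osculating_sum => v _.
have [v0|v0] := posnP (ord v); first by rewrite v0 mulr0n mul0r; exact: osculating0.
by apply: osculatingM; exact: or1.
Qed.

End OrthogonalReduction.

Lemma derived_subgroup_sub (F : fieldType) n (G : set 'M[F]_n) :
  mx_subgroup G -> (derived_subgroup (neutral_component G) `<=` G)%classic.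
Proof.
move=> sG; apply: smallest_sub => // C [M [N [GM GN ->]]].
have {}GM : G M by apply: connected_component_sub GM.
have {}GN : G N by apply: connected_component_sub GN.
by case: sG => _ _ mG iG; apply: (mG); [apply: (mG); [exact: mG|exact: iG]|exact: iG].
Qed.

Lemma lrmorphism_of (K : fieldType) (Q : comUnitAlgType K) (phi : Q -> Q) :
  zmod_morphism phi -> monoid_morphism phi -> scalable phi ->
  exists psi : {lrmorphism Q -> Q}, psi =1 phi.
Proof.
move=> phiB phiM phiZ.
pose psi : {lrmorphism Q -> Q} := HB.pack phi (GRing.isZmodMorphism.Build _ _ phi phiB)
  (GRing.isMonoidMorphism.Build _ _ phi phiM) (GRing.isScalable.Build _ _ _ _ phi phiZ).
by exists psi.
Qed.

(** * Derivations from one-parameter subgroups *)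

Section GaloisGroup.
Variables (F : fieldType) (q : F).
Hypothesis q_neq0 : q != 0.
Local Notation K := {fraction {poly F}}.
Variables (n : nat) (A : 'M[K]_n) (V : PicardVessiot q A) (Q : total_quotient_ring V).
Local Notation U := (pv_sol V).
Local Notation sV := (pv_sigma V).
Local Notation G := (galois_group Q).
Local Notation const := (fun c : F => (FracField.tofrac c%:P)%:A).

Definition constant (S : comUnitAlgType K) (c : F) : S := (FracField.tofrac c%:P)%:A.

Lemma constant_is_zmod_morphism S : zmod_morphism (constant S).
Proof. by move=> x y; rewrite /constant !rmorphB /= scalerBl. Qed.
HB.instance Definition _ (S : comUnitAlgType K) := GRing.isZmodMorphism.Build F S (constant S) (constant_is_zmod_morphism S).

Lemma constant_is_monoid_morphism S : monoid_morphism (constant S).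
Proof.
split=> [|x y]; first by rewrite /constant !rmorph1 scale1r.
by rewrite /constant !rmorphM /= -scalerAl mul1r scalerA.
Qed.
HB.instance Definition _ (S : comUnitAlgType K) := GRing.isMonoidMorphism.Build F S (constant S) (constant_is_monoid_morphism S).

Lemma lrmorphism_constant (S S' : comUnitAlgType K) (phi : {lrmorphism S -> S'}) c :
  phi (constant S c) = constant S' c.
Proof. by rewrite /constant linearZ rmorph1. Qed.

Lemma frac_sigma_constant c : frac_sigma q (FracField.tofrac c%:P) = FracField.tofrac c%:P.
Proof.
pose h : {rmorphism {poly F} -> K} := @FracField.tofrac {poly F} \o comp_poly (q *: 'X).
rewrite -[LHS]/(frac_lift h _) frac_lift_tofrac /=; first by rewrite comp_polyC.
by move=> x y /= /eqP; rewrite tofrac_eq => /eqP; exact: scale_comp_inj.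
Qed.

Lemma pv_sigma_constant c : sV (constant V c) = constant V c.
Proof. by rewrite /constant pv_sigma_ext frac_sigma_constant. Qed.

Lemma pv_sigma_simple : sigma_simple sV.
Proof.
move=> I I0 ID IM Is.
pose J : {pred V} := [pred x | `[< I x >]].
have JE x : (x \in J) = `[< I x >] by [].
have [|||H|H] := @pv_simple _ _ _ _ V J.
- split=> [|x y]; rewrite !JE; first exact/asboolP.
  move=> /asboolP Ix /asboolP Iy; apply/asboolP.
  have Ny : I (- y) by rewrite -mulN1r; exact: IM.
  exact: ID x (- y) Ix Ny.
- by move=> x y; rewrite !JE => /asboolP Iy; apply/asboolP; exact: IM.
- by move=> x; rewrite !JE => /asboolP Ix; apply/asboolP; exact: Is.
- by left=> x Ix; apply/eqP; have := H x; rewrite JE (asboolT Ix) inE => <-.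
- by right; have := H 1; rewrite JE inE => /asboolP.
Qed.

Lemma galois_group_subgroup : mx_subgroup G.
Proof.
split.
- by move=> M [].
- split; first exact: unitmx1.
  have [||| phi phiE] := @lrmorphism_of _ Q id; [by []|by split|by []|].
  exists phi; split; first by exists id => x; rewrite phiE.
    by move=> x; rewrite !phiE.
  rewrite -[map_mx const _]/(map_mx (constant Q) _) map_mx1 mulmx1.
  by apply/matrixP => i j; rewrite !mxE /= phiE.
- move=> M N [uM [phi [bphi sphi phiU]]] [uN [psi [bpsi spsi psiU]]].
  split; first by rewrite unitmx_mul uM.
  have [||| chi chiE] := @lrmorphism_of _ Q (phi \o psi).
  + by move=> x y; rewrite /= !rmorphB.
  + by split=> [|x y]; rewrite /= ?rmorph1 ?rmorphM.
  + by move=> a x; rewrite /= !linearZ.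
  exists chi; split.
  + by apply: (@eq_bij _ _ (phi \o psi)) => [|x]; [exact: bij_comp|rewrite chiE].
  + by move=> x; rewrite !chiE /= spsi sphi.
  have -> : map_mx (chi \o tq_in Q) U = map_mx phi (map_mx (psi \o tq_in Q) U).
    by apply/matrixP => i j; rewrite !mxE /= chiE.
  rewrite psiU map_mxM -map_mx_comp phiU -mulmxA; congr (_ *m _).
  rewrite -[map_mx const (M *m N)]/(map_mx (constant Q) (M *m N)) map_mxM; congr (_ *m _).
  by apply/matrixP => i j; rewrite !mxE /= -[LHS]/(phi (constant Q _)) lrmorphism_constant.
- move=> M [uM [phi [bphi sphi phiU]]]; split; first by rewrite unitmx_inv.
  case: (bphi) => psi0 phiK psiK.
  have phiI : injective phi := can_inj phiK.
  have [||| psi psiE] := @lrmorphism_of _ Q psi0.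
  + by move=> x y; apply: phiI; rewrite rmorphB /= !psiK.
  + split; first by apply: phiI; rewrite psiK rmorph1.
    by move=> x y; apply: phiI; rewrite rmorphM /= !psiK.
  + by move=> a x; apply: phiI; rewrite linearZ /= !psiK.
  exists psi; split.
  + by exists phi => x; rewrite psiE.
  + by move=> x; apply: phiI; rewrite sphi !psiE !psiK.
  have inj (X Y : 'M[Q]_n) : map_mx phi X = map_mx phi Y -> X = Y.
    move=> XY; apply/matrixP => i j; apply: phiI.
    by have := congr1 (fun Z : 'M[Q]_n => Z i j) XY; rewrite !mxE.
  apply: inj; rewrite map_mxM -[map_mx phi (map_mx (tq_in Q) U)]map_mx_comp phiU.
  have -> : map_mx phi (map_mx const (invmx M)) = map_mx (constant Q) (invmx M).
    by apply/matrixP => i j; rewrite !mxE -[LHS]/(phi (constant Q _)) lrmorphism_constant.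
  rewrite -mulmxA -[map_mx const M]/(map_mx (constant Q) M) -map_mxM mulmxV// map_mx1 mulmx1.
  by apply/matrixP => i j; rewrite !mxE /= psiE psiK.
Qed.

(* E is tangent to the Galois group along the curve t |-> exp (t E), where
   E ^ 3 = 0. *)
Lemma galois_derivation (E : 'M[F]_n) :
  (forall k, k.+1%:R != 0 :> F) ->
  (forall t, G (1%:M + t *: E + (t ^+ 2 / 2) *: (E *m E))) ->
  (forall t, \det (1%:M + t *: E + (t ^+ 2 / 2) *: (E *m E)) = 1) ->
  exists D : {additive V -> V}, [/\ forall x y, D (x * y) = D x * y + x * D y,
    forall c : K, D c%:A = 0, forall x, sV x = x -> D x = 0 &
    map_mx D U = U *m map_mx (constant V) E].
Proof.
move=> char0 GC detC; pose C t := 1%:M + t *: E + (t ^+ 2 / 2) *: (E *m E).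
have phiP t : exists phi : {lrmorphism Q -> Q}, (forall x, phi (tq_sigma Q x) = tq_sigma Q (phi x)) /\
    map_mx (phi \o tq_in Q) U = map_mx (tq_in Q) U *m map_mx (constant Q) (C t).
  by have [_ [phi [_ sphi phiU]]] := GC t; exists phi.
pose phi t : {lrmorphism Q -> Q} := projT1 (cid (phiP t)).
have sphi t x : phi t (tq_sigma Q x) = tq_sigma Q (phi t x).
  by rewrite /phi; case: cid => ? [].
have phiU t : map_mx (phi t \o tq_in Q) U = map_mx (tq_in Q) U *m map_mx (constant Q) (C t).
  by rewrite /phi; case: cid => ? [].
(* The orbit of x under the one-parameter group, written as a polynomial in t with coefficients in
   the Picard-Vessiot ring. It is unique, because distinct integers have invertible differences. D x
   will be its coefficient of t. *)
pose curve (x : V) (p : {poly V}) := p`_0 = x /\ forall t, phi t (tq_in Q x) = tq_in Q p.[constant V t].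
have curve_uniq x p p' : curve x p -> curve x p' -> p = p'.
  move=> [_ xp] [_ xp']; apply/eqP; rewrite -subr_eq0; apply: contraT => pp'.
  pose rs := [seq constant V k%:R | k <- iota 0 (size (p - p')%R)].
  have : (size rs < size (p - p')%R)%N.
    apply: max_ring_poly_roots => //.
      apply/allP => _ /mapP[k _ ->]; rewrite rootE !hornerE subr_eq0; apply/eqP.
      by apply: (@tq_in_inj _ _ _ _ _ Q); rewrite -xp -xp'.
    have : sorted ltn (iota 0 (size (p - p'))) by exact: iota_ltn_sorted.
    rewrite /rs; elim: (iota _ _) => //= k s IH ks; rewrite IH ?(path_sorted ks)// andbT.
    apply/allP => _ /mapP[l ls ->].
    have kl : (k < l)%N by have := order_path_min ltn_trans ks; move=> /allP/(_ _ ls).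
    rewrite /diff_roots mulrC eqxx -rmorphB /= -natrB ?(ltnW kl)//.
    by case E1 : (l - k)%N => [|d]; [lia|rewrite rmorph_unit ?unitfE].
  by rewrite size_map size_iota ltnn.
have curveB x y p r : curve x p -> curve y r -> curve (x - y) (p - r).
  move=> [p0 xp] [r0 yr]; split; first by rewrite coefB p0 r0.
  by move=> t; rewrite hornerD hornerN !rmorphB /= xp yr.
have curveM x y p r : curve x p -> curve y r -> curve (x * y) (p * r).
  move=> [p0 xp] [r0 yr]; split; first by rewrite coefM big_ord_recl big_ord0 addr0 p0 r0.
  by move=> t; rewrite hornerM !rmorphM /= xp yr.
have curveC (c : K) : curve c%:A (c%:A)%:P.
  split; first by rewrite coefC.
  by move=> t; rewrite hornerC !linearZ /= !rmorph1.
have curveU i j : curve (U i j) ((U i j)%:P + ((U *m map_mx (constant V) E) i j)%:P * 'X +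
    ((U *m map_mx (constant V) (E *m E)) i j * constant V 2^-1)%:P * 'X^2).
  pose c1 := (U *m map_mx (constant V) E) i j; pose c2 := (U *m map_mx (constant V) (E *m E)) i j.
  split; first by rewrite !coefD coefC !coefCM coefX coefXn !mulr0 !addr0.
  move=> t; have := congr1 (fun Z : 'M[Q]_n => Z i j) (phiU t); rewrite mxE /= => ->.
  have -> : map_mx (tq_in Q) U *m map_mx (constant Q) (C t) =
      map_mx (tq_in Q) (U *m map_mx (constant V) (C t)).
    rewrite map_mxM; congr (_ *m _); apply/matrixP => k l; rewrite 2![in RHS]mxE [in LHS]mxE.
    exact: esym (lrmorphism_constant (tq_in Q) (C t k l)).
  rewrite mxE; congr (tq_in Q _).
  rewrite /C !map_mxD map_mx1 !map_mxZ !mulmxDr mulmx1 -!scalemxAr !mxE -/c1 -/c2.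
  by rewrite !hornerE rmorphM rmorphXn /=; ring.
have curve_ex x : exists p, curve x p.
  have /asboolP// : x \in [pred x | `[< exists p, curve x p >]].
  apply: (@pv_generated _ _ _ _ V).
  - split.
    + by apply/asboolP; exists ((1%:A)%:P); rewrite -[X in curve X](scale1r 1).
    + move=> c x1 y1 /asboolP[p xp] /asboolP[r yr]; apply/asboolP.
      have := curveB _ _ _ _ (curveM _ _ _ _ (curveC c) xp) (curveM _ _ _ _ (curveC (-1)) yr).
      rewrite !mulr_algl scaleN1r opprK => H.
      by eexists; exact: H.
    + by move=> x1 y1 /asboolP[p xp] /asboolP[r yr]; apply/asboolP; exists (p * r); exact: curveM.
  - by move=> i j; apply/asboolP; eexists; exact: curveU.
  (* The one-parameter group has determinant 1, so the orbit of det U is constant. *)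
  - apply/asboolP; exists (((\det U)^-1)%:P); split; first by rewrite coefC.
    move=> t; rewrite hornerC.
    have uU : \det U \is a GRing.unit by have := pv_sol_unit V; rewrite unitmxE.
    rewrite !rmorphV ?rmorph_unit//; congr (_^-1).
    rewrite -[LHS]/((phi t \o tq_in Q) _) -det_map_mx phiU det_mulmx !det_map_mx /= detC rmorph1 mulr1.
    by [].
pose pol x := projT1 (cid (curve_ex x)).
have polP x : curve x (pol x) by rewrite /pol; case: cid.
pose D x := (pol x)`_1.
have DZ : zmod_morphism D.
  by move=> x y; rewrite /D (curve_uniq _ _ _ (polP _) (curveB _ _ _ _ (polP x) (polP y))) coefB.
pose D' : {additive V -> V} := HB.pack D (GRing.isZmodMorphism.Build _ _ D DZ).
exists D'; split.
- move=> x y; rewrite /= /D (curve_uniq _ _ _ (polP _) (curveM _ _ _ _ (polP x) (polP y))).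
  rewrite coefM big_ord_recl big_ord_recl big_ord0 addr0 /= subn0 /bump /= subnn.
  by rewrite (polP x).1 (polP y).1 addrC.
- by move=> c; rewrite /= /D (curve_uniq _ _ _ (polP _) (curveC c)) coefC.
- have pol_fixed x : sV x = x -> forall k, sV (pol x)`_k = (pol x)`_k.
    move=> fx k; rewrite -coef_map.
    suff -> : map_poly sV (pol x) = pol x by [].
    apply: (curve_uniq x) (polP x); split; first by rewrite coef_map /= (polP x).1.
    move=> t; rewrite -{1}fx -tq_sigma_ext sphi (polP x).2 tq_sigma_ext.
    by rewrite -(pv_sigma_constant t) horner_map /= pv_sigma_constant.
  move=> x fx; rewrite /= /D.
  have [x0|x0] := eqVneq x 0.
    by have := DZ 0 0; rewrite x0 !subrr.
  have ux : x \is a GRing.unit := sigma_fixed_unit pv_sigma_simple fx x0.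
  have fx1 : sV x^-1 = x^-1 by rewrite rmorphV// fx.
  (* Both factors have fixed coefficients, hence invertible leading coefficients, so their degrees
     add up to 0 and [pol x] is constant. *)
  have E1 : pol x * pol x^-1 = 1.
    have := curveM _ _ _ _ (polP x) (polP x^-1); rewrite divrr// => H.
    have H1 := curveC 1; rewrite scale1r in H1.
    exact: curve_uniq H H1.
  have lead_unit y : sV y = y -> y != 0 -> lead_coef (pol y) \is a GRing.unit.
    move=> fy y0; apply: (sigma_fixed_unit pv_sigma_simple (pol_fixed y fy _)).
    rewrite -/(lead_coef _) lead_coef_eq0; apply: contra_neq y0 => py0.
    by rewrite -(polP y).1 py0 coef0.
  have x10 : x^-1 != 0 by rewrite invr_eq0.
  have := size_proper_mul (p := pol x) (q := pol x^-1).
  rewrite E1 size_poly1; have ul := lead_unit _ fx x0; have ul1 := lead_unit _ fx1 x10.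
  have -> : lead_coef (pol x) * lead_coef (pol x^-1) != 0.
    by apply/negP => /eqP e0; have := unitr0 V; rewrite -e0 unitrM ul ul1.
  move=> /(_ isT) sz.
  have s1 : (0 < size (pol x))%N.
    by rewrite size_poly_gt0; apply: contraTneq ul => ->; rewrite lead_coef0 unitr0.
  have s2 : (0 < size (pol x^-1))%N.
    by rewrite size_poly_gt0; apply: contraTneq ul1 => ->; rewrite lead_coef0 unitr0.
  rewrite nth_default//; move: s1 s2 sz.
  by move: (size (pol x)) (size (pol x^-1)) => [|[|a]] [|[|b]] //=; rewrite ?addnS.
- apply/matrixP => i j; rewrite mxE /= /D (curve_uniq _ _ _ (polP _) (curveU i j)).
  by rewrite !coefD coefC !coefCM coefX coefXn !mulr0 add0r addr0 mulr1.
Qed.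

End GaloisGroup.

Lemma clear_denominators (D : idomainType) (m : nat) (x : 'I_m -> {fraction D}) :
  exists d : D, exists p : 'I_m -> D, d != 0 /\ forall i, FracField.tofrac d * x i = FracField.tofrac (p i).
Proof.
exists (\prod_i (repr (x i)).2), (fun i => (\prod_(j < m | j != i) (repr (x j)).2) * (repr (x i)).1).
split=> [|i]; first by apply/prodf_neq0 => i _; exact: denom_ratioP.
rewrite (bigD1 i)//= !rmorphM /= mulrAC mulrC; congr (_ * _).
by rewrite mulrC {1}(frac_num_den (x i)) divfK// tofrac_eq0 denom_ratioP.
Qed.

Lemma poly_kernel (D : idomainType) (t : nat) (M : 'M[D]_(t.+1, t)) :
  exists v : 'I_t.+1 -> D, (exists i, v i != 0) /\ forall k, \sum_i v i * M i k = 0.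
Proof.
pose M' := map_mx (@FracField.tofrac D) M.
have : kermx M' != 0.
  rewrite kermx_eq0 /row_free neq_ltn ltnS (leq_trans (rank_leq_col _))//.
case/matrix0Pn => i [j vij].
have [d [v [d0 dv]]] := clear_denominators (fun k => kermx M' i k).
exists v; split.
  by exists j; rewrite -tofrac_eq0 -dv mulf_neq0// tofrac_eq0.
move=> k; apply/eqP; rewrite -tofrac_eq0 rmorph_sum /=; apply/eqP.
under eq_bigr do rewrite rmorphM /= -dv -mulrA.
rewrite -mulr_sumr; have /sub_kermxP/matrixP/(_ 0 k) : (row i (kermx M') <= kermx M')%MS by exact: row_sub.
rewrite mxE [RHS]mxE; under eq_bigr do rewrite [row _ _ _ _]mxE [M' _ _]mxE.
by move=> ->; rewrite mulr0.
Qed.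

(** * Growth of coefficients and rational Puiseux series *)

Section Growth.
Import ComplexField.Normc.
Variable R : realType.
Local Notation C := R[i].
Implicit Types (G H : rat -> C) (u v h w : rat -> R).

Definition large (P : rat -> Prop) : Prop := exists a : rat, forall x, a <= x -> P x.

Lemma large_ge a : large (fun x => a <= x).
Proof. by exists a. Qed.

Lemma large_sub (P P' : rat -> Prop) : large P -> (forall x, P x -> P' x) -> large P'.
Proof. by move=> [a Pa] PP'; exists a => x /Pa/PP'. Qed.

Lemma largeI (P P' : rat -> Prop) : large P -> large P' -> large (fun x => P x /\ P' x).
Proof.
move=> [a Pa] [b Pb]; exists (Num.max a b) => x; rewrite ge_max => /andP[ax bx].
by split; [exact: Pa|exact: Pb].
Qed.

Lemma large_shift (P : rat -> Prop) k : large P -> large (fun x => P (x - k)).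
Proof. by move=> [a Pa]; exists (a + k) => x ax; apply: Pa; rewrite lerBrDr. Qed.

Lemma normc_ge0 (z : C) : 0 <= normc z.
Proof. by case: z => a b; exact: sqrtr_ge0. Qed.

Lemma normc_sum (I : Type) (r : seq I) (P : pred I) (f : I -> C) :
  normc (\sum_(i <- r | P i) f i) <= \sum_(i <- r | P i) normc (f i).
Proof.
elim/big_ind2: _ => // [|x a y b xa yb]; first by rewrite normc0.
by rewrite (le_trans (le_normcD _ _))// lerD.
Qed.

Lemma normc_real (y : R) : normc (y%:C)%C = `|y|.
Proof. by rewrite /normc /= expr0n /= addr0 sqrtr_sqr. Qed.

Lemma normcX (z : C) k : normc (z ^+ k) = normc z ^+ k.
Proof. by elim: k => [|k IH]; rewrite ?expr0 ?normc1// !exprS normcM IH. Qed.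

Lemma poly_upper (p : {poly C}) : exists c N, 0 <= c /\
  forall y : R, 1 <= y -> normc p.[(y%:C)%C] <= c * y ^+ N.
Proof.
elim/poly_ind: p => [|p a [c [N [c0 H]]]].
  by exists 0, 0%N; split=> // y _; rewrite horner0 normc0 mul0r.
exists (c + normc a), N.+1; split=> [|y y1]; first by rewrite addr_ge0 ?normc_ge0.
rewrite hornerMXaddC (le_trans (le_normcD _ _))// mulrDl lerD//.
  rewrite normcM normc_real ger0_norm ?(le_trans ler01)// exprSr mulrA.
  by rewrite ler_wpM2r ?H// (le_trans ler01).
by rewrite ler_peMr ?normc_ge0// exprn_ege1.
Qed.

Lemma poly_lower (p : {poly C}) : p != 0 -> exists c a, 0 < c /\
  forall y : R, a <= y -> c <= normc p.[(y%:C)%C].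
Proof.
elim/poly_ind: p => [|p a IH]; first by rewrite eqxx.
have [-> a0|p0 _] := eqVneq p 0.
  exists (normc a), 0; split=> [|y _]; last by rewrite mul0r add0r hornerC.
  rewrite lt_neqAle normc_ge0 andbT eq_sym; apply: contraNneq a0 => /eq0_normc ->.
  by rewrite mul0r add0r.
have [c [b [c0 H]]] := IH p0.
exists 1, (Num.max (Num.max b 0) ((1 + normc a) / c)); split=> // y.
rewrite !ge_max ler_pdivrMr// => /andP[/andP[/H cy y0] cay].
rewrite hornerMXaddC.
have := le_normcD (p.[(y%:C)%C] * (y%:C)%C + a) (- a).
rewrite addrK normcN normcM normc_real ger0_norm// -lerBlDr => /(le_trans _); apply.
rewrite lerBrDr (le_trans cay)// mulrC ler_wpM2r//.
Qed.

(** Bounds are taken up to a power of the exponent x, because solving recurrences multiplies and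
    divides by polynomials in x. *)
Definition bnd w h u := exists c N, 0 <= c /\
  large (fun x => u x <= c * ratr x ^+ N * w x * h x).

Lemma bnd_le w h u v : large (fun x => u x <= v x) -> bnd w h v -> bnd w h u.
Proof.
move=> uv [c [N [c0 H]]]; exists c, N; split=> //.
by refine (large_sub (largeI uv H) _) => x [/le_trans]; apply.
Qed.

Lemma ratr_ge1 (x : rat) : 1 <= x -> 1 <= ratr x :> R.
Proof. by rewrite -[1 in X in _ -> X](rmorph1 (ratr : rat -> R)) ler_rat. Qed.

Lemma bnd_mono w h h' u : (forall x, 0 <= w x) -> (forall x, h x <= h' x) ->
  bnd w h u -> bnd w h' u.
Proof.
move=> w0 hh' [c [N [c0 H]]]; exists c, N; split=> //.
refine (large_sub (largeI (large_ge 1) H) _) => x [x1 /le_trans]; apply.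
have y1 := ratr_ge1 x1.
by rewrite ler_wpM2l// !mulr_ge0// exprn_ge0// (le_trans ler01).
Qed.

Lemma bndD w h u v : (forall x, 0 <= w x) -> (forall x, 0 <= h x) ->
  bnd w h u -> bnd w h v -> bnd w h (fun x => u x + v x).
Proof.
move=> w0 h0 [c [N [c0 H]]] [c' [N' [c'0 H']]].
exists (c + c'), (N + N')%N; split; first exact: addr_ge0.
refine (large_sub (largeI (large_ge 1) (largeI H H')) _) => x [/ratr_ge1 y1 [xH xH']].
rewrite (le_trans (lerD xH xH'))// -!mulrDl !ler_wpM2r// mulrDl lerD// ler_wpM2l//.
  by rewrite exprD ler_peMr ?exprn_ge0 ?(le_trans ler01)// exprn_ege1.
by rewrite exprD ler_peMl ?exprn_ge0 ?(le_trans ler01)// exprn_ege1.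
Qed.

Lemma bnd0 w h : bnd w h (fun=> 0).
Proof. by exists 0, 0%N; split=> //; exists 0 => x _; rewrite !mul0r. Qed.

Lemma bnd_sum w h (I : Type) (r : seq I) (u : I -> rat -> R) :
  (forall x, 0 <= w x) -> (forall x, 0 <= h x) -> (forall i, bnd w h (u i)) ->
  bnd w h (fun x => \sum_(i <- r) u i x).
Proof.
move=> w0 h0 H; elim: r => [|i r IH].
  by apply: bnd_le (bnd0 w h); exists 0 => x _; rewrite big_nil.
by apply: bnd_le (bndD w0 h0 (H i) IH); exists 0 => x _; rewrite big_cons.
Qed.

Lemma bnd_mul w h u k M : 0 <= k -> bnd w h u -> bnd w h (fun x => k * ratr x ^+ M * u x).
Proof.
move=> k0 [c [N [c0 H]]]; exists (k * c), (M + N)%N; split; first exact: mulr_ge0.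
refine (large_sub (largeI (large_ge 1) H) _) => x [/ratr_ge1 y1 xH].
rewrite (le_trans (ler_wpM2l _ xH)) ?mulr_ge0 ?exprn_ge0 ?(le_trans ler01 y1)//.
by rewrite exprD le_eqVlt; apply/orP; left; apply/eqP; ring.
Qed.

Lemma bnd_trans w h h' u : (forall x, 0 <= w x) ->
  bnd w h u -> bnd (fun=> 1) h' h -> bnd w h' u.
Proof.
move=> w0 [c [N [c0 H]]] [c' [N' [c'0 H']]].
exists (c * c'), (N + N')%N; split; first exact: mulr_ge0.
refine (large_sub (largeI (large_ge 1) (largeI H H')) _) => x [/ratr_ge1 y1 [xH xH']].
rewrite (le_trans xH)// (le_trans (ler_wpM2l _ xH')) ?mulr_ge0 ?exprn_ge0 ?(le_trans ler01 y1)//.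
by rewrite exprD le_eqVlt; apply/orP; left; apply/eqP; ring.
Qed.

Lemma bnd_shift w h u (k : nat) A : (forall x, 0 <= w x) -> (forall x, 0 <= h x) -> 0 <= A ->
  (forall x, w (x - k%:R) <= A * w x) ->
  bnd w h u -> bnd w (fun x => h (x - k%:R)) (fun x => u (x - k%:R)).
Proof.
move=> w0 h0 A0 wA [c [N [c0 H]]]; exists (c * A), N; split; first exact: mulr_ge0.
refine (large_sub (largeI (large_ge (1 + k%:R)) (large_shift k%:R H)) _) => x [].
rewrite -lerBrDr => x1 xH; have y1 := ratr_ge1 x1.
have yy : ratr (x - k%:R) <= ratr x :> R by rewrite ler_rat gerBl.
have y0 := le_trans ler01 y1.
rewrite (le_trans xH)// ler_wpM2r//.
have -> : c * A * ratr x ^+ N * w x = c * (ratr x ^+ N * (A * w x)) by ring.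
by rewrite -mulrA ler_wpM2l// ler_pM ?exprn_ge0// lerXn2r// nnegrE ?(le_trans y0).
Qed.

Definition win D G x : R := \sum_(l < D) normc (G (x - l%:R)).

Lemma win_ge0 D G x : 0 <= win D G x.
Proof. by apply: sumr_ge0 => i _; exact: normc_ge0. Qed.

Lemma win_mono D D' G x : (D <= D')%N -> win D G x <= win D' G x.
Proof.
move=> DD'; rewrite /win -!(big_mkord xpredT (fun l => normc (G (x - l%:R)))).
rewrite [leRHS](big_cat_nat (leq0n D) DD') /= lerDl sumr_ge0// => i _.
exact: normc_ge0.
Qed.

Lemma win_shift D (k : nat) G x : win D G (x - k%:R) <= win (k + D) G x.
Proof.
rewrite /win big_split_ord /= ler_wpDl ?sumr_ge0// => [i _|]; first exact: normc_ge0.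
by apply: ler_sum => i _; rewrite natrD opprD addrA.
Qed.

Definition dom w G H := exists D, bnd w (win D H) (fun x => normc (G x)).

Definition weight w := (forall x, 0 <= w x) /\
  forall k : nat, exists2 A, 0 <= A & forall x, w (x - k%:R) <= A * w x.

Lemma weight1 : weight (fun=> 1).
Proof. by split=> // k; exists 1 => // x; rewrite mul1r. Qed.

Lemma dom_win w G H D : weight w -> dom w G H -> exists D', bnd w (win D' H) (win D G).
Proof.
move=> [w0 wA] [D0 GH]; exists (D + D0)%N.
apply: bnd_sum => // [x|l]; first exact: win_ge0.
have [A A0 AH] := wA l.
apply: bnd_mono (bnd_shift w0 (win_ge0 D0 H) A0 AH GH) => // x.
by rewrite (le_trans (win_shift _ _ _ _))// win_mono// leq_add2r ltnW.
Qed.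

Lemma dom_trans w G H H' : weight w -> dom w G H -> dom (fun=> 1) H H' -> dom w G H'.
Proof.
move=> [w0 wA] [D GH] HH'; have [D' DH] := dom_win D weight1 HH'.
by exists D'; exact: bnd_trans DH.
Qed.

(** Solve for G: a nonzero polynomial stays away from 0 at large arguments, and the other
    coefficients grow polynomially. *)
Lemma bnd_relation w h (p : {poly C}) G m (p' : 'I_m -> {poly C}) (G' : 'I_m -> rat -> C) :
  (forall x, 0 <= w x) -> (forall x, 0 <= h x) -> p != 0 ->
  (forall i, bnd w h (fun x => normc (G' i x))) ->
  (forall x, p.[ratr x] * G x + \sum_(i < m) (p' i).[ratr x] * G' i x = 0) ->
  bnd w h (fun x => normc (G x)).
Proof.
move=> w0 h0 p0 GH eqG.
have ratrE x : ((ratr x : R)%:C)%C = ratr x :> C by exact: (fmorph_eq_rat (real_complex R \o ratr) x).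
have [c [a [c0 pc]]] := poly_lower p0.
have H1 : bnd w h (fun x => \sum_(i < m) normc ((p' i).[ratr x]) * normc (G' i x)).
  apply: bnd_sum => // i.
  have [k [M [k0 kM]]] := poly_upper (p' i).
  apply: (@bnd_le _ _ _ (fun x => k * ratr x ^+ M * normc (G' i x))).
    exists 1 => x /ratr_ge1 y1; rewrite ler_wpM2r ?normc_ge0//.
    by have := kM _ y1; rewrite ratrE.
  exact: bnd_mul.
have ci0 : 0 <= c^-1 by rewrite invr_ge0 ltW.
apply: bnd_le (bnd_mul 0 ci0 H1).
have [b ab] : exists b : rat, a <= ratr b.
  exists ((Num.truncn `|a|).+1%:R); rewrite rmorph_nat (le_trans (ler_norm _))// ltW//.
  by rewrite truncnS_gt.
exists b => x bx; rewrite expr0 mulr1 ler_pdivlMl//.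
have ya : a <= ratr x by rewrite (le_trans ab)// ler_rat.
apply: le_trans (_ : normc p.[ratr x] * normc (G x) <= _).
  by rewrite ler_wpM2r ?normc_ge0//; have := pc _ ya; rewrite ratrE.
rewrite -normcM -[_ * _](addrK (\sum_(i < m) (p' i).[ratr x] * G' i x)) eqG sub0r normcN.
by rewrite (le_trans (normc_sum _ _ _))//; apply: ler_sum => i _; rewrite normcM.
Qed.

Lemma dom_relation w (p : {poly C}) G H m (p' : 'I_m -> {poly C}) (G' : 'I_m -> rat -> C) :
  weight w -> p != 0 -> (forall i, dom w (G' i) H) ->
  (forall x, p.[ratr x] * G x + \sum_(i < m) (p' i).[ratr x] * G' i x = 0) -> dom w G H.
Proof.
move=> [w0 wA] p0 /choice[D GH] eqG.
exists (\sum_i D i)%N; apply: bnd_relation p0 _ eqG => // [x|i]; first exact: win_ge0.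
apply: bnd_mono (GH i) => // x; apply: win_mono.
by rewrite (bigD1 i)//= leq_addr.
Qed.

Lemma bnd_term D l G : (l < D)%N -> bnd (fun=> 1) (win D G) (fun x => normc (G (x - l%:R))).
Proof.
move=> lD; exists 1, 0%N; split=> //; exists 0 => x _; rewrite expr0 !mul1r /win.
by rewrite (bigD1 (Ordinal lD))//= lerDl sumr_ge0// => i _; exact: normc_ge0.
Qed.

(** The recurrence for the coefficients of a solution of a linear differential equation. The nonzero
    coefficient [P t] belongs to the oldest term, so the recurrence is solved backwards. *)
Definition precursive t (P : nat -> {poly C}) G := P t != 0 /\
  forall x, \sum_(l < t.+1) (P l).[ratr x] * G (x - l%:R) = 0.

(** Each coefficient is bounded by the t coefficients that follow it, so windows of any length are
    controlled by a window of length t + 1 at the upper end. *)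
Lemma precursive_back t P G D : precursive t P G ->
  bnd (fun=> 1) (win t.+1 G) (win D G).
Proof.
move=> [Pt PG].
have W0 x : 0 <= win t.+1 G x by exact: win_ge0.
apply: bnd_sum => // l; move: l => [l _] /=; elim/ltn_ind: l => l IH.
have [lt|tl] := ltnP l t.+1; first exact: bnd_term.
have H1 : bnd (fun=> 1) (win t G) (fun x => normc (G (x - t%:R))).
  apply: (@bnd_relation _ _ (P t) _ t (fun i => P i) (fun i x => G (x - i%:R))) => //.
  - by move=> x; exact: win_ge0.
  - by move=> i; exact: bnd_term.
  - by move=> x; have := PG x; rewrite big_ord_recr /= addrC.
have H2 : bnd (fun=> 1) (fun x => win t G (x - (l - t)%:R)) (fun x => normc (G (x - l%:R))).
  have := bnd_shift (k := (l - t)%N) (A := 1) (fun _ => ler01) (win_ge0 t G) ler01.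
  move=> /(_ (fun x => normc (G (x - t%:R)))) H; apply: bnd_le (H _ H1) => [|x]; last by rewrite mul1r.
  by exists 0 => x _; rewrite -addrA -opprD -natrD subnK// ltnW.
apply: bnd_trans H2 _ => //; apply: bnd_sum => // i.
apply: bnd_le (IH (l - t + i)%N _); last by have := ltn_ord i; lia.
by exists 0 => x _; rewrite natrD opprD addrA.
Qed.

(** Combining both bounds, a window is at most half of itself once w has beaten the polynomial
    factors. *)
Lemma vanish_large w t P G : weight w ->
  (forall c N, large (fun x => c * ratr x ^+ N * w x <= 2^-1)) ->
  precursive t P G -> dom w G G -> large (fun x => G x = 0).
Proof.
move=> ww w_small PG GG; have [w0 _] := ww.
have [D DG] := dom_win t.+1 ww GG.
have [c [N [c0 H]]] := bnd_trans w0 DG (precursive_back D PG).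
refine (large_sub (largeI (w_small c N) H) _) => x [small Hx].
have W0 : win t.+1 G x <= 0.
  have := le_trans Hx (ler_wpM2r (win_ge0 _ _ _) small).
  by have := win_ge0 t.+1 G x; lra.
apply: eq0_normc; apply/eqP; rewrite eq_le normc_ge0 andbT (le_trans _ W0)//.
rewrite /win big_ord_recl subr0 lerDl sumr_ge0// => i _; exact: normc_ge0.
Qed.

Definition mulp (b : {poly C}) G x : C := \sum_(l < size b) b`_l * G (x - l%:R).

Lemma mulp_wide m (b : {poly C}) G x : (size b <= m)%N ->
  mulp b G x = \sum_(l < m) b`_l * G (x - l%:R).
Proof.
move=> bm; rewrite /mulp -!(big_mkord xpredT (fun l => b`_l * G (x - l%:R))).
rewrite [RHS](big_cat_nat (leq0n _) bm) /= [X in _ + X]big_nat_cond.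
rewrite [X in _ + X]big1 ?addr0// => l.
by rewrite andbT => /andP[bl _]; rewrite nth_default// mul0r.
Qed.

Lemma mulpD p p' G x : mulp (p + p') G x = mulp p G x + mulp p' G x.
Proof.
rewrite !(@mulp_wide (size p + size p')) ?leq_addr ?leq_addl//.
  by rewrite -big_split; apply: eq_bigr => l _; rewrite coefD mulrDl.
by rewrite (leq_trans (size_polyD _ _))// geq_max leq_addr leq_addl.
Qed.

Lemma mulpMXaddC p a G x : mulp (p * 'X + a%:P) G x = mulp p G (x - 1) + a * G x.
Proof.
rewrite (@mulp_wide (size p).+1); last first.
  by rewrite size_MXaddC; case: ifP.
rewrite big_ord_recl coefD coefMX coefC /= add0r subr0 addrC; congr (_ + _).
apply: eq_bigr => l _; rewrite coefD coefMX coefC /= addr0; congr (_ * G _).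
by rewrite -[bump _ _]/(l.+1) -addn1 natrD opprD addrA addrAC.
Qed.

Lemma mulpM p p' G x : mulp (p * p') G x = mulp p (mulp p' G) x.
Proof.
elim/poly_ind: p x => [|p a IH] x.
  by rewrite mul0r /mulp size_poly0 !big_ord0.
rewrite mulpMXaddC mulrDl mulpD -IH; congr (_ + _).
  by rewrite mulrAC -[_ * 'X]addr0 -[0](polyC0) mulpMXaddC mul0r addr0.
rewrite (@mulp_wide (size p')); last by rewrite mul_polyC size_scale_leq.
by rewrite /mulp mulr_sumr; apply: eq_bigr => l _; rewrite mul_polyC coefZ mulrA.
Qed.

(** G is a combination of the t shifts F, F(. - 1), ..., with coefficients rational in the exponent;
    d is the common denominator. *)
Definition reprs t F G := exists d : {poly C}, exists c : nat -> {poly C}, d != 0 /\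
  forall x, d.[ratr x] * G x = \sum_(k < t) (c k).[ratr x] * F (x - k%:R).

Lemma reprs0 t F : reprs t F (fun=> 0).
Proof.
exists 1, (fun=> 0); split=> [|x]; first exact: oner_neq0.
rewrite mulr0; apply/esym; apply: big1 => k _.
rewrite horner0; exact: mul0r.
Qed.

Lemma reprsD t F G H (p : {poly C}) : reprs t F G -> reprs t F H ->
  reprs t F (fun x => p.[ratr x] * G x + H x).
Proof.
move=> [d [c [d0 dc]]] [e [b [e0 eb]]].
exists (d * e), (fun k => p * e * c k + d * b k); split=> [|x]; first exact: mulf_neq0.
have -> : (d * e).[ratr x] * (p.[ratr x] * G x + H x) =
    (p * e).[ratr x] * (d.[ratr x] * G x) + d.[ratr x] * (e.[ratr x] * H x).
  by rewrite !hornerM; ring.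
rewrite dc eb !mulr_sumr -big_split; apply: eq_bigr => k _ /=.
by rewrite hornerD !hornerM; ring.
Qed.

Lemma reprs_ext t F G H : (forall x, G x = H x) -> reprs t F G -> reprs t F H.
Proof. by move=> GH [d [c [d0 dc]]]; exists d, c; split=> // x; rewrite -GH. Qed.

Lemma reprs_sum t F m (p : 'I_m -> {poly C}) (G : 'I_m -> rat -> C) :
  (forall i, reprs t F (G i)) -> reprs t F (fun x => \sum_i (p i).[ratr x] * G i x).
Proof.
elim: m p G => [|m IH] p G GF.
  by apply: reprs_ext (reprs0 t F) => x; rewrite big_ord0.
apply: reprs_ext (reprsD (p ord0) (GF ord0) (IH (fun i => p (lift ord0 i)) (fun i => G (lift ord0 i)) _)).
  by move=> x; rewrite big_ord_recl.
by move=> i; exact: GF.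
Qed.

Lemma reprs_div t F G (Q : {poly C}) : Q != 0 -> reprs t F (fun x => Q.[ratr x] * G x) -> reprs t F G.
Proof.
move=> Q0 [d [c [d0 dc]]]; exists (d * Q), c; split=> [|x]; first exact: mulf_neq0.
by rewrite hornerM -mulrA dc.
Qed.

Lemma reprs_shift t P F l : precursive t P F -> reprs t F (fun x => F (x - l%:R)).
Proof.
move=> [Pt PF]; elim/ltn_ind: l => l IH.
have [lt|tl] := ltnP l t.
  exists 1, (fun k => (k == l)%:R); split=> [|x]; first exact: oner_neq0.
  rewrite hornerC mul1r (bigD1 (Ordinal lt))//= eqxx hornerC mul1r big1 ?addr0// => k kl.
  by rewrite -val_eqE /= in kl; rewrite (negbTE kl) horner0 mul0r.
pose s := (l - t)%N; pose Q k := P k \Po ('X - (s%:R)%:P).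
have QE k x : (Q k).[ratr x] = (P k).[ratr (x - s%:R)].
  by rewrite /Q horner_comp !hornerE rmorphB rmorph_nat.
apply: (@reprs_div _ _ _ (Q t)).
  by rewrite /Q comp_poly2_eq0 ?size_XsubC.
apply: reprs_ext (reprs_sum (fun k : 'I_t => - Q k) (G := fun k x => F (x - (s + k)%:R)) _).
  move=> x; have := PF (x - s%:R); rewrite big_ord_recr /= => /eqP; rewrite addrC addr_eq0 => /eqP.
  rewrite -QE -addrA -opprD -natrD subnK// => ->; rewrite -sumrN; apply: eq_bigr => k _.
  by rewrite hornerN QE mulNr natrD opprD addrA.
by move=> k; apply: IH; have := ltn_ord k; rewrite /s; lia.
Qed.

Lemma reprs_mulp t P F b : precursive t P F -> reprs t F (mulp b F).
Proof.
move=> PF; apply: reprs_ext (reprs_sum (fun l : 'I_(size b) => (b`_l)%:P) (G := fun l x => F (x - l%:R)) _).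
  by move=> x; apply: eq_bigr => l _; rewrite hornerC.
by move=> l; exact: reprs_shift PF.
Qed.

Lemma reprs_dependent t F (G : 'I_t.+1 -> rat -> C) : (forall i, reprs t F (G i)) ->
  exists p : 'I_t.+1 -> {poly C}, (exists i, p i != 0) /\
    forall x, \sum_i (p i).[ratr x] * G i x = 0.
Proof.
move=> /choice[d /choice[c dc]].
have [v [[i vi] vM]] := poly_kernel (\matrix_(i, k) c i k : 'M[{poly C}]_(t.+1, t)).
exists (fun i => v i * d i); split; first by exists i; rewrite mulf_neq0// (dc i).1.
move=> x; have -> : \sum_i (v i * d i).[ratr x] * G i x =
    \sum_i \sum_(k < t) (v i * c i k).[ratr x] * F (x - k%:R).
  apply: eq_bigr => j _; rewrite hornerM -mulrA (dc j).2 mulr_sumr.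
  by apply: eq_bigr => k _; rewrite hornerM mulrA.
rewrite exchange_big big1// => k _; rewrite -mulr_suml -horner_sum.
have := vM k; under eq_bigr do rewrite mxE.
by move=> ->; rewrite horner0 mul0r.
Qed.

(** Iterating the contraction gives polynomial multiples G_0 = F, G_1, ... of F, each dominated by w
    times any earlier one. All lie in the t-dimensional space of shifts of F, so G_0, ..., G_t
    satisfy a relation with coefficients polynomial in x. Its first term G_k is dominated by the
    later ones, hence by w G_k, and so vanishes for large x. *)
Lemma chain_vanish w (S : (rat -> C) -> Prop) F : weight w ->
  (forall c N, large (fun x => c * ratr x ^+ N * w x <= 2^-1)) ->
  (forall G, S G -> exists t P, precursive t P G) ->
  (forall G, S G -> exists b, [/\ b != 0, S (mulp b G) & dom w (mulp b G) G]) ->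
  S F -> exists b, b != 0 /\ large (fun x => mulp b F x = 0).
Proof.
move=> ww w_small Srec Sstep SF; have [w0 _] := ww.
have [st stP] : exists st : (rat -> C) -> {poly C}, forall G, S G ->
    [/\ st G != 0, S (mulp (st G) G) & dom w (mulp (st G) G) G].
  suff /choice[st H] : forall G, exists b, S G -> [/\ b != 0, S (mulp b G) & dom w (mulp b G) G] by exists st.
  move=> G; have [/Sstep[b H]|nS] := pselect (S G); first by exists b.
  by exists 0 => SG.
pose G i := iter i (fun G => mulp (st G) G) F.
have SG i : S (G i) by elim: i => //= i IH; have [] := stP _ IH.
have GE i : exists b, b != 0 /\ forall x, G i x = mulp b F x.
  elim: i => [|i [b [b0 IH]]].
    exists 1; split=> [|x]; first exact: oner_neq0.
    by rewrite /mulp size_poly1 big_ord1 coefC /= mul1r subr0.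
  have [s0 _ _] := stP _ (SG i); set s := st (G i) in s0.
  exists (s * b); split=> [|x]; first exact: mulf_neq0.
  by rewrite mulpM /= -/s; apply: eq_bigr => l _; rewrite IH.
have Gdom i k : dom w (G (i + k.+1)%N) (G i).
  elim: k i => [|k IH] i; first by rewrite addn1; have [] := stP _ (SG i).
  rewrite addnS -addSn; apply: dom_trans (IH i.+1) _ => //.
  have [_ _ [D [c [N [c0 H]]]]] := stP _ (SG i).
  exists D, c, N; split=> //.
  refine (large_sub (largeI (large_ge 1) (largeI (w_small 1 0%N) H)) _) => x [/ratr_ge1 y1 [w1 Hx]].
  rewrite expr0 !mul1r in w1; apply: le_trans Hx _; rewrite ler_wpM2r ?win_ge0//.
  rewrite ler_wpM2l ?mulr_ge0 ?exprn_ge0 ?(le_trans ler01 y1)//; lra.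
have [t [P PF]] := Srec _ SF.
have [|p [[i pi] pG]] := @reprs_dependent t F (fun i => G i).
  by move=> i; have [b [_ GbF]] := GE i; apply: reprs_ext (reprs_mulp b PF) => x; rewrite GbF.
pose exi := ex_intro (fun k => p (inord k) != 0) (i : nat).
(* The least index k with p_k nonzero: every other term of the relation comes later in the chain. *)
have [|k pk kmin] := ex_minnP (P := fun k => p (inord k) != 0) (_ : exists k, p (inord k) != 0).
  by exists i; rewrite inord_val.
have kt : (k < t.+1)%N.
  by rewrite ltnNge; apply/negP => tk; have := kmin i; rewrite inord_val pi => /(_ isT); have := ltn_ord i; lia.
have [b [b0 GbF]] := GE k; exists b; split=> //.
have [t' [P' PG]] := Srec _ (SG k).
suff /(vanish_large ww w_small PG) H : dom w (G k) (G k).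
  by refine (large_sub H _) => x; rewrite GbF.
apply: (@dom_relation w (p (inord k)) _ _ (t - k)%N (fun j => p (inord (k + j.+1)))
  (fun j => G (k + j.+1)%N)) => // x.
have := pG x; under eq_bigr => j _ do rewrite -{1}(inord_val j); rewrite -(big_mkord xpredT (fun i => (p (inord i)).[ratr x] * G i x)) => pGx; rewrite -[RHS]pGx.
rewrite [RHS](big_cat_nat (leq0n k) (ltnW kt)) /= big_nat_cond [X in _ = X + _]big1 ?add0r; last first.
  move=> l /andP[/andP[_ lk] _]; have /negbNE/eqP-> : ~~ (p (inord l) != 0).
    by apply/negP => /kmin; rewrite leqNgt lk.
  by rewrite horner0 mul0r.
rewrite big_ltn//; congr (_ + _); rewrite -{1}[k.+1]add0n big_addn subSS big_mkord.
by apply: eq_bigr => l _; rewrite addnS addnC addnS.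
Qed.

End Growth.

(** * Spans inside a field extension *)

Section Restriction.
Variables (K L : fieldType) (io : {rmorphism K -> L}).

Definition restriction of {rmorphism K -> L} : Type := L.
Local Notation LK := (restriction io).

HB.instance Definition _ := GRing.Zmodule.on LK.

Definition restriction_scale (a : K) (x : LK) : LK := io a * (x : L).

Lemma restriction_scaleA a b v : restriction_scale a (restriction_scale b v) = restriction_scale (a * b) v.
Proof. by rewrite /restriction_scale rmorphM mulrA. Qed.

Lemma restriction_scale1 : left_id 1 restriction_scale.
Proof. by move=> v; rewrite /restriction_scale rmorph1 mul1r. Qed.

Lemma restriction_scaleDr : right_distributive restriction_scale +%R.
Proof. by move=> a u v; rewrite /restriction_scale mulrDr. Qed.

Lemma restriction_scaleDl v : {morph restriction_scale^~ v : a b / a + b}.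
Proof. by move=> a b; rewrite /restriction_scale rmorphD mulrDl. Qed.

HB.instance Definition _ := GRing.Zmodule_isLmodule.Build K LK
  restriction_scaleA restriction_scale1 restriction_scaleDr restriction_scaleDl.

Definition kspan (s : seq L) (y : L) : Prop := span (fun g : LK => g \in (s : seq LK)) (y : LK).

Lemma kspanD s x y : kspan s x -> kspan s y -> kspan s (x + y).
Proof. exact: spanD. Qed.

Lemma kspanZ s a x : kspan s x -> kspan s (io a * x).
Proof. exact: (@spanZ _ LK). Qed.

Lemma kspan0 s : kspan s 0.
Proof. exact: span_zero. Qed.

Lemma kspan_gen s x : x \in s -> kspan s x.
Proof. exact: (@span_gen _ LK). Qed.

Lemma kspan_sum s (I : Type) (r : seq I) (P : pred I) (F : I -> L) :
  (forall i, P i -> kspan s (F i)) -> kspan s (\sum_(i <- r | P i) F i).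
Proof. exact: (@span_sum _ LK). Qed.

Lemma kspan_ind_sub s (M : L -> Prop) x : M 0 ->
  (forall a y z, M y -> M z -> M (io a * y + z)) ->
  (forall y, y \in s -> M y) -> kspan s x -> M x.
Proof. by move=> M0 ML Ms; apply: (@span_ind_sub _ LK). Qed.

Lemma kspan_dependent s (y : nat -> L) : (forall k, kspan s (y k)) ->
  exists c : 'I_(size s).+1 -> K, (exists k, c k != 0) /\ \sum_k io (c k) * y k = 0.
Proof.
move=> /(_ _)/span_seq_coord ys; have /choice[c cE] : forall k, exists c : 'I_(size s) -> K, y k = \sum_i io (c i) * s`_i.
  by move=> k; have [c ->] := ys k; exists c.
pose M := \matrix_(k < (size s).+1, i < size s) c k i.
have : kermx M != 0.
  by rewrite kermx_eq0 /row_free neq_ltn ltnS (leq_trans (rank_leq_col _)).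
case/matrix0Pn => k0 [k vk]; exists (fun k => kermx M k0 k); split; first by exists k.
under eq_bigr do rewrite cE mulr_sumr.
rewrite exchange_big big1// => i _.
have /sub_kermxP/matrixP/(_ 0 i) : (row k0 (kermx M) <= kermx M)%MS by exact: row_sub.
rewrite mxE [RHS]mxE => E0.
under eq_bigr do rewrite mulrA -rmorphM.
rewrite -mulr_suml -rmorph_sum [X in io X](_ : _ = 0) ?rmorph0 ?mul0r//.
rewrite -[RHS]E0.
by apply: eq_bigr => j _; rewrite [row _ _ _ _]mxE [M _ _]mxE.
Qed.

End Restriction.

Lemma cleared_neq0 (D : idomainType) (d a : D) (x : {fraction D}) :
  d != 0 -> FracField.tofrac d * x = FracField.tofrac a -> x != 0 -> a != 0.
Proof. by move=> d0 dx x0; rewrite -tofrac_eq0 -dx mulf_neq0// tofrac_eq0. Qed.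

(** * Rationality of Puiseux series in stable spaces *)

Section QPower.
Variables (R : realType) (q : R[i]) (qs : nat -> R[i]).
Import ComplexField.Normc.
Hypothesis q_neq0 : q != 0.
Hypothesis q_norm : normc q != 1.
Hypothesis qs_root : forall j, (0 < j)%N -> qs j ^+ j = q.
Hypothesis qs_compat : forall k l, (0 < k)%N -> (0 < l)%N -> qs (l * k)%N ^+ l = qs k.
Local Notation C := R[i].
Local Notation K := {fraction {poly C}}.
Local Notation L := (puiseux C).
Local Notation qp := (qpow qs).

Lemma rat_common_den (x y : rat) : exists j : nat, exists a b : int,
  [/\ (0 < j)%N, x = a%:~R / j%:R & y = b%:~R / j%:R].
Proof.
have d0 (r : rat) : (0 < `|denq r|)%N by rewrite absz_gt0 denq_neq0.
have rE (r : rat) : r = (numq r)%:~R / `|denq r|%N%:R.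
  by rewrite -[`|denq r|%N%:R]/((Posz `|denq r|)%:~R) absz_denq divq_num_den.
exists (`|denq x| * `|denq y|)%N, (numq x * `|denq y|%N), (numq y * `|denq x|%N).
split; first by rewrite muln_gt0 !d0.
  rewrite [LHS]rE natrM intrM -[(Posz _)%:~R]/(`|denq y|%N%:R : rat) -mulf_div divff ?mulr1//.
  by rewrite pnatr_eq0 -lt0n.
rewrite [LHS]rE mulnC natrM intrM -[(Posz _)%:~R]/(`|denq x|%N%:R : rat) -mulf_div divff ?mulr1//.
by rewrite pnatr_eq0 -lt0n.
Qed.

Lemma qpowD x y : qp (x + y) = qp x * qp y.
Proof.
have [j [a [b [j0 -> ->]]]] := rat_common_den x y.
by rewrite -mulrDl -intrD !(qpowE qs_compat)// expfzDr// (qs_neq0 q_neq0 qs_root).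
Qed.

Lemma qpow_neq0 x : qp x != 0.
Proof.
have [j [a [_ [j0 -> _]]]] := rat_common_den x x.
by rewrite (qpowE qs_compat)// expfz_neq0// (qs_neq0 q_neq0 qs_root).
Qed.

(** Whichever of |q^x| and its inverse tends to 0; this is where |q| <> 1 is used. *)
Definition qweight (x : rat) : R := if normc q < 1 then normc (qp x) else (normc (qp x))^-1.

Lemma normc_gt0 (z : C) : z != 0 -> 0 < normc z.
Proof.
move=> z0; rewrite lt_neqAle normc_ge0 andbT eq_sym; apply: contraNneq z0.
by move=> /eq0_normc ->.
Qed.

Lemma qweight_gt0 x : 0 < qweight x.
Proof. by rewrite /qweight; case: ifP => _; rewrite ?invr_gt0 normc_gt0 ?qpow_neq0. Qed.

Lemma qweightD x y : qweight (x + y) = qweight x * qweight y.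
Proof. by rewrite /qweight qpowD normcM; case: ifP => _; rewrite ?invfM. Qed.

Lemma qweight_weight : weight qweight.
Proof.
split=> [x|k]; first exact/ltW/qweight_gt0.
exists (qweight (- k%:R)) => [|x]; first exact/ltW/qweight_gt0.
by rewrite qweightD mulrC.
Qed.

Definition qratio : R := if normc q < 1 then normc q else (normc q)^-1.

Lemma qratio_bounds : 0 < qratio < 1.
Proof.
rewrite /qratio; have q0 := normc_gt0 q_neq0; case: (ltP (normc q) 1) => q1; first by rewrite q0 q1.
by rewrite invr_gt0 q0 invf_lt1// lt_neqAle eq_sym q_norm.
Qed.

Lemma qweight_le x (n : nat) : n%:R <= x -> qweight x <= qratio ^+ n.
Proof.
have [j [a [_ [j0 -> _]]]] := rat_common_den x x.
rewrite ler_pdivlMr ?ltr0n// -natrM -[(n * j)%:R]/((n * j)%N%:~R) ler_int.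
case: a => // k; rewrite lez_nat => njk.
have E : qweight (k%:~R / j%:R) = (if normc q < 1 then normc (qs j) else (normc (qs j))^-1) ^+ k.
  rewrite /qweight (qpowE qs_compat)// -exprnP normcX.
  by case: ifP => _; rewrite ?exprVn.
have Ej : (if normc q < 1 then normc (qs j) else (normc (qs j))^-1) ^+ j = qratio.
  by rewrite /qratio; case: ifP => _; rewrite ?exprVn -normcX qs_root.
set v := (if _ then _ else _) in E Ej.
have v0 : 0 <= v by rewrite /v; case: ifP => _; rewrite ?invr_ge0 normc_ge0.
have v1 : v <= 1.
  have /andP[_ r1] := qratio_bounds; rewrite leNgt; apply/negP => v1.
  by have := exprn_ege1 j (ltW v1); rewrite Ej leNgt r1.
by rewrite E -Ej -exprM mulnC ler_wiXn2l.
Qed.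

Lemma geometric_bounded (N : nat) (r : R) : 0 < r < 1 -> exists c, forall n : nat, n%:R ^+ N * r ^+ n <= c.
Proof.
elim: N r => [|N IH] r /andP[r0 r1].
  by exists 1 => n; rewrite expr0 mul1r exprn_ile1// ltW.
(* Write r^n = s^n s^n: one factor absorbs a power of n by Bernoulli's inequality, the other serves
   the induction hypothesis. *)
pose s := Num.sqrt r.
have s0 : 0 < s by rewrite sqrtr_gt0.
have s2 : s * s = r by rewrite -expr2 sqr_sqrtr// ltW.
have s1 : s < 1 by rewrite -[1]sqrtr1 ltr_sqrt.
have [c cP] := IH s ltac:(by rewrite s0 s1).
have c0 : 0 <= c by apply: le_trans (cP 1%N); rewrite mulr_ge0// exprn_ge0// ltW.
pose h := s^-1 - 1; have h0 : 0 < h by rewrite subr_gt0 -invr1 ltf_pV2// posrE.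
exists (h^-1 * c) => n.
have -> : n%:R ^+ N.+1 * r ^+ n = (n%:R * s ^+ n) * (n%:R ^+ N * s ^+ n).
  by rewrite -s2 exprMn exprS; ring.
apply: ler_pM => //; rewrite ?mulr_ge0 ?exprn_ge0 ?ler0n// ?(ltW s0)//.
rewrite -ler_pdivlMr ?exprn_gt0// -exprVn.
have -> : s^-1 = 1 + h by rewrite /h addrC subrK.
have B k : 1 + k%:R * h <= (1 + h) ^+ k.
  elim: k => [|k IHk]; first by rewrite mul0r addr0 expr0.
  rewrite exprS; apply: le_trans (ler_wpM2l _ IHk); last by rewrite addr_ge0 ?ltW.
  rewrite -natr1; have : 0 <= k%:R * (h * h) by rewrite mulr_ge0// mulr_ge0// ltW.
  by lra.
rewrite ler_pdivlMl// mulrC; apply: le_trans (B n); lra.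
Qed.

Lemma qweight_small c (N : nat) : large (fun x => c * ratr x ^+ N * qweight x <= 2^-1).
Proof.
have /andP[r0 r1] := qratio_bounds.
have [b bP] := geometric_bounded N.+1 qratio_bounds.
have b0 : 0 <= b by apply: le_trans (bP 0%N); rewrite mulr_ge0.
(* The exponent N.+1 in b leaves a spare factor n.+1 in the denominator; from n0 on it exceeds 2 |c|
   b / qratio. *)
pose n0 := (Num.truncn (2 * `|c| * b / qratio)).+1.
exists n0%:R => x n0x; pose n := Num.truncn x.
have x0 : 0 <= x by apply: le_trans n0x.
have nx : n%:R <= x by rewrite truncn_le.
have xn : x < n.+1%:R by rewrite truncnS_gt.
have n0n : (n0 <= n)%N by rewrite /n truncn_ge_nat.
have y0 : 0 <= ratr x :> R by rewrite ler0q.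
apply: le_trans (_ : `|c| * (n.+1%:R ^+ N * qratio ^+ n) <= _).
  rewrite -mulrA; apply: le_trans (ler_wpM2r _ (ler_norm c)) _.
    by rewrite mulr_ge0 ?exprn_ge0// ltW// qweight_gt0.
  rewrite ler_wpM2l// ler_pM ?exprn_ge0//; first exact/ltW/qweight_gt0.
    rewrite lerXn2r// ?nnegrE// -[n.+1%:R](rmorph_nat (ratr : rat -> R)) ler_rat.
    exact: ltW.
  exact: qweight_le.
have B := bP n.+1.
have n1 : 0 < n.+1%:R :> R by rewrite ltr0n.
have E : n.+1%:R ^+ N * qratio ^+ n = n.+1%:R ^+ N.+1 * qratio ^+ n.+1 / (n.+1%:R * qratio).
  rewrite !exprS; field; rewrite (gt_eqF r0) /=.
    by rewrite -natr1 in n1; rewrite gt_eqF.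
rewrite E mulrA ler_pdivrMr ?mulr_gt0//.
apply: le_trans (ler_wpM2l (normr_ge0 c) B) _.
have : 2 * `|c| * b / qratio <= n.+1%:R.
  apply: le_trans (ltW (truncnS_gt _)) _; rewrite ler_nat -/n0.
  exact: leqW.
rewrite ler_pdivrMr//; lra.
Qed.

Local Notation io := (@puiseux_of_frac C).
Local Notation sL := (puiseux_sigma qs).
Local Notation dL := (@puiseux_delta C).

Lemma pmul_poly (b : {poly C}) (G : L) x : (puiseux_of_poly b * G : L) x = mulp b G x.
Proof.
rewrite -[LHS]/(puiseux_mul _ _ x) /puiseux_mul.
have e_inj : injective (fun k : nat => k%:R : rat) by move=> a c /eqP; rewrite eqr_nat => /eqP.
rewrite (fsbigE [seq k%:R | k <- iota 0 (size b)]) ?map_inj_uniq ?iota_uniq//.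
  rewrite big_map /mulp -(big_mkord xpredT (fun l => b`_l * G (x - l%:R))) /index_iota subn0.
  rewrite (eq_bigl xpredT) => [|a]; last by rewrite in_setT.
  apply: eq_bigr => k _; congr (_ * _).
  by have := serE 0 (fun i => b`_i) k (ltn0Sn 0); rewrite subr0 divr1.
move=> r _; apply: contraNeq => br0.
have /(ser_neq0 (ltn0Sn 0))[a] : ser 1 0 (fun i => b`_i) r != 0.
  by apply: contra_neq br0 => E0; rewrite [puiseux_of_poly b r]E0 mul0r.
rewrite subr0 divr1 => rE; apply/mapP; exists a => //; rewrite mem_iota add0n /=.
rewrite ltnNge; apply: contra br0 => ba; apply/eqP.
have -> : puiseux_of_poly b r = b`_a.
  by have := serE 0 (fun i => b`_i) a (ltn0Sn 0); rewrite subr0 divr1 rE.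
by rewrite nth_default// mul0r.
Qed.

Lemma iter_sigma k (G : L) x : (iter k sL G) x = qp x ^+ k * G x.
Proof.
elim: k => [|k IH]; first by rewrite expr0 mul1r.
by rewrite exprS -mulrA -IH.
Qed.

Lemma iter_delta k (G : L) x : (iter k dL G) x = ratr x ^+ k * G x.
Proof.
elim: k => [|k IH]; first by rewrite expr0 mul1r.
by rewrite exprS -mulrA -IH.
Qed.

Lemma poly_dependent s (y : nat -> L) : (forall k, kspan io s (y k)) ->
  exists p : 'I_(size s).+1 -> {poly C}, (exists k, p k != 0) /\
    forall x, \sum_k mulp (p k) (y k) x = 0.
Proof.
move=> /kspan_dependent[c [[k ck] cy]].
have [d [p [d0 dp]]] := clear_denominators c.
exists p; split; first by exists k; exact: cleared_neq0 d0 (dp k) ck.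
move=> x; have : (\sum_j puiseux_of_poly (p j) * y j : L) x = 0.
  have ioE (r : {poly C}) : puiseux_of_poly r = io (FracField.tofrac r).
    by rewrite /puiseux_of_frac frac_lift_tofrac//; exact: puiseux_of_poly_inj.
  under eq_bigr do rewrite ioE -dp rmorphM -mulrA.
  by rewrite -mulr_sumr cy mulr0.
have sumE (I : Type) (r : seq I) (G : I -> L) : (\sum_(i <- r) G i) x = \sum_(i <- r) G i x.
  by elim: r => [|i r IH]; rewrite ?big_nil// !big_cons -IH.
rewrite sumE => E0; rewrite -[RHS]E0; apply: eq_bigr => j _; exact/esym/pmul_poly.
Qed.

Definition stable s := forall y, y \in s -> kspan io s (sL y) /\ kspan io s (dL y).

Lemma puiseux_delta_zmod_morphism : zmod_morphism dL.
Proof. by move=> f g; apply: puiseux_ext; apply/funext => x; rewrite /= -mulrBr. Qed.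

HB.instance Definition _ := GRing.isZmodMorphism.Build L L dL puiseux_delta_zmod_morphism.

Definition sigmaL : {rmorphism L -> L} := HB.pack sL
  (GRing.isZmodMorphism.Build _ _ sL (@puiseux_sigma_zmod_morphism _ qs))
  (GRing.isMonoidMorphism.Build _ _ sL (puiseux_sigma_monoid_morphism q_neq0 qs_root qs_compat)).

Lemma puiseux_delta_poly (p : {poly C}) : dL (puiseux_of_poly p) = puiseux_of_poly ('X * p^`()).
Proof.
apply: puiseux_ext; apply: eq_ser => // [r|a].
  by move=> /= H; apply: (@ser_neq0 _ 1 0 (fun i => p`_i)) => //; apply: contra_neq H => ->; rewrite mulr0.
rewrite /= serE// subr0 divr1 coefXM; case: a => [|a]; first by rewrite rmorph0 mul0r.
by rewrite coef_deriv rmorph_nat mulr_natl.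
Qed.

Lemma puiseux_delta_frac (a : K) : exists a' : K, dL (io a) = io a'.
Proof.
have ioE (p : {poly C}) : io (FracField.tofrac p) = puiseux_of_poly p.
  by rewrite /puiseux_of_frac frac_lift_tofrac//; exact: puiseux_of_poly_inj.
pose n := (repr a).1; pose d := (repr a).2.
have d0 : FracField.tofrac d != 0 by rewrite tofrac_eq0 denom_ratioP.
have aE : io a * io (FracField.tofrac d) = io (FracField.tofrac n).
  by rewrite -rmorphM {1}(frac_num_den a) divfK.
have key N' D' : io N' = dL (io (FracField.tofrac n)) -> io D' = dL (io (FracField.tofrac d)) ->
    dL (io a) = io ((N' - a * D') / FracField.tofrac d).
  move=> hN hD.
  have -> : io ((N' - a * D') / FracField.tofrac d) = (io N' - io a * io D') / io (FracField.tofrac d).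
    by rewrite -(rmorphM io a D') -rmorphB -fmorphV -rmorphM.
  rewrite hN hD -aE (puiseux_deltaM (io a) (io (FracField.tofrac d))).
  by rewrite addrK mulfK// fmorph_eq0.
exists ((FracField.tofrac ('X * n^`()) - a * FracField.tofrac ('X * d^`())) / FracField.tofrac d).
by apply: key; rewrite !ioE puiseux_delta_poly.
Qed.

Lemma stable_kspan s y : stable s -> kspan io s y -> kspan io s (sL y) /\ kspan io s (dL y).
Proof.
move=> ss sy.
suff [] : kspan io s y /\ (kspan io s (sL y) /\ kspan io s (dL y)) by [].
move: sy; apply: (@kspan_ind_sub _ _ io s (fun y => kspan io s y /\
  (kspan io s (sL y) /\ kspan io s (dL y)))); last by move=> z zs; split; [exact: kspan_gen|exact: ss].
  by rewrite -[sL 0]/(sigmaL 0) rmorph0 raddf0; do !split; exact: kspan0.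
move=> a u v [su [ssu dsu]] [sv [ssv dsv]]; split; first by apply: kspanD => //; exact: kspanZ.
rewrite -[sL _]/(sigmaL (io a * u + v)) rmorphD rmorphM /= (puiseux_sigma_frac q_neq0 qs_root qs_compat).
split; first by apply: kspanD => //; exact: kspanZ.
rewrite (raddfD dL) /= puiseux_deltaM; have [a' ->] := puiseux_delta_frac a.
by apply: kspanD => //; apply: kspanD; exact: kspanZ.
Qed.

(** The exponents of b y are bounded below and have a common denominator, so b y is then a finite
    sum of monomials and y is rational in some z^(1/j). *)
Definition rational_series (y : L) := exists b : {poly C}, b != 0 /\ large (fun x => mulp b y x = 0).

(** The iterates of delta on y stay in a finite-dimensional space, so y satisfies a linear
    differential equation; comparing coefficients of z^x gives the recurrence. *)
Lemma kspan_precursive s y : stable s -> kspan io s y -> exists t P, precursive t P y.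
Proof.
move=> ss sy.
have [p [[k pk] py]] : exists p : 'I_(size s).+1 -> {poly C}, (exists k, p k != 0) /\
    forall x, \sum_k mulp (p k) (iter k dL y) x = 0.
  by apply: poly_dependent; elim=> // k IH /=; have [] := stable_kspan ss IH.
pose m := (\sum_k size (p k))%N.
(* The coefficient of y(x - l): delta^j multiplies it by (x - l)^j, whence the shift of the
   argument. *)
pose P l := (\poly_(j < (size s).+1) (p (inord j))`_l) \Po ('X - (l%:R)%:P).
have PE l x : (P l).[ratr x] = \sum_(j < (size s).+1) (p j)`_l * ratr (x - l%:R) ^+ j.
  rewrite /P horner_comp !hornerE horner_poly rmorphB rmorph_nat.
  by apply: eq_bigr => j _; rewrite inord_val.
have Pm l : (m <= l)%N -> P l = 0.
  move=> ml; rewrite /P (_ : \poly_(j < _) _ = 0) ?comp_poly0//.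
  apply/polyP => j; rewrite coef_poly coef0; case: ifP => // _.
  by rewrite nth_default// (leq_trans _ ml)// /m (bigD1 (inord j))//= leq_addr.
have Py m' x : (m <= m')%N -> \sum_(l < m') (P l).[ratr x] * y (x - l%:R) = 0.
  move=> mm'; rewrite -[RHS](py x).
  under eq_bigr do rewrite PE mulr_suml.
  rewrite exchange_big; apply: eq_bigr => i _.
  have im : (size (p i) <= m')%N.
    by apply: leq_trans mm'; rewrite /m (bigD1 i)//= leq_addr.
  rewrite (mulp_wide _ _ im).
  by apply: eq_bigr => k' _; rewrite iter_delta mulrA.
have exP : exists l, P l != 0.
  exists (size (p k)).-1; rewrite /P comp_poly2_eq0 ?size_XsubC//.
  apply: contraNneq pk => /polyP/(_ k); rewrite coef_poly ltn_ord inord_val coef0.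
  by rewrite -/(lead_coef _) => /eqP; rewrite lead_coef_eq0.
have Pbound l : P l != 0 -> (l <= m)%N by apply: contra_neqT; rewrite -ltnNge => /ltnW/Pm.
have [t Pt tmax] := ex_maxnP exP Pbound.
exists t, P; split=> // x; have := Py (t.+1 + m)%N x (leq_addl _ _); rewrite big_split_ord /= => E0; rewrite -[RHS]E0.
rewrite [X in _ = _ + X]big1 ?addr0// => l _.
have /negbNE/eqP-> : ~~ (P (t.+1 + l)%N != 0).
  by apply/negP => /tmax; rewrite leqNgt addSn ltnS leq_addr.
by rewrite horner0 mul0r.
Qed.

(** The iterates of sigma on y satisfy a linear relation whose k-th term grows like |q^x|^k. The
    dominant term is a polynomial multiple of y up to a power of q^x, and the others are smaller by
    a factor [qweight]. *)
Lemma kspan_contraction s y : stable s -> kspan io s y ->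
  exists b, [/\ b != 0, kspan io s (puiseux_of_poly b * y) & dom qweight (mulp b y) y].
Proof.
move=> ss sy.
have [p [[k0 pk0] py]] : exists p : 'I_(size s).+1 -> {poly C}, (exists k, p k != 0) /\
    forall x, \sum_k mulp (p k) (iter k sL y) x = 0.
  by apply: poly_dependent; elim=> // k IH /=; have [] := stable_kspan ss IH.
(* The dominant index is the smallest one when |q| < 1 and the largest one otherwise. *)
have [k1 [pk1 k1P]] : exists k1 : 'I_(size s).+1, p k1 != 0 /\ forall k, p k != 0 -> k != k1 ->
    forall x, 0 <= x -> normc (qp x) ^+ k <= normc (qp x) ^+ k1 * qweight x.
  case: (ltP (normc q) 1) => q1.
    exists [arg min_(k < k0 | p k != 0) (k : nat)]; case: arg_minnP => // k1 pk1 k1min.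
    split=> // k pk kk1 x x0.
    have kk : (k1 < k)%N by rewrite ltn_neqAle eq_sym kk1 k1min.
    have w1 : qweight x <= 1 by exact: (@qweight_le x 0).
    rewrite /qweight q1 in w1 *; rewrite -exprSr ler_wiXn2l ?normc_ge0//.
  exists [arg max_(k > k0 | p k != 0) (k : nat)]; case: arg_maxnP => // k1 pk1 k1max.
  split=> // k pk kk1 x x0.
  have kk : (k < k1)%N by rewrite ltn_neqAle kk1; exact: k1max.
  have w1 : qweight x <= 1 by exact: (@qweight_le x 0).
  have qx0 : 0 < normc (qp x) by rewrite normc_gt0// qpow_neq0.
  rewrite /qweight ltNge q1 /= in w1 *; rewrite ler_pdivlMr// -exprSr ler_weXn2l//.
  by rewrite -[1]invr1 lef_pV2// ?posrE// in w1.
(* Chosen so that p_k1 sigma^k1(y) has coefficient q^(k1 x) times that of b y at x. *)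
pose b := \poly_(l < size (p k1)) ((p k1)`_l * qp (- l%:R) ^+ k1).
have bE x : qp x ^+ k1 * mulp b y x = mulp (p k1) (iter k1 sL y) x.
  rewrite (@mulp_wide _ (size (p k1))) ?size_poly// mulr_sumr /mulp.
  by apply: eq_bigr => l _; rewrite coef_poly ltn_ord iter_sigma qpowD exprMn; ring.
have b0 : b != 0.
  apply/eqP => /polyP/(_ (size (p k1)).-1); rewrite coef_poly coef0 prednK ?size_poly_gt0// leqnn.
  by move/eqP; rewrite mulf_eq0 -/(lead_coef _) lead_coef_eq0 (negbTE pk1) expf_eq0 (negbTE (qpow_neq0 _)) andbF.
exists b; split=> //.
  by rewrite -[puiseux_of_poly b](frac_lift_tofrac (@puiseux_of_poly_inj C)); exact: kspanZ.
pose m := (\sum_k size (p k))%N.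
pose c k := \sum_(l < size (p k)) normc ((p k)`_l) * normc (qp (- l%:R)) ^+ k.
have c0 k : 0 <= c k by apply: sumr_ge0 => l _; rewrite mulr_ge0 ?exprn_ge0 ?normc_ge0.
have H k x : normc (mulp (p k) (iter k sL y) x) <= normc (qp x) ^+ k * (c k * win m y x).
  rewrite (le_trans (normc_sum _ _ _))// /c mulr_suml mulr_sumr; apply: ler_sum => l _.
  rewrite iter_sigma !normcM qpowD exprMn normcM !normcX.
  have : normc (y (x - l%:R)) <= win m y x.
    have lm : (l < m)%N by rewrite (leq_trans (ltn_ord l))// /m (bigD1 k)//= leq_addr.
    by rewrite /win (bigD1 (Ordinal lm))//= lerDl sumr_ge0// => i _; exact: normc_ge0.
  move=> yw; pose A := normc (qp x) ^+ k * (normc (p k)`_l * normc (qp (- l%:R)) ^+ k).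
  rewrite [leLHS](_ : _ = A * normc (y (x - l%:R))); last by rewrite /A; ring.
  rewrite mulrA -/A ler_wpM2l// /A !mulr_ge0 ?exprn_ge0 ?normc_ge0//.
exists m, (\sum_k c k), 0%N; split; first by apply: sumr_ge0 => k _.
exists 0 => x x0; rewrite expr0 mulr1.
have qx0 : 0 < normc (qp x) ^+ k1 by rewrite exprn_gt0// normc_gt0// qpow_neq0.
rewrite -(ler_pM2l qx0) -normcX -normcM bE.
have := py x; rewrite (bigD1 k1)//= => /eqP; rewrite addr_eq0 => /eqP ->.
rewrite normcN (le_trans (normc_sum _ _ _))//.
apply: le_trans (_ : \sum_(k | k != k1) normc (qp x) ^+ k1 * qweight x * (c k * win m y x) <= _).
  apply: ler_sum => k kk1; have [pk|pk] := eqVneq (p k) 0.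
    rewrite pk /mulp size_poly0 big_ord0 normc0 !mulr_ge0 ?exprn_ge0 ?normc_ge0 ?win_ge0//.
    exact/ltW/qweight_gt0.
  rewrite (le_trans (H k x))// ler_wpM2r ?mulr_ge0 ?win_ge0//; exact: k1P.
rewrite -mulr_sumr -mulr_suml normcX -mulrA ler_wpM2l ?exprn_ge0 ?normc_ge0//.
rewrite mulrA [X in X * _]mulrC ler_wpM2r ?win_ge0// ler_wpM2r//; first exact/ltW/qweight_gt0.
by rewrite [leRHS](bigD1 k1)//= lerDr.
Qed.

Lemma stable_rational s y : stable s -> kspan io s y -> rational_series y.
Proof.
move=> ss sy.
pose S (G : rat -> C) := exists2 z : L, kspan io s z & G = z.
apply: (@chain_vanish _ qweight S) => //.
- exact: qweight_weight.
- exact: qweight_small.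
- by move=> _ [z sz ->]; exact: kspan_precursive sz.
- move=> _ [z sz ->]; have [b [b0 bz zd]] := kspan_contraction ss sz.
  exists b; split=> //; exists (puiseux_of_poly b * z) => //.
  by apply/funext => x; rewrite pmul_poly.
- by exists y.
Qed.

End QPower.

Lemma course_of_values (T : Type) (t0 : T) (Phi : nat -> (nat -> T) -> T) :
  (forall a u v, (forall i, (i < a)%N -> u i = v i) -> Phi a u = Phi a v) ->
  exists w, forall a, w a = Phi a w.
Proof.
move=> Phi_ext; pose s := fix s a := if a is b.+1 then rcons (s b) (Phi b (nth t0 (s b))) else [::].
have ss a : size (s a) = a by elim: a => //= a IH; rewrite size_rcons IH.
pose w a := nth t0 (s a.+1) a.
have sw b a : (a < b)%N -> nth t0 (s b) a = w a.
  elim: b => // b IH; rewrite ltnS leq_eqVlt => /predU1P[->//|ab].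
  by rewrite /= nth_rcons ss ab IH.
exists w => a; rewrite /w /= nth_rcons ss ltnn eqxx; apply: Phi_ext => i ia.
exact: sw.
Qed.

(** * Monomials, coboundaries and logarithmic decompositions *)

Section PuiseuxFacts.
Variables (R : realType) (q : R[i]) (qs : nat -> R[i]).
Import ComplexField.Normc.
Hypothesis q_neq0 : q != 0.
Hypothesis q_norm : normc q != 1.
Hypothesis qs_root : forall j, (0 < j)%N -> qs j ^+ j = q.
Hypothesis qs_compat : forall k l, (0 < k)%N -> (0 < l)%N -> qs (l * k)%N ^+ l = qs k.
Local Notation C := R[i].
Local Notation K := {fraction {poly C}}.
Local Notation L := (puiseux C).
Local Notation qp := (qpow qs).
Local Notation io := (@puiseux_of_frac C).
Local Notation sL := (puiseux_sigma qs).
Local Notation dL := (@puiseux_delta C).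

Lemma io_tofrac (p : {poly C}) : io (FracField.tofrac p) = puiseux_of_poly p.
Proof. by rewrite /puiseux_of_frac frac_lift_tofrac//; exact: puiseux_of_poly_inj. Qed.

Lemma pmonomial_mul c e (G : L) x : (pmonomial c e * G : L) x = c * G (x - e).
Proof.
rewrite -[LHS]/(puiseux_mul _ _ x) /puiseux_mul (fsbigE [:: e])//.
  by rewrite (eq_bigl xpredT) => [|a]; rewrite ?in_setT// big_seq1 /= /puiseux_monomial eqxx.
move=> r _; rewrite inE /= /puiseux_monomial => /negbTE ->; exact: mul0r.
Qed.

Lemma pmonomialM c e c' e' : pmonomial c e * pmonomial c' e' = pmonomial (c * c') (e + e') :> L.
Proof.
apply: puiseux_ext; apply/funext => x; rewrite pmonomial_mul /= /puiseux_monomial.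
by rewrite subr_eq addrC; case: ifP => _; rewrite ?mulr0.
Qed.

Lemma pmonomial_neq0 c e : c != 0 -> pmonomial c e != 0 :> L.
Proof.
move=> c0; apply: contra_neq c0 => /(congr1 (fun f : L => f e)) /=.
by rewrite /puiseux_monomial eqxx.
Qed.

Lemma io_constE (c : C) : io (FracField.tofrac c%:P) = pmonomial c 0.
Proof.
rewrite io_tofrac; apply: puiseux_ext; rewrite /=.
have := monomialE 0 c (ltn0Sn 0); rewrite mul0r => ->; congr ser.
by apply/funext => i; rewrite coefC.
Qed.

Lemma ratr_puiseux (r : rat) : ratr r = pmonomial (ratr r) 0 :> L.
Proof.
pose h : {rmorphism rat -> L} := io \o (@FracField.tofrac {poly C} \o (polyC \o ratr)).
by rewrite -io_constE -[RHS]/(h r) fmorph_eq_rat.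
Qed.

Lemma delta_pmonomial c e : dL (pmonomial c e) = ratr e * pmonomial c e.
Proof.
rewrite ratr_puiseux pmonomialM add0r; apply: puiseux_ext; apply/funext => x.
by rewrite /= /puiseux_monomial; case: eqP => [->|]; rewrite ?mulr0.
Qed.

Lemma qpow_neq1 x : x != 0 -> qp x != 1.
Proof.
have [j [a [_ [j0 -> _]]]] := rat_common_den x x => x0.
have a0 : a != 0 by apply: contraNneq x0 => ->; rewrite mul0r.
apply: contra_neq q_norm => qx1.
have : normc (qp (a%:~R / j%:R)) = 1 by rewrite qx1 normc1.
rewrite (qpowE qs_compat)// => nj1.
have {}nj1 : normc (qs j) = 1.
  case: a a0 nj1 {x0 qx1} => [[|k]|k]// _; rewrite ?NegzE ?exprnN ?normcV ?normcX.
    by move=> /eqP; rewrite pexpr_eq1 ?normc_ge0// => /eqP.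
  move/(congr1 (fun y => y^-1)); rewrite invr1 invrK => /eqP.
  by rewrite pexpr_eq1 ?normc_ge0// => /eqP.
by rewrite -(qs_root j0) normcX nj1 expr1n.
Qed.

Lemma delta_eq0 (u : L) : dL u = 0 -> exists c : K, u = io c.
Proof.
move=> du; exists (FracField.tofrac (u 0)%:P); rewrite io_constE.
apply: puiseux_ext; apply/funext => x; rewrite /= /puiseux_monomial.
case: eqP => [->//|/eqP x0]; have := congr1 (fun f : L => f x) du => /= /eqP.
by rewrite mulf_eq0 fmorph_eq0 (negbTE x0) => /eqP.
Qed.

Lemma sigma_fixed_delta (u : L) : sL u = u -> dL u = 0.
Proof.
move=> su; apply: puiseux_ext; apply/funext => x /=.
have [->|x0] := eqVneq x 0; first by rewrite rmorph0 mul0r.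
have := congr1 (fun f : L => f x) su => /= /eqP; rewrite -subr_eq0 -[X in _ - X]mul1r -mulrBl mulf_eq0.
by rewrite subr_eq0 (negbTE (qpow_neq1 x0)) => /eqP ->; rewrite mulr0.
Qed.

(** sigma preserves the coefficient of z^0, so a coboundary has zero constant term. *)
Lemma sigma_coboundary_rat (u : L) (r : rat) : sL u - u = ratr r -> r = 0.
Proof.
rewrite ratr_puiseux => /(congr1 (fun f : L => f 0)).
have -> : (sL u - u) 0 = qp 0 * u 0 - u 0 by [].
have -> : qp 0 = 1 by exact: expr0z.
by rewrite mul1r subrr /= /puiseux_monomial eqxx => /esym/eqP; rewrite fmorph_eq0 => /eqP.
Qed.

(** Up to a factor sigma(d) / d, every nonzero series is its leading monomial u, whose logarithmic
    derivative is the rational exponent m. *)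
Lemma log_decomposition (al : L) : al != 0 -> exists d u, exists m : rat,
  [/\ d != 0, u != 0, dL u = ratr m * u & al * d = u * sL d].
Proof.
move=> al0; have [j j0 [N [u [_ [_ [alE _ _]]]]]] := puiseux_ser3 al al al.
have exk : exists k, u k != 0.
  apply/not_existsP => u0; move/eqP: al0; apply; apply: puiseux_ext.
  rewrite alE; apply/funext => r; rewrite /ser; case: ifP => // _.
  by have /negP := u0 (Num.truncn (r * j%:R + N%:R)); rewrite negbK => /eqP.
have [n0 un0 n0min] := ex_minnP exk.
pose m : rat := (n0%:R - N%:R) / j%:R.
pose v a := (u n0)^-1 * u (n0 + a)%N.
(* The coefficients of d, normalized to start with 1: comparing terms of order a gives (q_j^a - 1)
   w_a = sum_(i < a) w_i v_(a-i), and q_j^a differs from 1 because |q| <> 1. *)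
pose Phi a (w : nat -> C) := if a == 0%N then 1 else
  (qs j ^+ a - 1)^-1 * \sum_(i < a) w i * v (a - i)%N.
have [|w wE] := @course_of_values C 0 Phi.
  by move=> a w w' ww; rewrite /Phi; congr (if _ then _ else _ * _); apply: eq_bigr => i _; rewrite ww.
have w0 : w 0%N = 1 by rewrite wE.
have v0 : v 0%N = 1 by rewrite /v addn0 mulVf.
pose d : L := mkpuiseux (ser_supp 0 w j0).
pose U : L := pmonomial (u n0) m.
pose be : L := pmonomial (u n0)^-1 (- m) * al.
have Ube : U * be = al.
  by rewrite /U /be mulrA pmonomialM divff// subrr -[RHS]mul1r.
have beE : be = ser j 0 v :> (rat -> C).
  have bx x : be x = (u n0)^-1 * ser j N u (x + m) by rewrite /be pmonomial_mul opprK alE.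
  apply: eq_ser => // [x|a]; rewrite bx.
    rewrite mulf_eq0 negb_or => /andP[_ ux0]; have [a xa] := ser_neq0 j0 ux0.
    move: ux0; rewrite xa serE// => ua; exists (a - n0)%N.
    apply: (addIr m); rewrite xa /m subr0 natrB ?n0min// -mulrDl; congr (_ / _); ring.
  have -> : (a%:R - 0%:R) / j%:R + m = ((n0 + a)%:R - N%:R) / j%:R.
    by rewrite /m subr0 -mulrDl natrD; congr (_ / _); ring.
  by rewrite serE.
exists d, U, m; split.
- apply/eqP => d0; have := serE 0 w 0 j0; rewrite subrr mul0r w0.
  by rewrite -[ser _ _ _ _]/(d 0) d0 => /esym/eqP; rewrite oner_eq0.
- exact: pmonomial_neq0.
- exact: delta_pmonomial.
rewrite -Ube -mulrA; congr (_ * _); apply: puiseux_ext.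
rewrite -[LHS]/(puiseux_mul be d) beE /= mul_ser// puiseux_sigma_ser//; congr ser.
apply/funext => a; rewrite subr0 cauchyC /cauchy_prod big_ord_recr /= subnn v0 mulr1 -exprnP.
have [->|a0] := eqVneq a 0%N; first by rewrite big_ord0 add0r expr0 mul1r.
have qa : qs j ^+ a - 1 != 0.
  rewrite subr_eq0 exprnP -(qpowE qs_compat)//; apply: qpow_neq1.
  by apply: mulf_neq0; [rewrite intr_eq0|rewrite invr_eq0 natj_neq0].
set S := \sum_(i < a) _.
have wa : w a = (qs j ^+ a - 1)^-1 * S by rewrite {1}wE /Phi (negbTE a0).
have -> : S = (qs j ^+ a - 1) * w a by rewrite wa mulVKf.
by rewrite mulrBl mul1r subrK.
Qed.

Definition tbasis j : seq L := [seq pmonomial 1 (k%:R / j%:R) | k <- iota 0 j].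

Lemma pmonomial_kspan c (a : int) j l : (0 < j)%N -> (0 < l)%N ->
  kspan io (tbasis (l * j)) (pmonomial c (a%:~R / j%:R)).
Proof.
move=> j0 l0; pose J := (l * j)%N; have J0 : (0 < J)%N by rewrite muln_gt0 l0.
pose e := (a * l %/ J)%Z; pose k := `|(a * l %% J)%Z|%N.
have kE : (a * l %% J)%Z = k%:Z.
  by rewrite /k gez0_abs// modz_ge0// eqz_nat -lt0n.
have kJ : (k < J)%N.
  by have := ltz_pmod (a * l) (_ : 0 < J%:Z); rewrite kE ltz_nat => ->//.
have -> : pmonomial c (a%:~R / j%:R) = io (FracField.tofrac c%:P * FracField.tofrac 'X ^ e) *
    pmonomial 1 (k%:R / J%:R) :> L.
  have ioX : io (FracField.tofrac 'X) = pmonomial 1 1 :> L.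
    rewrite io_tofrac; apply: puiseux_ext; rewrite /=.
    have := monomialE 1 (1 : C) (ltn0Sn 0); rewrite divr1 => ->; congr ser.
    by apply/funext => i; rewrite coefX; case: eqP.
  have Xn (n : nat) : pmonomial 1 1 ^+ n = pmonomial 1 n%:R :> L.
    by elim: n => [//|n IH]; rewrite exprS IH pmonomialM mul1r -(natrD _ 1 n).
  have ioXe : io (FracField.tofrac 'X ^ e) = pmonomial 1 e%:~R :> L.
    have ioXn n : io (FracField.tofrac 'X ^+ n) = pmonomial 1 n%:R :> L.
      by rewrite -Xn -ioX; exact: (rmorphXn io n (FracField.tofrac 'X)).
    case: e => n; first by rewrite -exprnP ioXn.
    have -> : io (FracField.tofrac 'X ^ Negz n) = (pmonomial 1 n.+1%:R)^-1 :> L.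
      by rewrite -ioXn; exact: (fmorphV io (FracField.tofrac 'X ^+ n.+1)).
    rewrite NegzE; apply: (mulIf (pmonomial_neq0 n.+1%:R (oner_neq0 C))).
    by rewrite mulVf ?pmonomial_neq0 ?oner_neq0// pmonomialM mulr1 rmorphN addNr.
  have -> : io (FracField.tofrac c%:P * FracField.tofrac 'X ^ e) =
      io (FracField.tofrac c%:P) * io (FracField.tofrac 'X ^ e) by exact: (rmorphM io).
  rewrite io_constE ioXe !pmonomialM !mulr1 add0r; congr pmonomial.
  have := divz_eq (a * l) J; rewrite kE -/e => /(congr1 (fun i : int => i%:~R : rat)).
  rewrite !intrM intrD intrM -![(Posz _)%:~R]/(_%:R : rat) => E.
  have lr : l%:R != 0 :> rat by rewrite pnatr_eq0 -lt0n.
  have jr : j%:R != 0 :> rat by rewrite pnatr_eq0 -lt0n.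
  apply: (mulIf (mulf_neq0 lr jr)); rewrite [RHS]mulrDl -natrM -/J divfK ?natj_neq0//.
  by rewrite -E /J natrM mulrCA divfK// mulrC.
apply/kspanZ/kspan_gen/mapP; exists k => //; rewrite mem_iota add0n//.
Qed.

(** The free factor l lets finitely many such series share one denominator. *)
Lemma rational_kspan (y : L) : rational_series y -> exists2 j, (0 < j)%N &
  forall l, (0 < l)%N -> kspan io (tbasis (l * j)) y.
Proof.
move=> [b [b0 [x0 yb]]].
pose w : L := puiseux_of_poly b * y.
have w_large x : x0 <= x -> w x = 0 by move=> /yb; rewrite -pmul_poly.
have [j j0 [N wN]] := puiseux_suppP w; exists j => // l l0.
suff wk : kspan io (tbasis (l * j)) w.
  have -> : y = io (FracField.tofrac b)^-1 * w.
    have b0' : io (FracField.tofrac b) != 0 by rewrite fmorph_eq0 tofrac_eq0.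
    by rewrite fmorphV /w -io_tofrac mulKf.
  exact: kspanZ.
clearbody w; have j0' : (0 : rat) < j%:R by rewrite ltr0n.
pose M := (Num.truncn `|x0 * j%:R - N%:~R|).+1.
have -> : w = \sum_(i < M) pmonomial (w ((N + i%:Z)%:~R / j%:R)) ((N + i%:Z)%:~R / j%:R).
  apply: puiseux_ext; apply/funext => x.
  have sumE (I : Type) (r : seq I) (G : I -> L) : (\sum_(i <- r) G i) x = \sum_(i <- r) G i x.
    by elim: r => [|i r IH]; rewrite ?big_nil// !big_cons -IH.
  rewrite sumE /=; have [wx|wx] := eqVneq (w x) 0.
    by rewrite wx big1// => i _; rewrite /puiseux_monomial; case: eqP => // <-.
  have [k Nk xk] := wN _ wx; pose i := `|k - N|%N.
  have kE : k = N + i%:Z by rewrite /i; lia.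
  have iM : (i < M)%N.
    rewrite ltnS truncn_ge_nat// -[i%:R]/((i%:Z)%:~R); apply: le_trans (ler_norm _).
    have : x < x0 by rewrite ltNge; apply: contra wx => /w_large ->.
    rewrite xk ltr_pdivrMr// kE intrD => /ltW; lra.
  rewrite (bigD1 (Ordinal iM))//= big1 ?addr0 => [|i' ii].
    by rewrite /puiseux_monomial -kE -xk eqxx.
  rewrite /puiseux_monomial; case: eqP => // xi; case/eqP: ii; apply: val_inj => /=.
  have : k = N + i'%:Z.
    apply: (@intr_inj rat); apply: (mulIf (lt0r_neq0 (_ : 0 < j%:R^-1))); rewrite -?xk//.
    by rewrite invr_gt0.
  by rewrite kE => /addrI [].
by apply: kspan_sum => i _; exact: pmonomial_kspan.
Qed.

End PuiseuxFacts.

Lemma cancel_two (V : zmodType) (a b c y z : V) : a + z + b + y - c - (z + y) = a + b - c.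
Proof. by rewrite (addrAC a z b) -(addrA (a + b) z y) addrAC addrK. Qed.

Lemma cancel_head (V : zmodType) (a y z : V) : a + y + z - a = y + z.
Proof. by rewrite -(addrA a) addrAC subrr add0r. Qed.

(** * Directions stable under sigma and delta *)

Section EndGame.
Variables (K L : fieldType) (io : {rmorphism K -> L}) (sK dK : K -> K).
Variables (sL : {rmorphism L -> L}) (dL : {additive L -> L}).
Hypothesis dLM : forall x y, dL (x * y) = dL x * y + x * dL y.
Hypothesis sd : forall x, sL (dL x) = dL (sL x).

(** The span of s is stable under sigma up to the factor c, and under delta - mu. These defects add
    and multiply in products, so a suitable power can be corrected by a single element of L. *)
Definition kclosed (c mu : L) (s : seq L) : Prop := forall y, y \in s ->
  (exists2 y', kspan io s y' & sL y = c * y') /\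
  (exists2 y', kspan io s y' & dL y = mu * y + y').

Definition seq_mul (s s' : seq L) : seq L := [seq x * y | x <- s, y <- s'].

Lemma kspan_mul s s' x y : kspan io s x -> kspan io s' y -> kspan io (seq_mul s s') (x * y).
Proof.
move=> sx sy; move: sx; apply: (@kspan_ind_sub _ _ io s (fun x => kspan io (seq_mul s s') (x * y))).
- by rewrite mul0r; exact: kspan0.
- move=> a u v su sv; rewrite mulrDl -mulrA; apply: kspanD => //; exact: kspanZ.
move=> {}x xs; move: sy; apply: (@kspan_ind_sub _ _ io s' (fun y => kspan io (seq_mul s s') (x * y))).
- by rewrite mulr0; exact: kspan0.
- move=> a u v su sv; rewrite mulrDr mulrCA; apply: kspanD => //; exact: kspanZ.
by move=> {}y ys; apply: kspan_gen; exact: allpairs_f.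
Qed.

Lemma kclosed_mul c mu s c' mu' s' : kclosed c mu s -> kclosed c' mu' s' ->
  kclosed (c * c') (mu + mu') (seq_mul s s').
Proof.
move=> ss ss' _ /allpairsP[[x y] /= [xs ys ->]].
have [[x1 sx1 xE1] [x2 sx2 xE2]] := ss _ xs.
have [[y1 sy1 yE1] [y2 sy2 yE2]] := ss' _ ys.
split.
  exists (x1 * y1); first exact: kspan_mul.
  by rewrite rmorphM xE1 yE1; ring.
exists (x2 * y + x * y2).
  by apply: kspanD; apply: kspan_mul => //; exact: kspan_gen.
by rewrite dLM xE2 yE2; ring.
Qed.

Fixpoint seq_pow (s : seq L) (M : nat) : seq L :=
  if M is M'.+1 then seq_mul s (seq_pow s M') else [:: 1].

Lemma dL1 : dL 1 = 0.
Proof. by have := dLM 1 1; rewrite !mulr1 mul1r -{1}[dL 1]addr0 => /addrI. Qed.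

Lemma kclosed_pow c mu s M : kclosed c mu s -> kclosed (c ^+ M) (mu *+ M) (seq_pow s M).
Proof.
move=> ss; elim: M => [|M IH]; last by rewrite exprS mulrS; exact: kclosed_mul.
move=> y; rewrite inE => /eqP ->; split.
  by exists 1; [apply: kspan_gen; rewrite inE eqxx|rewrite rmorph1 mulr1].
by exists 0; [exact: kspan0|rewrite dL1 mul0r addr0].
Qed.

Lemma seq_pow_mem s M x y : x \in s -> y \in s -> x * y ^+ M \in seq_pow s M.+1.
Proof.
move=> xs ys; apply: allpairs_f => //; elim: M => [|M IH]; first by rewrite inE.
by rewrite exprS; exact: allpairs_f.
Qed.

Variable rt : {rmorphism rat -> L}.
Hypothesis log_dec : forall al : L, al != 0 -> exists d u, exists m : rat,
  [/\ d != 0, u != 0, dL u = rt m * u & al * d = u * sL d].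
Hypothesis dL_eq0 : forall u, dL u = 0 -> exists c, u = io c.
Hypothesis sL_fixed : forall u, sL u = u -> dL u = 0.
Hypothesis sL_coboundary : forall u (r : rat), sL u - u = rt r -> r = 0.

Variables (E : vectType L) (tau nabla : E -> E).
Hypothesis tauD : forall u v, tau (u + v) = tau u + tau v.
Hypothesis tauZ : forall c v, tau (c *: v) = sL c *: tau v.
Hypothesis nablaD : forall u v, nabla (u + v) = nabla u + nabla v.
Hypothesis nablaZ : forall c v, nabla (c *: v) = dL c *: v + c *: nabla v.
Variables (I : finType) (co : I -> E -> L) (a b : I -> I -> K).
Hypothesis coD : forall i u v, co i (u + v) = co i u + co i v.
Hypothesis coZ : forall i c v, co i (c *: v) = c * co i v.
Hypothesis co_s : forall i v, sL (co i v) = \sum_k io (a i k) * co k (tau v).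
Hypothesis co_d : forall i v, dL (co i v) = co i (nabla v) + \sum_k io (b i k) * co k v.
Variable S : E -> Prop.
Hypothesis SL : forall c u v, S u -> S v -> S (c *: u + v).
Hypothesis S_nabla : forall v, S v -> S (nabla v).
Variables (M : nat) (ell al : K) (rho : L) (x0 : E).
Hypothesis comm : forall v, S v -> tau (nabla v) = nabla (tau v) + io ell *: tau v.
Hypothesis ell_al : io ell *+ M.+1 = dL (io al) / io al.
Hypothesis al_neq0 : al != 0.
Hypothesis rho_neq0 : rho != 0.
Hypothesis Sx0 : S x0.
Hypothesis tau_x0 : tau x0 = rho *: x0.

Fixpoint rev_traject (v : nat -> E) k : seq E := if k is k'.+1 then v k' :: rev_traject v k' else [::].

Lemma rev_traject_mem v k i : (i < k)%N -> v i \in rev_traject v k.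
Proof.
elim: k => // k IH; rewrite ltnS leq_eqVlt => /predU1P[->|/IH ik]; rewrite inE ?eqxx//.
by rewrite ik orbT.
Qed.

Lemma rev_trajectP v k w : w \in rev_traject v k -> exists2 i, (i < k)%N & w = v i.
Proof.
elim: k => // k IH; rewrite inE => /predU1P[->|/IH[i ik ->]]; first by exists k.
by exists i => //; rewrite leqW.
Qed.

Lemma first_dependence (v : nat -> E) : exists k, free (rev_traject v k) /\ v k \in <<rev_traject v k>>%VS.
Proof.
have [k vk] : exists k, ~~ free (rev_traject v k).
  exists (\dim {:E}).+1; apply/negP => /eqP.
  have := dimvS (subvf <<rev_traject v (\dim {:E}).+1>>).
  have -> j : size (rev_traject v j) = j by elim: j => //= j ->.
  by move=> /[swap] ->; rewrite ltnn.
elim: k vk => [|k IH]; first by rewrite nil_free.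
rewrite /= free_cons negb_and negbK => vk.
by have [fk|/IH//] := boolP (free (rev_traject v k)); exists k; split=> //; case/orP: vk; rewrite ?fk.
Qed.

(** The iterates of [nabla] on x0, suitably normalized, are eigenvectors of [tau] with one common
    eigenvalue. In a first linear dependence among them the coefficients are therefore fixed by
    sigma, hence come from K, and the coordinates of the iterates span a space closed under sigma
    and delta up to scalars. *)
Lemma rational_direction i0 : co i0 x0 != 0 -> exists2 c : L, c != 0 & exists s : seq L,
  (forall y, y \in s -> kspan io s (sL y) /\ kspan io s (dL y)) /\ forall i, c * co i x0 \in s.
Proof.
move=> x0i0.
have io_al : io al != 0 by rewrite fmorph_eq0.
have [d [u1 [m1 [d0 u10 du1 ald]]]] := log_dec io_al.
have [e [u2 [m2 [e0 u20 du2 rhoe]]]] := log_dec rho_neq0.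
have M0 : M.+1%:R != 0 :> L by rewrite -(rmorph_nat rt) fmorph_eq0 pnatr_eq0.
(* Subtracting mu turns the commutator [io ell] into the rational constant m1 / (M + 1): only (M +
   1) ell is a logarithmic derivative, whence the division. *)
pose mu := dL d / d / M.+1%:R.
pose nab v := nabla v - mu *: v.
pose m : rat := m1 / M.+1%:R + m2.
have ratm : rt m = rt m1 / M.+1%:R + rt m2 :> L.
  by rewrite /m rmorphD fmorph_div rmorph_nat.
have sd0 : sL d != 0 by rewrite fmorph_eq0.
have ell_mu : io ell - sL mu + mu = rt m1 / M.+1%:R.
  have h1 : dL (io al) * d + io al * dL d = rt m1 * u1 * sL d + u1 * sL (dL d).
    by rewrite -dLM ald dLM du1 sd.
  have ellE : io ell = dL (io al) / io al / M.+1%:R by rewrite -ell_al -mulr_natr mulfK.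
  rewrite ellE /mu !rmorphM !fmorphV rmorph_nat.
  have u1E : u1 = io al * d / sL d by rewrite ald mulfK.
  have -> : dL (io al) = (rt m1 * u1 * sL d + u1 * sL (dL d) - io al * dL d) / d.
    by rewrite -h1 addrK mulfK.
  by rewrite u1E; move: (M.+1%:R) M0 => MM M0; field; rewrite d0 sd0 io_al M0.
pose x := e^-1 *: x0.
have tau_x : tau x = u2 *: x.
  rewrite /x tauZ tau_x0 !scalerA fmorphV; congr (_ *: _).
  have se0 : sL e != 0 by rewrite fmorph_eq0.
  by apply: (mulIf (mulf_neq0 e0 se0)); rewrite mulrA; field: rhoe; rewrite e0.
have nabD u v : nab (u + v) = nab u + nab v.
  by rewrite /nab nablaD scalerDr opprD addrACA.
have nabZ c v : nab (c *: v) = dL c *: v + c *: nab v.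
  by rewrite /nab nablaZ scalerBr !scalerA mulrC addrA.
pose v j := iter j nab x.
have Sv j : S (v j).
  have S0 : S 0 by have := SL (-1) Sx0 Sx0; rewrite scaleN1r addNr.
  elim: j => [|j IH]; first by have := SL e^-1 Sx0 S0; rewrite addr0.
  by rewrite /= /nab addrC -scaleNr; apply: SL => //; exact: S_nabla.
have tau_nab w : S w -> tau (nab w) = nab (tau w) + (rt m1 / M.+1%:R) *: tau w.
  move=> Sw; rewrite /nab -scaleNr tauD tauZ comm// rmorphN -ell_mu !scalerDl !scaleNr.
  by rewrite -!addrA; congr (_ + _); rewrite [io ell *: _ + (_ + _)]addrA [RHS]addrC -!addrA subrr addr0.
have nabE y : nab y = nabla y - mu *: y by [].
have vS j : nab (v j) = v j.+1 by [].
have v0 : v 0%N = x by [].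
clearbody v; clearbody nab.
pose w j := iter j (fun y => nab y + rt m *: y) x.
(* Moving [tau] past each [nab] costs m1 / (M + 1), and past the factor u2 it costs m2; in all each
   [nab] becomes [nab] + m. *)
have tau_v j : tau (v j) = u2 *: w j.
  elim: j => [|j IH]; first by rewrite v0.
  rewrite -vS tau_nab// IH /= nabZ du2 (scalerDr u2 (nab (w j))) !scalerA ratm.
  by rewrite addrAC -scalerDl addrC; congr (_ + _ *: _); ring.
have rt0 r : dL (rt r) = 0.
  apply: sL_fixed; rewrite -[sL (rt r)]/((sL \o rt) r).
  by rewrite (fmorph_eq_rat (sL \o rt)) -(fmorph_eq_rat rt).
pose X := rev_traject v.
have Xs j : (<<X j>> <= <<X j.+1>>)%VS by rewrite /X /= vector.span_cons addvSr.
have Xv j : v j \in <<X j.+1>>%VS by rewrite memv_span//= inE eqxx.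
have nab0 : nab 0 = 0 by have := nabD 0 0; rewrite addr0 -{1}[nab 0]addr0 => /addrI.
have tau0 : tau 0 = 0 by have := tauD 0 0; rewrite addr0 -{1}[tau 0]addr0 => /addrI.
have nabX j z : z \in <<X j>>%VS -> nab z \in <<X j.+1>>%VS.
  move=> zX; rewrite (@coord_span _ _ _ (in_tuple (X j)) z zX); elim/big_ind: _ => [|y y' yX yX'|i _].
  - by rewrite nab0 mem0v.
  - by rewrite nabD rpredD.
  have /rev_trajectP[l lj lE] : (X j)`_i \in X j by rewrite mem_nth.
  have -> : (in_tuple (X j))`_i = v l by exact: lE.
  rewrite nabZ vS memvD ?memvZ//; last by rewrite memv_span// (@rev_traject_mem v j.+1 l.+1).
  by rewrite memv_span// (@rev_traject_mem v j.+1)// ltnW.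
have wE j : exists2 z, z \in <<X j>>%VS & w j.+1 = v j.+1 + rt (j.+1%:R * m) *: v j + z.
  elim: j => [|j [z zX IH]]; first by exists 0; rewrite ?mem0v// mul1r addr0 -vS v0.
  exists (nab z + (rt m * rt (j.+1%:R * m)) *: v j + rt m *: z).
    apply: memvD; last by apply: memvZ; exact: (subvP (Xs j)).
    by apply: memvD; [exact: nabX|exact: memvZ].
  rewrite -[w j.+2]/(nab (w j.+1) + rt m *: w j.+1) IH !nabD nabZ rt0 scale0r add0r.
  rewrite !vS !scalerDr !scalerA.
  have -> : rt (j.+2%:R * m) *: v j.+1 = rt (j.+1%:R * m) *: v j.+1 + rt m *: v j.+1.
    by rewrite -scalerDl -rmorphD; congr (rt _ *: _); rewrite -[j.+2%:R]natr1 mulrDl mul1r.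
  rewrite -!addrA; by congr (_ + (_ + _)); exact: addrCA.
have wv j : exists2 z, z \in <<X j>>%VS & w j = v j + z.
  case: j => [|j]; first by exists 0; rewrite ?mem0v// addr0 v0.
  have [z zX ->] := wE j; exists (rt (j.+1%:R * m) *: v j + z); last by rewrite addrA.
  by apply: memvD; [exact: memvZ|exact: (subvP (Xs j))].
have tauX j z : z \in <<X j>>%VS -> tau z \in <<X j>>%VS.
  move=> zX; rewrite (@coord_span _ _ _ (in_tuple (X j)) z zX); elim/big_ind: _ => [|y y' yX yX'|i _].
  - by rewrite tau0 mem0v.
  - by rewrite tauD rpredD.
  have /rev_trajectP[l lj lE] : (X j)`_i \in X j by rewrite mem_nth.
  have -> : (in_tuple (X j))`_i = v l by exact: lE.
  have lX : {subset <<X l.+1>>%VS <= <<X j>>%VS}.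
    apply/subvP/sub_span => y /rev_trajectP[i' il ->].
    by rewrite rev_traject_mem// (leq_trans il).
  rewrite tauZ tau_v !memvZ//; have [z' zX' ->] := wv l.
  by apply: lX; rewrite memvD// (subvP (Xs l)).
have [[|k] [kfree kdep]] := first_dependence v.
  move: kdep; rewrite /= v0 span_nil memv0 scaler_eq0 invr_eq0 (negbTE e0) /= => /eqP x00.
  by move: x0i0; rewrite x00 -[0](scale0r 0) coZ mul0r eqxx.
(* Let k + 1 be the first dependent index and c the coefficient of v_k in v_(k+1). Comparing both
   sides of [tau_v] modulo earlier vectors gives sigma(c) - c = (k + 1) m, and a rational constant
   is a coboundary only when it is 0. *)
have m0 : m = 0.
  move: kdep; rewrite [rev_traject _ _]/= vector.span_cons => /memv_addP[_ /vlineP[c ->] [z0 z0X vk]].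
  have [z1 z1X w1] := wv k; have [z2 z2X w2] := wE k.
  have := tau_v k.+1; rewrite {1}vk tauD tauZ tau_v w1 w2 vk => E1.
  have : (c + rt (k.+1%:R * m) - sL c) *: v k \in <<X k>>%VS.
    have : u2 *: ((c + rt (k.+1%:R * m) - sL c) *: v k) \in <<X k>>%VS.
      have -> : u2 *: ((c + rt (k.+1%:R * m) - sL c) *: v k) = (sL c * u2) *: z1 + tau z0 - u2 *: (z0 + z2).
        rewrite -[_ *: z1 + _](cancel_head ((sL c * u2) *: v k)) -scalerDr.
        rewrite -(scalerA (sL c) u2 (v k + z1)) E1 [sL c * u2]mulrC -scalerA -!scalerBr cancel_two.
        by rewrite -scalerDl -scalerBl.
      by rewrite memvB ?memvD ?memvZ ?tauX// memvD.
    by move=> /(memvZ u2^-1); rewrite scalerA mulVf// scale1r.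
  move: kfree; rewrite [rev_traject _ _]/= free_cons => /andP[vkX _].
  have [cm _|cm] := eqVneq (c + rt (k.+1%:R * m) - sL c) 0.
    have := @sL_coboundary c (k.+1%:R * m); have -> : sL c - c = rt (k.+1%:R * m).
      by move/eqP: cm; rewrite subr_eq0 => /eqP <-; rewrite addrC addKr.
    by move=> /(_ erefl)/eqP; rewrite mulf_eq0 pnatr_eq0 => /eqP.
  by move=> /(memvZ (c + rt (k.+1%:R * m) - sL c)^-1); rewrite scalerA mulVf// scale1r (negbTE vkX).
have wv0 j : w j = v j.
  by elim: j => [|j /= ->]; [by rewrite v0|rewrite vS m0 rmorph0 scale0r addr0].
have {}tau_v j : tau (v j) = u2 *: v j by rewrite tau_v wv0.
pose t := in_tuple (X k.+1); pose c i := coord t i (v k.+1).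
have vkE : v k.+1 = \sum_i c i *: t`_i by exact: (@coord_span _ _ _ t).
have t_v (i : 'I_(size (X k.+1))) : exists2 l, (l < k.+1)%N & t`_i = v l.
  by apply: rev_trajectP; rewrite mem_nth.
have tau_sum (J : Type) (r : seq J) (F : J -> E) : tau (\sum_(i <- r) F i) = \sum_(i <- r) tau (F i).
  by elim: r => [|i r IH]; rewrite ?big_nil ?tau0// !big_cons tauD IH.
have c_fixed i : sL (c i) = c i.
  have E1 : v k.+1 = \sum_i sL (c i) *: t`_i.
    have := tau_v k.+1; rewrite {1}vkE tau_sum => H.
    apply: (can_inj (scalerK u20)); rewrite -H scaler_sumr; apply: eq_bigr => i' _.
    by have [l _ ->] := t_v i'; rewrite tauZ tau_v !scalerA mulrC.
  by rewrite {2}/c E1 coord_sum_free.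
have /choice[c' cE] i : exists c', c i = io c' by exact/dL_eq0/sL_fixed.
have co0 i : co i 0 = 0 by rewrite -[0](scale0r 0) coZ mul0r.
have co_sum i (J : Type) (r : seq J) (F : J -> E) : co i (\sum_(i <- r) F i) = \sum_(j <- r) co i (F j).
  by elim: r => [|j r IH]; rewrite ?big_nil// !big_cons coD IH.
pose s1 := [seq co i y | i <- enum I, y <- X k.+1].
have s1_co i y : y \in X k.+1 -> co i y \in s1 by move=> yX; apply: allpairs_f => //; rewrite mem_enum.
have s1v i l : (l < k.+1)%N -> kspan io s1 (co i (v l)).
  by move=> lk; apply/kspan_gen/s1_co/rev_traject_mem.
have s1_closed : kclosed u2 mu s1.
  move=> _ /allpairsP[[i y] /= [_ /rev_trajectP[l lk ->] ->]]; split.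
    exists (\sum_k io (a i k) * co k (v l)).
      by apply: kspan_sum => j _; apply: kspanZ; exact: s1v.
    by rewrite co_s mulr_sumr; apply: eq_bigr => j _; rewrite tau_v coZ mulrCA.
  exists (co i (v l.+1) + \sum_k io (b i k) * co k (v l)).
    apply: kspanD; last by apply: kspan_sum => j _; apply: kspanZ; exact: s1v.
    move: lk; rewrite ltnS leq_eqVlt => /predU1P[->|lk]; last exact: s1v.
    rewrite vkE co_sum; apply: kspan_sum => j _; rewrite coZ cE; apply: kspanZ.
    by have [l' lk' ->] := t_v j; exact: s1v.
  rewrite co_d addrA; congr (_ + _).
  have -> : nabla (v l) = v l.+1 + mu *: v l by rewrite -vS nabE subrK.
  by rewrite coD coZ addrC.
(* In products of M + 1 coordinates the defect of delta is (M + 1) mu = delta(d) / d, which division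
   by d removes. *)
have sM := @kclosed_pow _ _ _ M.+1 s1_closed.
set sp := seq_pow s1 M.+1 in sM.
(* Since m = 0, the element u2^(M+1) u1 is killed by delta, so it lies in K; this also removes the
   defect of sigma. *)
have [kap kapE] : exists kap, u2 ^+ M.+1 / sL d = io kap / d.
  have [c0 c0E] : exists c0, u2 ^+ M.+1 * u1 = io c0.
    apply: dL_eq0; rewrite dLM du1.
    have -> : dL (u2 ^+ M.+1) = M.+1%:R * rt m2 * u2 ^+ M.+1.
      elim: (M.+1) => [|j IH]; first by rewrite expr0 dL1 !mul0r.
      by rewrite exprS dLM IH du2 -natr1; ring.
    have mm : M.+1%:R * rt m2 + rt m1 = 0.
      have := congr1 rt m0; rewrite rmorph0 ratm => /eqP; rewrite addr_eq0 => /eqP E1.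
      by rewrite -[rt m1](divfK M0) E1 mulNr mulrC subrr.
    have -> : M.+1%:R * rt m2 * u2 ^+ M.+1 * u1 + u2 ^+ M.+1 * (rt m1 * u1) =
      (M.+1%:R * rt m2 + rt m1) * (u2 ^+ M.+1 * u1) by ring.
    by rewrite mm mul0r.
  exists (c0 / al); rewrite rmorphM fmorphV -c0E.
  have -> : sL d = io al * d / u1 by rewrite ald mulrC mulKf.
  by field; rewrite u10 d0 io_al.
have x_s1 i : co i x \in s1 by rewrite -v0; apply/s1_co/(@rev_traject_mem v k.+1 0).
(* M of the M + 1 factors are taken equal to the nonzero coordinate at i0, so a common multiple of
   all coordinates of x0 lies among the products. *)
exists (e^-1 * co i0 x ^+ M / d).
  have xi0 : co i0 x != 0 by rewrite /x coZ mulf_neq0 ?invr_eq0.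
  by rewrite !mulf_neq0 ?invr_eq0 ?expf_neq0.
exists [seq y / d | y <- sp]; split=> [_ /mapP[y ys ->]|i]; last first.
  apply/mapP; exists (co i x * co i0 x ^+ M); first exact: seq_pow_mem.
  by have -> : co i x = e^-1 * co i x0 by [rewrite /x coZ]; ring.
have divd z : kspan io sp z -> kspan io [seq y / d | y <- sp] (z / d).
  apply: (@kspan_ind_sub _ _ io sp (fun z => kspan io [seq y / d | y <- sp] (z / d))).
  - by rewrite mul0r; exact: kspan0.
  - by move=> a0 u1' v1 su sv; rewrite mulrDl -mulrA; apply: kspanD => //; exact: kspanZ.
  - by move=> y' ys'; apply/kspan_gen/map_f.
have [[y1 sy1 yE1] [y2 sy2 yE2]] := sM _ ys; split.
  rewrite rmorphM fmorphV yE1 mulrAC kapE.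
  have -> : io kap / d * y1 = io kap * (y1 / d) by ring.
  by apply: kspanZ; exact: divd.
have ddinv : dL d^-1 = - dL d / d ^+ 2.
  have := dLM d d^-1; rewrite divff// dL1 => /esym/eqP; rewrite addrC addr_eq0 => /eqP E1.
  by apply: (mulfI d0); rewrite E1; field.
have -> : dL (y / d) = y2 / d; last exact: divd.
rewrite dLM yE2 ddinv -mulr_natr /mu; move: (M.+1%:R) M0 => MM M0.
by field; rewrite d0 M0.
Qed.

End EndGame.

(** * Contractions of elementary matrices and Casimir sums *)

Lemma delta_sandwich (V : comNzRingType) m (Z : 'M[V]_m) (i j r s : 'I_m) :
  delta_mx i j *m Z *m delta_mx r s = Z j r *: delta_mx i s.
Proof.
apply/matrixP => a b; rewrite mxE (bigD1 r)//= big1 ?addr0 => [|c cr]; last first.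
  by rewrite [delta_mx r s c b]mxE (negbTE cr) mulr0.
rewrite mxE (bigD1 j)//= big1 ?addr0 => [|c cj]; last first.
  by rewrite mxE (negbTE cj) andbF mul0r.
rewrite !mxE !eqxx andbT /= mulrAC -natrM mulnb mulrC; congr (_ * _%:R).
Qed.

Lemma sum_delta_sandwich (V : comNzRingType) m (X : 'M[V]_m) :
  \sum_(a < m) \sum_(b < m) delta_mx a b *m X *m delta_mx b a = (\tr X)%:M.
Proof.
under eq_bigr => a _ do under eq_bigr => b _ do rewrite delta_sandwich.
under eq_bigr => a _ do rewrite -scaler_suml.
by rewrite -scaler_sumr -scalemx1 mx1_sum_delta.
Qed.

Lemma sum_delta_transpose (V : comNzRingType) m (X : 'M[V]_m) :
  \sum_a \sum_b delta_mx a b *m X *m delta_mx a b = X^T.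
Proof.
rewrite [RHS]matrix_sum_delta; apply: eq_bigr => a _; apply: eq_bigr => b _.
by rewrite delta_sandwich mxE.
Qed.

Lemma double_sum_mul (V : comNzRingType) m (X Y : 'M[V]_m) (F : 'I_m -> 'I_m -> 'M[V]_m) :
  \sum_a \sum_b X *m F a b *m Y = X *m (\sum_a \sum_b F a b) *m Y.
Proof.
rewrite mulmx_sumr mulmx_suml; apply: eq_bigr => a _.
by rewrite mulmx_sumr mulmx_suml.
Qed.

Lemma casimir_sum (V : comNzRingType) m (F : 'I_m -> 'I_m -> 'M[V]_m) X :
  \sum_a \sum_b lie (F a b) (lie (F b a) X) =
  (\sum_a \sum_b F a b *m F b a) *m X - \sum_a \sum_b F a b *m X *m F b a
  - \sum_a \sum_b F a b *m X *m F b a + X *m (\sum_a \sum_b F a b *m F b a).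
Proof.
have E1 a b : lie (F a b) (lie (F b a) X) = 1%:M *m (F a b *m F b a) *m X
    - F a b *m X *m F b a - F b a *m X *m F a b + X *m (F b a *m F a b) *m 1%:M.
  by rewrite /lie mulmxBr mulmxBl mulmx1 mul1mx !mulmxA opprB addrA addrAC.
under eq_bigr => a _ do under eq_bigr => b _ do rewrite E1.
under eq_bigr => a _ do rewrite !big_split /= !sumrN.
rewrite !big_split /= !sumrN !double_sum_mul mul1mx mulmx1.
have ex G : \sum_a \sum_b F b a *m G a b *m F a b = \sum_a \sum_b F a b *m G b a *m F b a.
  by rewrite exchange_big.
rewrite (ex (fun _ _ => X)); congr (_ + X *m _).
by rewrite exchange_big.
Qed.

Lemma two_differences (V : zmodType) (a b : V) : a - b - b + a = (a - b) + (a - b).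
Proof. by rewrite -addrA [- b + a]addrC. Qed.

Lemma split_differences (V : zmodType) (a a' b b' c c' : V) :
  (a - a') - ((b - b') + (b - b')) + (c - c') = (a - (b + b) + c) - (a' - (b' + b') + c').
Proof.
rewrite [b - b' + _]addrACA -opprD; move: (b + b) (b' + b') => B B'.
by rewrite !opprD !opprK [X in X + _ = _]addrACA [LHS]addrACA.
Qed.

(** * Orthogonal and symplectic Lie algebras *)

Section BilinearForm.
Variables (k : fieldType) (n : nat).
Hypothesis char0 : forall i, i.+1%:R != 0 :> k.
Variables (J : 'M[k]_n) (eta : k).
Hypothesis J_unit : J \in unitmx.
Hypothesis J_sym : J^T = eta *: J.
Hypothesis eta2 : eta * eta = 1.
Implicit Types (X Y P Q : 'M[k]_n) (x y : 'cV[k]_n).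

Definition adjoint X : 'M[k]_n := invmx J *m X^T *m J.
Local Notation th := adjoint.

Lemma adjointD X Y : th (X + Y) = th X + th Y.
Proof. by rewrite /adjoint linearD /= mulmxDr mulmxDl. Qed.

Lemma adjointZ a X : th (a *: X) = a *: th X.
Proof. by rewrite /adjoint linearZ /= -scalemxAr -scalemxAl. Qed.

Lemma adjointN X : th (- X) = - th X.
Proof. by rewrite -scaleN1r adjointZ scaleN1r. Qed.

Lemma adjointM X Y : th (X *m Y) = th Y *m th X.
Proof. by rewrite /adjoint trmx_mul !mulmxA mulmxK. Qed.

Lemma adjoint1 : th 1%:M = 1%:M.
Proof. by rewrite /adjoint trmx1 mulmx1 mulVmx. Qed.

Lemma invJ_sym : (invmx J)^T = eta *: invmx J.
Proof.
have : (invmx J *m J)^T = 1%:M by rewrite mulVmx// trmx1.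
rewrite trmx_mul J_sym -scalemxAl => /(congr1 (fun M => eta *: (invmx J *m M))).
by rewrite -scalemxAr scalerA eta2 scale1r mulmx1 mulKmx.
Qed.

Lemma adjointK X : th (th X) = X.
Proof.
rewrite /adjoint !trmx_mul trmxK invJ_sym J_sym -!scalemxAl -!scalemxAr !mulmxA -!scalemxAl scalerA.
by rewrite eta2 scale1r mulVmx// mul1mx -mulmxA mulVmx// mulmx1.
Qed.

Lemma trace_adjoint X : \tr (th X) = \tr X.
Proof. by rewrite /adjoint mxtrace_mulC mulmxA mulmxV// mul1mx mxtrace_tr. Qed.

Definition skew X := th X = - X.

Lemma skewE X : skew X <-> X^T *m J + J *m X = 0.
Proof.
rewrite /skew /adjoint -mulmxA; split => [H|/eqP].
  have -> : X^T *m J = - (J *m X) by rewrite -mulmxN -H mulKVmx.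
  by rewrite addNr.
by rewrite addr_eq0 => /eqP ->; rewrite mulmxN mulKmx.
Qed.

Lemma skew_lie X Y : skew X -> skew Y -> skew (lie X Y).
Proof.
move=> sX sY; rewrite /skew /lie adjointD adjointN !adjointM sX sY.
by rewrite !mulNmx !mulmxN !opprK opprB.
Qed.

Lemma skew_lin a X Y : skew X -> skew Y -> skew (a *: X + Y).
Proof. by move=> sX sY; rewrite /skew adjointD adjointZ sX sY scalerN opprD. Qed.

Definition skew_part X : 'M[k]_n := 2^-1 *: (X - th X).

Lemma skew_part_is_linear : linear skew_part.
Proof.
move=> a X Y; rewrite /skew_part adjointD adjointZ opprD addrACA -scalerBr scalerDr.
by rewrite !scalerA mulrC.
Qed.

Let two : (2 : k) != 0. Proof. exact: (char0 1). Qed.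

Lemma half2 : 2^-1 + 2^-1 = 1 :> k.
Proof. by rewrite -[LHS]mulr2n -[LHS]mulr_natl mulfV. Qed.

Lemma skew_part_skew X : skew (skew_part X).
Proof. by rewrite /skew /skew_part adjointZ adjointD adjointN adjointK -scalerN opprB. Qed.

Lemma skew_part_id X : skew X -> skew_part X = X.
Proof.
by move=> sX; rewrite /skew_part sX opprK -mulr2n -scaler_nat scalerA mulVf// scale1r.
Qed.

Lemma skew_sandwich X : \sum_a \sum_b skew_part (delta_mx a b) *m X *m skew_part (delta_mx b a) =
  2^-1 *: ((\tr X)%:M - eta *: th X).
Proof.
have E1 a b : skew_part (delta_mx a b) *m X *m skew_part (delta_mx b a) =
    4^-1 *: (delta_mx a b *m X *m delta_mx b a
      - delta_mx a b *m (X *m invmx J) *m delta_mx a b *m J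
      - invmx J *m (delta_mx b a *m (J *m X) *m delta_mx b a)
      + invmx J *m (delta_mx b a *m (J *m X *m invmx J) *m delta_mx a b) *m J).
  rewrite /skew_part /adjoint !trmx_delta -!scalemxAl -!scalemxAr scalerA.
  have -> : 2^-1 * 2^-1 = 4^-1 :> k by rewrite -invfM -natrM.
  by congr (_ *: _); rewrite !mulmxBl !mulmxBr !mulmxA opprB addrA addrAC; congr (_ + _); rewrite addrAC.
under eq_bigr => a _ do under eq_bigr => b _ do rewrite E1.
under eq_bigr => a _ do rewrite -scaler_sumr !big_split /= !sumrN.
rewrite -scaler_sumr !big_split /= !sumrN sum_delta_sandwich.
have -> : \sum_a \sum_b delta_mx a b *m (X *m invmx J) *m delta_mx a b *m J = eta *: th X.
  under eq_bigr => a _ do rewrite -mulmx_suml.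
  by rewrite -mulmx_suml sum_delta_transpose trmx_mul invJ_sym -!scalemxAl.
have -> : \sum_a \sum_b invmx J *m (delta_mx b a *m (J *m X) *m delta_mx b a) = eta *: th X.
  rewrite exchange_big /=; under eq_bigr => a _ do rewrite -mulmx_sumr.
  rewrite -mulmx_sumr sum_delta_transpose trmx_mul J_sym -scalemxAr -scalemxAr.
  by rewrite mulmxA.
have -> : \sum_a \sum_b invmx J *m (delta_mx b a *m (J *m X *m invmx J) *m delta_mx a b) *m J = (\tr X)%:M.
  rewrite double_sum_mul exchange_big sum_delta_sandwich mxtrace_mulC mulmxA mulVmx// mul1mx.
  by rewrite mul_mx_scalar -scalemxAl mulVmx// scalemx1.
rewrite two_differences scalerDr -scalerDl; congr (_ *: _).
have -> : 4^-1 = 2^-1 * 2^-1 :> k by rewrite -invfM -natrM.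
by rewrite -mulrDl half2 mul1r.
Qed.

Lemma casimir_form (pr : {linear 'M[k]_n -> 'M[k]_n}) X : (forall Y, pr Y = skew_part Y) ->
  casimir pr X = (n%:R - eta) *: X - ((\tr X)%:M - eta *: th X).
Proof.
move=> prE; rewrite /casimir (casimir_sum (fun a b => pr (delta_mx a b))).
have prS Z : \sum_a \sum_b pr (delta_mx a b) *m Z *m pr (delta_mx b a) =
    2^-1 *: ((\tr Z)%:M - eta *: th Z).
  by rewrite -skew_sandwich; apply: eq_bigr => a _; apply: eq_bigr => b _; rewrite !prE.
have pr1 : \sum_a \sum_b pr (delta_mx a b) *m pr (delta_mx b a) = (2^-1 * (n%:R - eta))%:M.
  rewrite -[RHS]scale_scalar_mx raddfB /= -[eta%:M]scalemx1 -{1}adjoint1 -{1}(mxtrace1 _ n) -prS.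
  by apply: eq_bigr => a _; apply: eq_bigr => b _; rewrite mulmx1.
rewrite prS pr1 mul_scalar_mx mul_mx_scalar two_differences addrACA -opprD.
by rewrite -!scalerDl -mulrDl half2 mul1r scale1r.
Qed.

Lemma skew_trace X : skew X -> \tr X = 0.
Proof.
move=> sX; have := trace_adjoint X; rewrite sX linearN /= => /eqP.
by rewrite eq_sym -subr_eq0 opprK -mulr2n -mulr_natl mulf_eq0 (negbTE two) => /eqP.
Qed.

(** The eigenvalue on the adjoint representation: n - 2 for a symmetric form and n + 2 for an
    alternating one. *)
Lemma casimir_skew (pr : {linear 'M[k]_n -> 'M[k]_n}) X : (forall Y, pr Y = skew_part Y) ->
  skew X -> casimir pr X = (n%:R - 2 * eta) *: X.
Proof.
move=> prE sX; rewrite casimir_form// sX.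
rewrite (skew_trace sX).
rewrite raddf0 sub0r opprK scalerN -scaleNr -scalerDl; congr (_ *: _); ring.
Qed.

Lemma contract_delta P Q b c : \sum_i (P *m delta_mx i b *m Q) i c = (\tr P) * Q b c.
Proof.
rewrite mulr_suml; apply: eq_bigr => i _.
rewrite mxE (bigD1 b)//= big1 ?addr0 => [|d db]; last first.
  by rewrite mxE big1 ?mul0r// => e _; rewrite mxE (negbTE db) andbF mulr0.
rewrite mxE (bigD1 i)//= big1 ?addr0 => [|d db]; last by rewrite mxE (negbTE db) mulr0.
by rewrite mxE !eqxx mulr1.
Qed.

Lemma contract_adjoint P Q b c : eta = 1 -> \sum_i (P *m th (delta_mx i b) *m Q) i c = (th P *m Q) b c.
Proof.
move=> eta1; have Js : J^T = J by rewrite J_sym eta1 scale1r.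
have Ji : (invmx J)^T = invmx J by rewrite invJ_sym eta1 scale1r.
have -> : (th P *m Q) b c = \sum_i (P *m invmx J) i b * (J *m Q) i c.
  rewrite /adjoint -!mulmxA [invmx J *m _]mulmxA -{1}Ji -trmx_mul mxE.
  by apply: eq_bigr => i _; rewrite mxE.
apply: eq_bigr => i _; rewrite /adjoint trmx_delta !mulmxA -mulmxA -mulmxA.
rewrite mxE (bigD1 b)//= big1 ?addr0 => [|d db]; last first.
  rewrite [X in _ * X]mxE big1 ?mulr0// => e _.
  by rewrite mxE (negbTE db) mul0r.
congr (_ * _); rewrite mxE (bigD1 i)//= big1 ?addr0 => [|d db]; last by rewrite mxE (negbTE db) andbF mul0r.
by rewrite mxE !eqxx mul1r.
Qed.

(** Testing on the skew part of E_ib J gives P_ri (J Y)_bc = P_rb (J Y)_ic. Since J Y is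
    alternating, a nonzero entry of P forces J Y = 0. *)
Lemma skew_proportional P Y : eta = 1 -> skew Y ->
  (forall X, skew X -> P *m X *m Y = 0) -> P = 0 \/ Y = 0.
Proof.
move=> eta1 sY PXY.
have JY : (J *m Y)^T = - (J *m Y).
  move/skewE: sY => /eqP; rewrite addr_eq0 => /eqP H.
  by rewrite trmx_mul J_sym eta1 scale1r H.
have E1 i b r c : P r i * (J *m Y) b c = P r b * (J *m Y) i c.
  have := PXY _ (skew_part_skew (delta_mx i b *m J)).
  rewrite /skew_part -scalemxAr -scalemxAl => /(congr1 (fun M => 2 *: M)).
  rewrite scalerA mulfV// scale1r scaler0 mulmxBr mulmxBl => /eqP; rewrite subr_eq0 => /eqP.
  have -> : th (delta_mx i b *m J) = delta_mx b i *m J.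
    by rewrite /adjoint trmx_mul trmx_delta J_sym eta1 scale1r !mulmxA mulVmx// mul1mx.
  move=> /matrixP/(_ r c); rewrite !mulmxA -!mulmxA.
  have aux a d : (P *m (delta_mx a d *m (J *m Y))) r c = P r a * (J *m Y) d c.
    rewrite mxE (bigD1 a)//= big1 ?addr0 => [|e ea].
      congr (_ * _); rewrite mxE (bigD1 d)//= big1 ?addr0 => [|e ed]; first by rewrite mxE !eqxx mul1r.
      by rewrite mxE (negbTE ed) andbF mul0r.
    by rewrite mxE big1 ?mulr0// => f _; rewrite mxE (negbTE ea) mul0r.
  by rewrite !aux.
have [->|/matrix0Pn[r [w Pw]]] := eqVneq P 0; [by left|right].
suff JY0 : J *m Y = 0 by rewrite -[Y](mulKmx J_unit) JY0 mulmx0.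
have skewJY a b : (J *m Y) a b = - (J *m Y) b a.
  by have /matrixP/(_ b a) := JY; rewrite !mxE.
have diag0 a : (J *m Y) a a = 0.
  have /eqP := skewJY a a; rewrite -subr_eq0 opprK -mulr2n -mulr_natl mulf_eq0 (negbTE two) /=.
  by move/eqP.
have row0 c : (J *m Y) w c = 0.
  have := E1 w c r c; rewrite diag0 mulr0 => H.
  have [c0|c0] := eqVneq (P r c) 0.
    have := E1 w c r w; rewrite c0 mul0r => /eqP; rewrite mulf_eq0 (negbTE Pw) /= => /eqP cw.
    by rewrite skewJY cw oppr0.
  by move/eqP: H; rewrite eq_sym mulf_eq0 (negbTE c0) => /eqP.
apply/matrixP => b c; rewrite [RHS]mxE; have /eqP := E1 w b r c; rewrite row0 mulr0.
by rewrite mulf_eq0 (negbTE Pw) => /eqP.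
Qed.

(** No nonzero Y satisfies ad(Y)^2 = 0 on so_n, which excludes nilpotent ideals. Expanding gives Y^2
    X - 2 Y X Y + X Y^2 = 0 for skew X; contractions of this identity yield Y^3 = 0, then Y^2 X Y =
    0, and [skew_proportional] applies twice. *)
Lemma skew_abelian0 Y : eta = 1 -> (2 < n)%N -> skew Y ->
  (forall X, skew X -> lie Y (lie Y X) = 0) -> Y = 0.
Proof.
move=> eta1 n3 sY YX.
have E0 X : skew X -> Y *m Y *m X - (Y *m X *m Y + Y *m X *m Y) + X *m (Y *m Y) = 0.
  move=> sX; rewrite -[RHS](YX X sX) /lie mulmxBr mulmxBl !mulmxA opprB opprD !addrA.
  by rewrite [in RHS]addrAC.
pose G (Z M : 'M[k]_n) := Z *m (Y *m Y) *m M *m 1%:M - (Z *m Y *m M *m Y + Z *m Y *m M *m Y) + Z *m M *m (Y *m Y).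
have F Z M : G Z M = G Z (th M).
  have sM : skew (M - th M) by rewrite /skew adjointD adjointN adjointK opprB.
  apply/eqP; rewrite -subr_eq0 /G -split_differences -!mulmxBl -!mulmxBr; apply/eqP.
  move: (M - th M) sM => M' sM; have := congr1 (mulmx Z) (E0 _ sM).
  by rewrite mulmx0 mulmxDr mulmxBr mulmxDr mulmx1 !mulmxA.
pose t := \tr (Y *m Y).
have trY : \tr Y = 0 by exact: skew_trace.
have thYY : th (Y *m Y) = Y *m Y by rewrite adjointM sY mulmxN mulNmx opprK.
(* F contracted over the elementary matrices M = E_ib *)
have C Z b c : \tr (Z *m (Y *m Y)) * (1%:M : 'M[k]_n) b c - (\tr (Z *m Y) * Y b c + \tr (Z *m Y) * Y b c)
    + \tr Z * (Y *m Y) b c = (th (Z *m (Y *m Y)) *m 1%:M) b c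
    - ((th (Z *m Y) *m Y) b c + (th (Z *m Y) *m Y) b c) + (th Z *m (Y *m Y)) b c.
  rewrite -!contract_delta -!contract_adjoint// -!big_split -!sumrB -!big_split.
  by apply: eq_bigr => i _; have /matrixP/(_ i c) := F Z (delta_mx i b); rewrite !mxE.
have t0 : t = 0.
  (* The contraction at Z = 1. Its trace reads (2n - 4) tr(Y^2) = 0, and n > 2. *)
  have C1 : t%:M + n%:R *: (Y *m Y) = 4 *: (Y *m Y).
    apply/matrixP => b c; have := C 1%:M b c.
    rewrite !mul1mx trY !mul0r addr0 subr0 adjoint1 mul1mx thYY mulmx1 sY mulNmx mxtrace1 => H.
    have -> : (t%:M + n%:R *: (Y *m Y)) b c = t * (1%:M : 'M[k]_n) b c + n%:R * (Y *m Y) b c.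
      by move: (Y *m Y) => W; rewrite !mxE mulr_natr.
    rewrite -/t in H; rewrite H; move: (Y *m Y) => W; rewrite !mxE; ring.
  have H2 : n%:R * t + n%:R * t = 4 * t.
    have := congr1 mxtrace C1; rewrite linearD /= mxtrace_scalar !mxtraceZ => <-.
    by rewrite mulr_natl.
  have /eqP : (n%:R + n%:R - 4) * t = 0 by rewrite mulrBl mulrDl H2 subrr.
  rewrite mulf_eq0 => /orP[|/eqP//].
  have -> : (n%:R + n%:R - 4 : k) = (n + n - 4).-1.+1%:R.
    by rewrite prednK; [rewrite natrB ?natrD//; lia|lia].
  by rewrite (negbTE (char0 _)).
have Y3 : Y *m Y *m Y = 0.
  have thY3 : th (Y *m (Y *m Y)) = - (Y *m (Y *m Y)) by rewrite adjointM thYY sY mulmxN -mulmxA.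
  have C2 : 0 = - (4 *: (Y *m (Y *m Y))).
    apply/matrixP => b c; have := C Y b c.
    rewrite -/t t0 (skew_trace thY3) trY !mul0r !addr0 subrr thYY thY3 sY mulmx1 mulNmx.
    move=> H; transitivity (0 : k); first by rewrite mxE.
    rewrite H -(mulmxA Y Y Y); move: (Y *m (Y *m Y)) => W.
    by rewrite !mxE; ring.
  move/eqP: C2; rewrite eq_sym oppr_eq0 scaler_eq0 (negbTE (char0 3)) /= => /eqP.
  by rewrite mulmxA.
have YXY X : skew X -> Y *m Y *m X *m Y = 0.
  move=> sX; have e := E0 X sX.
  have e1 : Y *m X *m (Y *m Y) = Y *m Y *m X *m Y + Y *m Y *m X *m Y.
    have := congr1 (mulmx Y) e; rewrite mulmx0 mulmxDr mulmxBr mulmxDr !mulmxA Y3 !mul0mx sub0r => /eqP.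
    by rewrite addrC subr_eq0 => /eqP.
  have := congr1 (mulmx^~ Y) e; rewrite mul0mx !mulmxDl mulNmx mulmxDl -!mulmxA [Y *m (Y *m Y)]mulmxA Y3 !mulmx0 addr0 !mulmxA.
  rewrite -[Y *m X *m Y *m Y]mulmxA e1 => /eqP; rewrite -[X in X - _]scale1r -!mulr2n -scaler_nat.
  rewrite -[(Y *m Y *m X *m Y) *+ 2]scaler_nat scalerA -scalerBl scaler_eq0 => /orP[|/eqP//].
  have -> : (1 - 2 * 2 : k) = - 3%:R by ring.
  by rewrite oppr_eq0 (negbTE (char0 2)).
have [YY0|//] := skew_proportional eta1 sY YXY.
have YXY2 X : skew X -> Y *m X *m Y = 0.
  move=> sX; have := E0 X sX; rewrite YY0 mul0mx mulmx0 addr0 sub0r => /eqP.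
  by rewrite oppr_eq0 -mulr2n -scaler_nat scaler_eq0 (negbTE two) => /eqP.
by case: (skew_proportional eta1 sY YXY2).
Qed.

End BilinearForm.

(** * Separating linear forms and orthogonality *)

Section Functional.
Variables (K : fieldType) (R : comNzRingType) (inc : {rmorphism K -> R}) (x0 : R).

Definition linear_form (l : {additive R -> K}) : Prop := forall c x, l (inc c * x) = c * l x.

Let subsp (M : set R) : Prop :=
  (forall c x y, M x -> M y -> M (inc c * x + y)) /\ ~ M x0.

(** By Zorn's lemma, a K-subspace maximal among those avoiding x0 is a complement of the line K x0;
    l is the coordinate along that line. *)
Lemma linear_form_separates : x0 != 0 -> exists2 l : {additive R -> K}, linear_form l & l x0 = 1.
Proof.
move=> x00; have [|M [[ML M1] maxM]] := @Zorn_bigcup R subsp.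
  move=> C CP Ctot; split=> [c x y [A CA Ax] [B CB By]|[A CA]]; last exact: (CP _ CA).2.
  have [AB|BA] := Ctot A B CA CB.
    by exists B => //; apply: (CP _ CB).1 => //; exact: AB.
  by exists A => //; apply: (CP _ CA).1 => //; exact: BA.
have M0 : M 0.
  apply: contrapT => nM0; apply: (maxM (fun x => x = 0)).
    split=> [x Mx|E]; last exact/nM0/E.
    exfalso; apply: nM0; have := ML (-1) x x Mx Mx.
    by rewrite rmorphN1 mulN1r addNr.
  split=> [c x y -> ->|/eqP]; first by rewrite mulr0 addr0.
  by rewrite (negbTE x00).
have dec x : exists c, M (x - inc c * x0).
  have [Mx|nMx] := pselect (M x); first by exists 0; rewrite rmorph0 mul0r subr0.
  have [[d [m [Mm dE]]]|nM1] := pselect (exists d m, M m /\ x0 = m + inc d * x).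
    have d0 : d != 0.
      by apply: contra_notN M1 => /eqP d0; rewrite dE d0 rmorph0 mul0r addr0.
    exists d^-1; have -> : x - inc d^-1 * x0 = inc (- d^-1) * m + 0.
      have -> : m = x0 - inc d * x by rewrite {1}dE addrK.
      rewrite addr0 mulrBr mulrA -rmorphM mulNr mulVf// !rmorphN rmorph1 mulN1r opprK mulNr.
      by rewrite addrC.
    exact: ML.
  exfalso; have pU : subsp (fun y => exists d m, M m /\ y = m + inc d * x).
    split; last by move=> [d [m [Mm E]]]; apply: nM1; exists d, m.
    move=> c _ _ [d [m [Mm ->]]] [e [m' [Mm' ->]]]; exists (c * d + e), (inc c * m + m').
    by split; [exact: ML|rewrite rmorphD rmorphM; ring].
  apply: (maxM _ _ pU); split=> [y My|E]; first by exists 0, y; rewrite rmorph0 mul0r addr0.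
  by apply: nMx; apply: E; exists 1, 0; rewrite rmorph1 mul1r add0r.
have uniq_c c c' x : M (x - inc c * x0) -> M (x - inc c' * x0) -> c = c'.
  move=> Mc Mc'; apply: contrapT => /eqP; rewrite -subr_eq0 => cc'; apply: M1.
  have -> : x0 = inc (c - c')^-1 * (inc (-1) * (x - inc c * x0) + (x - inc c' * x0)) + 0.
    rewrite addr0 rmorphN1 mulN1r opprB addrA subrK -mulrBl -rmorphB mulrA -rmorphM mulVf//.
    by rewrite rmorph1 mul1r.
  by apply: (ML) => //; apply: ML.
pose l x := projT1 (cid (dec x)).
have lP x : M (x - inc (l x) * x0) by rewrite /l; case: cid.
have lL c x y : l (inc c * x + y) = c * l x + l y.
  apply: (@uniq_c _ _ (inc c * x + y)) => //.
  have -> : inc c * x + y - inc (c * l x + l y) * x0 =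
      inc c * (x - inc (l x) * x0) + (y - inc (l y) * x0) by rewrite rmorphD rmorphM; ring.
  exact: ML.
have l0 : l 0 = 0 by have := lL 1 0 0; rewrite mulr0 addr0 mul1r -{1}[l 0]addr0 => /addrI.
have lB : zmod_morphism l by move=> x y; rewrite addrC -mulN1r -(rmorphN1 inc) lL mulN1r addrC.
pose l' : {additive R -> K} := HB.pack l (GRing.isZmodMorphism.Build _ _ l lB).
exists l' => [c x|]; first by have := lL c x 0; rewrite l0 !addr0.
by apply: (@uniq_c _ _ x0) => //; rewrite rmorph1 mul1r subrr.
Qed.

End Functional.

Lemma tr_mxvec (F : fieldType) n (M Y : 'M[F]_n) : \tr (M *m Y) = (mxvec Y *m (mxvec M^T)^T) 0 0.
Proof.
transitivity (\sum_(i < n) \sum_(j < n) Y i j * M j i).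
  by rewrite mxtrace_mulC; apply: eq_bigr => i _; rewrite mxE.
rewrite pair_bigA mxE (reindex _ (curry_mxvec_bij n n)) /=.
by apply: eq_bigr => -[i j] _ /=; rewrite mxE !mxvecE mxE.
Qed.

(** Double orthogonality for the trace form. The span of the possibly infinite G is realized as a
    row space of maximal rank, whose cokernel supplies the matrices M. *)
Lemma span_orthogonal (F : fieldType) n (G : 'M[F]_n -> Prop) Y :
  (forall M, (forall g, G g -> \tr (M *m g) = 0) -> \tr (M *m Y) = 0) -> span G Y.
Proof.
move=> H; pose ok (S : 'M[F]_(n * n)) := forall u : 'rV_(n * n), (u <= S)%MS -> span G (vec_mx u).
have [S okS maxS] : exists2 S, ok S & forall S', ok S' -> (\rank S' <= \rank S)%N.
  pose P k := `[< exists2 S, ok S & \rank S = k >].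
  have exP : exists k, P k.
    exists 0%N; apply/asboolP; exists 0; rewrite ?mxrank0// => u; rewrite submx0 => /eqP->.
    by rewrite linear0; exact: span_zero.
  have bP k : P k -> (k <= n * n)%N by move=> /asboolP[S _ <-]; exact: rank_leq_row.
  case: (ex_maxnP exP bP) => k /asboolP[S okS Sk] kmax; exists S => // S' okS'.
  by rewrite Sk; apply: kmax; apply/asboolP; exists S'.
have GS g : G g -> (mxvec g <= S)%MS.
  move=> Gg; have okS' : ok (S + mxvec g)%MS.
    move=> u /sub_addsmxP[[u1 u2] /= ->]; rewrite linearD /=; apply: spanD.
      by apply: okS; exact: submxMl.
    by rewrite [u2]mx11_scalar mul_scalar_mx linearZ /= mxvecK; apply: spanZ; exact: span_gen.
  have := maxS _ okS' => le; have := mxrank_leqif_sup (addsmxSl S (mxvec g)) => -[le2 eq2].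
  have : \rank S == \rank (S + mxvec g)%MS by rewrite eqn_leq le2 le.
  by rewrite eq2 => /(submx_trans (addsmxSr _ _)).
rewrite -[Y]mxvecK; apply: okS; rewrite submxE; apply/eqP/rowP => j.
pose M := (vec_mx (col j (cokermx S))^T)^T.
have MP g : \tr (M *m g) = (mxvec g *m cokermx S) 0 j.
  rewrite tr_mxvec /M trmxK vec_mxK trmxK !mxE; apply: eq_bigr => k _; by rewrite !mxE.
have := H M; rewrite MP => ->; first by rewrite mxE.
by move=> g /GS; rewrite submxE MP => /eqP->; rewrite mxE.
Qed.

(** * The tangent algebra *)

Section TangentAlgebra.
Variables (n : nat) (K : fieldType) (R : comUnitRingType).
Variables (sK sKi : {rmorphism K -> K}) (sR sRi : {rmorphism R -> R}) (inc : {rmorphism K -> R}).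
Hypothesis sRiK : forall x, sRi (sR x) = x.
Hypothesis simp : sigma_simple sR.
Hypothesis sR_inc : forall c, sR (inc c) = inc (sK c).
Variables (A Ai : 'M[K]_n) (U Ui : 'M[R]_n).
Hypothesis AAi : A *m Ai = 1%:M.
Hypothesis AiA : Ai *m A = 1%:M.
Hypothesis UUi : U *m Ui = 1%:M.
Hypothesis UiU : Ui *m U = 1%:M.
Hypothesis sU : map_mx sR U = map_mx inc A *m U.
Variable EE : 'M[R]_n -> Prop.
Hypothesis EE_fixed : forall E, EE E -> map_mx sR E = E.
Hypothesis EE_der : forall E, EE E -> exists D : {additive R -> R},
  [/\ forall x y, D (x * y) = D x * y + x * D y, forall c, D (inc c) = 0,
      forall x, sR x = x -> D x = 0 & map_mx D U = U *m E].
Local Notation mtau := (@mtau n K sK A Ai).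

(** Linear forms stand in for coordinates of R over K: T is the K-space of matrices generated by all
    coordinates of the conjugates U E U^-1. *)
Definition tangent : 'M[K]_n -> Prop := span (fun Y => exists E (l : {additive R -> K}),
  [/\ EE E, linear_form inc l & Y = map_mx l (U *m E *m Ui)]).
Local Notation T := tangent.

Lemma sR_Ui : map_mx sR Ui = Ui *m map_mx inc Ai.
Proof.
have incAi : map_mx inc A *m map_mx inc Ai = 1%:M by rewrite -map_mxM AAi map_mx1.
have H : map_mx sR Ui *m (map_mx inc A *m U) = 1%:M.
  by rewrite -sU -map_mxM UiU map_mx1.
rewrite -[LHS]mulmx1 -incAi -[map_mx inc A]mulmx1 -UUi !mulmxA -[_ *m _ *m U]mulmxA H.
by rewrite mul1mx.
Qed.

Lemma linear_form_mx (l : {additive R -> K}) (B C : 'M[K]_n) (X : 'M[R]_n) : linear_form inc l ->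
  map_mx l (map_mx inc B *m X *m map_mx inc C) = B *m map_mx l X *m C.
Proof.
move=> lL; apply/matrixP => i j; rewrite !mxE raddf_sum; apply: eq_bigr => k _.
rewrite !mxE mulrC lL mulrC raddf_sum !mulr_suml; apply: eq_bigr => k' _.
by rewrite !mxE lL.
Qed.

Lemma tangent_lift N (c : 'M[K]_n) : connection_lifting N sK A c T.
Proof.
move=> PP PP0 PPL PPtau PPfin Y; apply: (@span_ind_sub _ _ _ (fun Y => exists B, forall p p',
  PP p p' -> PP (jder 0 Y p) (jder 0 Y p' - jder 1 B p))).
- by exists 0 => p p' _; rewrite !jder0 subrr.
- move=> a y z [B HB] [B' HB']; exists (a *: B + B') => p p' Pp.
  rewrite !jderD !jderZ.
  have -> : a *: jder 0 y p' + jder 0 z p' - (a *: jder 1 B p + jder 1 B' p) =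
      a *: (jder 0 y p' - jder 1 B p) + (jder 0 z p' - jder 1 B' p).
    by rewrite scalerBr opprD addrACA.
  by apply: PPL; [exact: HB|exact: HB'].
move=> _ [E [l [EEE lL ->]]]; have [D [DM D_inc D_fixed DU]] := EE_der EEE.
exact: (connection_lift simp sR_inc AAi UUi UiU sU PP0 PPL PPtau PPfin DM D_inc D_fixed DU lL).
Qed.

Definition annihilates (M : 'M[K]_n) : Prop :=
  forall E, EE E -> \tr (Ui *m map_mx inc M *m U *m E) = 0.

Lemma form_trace (l : {additive R -> K}) M (Z : 'M[R]_n) : linear_form inc l ->
  l (\tr (map_mx inc M *m Z)) = \tr (M *m map_mx l Z).
Proof.
move=> lL; rewrite /mxtrace raddf_sum; apply: eq_bigr => i _; rewrite !mxE raddf_sum.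
by apply: eq_bigr => j _; rewrite !mxE lL.
Qed.

Lemma annihilates_trace M E :
  \tr (Ui *m map_mx inc M *m U *m E) = \tr (map_mx inc M *m (U *m E *m Ui)).
Proof. by rewrite -!mulmxA mxtrace_mulC !mulmxA. Qed.

Lemma tangentP Y : T Y <-> forall M, annihilates M -> \tr (M *m Y) = 0.
Proof.
split=> [TY M MP|H].
  move: TY; apply: (@span_ind_sub _ _ _ (fun Y => \tr (M *m Y) = 0)).
  - by rewrite mulmx0 mxtrace0.
  - by move=> c y z y0 z0; rewrite mulmxDr -scalemxAr mxtraceD mxtraceZ y0 z0 mulr0 addr0.
  by move=> _ [E [l [EEE lL ->]]]; rewrite -form_trace// -annihilates_trace MP// raddf0.
apply: span_orthogonal => M MP; apply: H => E EEE; apply: contrapT => /eqP x0.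
have [l lL] := linear_form_separates inc x0.
rewrite annihilates_trace form_trace// MP; first by move=> /esym/eqP; rewrite oner_eq0.
by exists E, l.
Qed.

(** The annihilator of T, conjugated back by U: there sigma acts entrywise and the constant matrices
    E act by brackets. *)
Definition annihilator_span : 'M[R]_n -> Prop :=
  span (fun Z => exists2 M, annihilates M & Z = Ui *m map_mx inc M *m U).
Local Notation W := annihilator_span.

Lemma sR_conj_inv M :
  map_mx sR (Ui *m map_mx inc M *m U) = Ui *m map_mx inc (mtau M) *m U.
Proof.
rewrite !(map_mxM sR) sR_Ui sU /mtau !(map_mxM inc) !mulmxA; congr (_ *m _ *m _ *m _ *m _).
by apply/matrixP => i j; rewrite !mxE sR_inc.
Qed.

Lemma annihilator_span_sigma Z : W Z -> W (map_mx sR Z).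
Proof.
apply: (@span_ind_sub _ _ _ (fun Z => W (map_mx sR Z))).
- by rewrite map_mx0; exact: span_zero.
- by move=> c y z Wy Wz; rewrite map_mxD map_mxZ; apply: spanD => //; exact: spanZ.
move=> _ [M MP ->]; apply: span_gen; rewrite sR_conj_inv; exists (mtau M) => // E EEE.
rewrite -sR_conj_inv -{1}(EE_fixed EEE) -(map_mxM sR).
have -> (X : 'M[R]_n) : \tr (map_mx sR X) = sR (\tr X).
  by rewrite /mxtrace raddf_sum; apply: eq_bigr => i _; rewrite mxE.
by rewrite MP// rmorph0.
Qed.

Lemma fixed_span_mx (V : 'M[R]_n -> Prop) Z : V 0 ->
  (forall c x y, V x -> V y -> V (c *: x + y)) -> (forall x, V x -> V (map_mx sR x)) ->
  V Z -> span (fun X => V X /\ map_mx sR X = X) Z.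
Proof.
move=> V0 VL Vs; apply: (@fixed_span R sR 'M[R]_n ('I_n * 'I_n)%type (fun i X => X i.1 i.2)
  (fun=> enum {: 'I_n * 'I_n}) (fun X => map_mx sR X)) => //.
- by move=> i c x y; rewrite !mxE.
- by move=> i x; rewrite !mxE.
- by move=> i x _; rewrite mem_enum.
- by move=> x H; apply/matrixP => i j; rewrite (H (i, j)) mxE.
Qed.

Lemma annihilator_span_lin c X Y : W X -> W Y -> W (c *: X + Y).
Proof. by move=> WX WY; apply: spanD => //; exact: spanZ. Qed.

Lemma annihilator_span_fixed Z : W Z -> span (fun X => W X /\ map_mx sR X = X) Z.
Proof.
apply: fixed_span_mx; [exact: span_zero|exact: annihilator_span_lin|].
exact: annihilator_span_sigma.
Qed.

(* For a fixed combination w of conjugates m of rational matrices, D w = 0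
   while D m = [m, E]. *)
Lemma annihilator_span_lie Z E : W Z -> EE E -> W (lie Z E).
Proof.
move=> WZ EEE; have [D [DM D_inc D_fixed DU]] := EE_der EEE.
have DmxM (X Y : 'M[R]_n) : map_mx D (X *m Y) = map_mx D X *m Y + X *m map_mx D Y.
  apply/matrixP => i j; rewrite !mxE raddf_sum -big_split; apply: eq_bigr => k _.
  by rewrite !mxE DM.
have D1 : D 1 = 0 by apply: D_fixed; rewrite rmorph1.
have DUi : map_mx D Ui = - (E *m Ui).
  have := DmxM Ui U; rewrite UiU DU mulmxA UiU mul1mx.
  have -> : map_mx D (1%:M : 'M[R]_n) = 0.
    by apply/matrixP => i j; rewrite !mxE; case: (_ == _); rewrite ?D1 ?raddf0.
  move=> /esym/eqP; rewrite addr_eq0 => /eqP H.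
  by rewrite -[LHS]mulmx1 -UUi mulmxA H mulNmx.
have WD X : W X -> W (map_mx D X - lie X E).
  suff: W X -> W X /\ W (map_mx D X - lie X E) by move=> H /H[].
  apply: (@span_ind_sub _ _ _ (fun X => W X /\ W (map_mx D X - lie X E))).
  - split; first exact: span_zero.
    rewrite /lie mul0mx mulmx0 subrr subr0 (_ : map_mx D 0 = 0); first exact: span_zero.
    by apply/matrixP => i j; rewrite !mxE raddf0.
  - move=> c y z [Wy Wy'] [Wz Wz']; split; first exact: annihilator_span_lin.
    have -> : map_mx D (c *: y + z) - lie (c *: y + z) E =
        D c *: y + (c *: (map_mx D y - lie y E) + (map_mx D z - lie z E)).
      rewrite lieDl lieZl; apply/matrixP => i j; rewrite !mxE raddfD /= DM; ring.
    by apply: annihilator_span_lin => //; exact: annihilator_span_lin.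
  move=> _ [M MP ->]; split; first by apply: span_gen; exists M.
  rewrite !DmxM DUi DU.
  have -> : map_mx D (map_mx inc M) = 0 by apply/matrixP => i j; rewrite !mxE D_inc.
  rewrite mulmx0 addr0 /lie !mulNmx !mulmxA [- _ + _]addrC subrr.
  exact: span_zero.
move: Z WZ; have fixed Z : W Z /\ map_mx sR Z = Z -> W (lie Z E).
  move=> [/WD + sZ]; rewrite (_ : map_mx D Z = 0); first by rewrite sub0r => /spanN; rewrite opprK.
  by apply/matrixP => i j; rewrite !mxE D_fixed// -{2}sZ mxE.
move=> Z /annihilator_span_fixed; apply: (@span_ind_sub _ _ _ (fun X => W (lie X E))) => //.
- by rewrite /lie mul0mx mulmx0 subrr; exact: span_zero.
by move=> c y z Wy Wz; rewrite lieDl lieZl; exact: annihilator_span_lin.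
Qed.

Lemma inc_inj : injective inc. Proof. exact: fmorph_inj. Qed.

Lemma inc_mx_inj (X Y : 'M[K]_n) : map_mx inc X = map_mx inc Y -> X = Y.
Proof. by move=> /matrixP H; apply/matrixP => i j; apply: inc_inj; have := H i j; rewrite !mxE. Qed.

Lemma unconj_scalar (X : 'M[R]_n) r : Ui *m X *m U = r%:M -> X = r%:M.
Proof.
move=> /(congr1 (fun X => U *m X *m Ui)).
rewrite !mulmxA UUi mul1mx -mulmxA UUi mulmx1 => ->.
by rewrite scalar_mxC -mulmxA UUi mulmx1.
Qed.

(** By descent the annihilator of T then consists of scalar matrices, and these are orthogonal to
    trace-zero matrices. *)
Lemma tangent_full : (forall y, W y -> map_mx sR y = y -> exists a, y = a%:M) ->
  forall Y, \tr Y = 0 -> T Y.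
Proof.
move=> H Y Y0; apply/tangentP => M MP.
have [a aE] : exists a, Ui *m map_mx inc M *m U = a%:M.
  have /annihilator_span_fixed : W (Ui *m map_mx inc M *m U) by apply: span_gen; exists M.
  apply: (@span_ind_sub _ _ _ (fun X => exists a, X = a%:M)).
  - by exists 0; rewrite raddf0.
  - move=> c _ _ [x ->] [y ->]; exists (c * x + y).
    by apply/matrixP => i j; rewrite !mxE; case: (_ == _); rewrite ?mulr1n// !mulr0n mulr0 addr0.
  by move=> X [WX sX]; exact: H.
have aM : map_mx inc M = a%:M by exact: unconj_scalar.
apply: inc_inj; rewrite rmorph0.
have -> : inc (\tr (M *m Y)) = \tr (map_mx inc M *m map_mx inc Y).
  rewrite -map_mxM /mxtrace raddf_sum; apply: eq_bigr => i _; by rewrite [in RHS]mxE.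
have trY : \tr (map_mx inc Y) = inc (\tr Y).
  by rewrite /mxtrace raddf_sum; apply: eq_bigr => i _; rewrite mxE.
by rewrite aM mul_scalar_mx mxtraceZ trY Y0 rmorph0 mulr0.
Qed.

Lemma intertwine_inv (S Si X X' : 'M[R]_n) : S *m Si = 1%:M -> Si *m S = 1%:M ->
  X' *m S = S *m X -> Si *m X' = X *m Si.
Proof.
move=> SK KS XS; rewrite -[LHS]mulmx1 -SK -!mulmxA (mulmxA X') XS.
by rewrite -!mulmxA (mulmxA Si) KS mul1mx.
Qed.

Lemma conj_commute (P M : 'M[R]_n) : P *m M = M *m P ->
  (Ui *m P *m U) *m (Ui *m M *m U) = (Ui *m M *m U) *m (Ui *m P *m U).
Proof.
move=> PM; rewrite !mulmxA -[_ *m U *m Ui]mulmxA UUi mulmx1.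
by rewrite -[Ui *m M *m U *m Ui]mulmxA UUi mulmx1 -!mulmxA [P *m _]mulmxA PM !mulmxA.
Qed.

Variables (eta : K) (J0 J0i : 'M[R]_n).
Hypothesis two_neq0 : (2 : K) != 0.
Hypothesis n_gt0 : (0 < n)%N.
Hypothesis J0J0i : J0 *m J0i = 1%:M.
Hypothesis J0iJ0 : J0i *m J0 = 1%:M.
Hypothesis J0_fixed : map_mx sR J0 = J0.
Hypothesis J0_tr : J0^T = inc eta *: J0.
Hypothesis EE_skew : forall E, EE E -> E^T *m J0 + J0 *m E = 0.
Hypothesis EE_sym : forall X, (forall E, EE E -> \tr (X *m E) = 0) -> X^T *m J0 = J0 *m X.
Hypothesis EE_generates : forall V : 'M[R]_n -> Prop,
  (forall c x y, V x -> V y -> V (c *: x + y)) ->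
  (forall x E, V x -> EE E -> V (lie x E)) ->
  forall y, V y -> map_mx sR y = y -> y^T *m J0 = J0 *m y -> ~ (exists a, y = a%:M) ->
  forall p, (forall w, V w -> p *m w = w *m p) -> exists a, p = a%:M.

Lemma tangent_dichotomy : (forall Y, \tr Y = 0 -> T Y) \/
  exists (J : 'M[K]_n) (kappa : K), [/\ J \in unitmx, J^T = eta *: J, kappa != 0,
    A^T *m map_mx sK J *m A = kappa *: J &
    forall Y, T Y <-> Y^T *m J + J *m Y = 0].
Proof.
have [H|/existsNP[y /not_implyP[Wy /not_implyP[sy ny]]]] :=
  pselect (forall y, W y -> map_mx sR y = y -> exists a, y = a%:M).
  by left; exact: tangent_full.
right; have symM M : annihilates M ->
    (Ui *m map_mx inc M *m U)^T *m J0 = J0 *m (Ui *m map_mx inc M *m U).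
  by move=> MP; exact: EE_sym.
have symW w : W w ->
    w^T *m J0 = J0 *m w.
  apply: (@span_ind_sub _ _ _ (fun w => w^T *m J0 = J0 *m w)).
  - by rewrite trmx0 mul0mx mulmx0.
  - by move=> c x z Hx Hz; rewrite linearP /= mulmxDl mulmxDr -scalemxAl -scalemxAr Hx Hz.
  by move=> _ [M MP ->]; exact: symM.
(* The form J0 in the moving frame U; the annihilators of T are self-adjoint for it. *)
pose S0 := Ui^T *m J0 *m Ui; pose S0i := U *m J0i *m U^T.
have UiT : Ui^T *m U^T = 1%:M by rewrite -trmx_mul UUi trmx1.
have UT : U^T *m Ui^T = 1%:M by rewrite -trmx_mul UiU trmx1.
have S0K : S0 *m S0i = 1%:M.
  by rewrite /S0 /S0i !mulmxA -[_ *m Ui *m U]mulmxA UiU mulmx1 -[_ *m J0 *m J0i]mulmxA J0J0i mulmx1.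
have S0iK : S0i *m S0 = 1%:M.
  by rewrite /S0 /S0i !mulmxA -[_ *m U^T *m _]mulmxA UT mulmx1 -[_ *m J0i *m J0]mulmxA J0iJ0 mulmx1.
have MS M : annihilates M -> (map_mx inc M)^T *m S0 = S0 *m map_mx inc M.
  move=> /symM/(congr1 (fun X => Ui^T *m X *m Ui)).
  rewrite !trmx_mul !mulmxA UiT mul1mx => ->.
  by rewrite -[_ *m U *m Ui]mulmxA UUi mulmx1.
have [i [j S0ij]] : exists i j, S0 i j != 0.
  apply: contrapT => /forallNP H; have S00 : S0 = 0.
    apply/matrixP => i j; rewrite [RHS]mxE; apply/eqP; apply: contrapT => /negP h.
    by apply: (H i); exists j.
  move/matrixP: S0K; rewrite S00 mul0mx => /(_ (Ordinal n_gt0) (Ordinal n_gt0))/eqP.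
  by rewrite !mxE eqxx eq_sym oner_eq0.
have [l lL l1] := linear_form_separates inc S0ij.
pose J := map_mx l S0.
have MJ M : annihilates M -> M^T *m J = J *m M.
  move=> /MS/(congr1 (map_mx l)).
  have := linear_form_mx M^T 1%:M S0 lL; have := linear_form_mx 1%:M M S0 lL.
  by rewrite !map_mx1 !mulmx1 !mul1mx map_trmx => -> ->.
pose P0 := S0i *m map_mx inc J.
have [r rE] : exists r, Ui *m P0 *m U = r%:M.
  apply: (EE_generates annihilator_span_lin annihilator_span_lie Wy sy (symW _ Wy) ny).
  move=> w; apply: (@span_ind_sub _ _ _ (fun w => Ui *m P0 *m U *m w = w *m (Ui *m P0 *m U))).
  - by rewrite mulmx0 mul0mx.
  - by move=> c x z Hx Hz; rewrite mulmxDl mulmxDr -scalemxAl -scalemxAr Hx Hz.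
  move=> _ [M MP ->]; apply: conj_commute; rewrite /P0 -mulmxA -(map_mxM inc) -MJ// (map_mxM inc).
  by rewrite mulmxA -map_trmx (intertwine_inv S0K S0iK (MS _ MP)) -mulmxA.
have JS : map_mx inc J = r *: S0.
  have : P0 = r%:M by exact: unconj_scalar.
  move=> /(congr1 (mulmx S0)); rewrite /P0 mulmxA S0K mul1mx => ->.
  by rewrite scalar_mxC mul_scalar_mx.
have rS : r * S0 i j = 1.
  by have := congr1 (fun X : 'M[R]_n => X i j) JS; rewrite mxE [J _ _]mxE l1 rmorph1 [in RHS]mxE.
have rU : r \is a GRing.unit.
  by apply/unitrP; exists (S0 i j); rewrite mulrC rS.
have JT : J^T = eta *: J.
  apply: inc_mx_inj; rewrite map_mxZ -map_trmx JS linearZ /= /S0 !trmx_mul trmxK J0_tr.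
  by rewrite -scalemxAl -scalemxAr mulmxA scalerA mulrC -scalerA.
have SE : S0 = r^-1 *: map_mx inc J by rewrite JS scalerA mulVr// scale1r.
have sJ : map_mx inc (A^T *m map_mx sK J *m A) = (sR r / r) *: map_mx inc J.
  rewrite !(map_mxM inc) -map_trmx.
  have -> : map_mx inc (map_mx sK J) = map_mx sR (map_mx inc J).
    by apply/matrixP => a b; rewrite !mxE sR_inc.
  rewrite {1}JS map_mxZ /S0 !(map_mxM sR) -map_trmx sR_Ui.
  rewrite J0_fixed -scalemxAr -scalemxAl !trmx_mul !mulmxA -trmx_mul -(map_mxM inc) AiA map_mx1 trmx1 mul1mx.
  by rewrite -[_ *m map_mx inc Ai *m _]mulmxA -(map_mxM inc) AiA map_mx1 mulmx1 -/S0 SE scalerA.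
have JU : J \in unitmx.
  rewrite unitmxE unitfE; apply/eqP => /(congr1 inc); rewrite rmorph0 -det_map_mx JS detZ => d0.
  have : r ^+ n * \det S0 * \det S0i = r ^+ n by rewrite -mulrA -det_mulmx S0K det1 mulr1.
  by rewrite d0 mul0r => /esym/eqP; apply/negP; apply: contraTneq (unitrX n rU) => ->; rewrite unitr0.
(* J was normalized to have entry 1 at (i, j), so this entry is the multiplier sigma(r) / r, now
   seen in K. *)
pose kappa := (A^T *m map_mx sK J *m A) i j.
have kE : inc kappa = sR r / r.
  have := congr1 (fun X : 'M[R]_n => X i j) sJ; rewrite mxE -/kappa => ->.
  by rewrite [LHS]mxE [X in _ * X]mxE [J _ _]mxE l1 rmorph1 mulr1.
exists J, kappa; split=> //.
- apply/eqP => k0; have : sR r / r = 0 by rewrite -kE k0 rmorph0.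
  move=> /(congr1 ( *%R^~ r)); rewrite divrK// mul0r => sr0.
  have : r = 0 by rewrite -[r]sRiK sr0 rmorph0.
  by move=> r0; move: rU; rewrite r0 unitr0.
- by apply: inc_mx_inj; rewrite map_mxZ kE.
move=> Y; split=> [|YJ].
  apply: (@span_ind_sub _ _ _ (fun Y => Y^T *m J + J *m Y = 0)).
  - by rewrite trmx0 mul0mx mulmx0 addr0.
  - move=> c y1 z Hy Hz; rewrite linearP /= mulmxDl mulmxDr -scalemxAl -scalemxAr addrACA.
    by rewrite Hz -scalerDr Hy scaler0 addr0.
  move=> _ [E [l' [EEE l'L ->]]]; set Z := U *m E *m Ui.
  have ZS : Z^T *m map_mx inc J + map_mx inc J *m Z = 0.
    rewrite JS -scalemxAr -scalemxAl -scalerDr /Z /S0 !trmx_mul !mulmxA.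
    rewrite -[_ *m U^T *m _]mulmxA UT mulmx1 -[_ *m Ui *m U]mulmxA UiU mulmx1.
    by rewrite -mulmxDl -!mulmxA -mulmxDr EE_skew// mulmx0 mul0mx scaler0.
  have := congr1 (map_mx l') ZS; have -> : map_mx l' (0 : 'M[R]_n) = 0.
    by apply/matrixP => a b; rewrite !mxE raddf0.
  have -> : map_mx l' (Z^T *m map_mx inc J + map_mx inc J *m Z) =
    map_mx l' (map_mx inc 1%:M *m Z^T *m map_mx inc J) + map_mx l' (map_mx inc J *m Z *m map_mx inc 1%:M).
    by rewrite map_mx1 mul1mx mulmx1; apply/matrixP => a b; rewrite !mxE raddfD.
  by rewrite !linear_form_mx// mul1mx mulmx1 map_trmx.
apply/tangentP => M /MJ MJE.
have : \tr (M *m Y) = - \tr (M *m Y).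
  have YJ' : Y^T *m J = - (J *m Y) by apply/eqP; rewrite -addr_eq0 YJ.
  have H : (M *m Y)^T *m J = - (J *m (Y *m M)).
    by rewrite trmx_mul -mulmxA MJE !mulmxA YJ' mulNmx.
  rewrite -[LHS]mxtrace_tr -[(M *m Y)^T]mulmx1 -(mulmxV JU) mulmxA H mulNmx raddfN /=.
  by rewrite mxtrace_mulC !mulmxA mulVmx// mul1mx mxtrace_mulC.
move=> /eqP; rewrite -addr_eq0 -mulr2n -mulr_natr mulf_eq0 (negbTE two_neq0) orbF.
by move/eqP.
Qed.

End TangentAlgebra.

(** * Matrices commuting with an invariant module *)

Lemma mul_mx_delta (S : pzRingType) m n p (X : 'M[S]_(m, n)) (a : 'I_n) (b : 'I_p) i j :
  (X *m delta_mx a b) i j = X i a * (j == b)%:R.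
Proof.
rewrite mxE (bigD1 a)//= big1 ?addr0 => [|k ka]; first by rewrite mxE eqxx.
by rewrite mxE (negbTE ka) mulr0.
Qed.

Lemma mul_delta_mx_l (S : pzRingType) m n p (X : 'M[S]_(n, p)) (a : 'I_m) (b : 'I_n) i j :
  (delta_mx a b *m X) i j = (i == a)%:R * X b j.
Proof.
rewrite mxE (bigD1 b)//= big1 ?addr0 => [|k kb]; first by rewrite mxE eqxx andbT.
by rewrite mxE (negbTE kb) andbF mul0r.
Qed.

Lemma lie_lie (S : comNzRingType) n (z g : 'M[S]_n) :
  lie (lie z g) g = z *m (g *m g) - 2 *: (g *m z *m g) + (g *m g) *m z.
Proof.
rewrite /lie mulmxBl mulmxBr !mulmxA.
move: (z *m g *m g) (g *m z *m g) (g *m g *m z) => *.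
by apply/matrixP => i j; rewrite !mxE; ring.
Qed.

(** ad(g) has eigenvalues 0, i, -i, 2i, -2i for a plane rotation g with projector e. The polynomial
    l^4 + l^2 kills the first three and equals 12 at the last two, on which e x e + g x g is twice
    the projection. *)
Lemma lie_rotation (S : comNzRingType) n (x g e : 'M[S]_n) :
  g *m g = - e -> g *m e = g -> e *m g = g -> e *m e = e ->
  lie (lie (lie (lie x g) g) g) g + lie (lie x g) g = 6 *: (g *m x *m g + e *m x *m e).
Proof.
move=> gg ge eg ee; rewrite lie_lie gg; set x' := lie _ g.
have x'E : x' = - (x *m e) - 2 *: (g *m x *m g) - e *m x.
  by rewrite /x' lie_lie gg mulmxN mulNmx.
have H1 : x' *m e = - (x *m e) - 2 *: (g *m x *m g) - e *m x *m e.
  by rewrite x'E !mulmxBl mulNmx -scalemxAl -!mulmxA ge ee.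
have H2 : e *m x' = - (e *m x *m e) - 2 *: (g *m x *m g) - e *m x.
  by rewrite x'E !mulmxBr mulmxN -scalemxAr !mulmxA eg ee.
have H3 : g *m x' *m g = - (g *m x *m g) - 2 *: (e *m x *m e) - g *m x *m g.
  rewrite x'E !mulmxBr !mulmxBl mulmxN mulNmx -scalemxAr -scalemxAl !mulmxA ge gg.
  by rewrite -!mulmxA eg gg !mulmxN !mulNmx opprK.
rewrite mulmxN mulNmx H1 H2 H3 x'E.
move: (x *m e) (g *m x *m g) (e *m x *m e) (e *m x) => *.
by apply/matrixP => i j; rewrite !mxE; ring.
Qed.

Section Generation.
Variables (n : nat) (R : comUnitRingType) (sR : {rmorphism R -> R}).
Hypothesis fixed_unit : forall x, sR x = x -> x != 0 -> x \is a GRing.unit.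
Hypothesis nat_unit : forall k, (k.+1%:R : R) \is a GRing.unit.
Variable V : 'M[R]_n -> Prop.
Hypothesis VL : forall c x y, V x -> V y -> V (c *: x + y).
Variable y : 'M[R]_n.
Hypothesis Vy : V y.
Hypothesis y_fixed : map_mx sR y = y.
Hypothesis y_nscalar : ~ exists a, y = a%:M.

Let V0 : V 0. Proof. by have := VL (-1) Vy Vy; rewrite scaleN1r addNr. Qed.
Let VZ c x : V x -> V (c *: x). Proof. by move=> Vx; rewrite -[_ *: _]addr0; exact: VL. Qed.
Let VD x z : V x -> V z -> V (x + z). Proof. by move=> Vx Vz; rewrite -[x]scale1r; exact: VL. Qed.
Let VN x : V x -> V (- x). Proof. by move=> Vx; rewrite -scaleN1r; exact: VZ. Qed.
Let VB x z : V x -> V z -> V (x - z). Proof. by move=> Vx Vz; apply: VD => //; exact: VN. Qed.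
Let VZu c x : c \is a GRing.unit -> V (c *: x) -> V x.
Proof. by move=> cU /(VZ c^-1); rewrite scalerA mulVr// scale1r. Qed.
Let y_entry i j : sR (y i j) = y i j. Proof. by rewrite -{2}y_fixed mxE. Qed.

Lemma nonscalar_entries : exists i j, i != j /\ (y i j != 0 \/ y i i - y j j != 0).
Proof.
apply: contrapT => /forallNP H; apply: y_nscalar.
have [n0|n0] := posnP n.
  by exists 0; apply/matrixP => i; have := ltn_ord i; rewrite {2}n0.
have off i j : i != j -> y i j = 0 /\ y i i = y j j.
  move=> ij; split; apply/eqP.
    by apply: contrapT => /negP h; apply: (H i); exists j; split=> //; left.
  by rewrite -subr_eq0; apply: contrapT => /negP h; apply: (H i); exists j; split=> //; right.
exists (y (Ordinal n0) (Ordinal n0)); apply/matrixP => i j; rewrite mxE.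
have [<-|ij] := eqVneq i j; last by rewrite (off i j ij).1.
by have [->//|h] := eqVneq i (Ordinal n0); rewrite mulr1n (off _ _ h).2.
Qed.

Section Orthogonal.
Definition rotation (S : pzRingType) m (a b : 'I_m) : 'M[S]_m := delta_mx a b - delta_mx b a.
Local Notation k := (rotation R).
Hypothesis n_gt2 : (2 < n)%N.
Hypothesis Vk : forall x a b, V x -> a != b -> V (lie x (k a b)).
Hypothesis y_sym : y^T = y.

(** The value of e x e + g x g for the rotation in the plane (a, b): twice the traceless symmetric
    part of that 2 by 2 block. *)
Let plane (a b : 'I_n) (x : 'M[R]_n) : 'M[R]_n :=
  (x a a - x b b) *: (delta_mx a a - delta_mx b b) + (x a b + x b a) *: (delta_mx a b + delta_mx b a).

Let V_plane a b x : a != b -> V x -> V (plane a b x).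
Proof.
move=> ab Vx; have ba : b != a by rewrite eq_sym.
pose g := k a b; pose e : 'M[R]_n := delta_mx a a + delta_mx b b.
have gg : g *m g = - e.
  rewrite /g /rotation mulmxBl !mulmxBr !mul_delta_mx_cond !eqxx (negbTE ab) (negbTE ba).
  by rewrite !mulr0n !mulr1n sub0r subr0 -opprD.
have ge : g *m e = g.
  rewrite /g /rotation /e mulmxBl !mulmxDr !mul_delta_mx_cond !eqxx (negbTE ab) (negbTE ba).
  by rewrite !mulr0n !mulr1n add0r addr0.
have eg : e *m g = g.
  rewrite /g /rotation /e mulmxBr !mulmxDl !mul_delta_mx_cond !eqxx (negbTE ab) (negbTE ba).
  by rewrite !mulr0n !mulr1n addr0 add0r.
have ee : e *m e = e.
  rewrite /e mulmxDl !mulmxDr !mul_delta_mx_cond !eqxx (negbTE ab) (negbTE ba).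
  by rewrite !mulr0n !mulr1n addr0 add0r.
have : V (6 *: (g *m x *m g + e *m x *m e)).
  by rewrite -(lie_rotation _ gg ge eg ee); apply: VD; do ?apply: Vk.
move/(VZu (nat_unit 5)); congr V.
rewrite /e /g /rotation /plane !(mulmxBl, mulmxBr, mulmxDl, mulmxDr).
rewrite !(mulNmx, mulmxN) !delta_sandwich; apply/matrixP => i j; rewrite !mxE; ring.
Qed.

Let pole a b : 'M[R]_n := delta_mx a a - delta_mx b b.
Let swap a b : 'M[R]_n := delta_mx a b + delta_mx b a.

Let lie_pole a b : a != b -> lie (pole a b) (k a b) = 2 *: swap a b.
Proof.
move=> ab; have ba : b != a by rewrite eq_sym.
rewrite /lie /pole /rotation /swap !(mulmxBl, mulmxBr) !mul_delta_mx_cond !eqxx (negbTE ab) (negbTE ba).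
by rewrite !mulr0n !mulr1n; apply/matrixP => i j; rewrite !mxE; ring.
Qed.

Let lie_swap a b : a != b -> lie (swap a b) (k a b) = -2 *: pole a b.
Proof.
move=> ab; have ba : b != a by rewrite eq_sym.
rewrite /lie /pole /rotation /swap !(mulmxBl, mulmxBr, mulmxDl, mulmxDr).
rewrite !mul_delta_mx_cond !eqxx (negbTE ab) (negbTE ba).
by rewrite !mulr0n !mulr1n; apply/matrixP => i j; rewrite !mxE; ring.
Qed.

Let third (a b : 'I_n) : exists c, c != a /\ c != b.
Proof.
apply: contrapT => /forallNP H; have : (#|'I_n| <= #|[set a; b]|)%N.
  apply: subset_leq_card; apply/fintype.subsetP => c _; rewrite !inE.
  by apply: contrapT => /negP; rewrite negb_or => /andP[? ?]; apply: (H c).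
by rewrite card_ord cards2; case: (_ == _); lia.
Qed.

(** A nonscalar y leaves a nonzero component in some coordinate plane. A third index isolates the
    difference E_aa - E_cc, brackets with rotations spread it to all pairs (a, d), and commuting
    with these makes p scalar. *)
Lemma orthogonal_generates p : (forall w, V w -> p *m w = w *m p) -> exists a, p = a%:M.
Proof.
move=> pV; have two_unit := nat_unit 1.
have [a [b [ab [al [be [alU Vab]]]]]] : exists a b, a != b /\ exists al be,
    al \is a GRing.unit /\ V (al *: pole a b + be *: swap a b).
  have [a [b [ab H]]] := nonscalar_entries; exists a, b; split=> //.
  have VP : V ((y a a - y b b) *: pole a b + (y a b *+ 2) *: swap a b).
    have <- : plane a b y = (y a a - y b b) *: pole a b + (y a b *+ 2) *: swap a b.
      by have yba : y b a = y a b; [rewrite -{1}y_sym mxE|rewrite /plane yba -mulr2n].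
    exact: V_plane.
  have [d0|d0] := eqVneq (y a a - y b b) 0; last first.
    by exists (y a a - y b b), (y a b *+ 2); split=> //; apply: fixed_unit; rewrite // rmorphB !y_entry.
  have yab : y a b != 0 by case: H => //; rewrite d0 eqxx.
  exists (-2 * (y a b *+ 2)), 0; split.
    rewrite unitrM unitrN two_unit -mulr_natr unitrM two_unit andbT.
    by apply: fixed_unit; rewrite // y_entry.
  rewrite scale0r addr0 mulrC -scalerA -lie_swap// -lieZl; apply: Vk => //.
  by move: VP; rewrite d0 scale0r add0r.
have ba : b != a by rewrite eq_sym.
have [c [ca cb]] := third a b.
have F := (negbTE ca, negbTE cb, negbTE ab, negbTE ba, etrans (eq_sym a c) (negbTE ca), etrans (eq_sym b c) (negbTE cb)).
have Vpole d : d != a -> V (pole a d).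
  have ac : V (pole a c).
    have := V_plane _ Vab; rewrite /plane => /(_ a c); rewrite eq_sym => /(_ ca).
    rewrite /pole /swap !mxE !eqxx !F /=.
    rewrite !(mulr0n, mulr1n, mulr0, mulr1, subr0, addr0, scale0r, andbF) /=.
    by move/(VZu alU).
  move=> da; have := V_plane _ ac => /(_ a d); rewrite eq_sym da => /(_ isT).
  have F2 := (negbTE da, etrans (eq_sym a d) (negbTE da)).
  rewrite /plane /pole !mxE !eqxx !F !F2 /=.
  have [->//|dc] := eqVneq d c.
  by rewrite !(mulr0n, mulr1n, mulr0, mulr1, subr0, addr0, scale0r, andbF) /= scale1r.
have Vswap d : d != a -> V (swap a d).
  by move=> da; apply: (VZu two_unit); rewrite -lie_pole 1?eq_sym//; apply: Vk; rewrite 1?eq_sym//; exact: Vpole.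
have dbl (x : R) : x = - x -> x = 0.
  by move=> xx; apply: (mulrI two_unit); rewrite mulr0 mulr_natl mulr2n {2}xx subrr.
have mxB_entry (X Y : 'M[R]_n) i j : (X - Y) i j = X i j - Y i j by rewrite !mxE.
have mxD_entry (X Y : 'M[R]_n) i j : (X + Y) i j = X i j + Y i j by rewrite !mxE.
have cpole d i j : d != a ->
    p i a * (j == a)%:R - p i d * (j == d)%:R = (i == a)%:R * p a j - (i == d)%:R * p d j.
  move=> /Vpole/pV/matrixP/(_ i j); rewrite /pole mulmxBr mulmxBl.
  by rewrite !mxB_entry !mul_mx_delta !mul_delta_mx_l.
have cdiag d : p d d = p a a.
  have [->//|da] := eqVneq d a.
  have /pV/matrixP/(_ a d) := Vswap d da; rewrite /swap mulmxDr mulmxDl.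
  rewrite !mxD_entry !mul_mx_delta !mul_delta_mx_l !eqxx (negbTE da) [a == d]eq_sym (negbTE da).
  by rewrite !(mulr0, mul0r, mulr1, mul1r, addr0).
exists (p a a); apply/matrixP => i j; rewrite mxE.
have [<-|ij] := eqVneq i j; first by rewrite cdiag.
rewrite mulr0n; have [ja|ja] := eqVneq j a.
  have ji : (j == i) = false by rewrite eq_sym (negbTE ij).
  have := cpole i i j; rewrite -ja (negbTE ij) ji !eqxx mulr1 mulr0 subr0 mul0r mul1r sub0r.
  by move=> /(_ isT)/dbl.
have := cpole j i j ja; rewrite (negbTE ja) eqxx mulr0 mulr1 sub0r (negbTE ij) mul0r subr0.
have [->|ia] := eqVneq i a; first by rewrite mul1r => /esym/dbl.
by rewrite mul0r => /eqP; rewrite oppr_eq0 => /eqP.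
Qed.
End Orthogonal.

Section Symplectic.
Variables (J Ji : 'M[R]_n).
Hypothesis JJi : J *m Ji = 1%:M.
Hypothesis JiJ : Ji *m J = 1%:M.
Hypothesis J_tr : J^T = - J.
Hypothesis J_fixed : map_mx sR J = J.

Definition pairing (v w : 'cV[R]_n) : R := (v^T *m J *m w) 0 0.
Definition rank_one (v w : 'cV[R]_n) : 'M[R]_n := v *m w^T *m J.
Local Notation b := pairing.
Local Notation rk := rank_one.
Hypothesis Vrk : forall x v w, V x -> V (lie x (rk v w + rk w v)).
Hypothesis y_sym : y^T *m J = J *m y.

Let bC v w : b v w = - b w v.
Proof.
transitivity ((v^T *m J *m w)^T 0 0); first by rewrite mxE.
by rewrite !trmx_mul trmxK J_tr mulNmx mulmxN mulmxA mxE.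
Qed.
Let bvv v : b v v = 0.
Proof.
have two_unit := nat_unit 1.
by apply: (mulrI two_unit); rewrite mulr0 mulr_natl mulr2n {2}bC subrr.
Qed.
Let rkM v w x z : rk v w *m rk x z = b w x *: rk v z.
Proof.
rewrite /rk !mulmxA -[v *m w^T *m J *m x]mulmxA -[v *m w^T *m _]mulmxA [w^T *m _]mulmxA.
rewrite [w^T *m J *m x]mx11_scalar -/(b w x) mul_mx_scalar.
by rewrite -!scalemxAl.
Qed.
Let rkl X v w : X *m rk v w = rk (X *m v) w. Proof. by rewrite /rk !mulmxA. Qed.
Let rkr v w : rk v w *m y = rk v (y *m w).
Proof. by rewrite /rk trmx_mul -!mulmxA y_sym. Qed.
Let by_alt w : b (y *m w) w = 0.
Proof.
suff E : b (y *m w) w = - b (y *m w) w.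
  have two_unit := nat_unit 1.
  by apply: (mulrI two_unit); rewrite mulr0 mulr_natl mulr2n {2}E subrr.
rewrite {1}/b trmx_mul -[_ *m y^T *m J]mulmxA y_sym !mulmxA -[_ *m y *m w]mulmxA.
by rewrite -/(b w (y *m w)) bC.
Qed.

Let A2 := span (fun X => exists w1 w2, [/\ V w1, V w2 & X = w1 *m w2]).

Let A2_lie X v w : A2 X -> A2 (lie X (rk v w + rk w v)).
Proof.
apply: (@span_ind_sub _ _ _ (fun X => A2 (lie X (rk v w + rk w v)))).
- by rewrite /lie mul0mx mulmx0 subrr; exact: span_zero.
- by move=> c x z Ax Az; rewrite lieDl lieZl; apply: spanD => //; exact: spanZ.
move=> _ [w1 [w2 [V1 V2 ->]]]; set E := rk v w + rk w v.
have -> : lie (w1 *m w2) E = w1 *m lie w2 E + lie w1 E *m w2.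
  by rewrite /lie mulmxBr mulmxBl !mulmxA addrA subrK.
by apply: spanD; apply: span_gen; [exists w1, (lie w2 E)|exists (lie w1 E), w2]; split=> //; exact: Vrk.
Qed.

Let two_rk v : rk v v + rk v v = 2 *: rk v v.
Proof. by rewrite scaler_nat mulr2n. Qed.

Let lieZr2 X v : lie X (rk v v + rk v v) = 2 *: lie X (rk v v).
Proof. by rewrite two_rk lieZr. Qed.

(** Products of two members of V also commute with p and are stable under brackets with
    transvections. They contain the rank-one matrix of every fixed vector z, so each fixed z with a
    coordinate 1 is an eigenvector of p. *)
Lemma symplectic_generates p : (forall w, V w -> p *m w = w *m p) -> exists a, p = a%:M.
Proof.
move=> pV; have two_unit := nat_unit 1.
have Vsq x v : V x -> V (lie x (rk v v)).
  by move=> Vx; apply: (VZu two_unit); rewrite -lieZr2; exact: Vrk.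
have A2sq x v : A2 x -> A2 (lie x (rk v v)).
  move=> Ax; rewrite -[lie _ _]scale1r -(mulVr two_unit) -scalerA; apply: spanZ.
  by rewrite -lieZr2; exact: A2_lie.
have A2p X : A2 X -> p *m X = X *m p.
  apply: (@span_ind_sub _ _ _ (fun X => p *m X = X *m p)).
  - by rewrite mulmx0 mul0mx.
  - by move=> c x z Hx Hz; rewrite mulmxDl mulmxDr -scalemxAl -scalemxAr Hx Hz.
  by move=> _ [w1 [w2 [V1 V2 ->]]]; rewrite mulmxA pV// -mulmxA pV// mulmxA.
pose e i : 'cV[R]_n := delta_mx i 0.
have dot (x w : 'cV[R]_n) : b (- (Ji *m x)) w = (x^T *m w) 0 0.
  have JiT : Ji^T = - Ji.
    have : Ji^T *m J^T = 1%:M by rewrite -trmx_mul JJi trmx1.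
    rewrite J_tr mulmxN => H; rewrite -[Ji^T]mulmx1 -JJi mulmxA -[_ *m J]opprK H.
    by rewrite mulNmx mul1mx.
  by rewrite /b linearN /= trmx_mul JiT mulmxN opprK -[_ *m Ji *m J]mulmxA JiJ mulmx1.
(* A nonscalar y does not preserve some fixed vector w up to scalars: a form v vanishes on w but
   takes an invertible value on y w. *)
have [v [w [vw [c0 [i [wi sc]]]]]] : exists v w, b v w = 0 /\
   (b v (y *m w) \is a GRing.unit /\ exists i, w i 0 = 1 /\ map_mx sR w = w).
  have fe i : map_mx sR (e i) = e i by rewrite map_delta_mx.
  have ee i j : ((e i)^T *m e j) 0 0 = (i == j)%:R.
    by rewrite mul_mx_delta !mxE eqxx andbT mulr1 eq_sym.
  have ye i j : ((e i)^T *m (y *m e j)) 0 0 = y i j.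
    by rewrite /e trmx_delta mul_delta_mx_l mul_mx_delta eqxx mul1r mulr1.
  have [i [j [ij H]]] := nonscalar_entries.
  have ji : j != i by rewrite eq_sym.
  have [yij|yij] := eqVneq (y i j) 0; last first.
    exists (- (Ji *m e i)), (e j); rewrite !dot ee (negbTE ij) ye; split=> //; split.
      by apply: fixed_unit; rewrite ?y_entry.
    by exists j; rewrite fe /e mxE !eqxx.
  have [yji|yji] := eqVneq (y j i) 0; last first.
    exists (- (Ji *m e j)), (e i); rewrite !dot ee (negbTE ji) ye; split=> //; split.
      by apply: fixed_unit; rewrite ?y_entry.
    by exists i; rewrite fe /e mxE !eqxx.
  exists (- (Ji *m e i) - (- (Ji *m e j))), (e i + e j).
  have bBD (v1 v2 w1 w2 : 'cV[R]_n) : b (v1 - v2) (w1 + w2) = b v1 w1 + b v1 w2 - b v2 w1 - b v2 w2.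
    rewrite /b linearB /= !mulmxBl !mulmxDr.
    move: (v1^T *m J *m w1) (v1^T *m J *m w2) (v2^T *m J *m w1) (v2^T *m J *m w2) => *.
    by rewrite !mxE opprD addrA.
  rewrite mulmxDr !bBD !dot !ee !ye yij yji !eqxx (negbTE ij) (negbTE ji).
  rewrite !(addr0, subr0) subrr; split=> //; split.
    case: H => [|d0]; first by rewrite yij eqxx.
    by apply: fixed_unit; rewrite ?rmorphB ?y_entry.
  exists i; rewrite map_mxD !fe /e !mxE !eqxx (negbTE ij) addr0; by split.
set c := b v (y *m w) in c0.
have ywv : b (y *m w) v = - c by rewrite bC.
have wv : b w v = 0 by rewrite bC vw oppr0.
have Vvw : V (rk v w - rk w v).
  have := Vsq _ v (Vsq _ w Vy).
  have -> : lie (lie y (rk w w)) (rk v v) = - c *: (rk v w - rk w v).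
    have -> : lie y (rk w w) = rk (y *m w) w - rk w (y *m w) by rewrite /lie rkl rkr.
    rewrite /lie mulmxBl mulmxBr !rkM wv vw ywv -/c !scale0r.
    by move: (rk v w) (rk w v) => *; apply/matrixP => ? ?; rewrite !mxE; ring.
  by apply: VZu; rewrite unitrN.
pose u := - c^-1 *: (y *m w).
have bZ s x z : b (s *: x) z = s * b x z.
  by rewrite /b linearZ /= -!scalemxAl mxE.
have uw : b u w = 0 by rewrite bZ by_alt mulr0.
have uv : b u v = 1 by rewrite bZ ywv mulNr mulrN opprK mulVr.
have wu : b w u = 0 by rewrite bC uw oppr0.
have vu : b v u = -1 by rewrite bC uv.
have Vuw : V (rk w u - rk u w).
  have := Vsq _ u Vvw.
  have -> // : lie (rk v w - rk w v) (rk u u) = rk w u - rk u w.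
  rewrite /lie mulmxBl mulmxBr !rkM wu vu uv uw.
  by move: (rk v u) (rk w u) (rk u w) (rk u v) => *; apply/matrixP => ? ?; rewrite !mxE; ring.
(* The first rank-one element, obtained as a product of two alternating elements of V whose vectors
   pair to 0 or 1. *)
have Aw : A2 (rk w w).
  apply: span_gen; exists (rk v w - rk w v), (rk u w - rk w u); split=> //.
    by rewrite -opprB; exact: VN.
  rewrite mulmxBl !mulmxBr !rkM wu vu vw bvv.
  by move: (rk v u) (rk v w) (rk w u) (rk w w) => *; apply/matrixP => ? ?; rewrite !mxE; ring.
have A2x x : b w x \is a GRing.unit -> A2 (rk x x).
  move=> bU; have := A2sq _ x (A2sq _ x Aw).
  have -> : lie (lie (rk w w) (rk x x)) (rk x x) = (2 * b w x ^+ 2) *: rk x x.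
    rewrite /lie mulmxBl mulmxBr !rkM -!scalemxAl -!scalemxAr !rkM bvv [b x w]bC.
    by move: (rk x x) (rk w x) (rk x w) => *; apply/matrixP => ? ?; rewrite !mxE; ring.
  move/(spanZ (2 * b w x ^+ 2)^-1); rewrite scalerA mulVr ?scale1r//.
  by rewrite unitrM two_unit unitrX.
pose x0 := Ji *m e i.
have wx0 : b w x0 = 1.
  by rewrite /b /x0 mulmxA -[_ *m J *m Ji]mulmxA JJi mulmx1 mul_mx_delta mxE wi eqxx mulr1.
have bDr x z t : b x (z + t) = b x z + b x t.
  by rewrite /b mulmxDr mxE.
(* The pairing of w with z is fixed, so it is zero or a unit. If it is zero, polarization with x0,
   which pairs to 1 with w, reaches z. *)
have A2z z : map_mx sR z = z -> A2 (rk z z).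
  move=> sz; have [g0|g0] := eqVneq (b w z) 0; last first.
    apply: A2x; apply: fixed_unit g0.
    have -> : sR (b w z) = (map_mx sR (w^T *m J *m z)) 0 0 by rewrite mxE.
    by rewrite !map_mxM -map_trmx sc J_fixed sz.
  have bN x t : b x (- t) = - b x t by rewrite /b mulmxN mxE.
  have Ap : A2 (rk (x0 + z) (x0 + z)) by apply: A2x; rewrite bDr wx0 g0 addr0 unitr1.
  have Am : A2 (rk (x0 - z) (x0 - z)) by apply: A2x; rewrite bDr bN wx0 g0 subr0 unitr1.
  have A0 : A2 (rk x0 x0) by apply: A2x; rewrite wx0 unitr1.
  rewrite -[rk z z]scale1r -(mulVr two_unit) -scalerA; apply: spanZ.
  have -> : 2 *: rk z z = rk (x0 + z) (x0 + z) + rk (x0 - z) (x0 - z) - 2 *: rk x0 x0.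
    rewrite /rk !linearD !linearN /= !(mulmxDl, mulmxDr, mulmxN, mulNmx).
    move: (x0 *m x0^T *m J) (x0 *m z^T *m J) (z *m x0^T *m J) (z *m z^T *m J) => *.
    by apply/matrixP => ? ?; rewrite !mxE; ring.
  by apply: spanB; [exact: spanD|exact: spanZ].
have eig (z : 'cV[R]_n) j : map_mx sR z = z -> z j 0 = 1 -> exists s, p *m z = s *: z.
  move=> /A2z/A2p + zj; rewrite rkl /rk => /(congr1 (fun X => X *m Ji *m e j)).
  rewrite -[_ *m J *m Ji]mulmxA JJi mulmx1.
  have zje : z^T *m e j = 1%:M.
    by apply/matrixP => a a'; rewrite !ord1 mul_mx_delta !mxE zj eqxx mulr1.
  rewrite -[_ *m z^T *m e j]mulmxA zje mulmx1 => ->.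
  by rewrite -!mulmxA [X in z *m X]mx11_scalar mul_mx_scalar; eexists.
have fe j : map_mx sR (e j) = e j by rewrite map_delta_mx.
have pe j i' : (p *m e j) i' 0 = p i' j by rewrite mul_mx_delta eqxx mulr1.
have poff i' j : i' != j -> p i' j = 0.
  move=> ij; have [|s /matrixP/(_ i' 0)] := eig (e j) j (fe j); first by rewrite mxE !eqxx.
  by rewrite pe => ->; rewrite !mxE (negbTE ij) mulr0.
exists (p i i); apply/matrixP => i' j; rewrite mxE.
have [<-|ij] := eqVneq i' j; last by rewrite poff.
rewrite mulr1n; have [->//|ii] := eqVneq i' i.
have [||s sE] := eig (e i + e i') i.
- by rewrite map_mxD !fe.
- by rewrite !mxE !eqxx [i == i']eq_sym (negbTE ii) addr0.
have mxD_entry (X Y : 'cV[R]_n) j' : (X + Y) j' 0 = X j' 0 + Y j' 0 by rewrite !mxE.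
move: sE; rewrite mulmxDr => /matrixP sE; have := sE i 0; have := sE i' 0.
rewrite !mxD_entry !pe (poff i' i)// (poff i i') 1?eq_sym// add0r addr0.
by rewrite !mxE !eqxx (negbTE ii) [i == i']eq_sym (negbTE ii) add0r addr0 => -> ->.
Qed.
End Symplectic.
End Generation.

(** * Norms of linear relations and frames of orbits *)

Section RationalRelation.
Variables (n : nat) (K L : fieldType) (io : {rmorphism K -> L}).
Local Notation P := (mpoly #|{: 'I_n * 'I_1}| K).
Local Notation row v := (enum_val v).1.

Local Notation wt r := (fun v : 'I_#|{: 'I_n * 'I_1}| => nat_of_bool (r <= row v)%N).

Lemma no_rows_wsupp r (p : P) : wsupp (wt r) leq 0 0 p -> no_rows r p.
Proof.
move=> H k v kp rv; have := H k kp; rewrite addn0 leqn0 /mwt sum_nat_eq0 => /forallP/(_ v).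
by rewrite /= rv muln1 => /eqP.
Qed.

Lemma kspan_closed (e : seq L) x y : (forall x y, x \in e -> y \in e -> kspan io e (x * y)) ->
  kspan io e x -> kspan io e y -> kspan io e (x * y).
Proof.
move=> eM ex ey; move: ex; apply: (@kspan_ind_sub _ _ io e (fun x => kspan io e (x * y))).
- by rewrite mul0r; exact: kspan0.
- move=> a u v su sv; rewrite mulrDl -mulrA; apply: kspanD => //; exact: kspanZ.
move=> {}x xs; move: ey; apply: (@kspan_ind_sub _ _ io e (fun y => kspan io e (x * y))).
- by rewrite mulr0; exact: kspan0.
- move=> a u v su sv; rewrite mulrDr mulrCA; apply: kspanD => //; exact: kspanZ.
by move=> {}y ys; exact: eM.
Qed.

Lemma kspan_basis (e : seq L) : exists d (u : 'I_d -> L), [/\ forall a, kspan io e (u a),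
  forall y, kspan io e y -> exists c : 'I_d -> K, y = \sum_a io (c a) * u a &
  forall c : 'I_d -> K, \sum_a io (c a) * u a = 0 -> forall a, c a = 0].
Proof.
pose gen d (u : 'I_d -> L) := (forall a, kspan io e (u a)) /\
  forall y, kspan io e y -> exists c : 'I_d -> K, y = \sum_a io (c a) * u a.
pose Q d := `[< exists u : 'I_d -> L, gen d u >].
have exQ : exists d, Q d.
  exists (size e); apply/asboolP; exists (fun i => e`_i); split=> [a|y].
    by apply: kspan_gen; exact: mem_nth.
  apply: (@kspan_ind_sub _ _ io e (fun y => exists c : 'I_(size e) -> K, y = \sum_a io (c a) * e`_a)).
  - by exists (fun=> 0); rewrite big1// => a _; rewrite rmorph0 mul0r.
  - move=> a _ _ [c ->] [c' ->]; exists (fun i => a * c i + c' i).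
    rewrite mulr_sumr -big_split; apply: eq_bigr => i _ /=.
    by rewrite rmorphD rmorphM mulrDl mulrA.
  move=> {}y ye; have yi : (index y e < size e)%N by rewrite index_mem.
  exists (fun i => (i == Ordinal yi)%:R).
  rewrite (bigD1 (Ordinal yi))//= eqxx rmorph1 mul1r nth_index// big1 ?addr0// => i /negbTE->.
  by rewrite rmorph0 mul0r.
case: (ex_minnP exQ) => d /asboolP[u [ue ug]] dmin; exists d, u; split=> // c c0 a0.
apply: contrapT => /eqP ca; move: dmin u ue ug c c0 a0 ca; case: d => [|d] dmin u ue ug c c0 a0 ca.
  by case: a0 ca.
have u0 : u a0 = \sum_i io (- (c (lift a0 i) / c a0)) * u (lift a0 i).
  move: c0; rewrite (bigD1_ord a0)//= => /eqP; rewrite addr_eq0 => /eqP c0.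
  have i0 : io (c a0) != 0 by rewrite fmorph_eq0.
  apply: (mulfI i0); rewrite c0 mulr_sumr -sumrN; apply: eq_bigr => i _.
  by rewrite mulrA -rmorphM mulrN mulrCA divff// mulr1 rmorphN mulNr.
suff /dmin : Q d by rewrite ltnn.
apply/asboolP; exists (fun i => u (lift a0 i)); split=> [i|y /ug[c' ->]]; first exact: ue.
exists (fun i => c' (lift a0 i) - c' a0 * (c (lift a0 i) / c a0)).
rewrite (bigD1_ord a0)//= u0 mulr_sumr -big_split; apply: eq_bigr => i _ /=.
by rewrite rmorphB !rmorphN !rmorphM; ring.
Qed.

(* The determinant of multiplication by \sum_i X_i w_i on the span of e, which
   is singular at X = f. *)
Lemma rational_relation (r : nat) (f w : 'I_n -> L) (e : seq L) (i0 : 'I_n) :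
  (forall x y, x \in e -> y \in e -> kspan io e (x * y)) ->
  (forall i, kspan io e (w i)) -> \sum_(i < n | (i < r)%N) w i * f i = 0 ->
  (i0 < r)%N -> w i0 != 0 ->
  exists p : P, [/\ p != 0, no_rows r p &
    forall g, (forall i, g i 0%N = f i) -> ev_at io g p = 0].
Proof.
move=> eM we wf ir wi0; have [d [u [ue ug uind]]] := kspan_basis e.
have MP i : exists M : 'M[K]_d, forall a, w i * u a = \sum_b io (M a b) * u b.
  have H a : exists c : 'I_d -> K, w i * u a = \sum_b io (c b) * u b.
    by apply: ug; exact: kspan_closed.
  exists (\matrix_(a, b) projT1 (cid (H a)) b) => a.
  by rewrite {1}(projT2 (cid (H a))); apply: eq_bigr => b _; rewrite mxE.
pose M i := projT1 (cid (MP i)); have ME i a : w i * u a = \sum_b io (M i a b) * u b.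
  exact: (projT2 (cid (MP i))).
pose D : 'M[P]_d := \matrix_(a, b) \sum_(i < n | (i < r)%N) M i a b *: @jX n 1 K i 0.
have evD (L' : fieldType) (io' : {rmorphism K -> L'}) g a b :
    ev_at io' g (D a b) = \sum_(i < n | (i < r)%N) io' (M i a b) * g i 0%N.
  rewrite mxE raddf_sum; apply: eq_bigr => i _.
  by rewrite /= ev_atZ ev_at_jX.
exists (\det D); split.
(* At the basis vector of index i0 the matrix is multiplication by w_i0 on the algebra, which is
   injective because the algebra sits in a field. *)
- apply/eqP => D0; have : ev_at (idfun : {rmorphism K -> K}) (fun i _ => (i == i0)%:R) (\det D) = 0.
    by rewrite D0 raddf0.
  rewrite -det_map_mx => /eqP/det0P[v v0 vM].
  suff v00 : forall a, v 0 a = 0 by move/eqP: v0; apply; apply/rowP => a; rewrite v00 mxE.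
  apply: uind; apply: (mulfI wi0); rewrite mulr0 mulr_sumr.
  transitivity (\sum_b io (\sum_a v 0 a * M i0 a b) * u b).
    under eq_bigr => a _ do rewrite mulrCA ME mulr_sumr.
    rewrite exchange_big; apply: eq_bigr => b _ /=; rewrite raddf_sum mulr_suml.
    by apply: eq_bigr => a _; rewrite mulrA -(rmorphM io).
  apply: big1 => b _; have /matrixP/(_ 0 b) := vM; rewrite mxE [RHS]mxE => E.
  rewrite (_ : \sum_a _ = 0) ?rmorph0 ?mul0r// -[RHS]E; apply: eq_bigr => a _.
  congr (_ * _).
  transitivity (ev_at (idfun : {rmorphism K -> K}) (fun i _ => (i == i0)%:R) (D a b)); last first.
    by rewrite [RHS]mxE.
  rewrite evD (bigD1 i0)//= eqxx mulr1 big1 ?addr0// => i /andP[_ /negbTE->].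
  by rewrite mulr0.
- have leD x y z t : (x <= y)%N -> (z <= t)%N -> (x + z <= y + t)%N by exact: leq_add.
  apply: no_rows_wsupp; rewrite /determinant; apply: wsupp_sum => // s _.
  rewrite mulr_sign; move: (perm.fun_of_perm s) (perm.odd_perm s) => g sgn.
  have prod0 : wsupp (wt r) leq 0 0 (\prod_i D i (g i)).
    apply: (big_ind (wsupp (wt r) leq 0 0)).
    - exact: (@wsuppC _ K (wt r) leq leqnn 1).
    - by move=> x y; exact: (wsuppM leD).
    move=> a _; rewrite mxE; apply: wsupp_sum => // i ir'; apply: wsuppZ.
    rewrite /jX; case: insubP => [l _ lj|_]; last exact: wsupp0.
    have := @wsuppX _ K (wt r) leq leqnn (enum_rank (i, l)).
    by rewrite enum_rankK /= leqNgt ir'.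
  by case: sgn => //; exact: wsuppN.
move=> g gf; rewrite -det_map_mx -det_tr; apply/eqP/det0P; exists (\row_a u a).
  apply/eqP => u0; move/eqP: wi0; apply; have [c ->] := ug _ (we i0).
  apply: big1 => a _; have /matrixP/(_ 0 a) := u0; rewrite !mxE => ->; exact: mulr0.
apply/rowP => b; rewrite mxE [RHS]mxE.
transitivity (\sum_(i < n | (i < r)%N) f i * (w i * u b)); last first.
  by under eq_bigr do rewrite mulrA [f _ * _]mulrC; rewrite -mulr_suml wf mul0r.
have evT a : (map_mx (ev_at io g) D)^T a b = \sum_(i < n | (i < r)%N) io (M i b a) * g i 0%N.
  by rewrite mxE mxE; exact: evD.
under eq_bigr => a _ do rewrite evT mxE mulr_sumr.
rewrite exchange_big; apply: eq_bigr => i _; rewrite ME mulr_sumr; apply: eq_bigr => a _.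
by rewrite gf; ring.
Qed.
End RationalRelation.

(** Greedy choice: a form vanishing on the vectors already chosen is a nonzero column of a cokernel,
    and some v x does not vanish on it. *)
Lemma spanning_frame (L : fieldType) r (X : Type) (G : X -> Prop) (v : X -> 'rV[L]_r) :
  (forall phi : 'cV_r, (forall x, G x -> v x *m phi = 0) -> phi = 0) ->
  exists Ys : 'I_r -> X, (forall s, G (Ys s)) /\ \det (\matrix_s v (Ys s)) != 0.
Proof.
move=> sep.
suff H k : (k <= r)%N -> exists Ys : 'I_k -> X, (forall s, G (Ys s)) /\ row_free (\matrix_s v (Ys s)).
  have [Ys [GY fY]] := H r (leqnn r); exists Ys; split=> //.
  by move: fY; rewrite row_free_unit unitmxE unitfE.
elim: k => [_|k IH kr].
  have Y0 : 'I_0 -> X by case.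
  by exists Y0; split; [case|apply/eqP; rewrite flatmx0 mxrank0].
have [Ys [GY fY]] := IH (ltnW kr); set M := \matrix_s v (Ys s) in fY.
have [j cj] : exists j, col j (cokermx M) != 0.
  apply/existsP; apply: contraT; rewrite negb_exists => /forallP H.
  have : cokermx M = 0.
    by apply/matrixP => i j; have := H j; rewrite negbK => /eqP/matrixP/(_ i 0); rewrite !mxE.
  move/eqP; rewrite -mxrank_eq0 mxrank_coker subn_eq0 => rM.
  by have := leq_trans rM (rank_leq_row M); rewrite leqNgt kr.
have Mphi : M *m col j (cokermx M) = 0 by rewrite colE mulmxA mulmx_coker mul0mx.
set phi := col j _ in cj Mphi.
have [x Gx xphi] : exists2 x, G x & v x *m phi != 0.
  apply: contrapT => /forall2NP H; move/eqP: cj; apply; apply: sep => x Gx.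
  by case: (H x) => // /negP; rewrite negbK => /eqP.
pose Ys' (i : 'I_k.+1) := if unlift ord_max i is Some j then Ys j else x.
exists Ys'; split=> [s|]; first by rewrite /Ys'; case: unlift.
apply/inj_row_free => u; rewrite mulmx_sum_row big_ord_recr /= rowK /Ys' unlift_none.
have -> : \sum_(i < k) u 0 (widen_ord (leqnSn k) i) *: row (widen_ord (leqnSn k) i) (\matrix_s v (Ys' s)) =
    \row_i u 0 (widen_ord (leqnSn k) i) *m M.
  rewrite mulmx_sum_row; apply: eq_bigr => i _; rewrite mxE !rowK /Ys'.
  have -> : widen_ord (leqnSn k) i = lift ord_max i by apply: ord_inj; rewrite lift_max.
  by rewrite liftK.
move=> E; have um : u 0 ord_max = 0.
  have := congr1 (mulmx^~ phi) E; rewrite mulmxDl -mulmxA Mphi mulmx0 add0r mul0mx -scalemxAl.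
  by move/eqP; rewrite scaler_eq0 (negbTE xphi) orbF => /eqP.
move: E; rewrite um scale0r addr0 => /eqP; rewrite mulmx_free_eq0// => /eqP u0.
apply/rowP => i; rewrite [RHS]mxE; case: (unliftP ord_max i) => [i' ->|->//].
have /rowP/(_ i') := u0; rewrite !mxE => <-; congr (u _ _).
by apply: ord_inj; rewrite lift_max.
Qed.

Lemma trace_lie (V : comNzRingType) n (X Y Z : 'M[V]_n) : \tr (X *m lie Y Z) = \tr (lie X Y *m Z).
Proof.
rewrite /lie mulmxBr mulmxBl !raddfB /= !mulmxA; congr (_ - _).
by rewrite mxtrace_mulC mulmxA.
Qed.

(** * Ideals of orthogonal Lie algebras and their orbits *)

Section PerfectIdeal.
Variables (k : fieldType) (n : nat) (J : 'M[k]_n).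
Hypothesis char0 : forall i, i.+1%:R != 0 :> k.
Hypothesis J_unit : J \in unitmx.
Hypothesis J_sym : J^T = 1 *: J.
Hypothesis n_gt2 : (2 < n)%N.
Variable I : 'M[k]_n -> Prop.
Hypothesis IL : forall a X Y, I X -> I Y -> I (a *: X + Y).
Hypothesis I_skew : forall X, I X -> skew J X.
Hypothesis I_lie : forall X Y, skew J X -> I Y -> I (lie X Y).

Let two : (2 : k) != 0. Proof. exact: (char0 1). Qed.

Let pr : {linear 'M[k]_n -> 'M[k]_n} := HB.pack (skew_part J) (GRing.isLinear.Build k _ _ _ _ (skew_part_is_linear J)).

Let trace_skew_part P Z : skew J Z -> \tr (skew_part J P *m Z) = \tr (P *m Z).
Proof.
move=> sZ; rewrite /skew_part -scalemxAl mxtraceZ mulmxBl raddfB /=.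
have -> : \tr (adjoint J P *m Z) = - \tr (P *m Z).
  rewrite -(trace_adjoint J_unit) (adjointM J_unit) (adjointK J_unit J_sym) ?mulr1//.
  by rewrite sZ mulNmx raddfN /= mxtrace_mulC.
by rewrite opprK mulrDr -mulrDl half2// mul1r.
Qed.

Let trace_nondeg Z : skew J Z -> (forall W, skew J W -> \tr (Z *m W) = 0) -> Z = 0.
Proof.
move=> sZ ZW; apply/matrixP => i j; rewrite [RHS]mxE.
have := ZW _ (skew_part_skew J_unit J_sym (mulr1 1) (delta_mx j i)).
rewrite mxtrace_mulC trace_skew_part// mxtrace_mulC => <-.
rewrite /mxtrace (bigD1 i)//= big1 ?addr0 => [|l li].
  by rewrite mul_mx_delta eqxx mulr1.
by rewrite mul_mx_delta (negbTE li) mulr0.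
Qed.

Let I_lie_r X Y : I X -> skew J Y -> I (lie X Y).
Proof.
move=> IX sY; rewrite -lieN -scaleN1r -[_ *: _]addr0.
by apply: IL; [exact: I_lie|rewrite -(subrr X) -scaleN1r addrC; exact: IL].
Qed.

(** I = [I, I], by trace duality. If S is skew and orthogonal to [I, I], the brackets [S, a] with a
    in I are orthogonal to I; such elements of I have ad^2 = 0, so they vanish by [skew_abelian0].
    Then S commutes with I, and the Casimir, equal to n - 2, shows that S is orthogonal to I. *)
Lemma ideal_perfect (M : 'M[k]_n -> Prop) : M 0 ->
  (forall a Y Z, M Y -> M Z -> M (a *: Y + Z)) ->
  (forall Y Z, I Y -> I Z -> M (lie Y Z)) -> forall Y, I Y -> M Y.
Proof.
move=> M0 ML MI Y IY.
apply: (@span_ind_sub _ _ (fun Z => exists a b, [/\ I a, I b & Z = lie a b])) => //.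
  by move=> Z [a [b [Ia Ib ->]]]; exact: MI.
apply: span_orthogonal => P Pab.
have sP := skew_part_skew J_unit J_sym (mulr1 1) P.
rewrite -trace_skew_part; last exact: I_skew.
set S := skew_part J P in sP *.
have {}Pab a b : I a -> I b -> \tr (lie S a *m b) = 0.
  move=> Ia Ib; rewrite -trace_lie trace_skew_part; last first.
    by apply: (skew_lie J_unit) => //; exact: I_skew.
  by apply: Pab; exists a, b.
have A0 a : I a -> (forall b, I b -> \tr (a *m b) = 0) -> a = 0.
  move=> Ia ab0; apply: (skew_abelian0 char0 J_unit J_sym (mulr1 1)) => // [|X sX]; first exact: I_skew.
  have Ib : I (lie a X) by exact: I_lie_r.
  have sab : skew J (lie a (lie a X)) by apply: (skew_lie J_unit) => //; exact: I_skew.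
  apply: trace_nondeg => // W sW.
  by rewrite -trace_lie; apply: ab0; exact: I_lie_r.
have Sa a : I a -> lie S a = 0 by move=> Ia; apply: A0 => [|b Ib]; [exact: I_lie|exact: Pab].
have n2 : (n%:R - 2 * 1 : k) != 0.
  rewrite mulr1 -natrB; last exact: ltnW.
  by case: n n_gt2 => [|[|[|n']]]// _; rewrite !subSS subn0 char0.
have /eqP : (n%:R - 2 * 1) * \tr (S *m Y) = 0.
  rewrite -mxtraceZ scalemxAr.
  rewrite -(@casimir_skew _ _ char0 _ _ J_unit J_sym (mulr1 1) pr)//; last exact: I_skew.
  rewrite /casimir mulmx_sumr raddf_sum big1// => a _.
  rewrite mulmx_sumr raddf_sum big1// => b _.
  have Ib : I (lie (pr (delta_mx b a)) Y) by apply: I_lie => //; exact: (skew_part_skew J_unit J_sym (mulr1 1)).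
  by rewrite -lieN mulmxN raddfN /= trace_lie Sa// mul0mx mxtrace0 oppr0.
by rewrite mulf_eq0 (negbTE n2) /= => /eqP.
Qed.

End PerfectIdeal.

Section QuadraticSpace.
Variables (L : fieldType) (n : nat) (J : 'M[L]_n).
Hypothesis two : (2 : L) != 0.
Hypothesis J_unit : J \in unitmx.
Hypothesis J_sym : J^T = J.
Implicit Types (x y z a d f h : 'cV[L]_n) (X Y Z : 'M[L]_n).

Definition form x y : L := (x^T *m J *m y) 0 0.
Definition infinitesimal_rotation a d : 'M[L]_n := a *m d^T *m J - d *m a^T *m J.
Local Notation q := form.
Local Notation g := infinitesimal_rotation.

Lemma formC x y : q x y = q y x.
Proof.
have -> : q x y = ((x^T *m J *m y)^T) 0 0 by rewrite mxE.
by rewrite !trmx_mul J_sym trmxK mulmxA.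
Qed.

Lemma formDr x y z : q x (y + z) = q x y + q x z.
Proof. by rewrite /form mulmxDr mxE. Qed.

Lemma formZr x c y : q x (c *: y) = c * q x y.
Proof. by rewrite /form -scalemxAr mxE. Qed.

Lemma formNr x y : q x (- y) = - q x y.
Proof. by rewrite /form mulmxN mxE. Qed.

Lemma formBr x y z : q x (y - z) = q x y - q x z.
Proof. by rewrite formDr formNr. Qed.

Lemma formDl x y z : q (x + y) z = q x z + q y z.
Proof. by rewrite !(formC _ z) formDr. Qed.

Lemma formZl c x y : q (c *: x) y = c * q x y.
Proof. by rewrite !(formC _ y) formZr. Qed.

Lemma formBl x y z : q (x - y) z = q x z - q y z.
Proof. by rewrite !(formC _ z) formBr. Qed.

Lemma form0r x : q x 0 = 0.
Proof. by rewrite /form mulmx0 mxE. Qed.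

Lemma form_nondeg x : (forall y, q y x = 0) -> x = 0.
Proof.
move=> yx; suff Jx : J *m x = 0 by rewrite -[x](mulKmx J_unit) Jx mulmx0.
apply/colP => i; rewrite [RHS]mxE -[RHS](yx (delta_mx i 0)) /form trmx_delta -mulmxA -rowE.
by rewrite !mxE.
Qed.

Lemma form_dual x : x != 0 -> exists y, q y x = 1.
Proof.
move=> x0; have [y yx] : exists y, q y x != 0.
  apply: contrapT => /forallNP H; move/eqP: x0; apply; apply: form_nondeg => y.
  by apply/eqP; apply: contraT => yx; case: (H y).
by exists ((q y x)^-1 *: y); rewrite formZl mulVf.
Qed.

Lemma mul_rv_cv (r : 'rV[L]_n) (c : 'cV[L]_n) : r *m c = ((r *m c) 0 0)%:M.
Proof. by apply/matrixP => i j; rewrite !ord1 !mxE mulr1n. Qed.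

Lemma rotation_mul a d x : g a d *m x = q d x *: a - q a x *: d.
Proof.
rewrite /g mulmxBl -!mulmxA ![_^T *m (_ *m _)]mulmxA.
by rewrite (mul_rv_cv _ x) [a^T *m J *m x]mul_rv_cv !mul_mx_scalar.
Qed.

Lemma rotation_skew a d : skew J (g a d).
Proof.
apply/(skewE J_unit); rewrite /g linearB /= !trmx_mul !trmxK J_sym mulmxBl mulmxBr !mulmxA.
by rewrite addrA subrK subrr.
Qed.

Lemma skew_form Y x y : skew J Y -> q (Y *m x) y = - q x (Y *m y).
Proof.
move/(skewE J_unit)/eqP; rewrite addr_eq0 => /eqP E.
by rewrite /form trmx_mul -!mulmxA (mulmxA Y^T) E mulNmx !mulmxN -!mulmxA mxE.
Qed.

Lemma skew_form0 Y x : skew J Y -> q x (Y *m x) = 0.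
Proof.
move=> sY; have /eqP := skew_form x x sY; rewrite formC -subr_eq0 opprK -mulr2n -mulr_natl.
by rewrite mulf_eq0 (negbTE two) => /eqP.
Qed.

Lemma lie_rotation_skew Y a d : skew J Y -> lie Y (g a d) = g (Y *m a) d + g a (Y *m d).
Proof.
move/(skewE J_unit)/eqP; rewrite addr_eq0 => /eqP E.
have trY b : (Y *m b)^T *m J = - (b^T *m J *m Y) by rewrite trmx_mul -(mulmxA _ Y^T) E mulmxN mulmxA.
rewrite /lie /g mulmxBr mulmxBl -!mulmxA !trY !mulmxN !mulmxA.
rewrite opprB opprK; move: (_ *m Y) (_ *m Y) => X1 X2.
by apply/matrixP => i j; rewrite !mxE; ring.
Qed.

(** Irreducibility of the standard representation of so_n for n > 2, over any field and without
    classifying the form. *)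
Lemma rotation_stable (n_gt2 : (2 < n)%N) (V : 'cV[L]_n -> Prop) x :
  (forall c y z, V y -> V z -> V (c *: y + z)) ->
  (forall a d y, V y -> V (g a d *m y)) -> V x -> x != 0 -> forall z, V z.
Proof.
move=> VL Vg Vx x0 z; have [b0 b0x] := form_dual x0.
have VZ c y : V y -> V (c *: y).
  move=> Vy; rewrite -[_ *: _]addr0; apply: (VL) => //.
  by rewrite -(subrr y) -scaleN1r addrC; exact: VL.
have VB y w : V y -> V w -> V (y - w).
  by move=> Vy Vw; rewrite addrC -scaleN1r; exact: VL.
pose w a := a - q a x *: b0.
have Vw a : V (w a) by have := Vg a b0 x Vx; rewrite rotation_mul b0x scale1r.
suff Vb0 : V b0.
  by rewrite -[z](subrK (q z x *: b0)) -[z - _]scale1r; apply: (VL); [exact: Vw|exact: VZ].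
(* Otherwise the identity would be a sum of two matrices of rank at most 1, although n > 2. *)
have [a wa] : exists a, w a != q b0 (w a) *: x.
  pose W := 1%:M - b0 *m (x^T *m J); pose D := W - x *m (b0^T *m J *m W).
  have wE a : w a = W *m a.
    by rewrite /W mulmxBl mul1mx -mulmxA mul_rv_cv mul_mx_scalar -/(q x a) formC.
  have DE a : D *m a = w a - q b0 (w a) *: x.
    by rewrite /D mulmxBl -wE -(mulmxA x) -(mulmxA _ W) -wE (mul_rv_cv _ (w a)) mul_mx_scalar.
  have [D0|/matrix0Pn[i [j Dij]]] := eqVneq D 0.
    have : (\rank (1%:M : 'M[L]_n) <= 2)%N.
      have -> : (1%:M : 'M[L]_n) = b0 *m (x^T *m J) + x *m (b0^T *m J *m W).
        by move/eqP: D0; rewrite subr_eq0 => /eqP <-; rewrite addrC subrK.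
      apply: leq_trans (mxrank_add _ _) _; rewrite -[2%N]/(1 + 1)%N leq_add//.
        by apply: leq_trans (mxrankM_maxr _ _) _; exact: rank_leq_row.
      by apply: leq_trans (mxrankM_maxr _ _) _; exact: rank_leq_row.
    by rewrite mxrank1 leqNgt n_gt2.
  exists (delta_mx j 0); rewrite -subr_eq0 -DE -colE; apply: contraNneq Dij => /colP/(_ i) H.
  by move: H; rewrite !mxE => ->.
move: (w a) wa (Vw a) => v vx Vv.
have [b bv] : exists b, q b (v - q b0 v *: x) = 1 by apply: form_dual; rewrite subr_eq0.
have := VL (q b0 v) (w b) _ (Vw b) (Vg b0 b v Vv).
rewrite rotation_mul /w; set y := (X in V X); suff -> : y = b0 by [].
move: bv; rewrite formBr formZr => /eqP; rewrite subr_eq => /eqP bv; rewrite /y bv.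
move: (q b0 v) (q b x) => s t.
by apply/matrixP => i j; rewrite !mxE; ring.
Qed.

End QuadraticSpace.

Section IdealOrbit.
Variables (L : fieldType) (n : nat) (J : 'M[L]_n).
Hypothesis two : (2 : L) != 0.
Hypothesis J_unit : J \in unitmx.
Hypothesis J_sym : J^T = J.
Hypothesis n_gt2 : (2 < n)%N.
Variable I : 'M[L]_n -> Prop.
Hypothesis I_skew : forall X, I X -> skew J X.
Hypothesis I_lie : forall X Y, skew J X -> I Y -> I (lie X Y).
Hypothesis I_neq0 : exists2 Y, I Y & Y != 0.
Local Notation q := (form J).
Local Notation g := (infinitesimal_rotation J).
Implicit Types (x y z a d f h : 'cV[L]_n).

Let I_rot a d Y : I Y -> I (lie (g a d) Y).
Proof. by apply: I_lie; exact: rotation_skew. Qed.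

(** The common kernel of an ideal is stable under so_n, so by irreducibility it is zero or
    everything. *)
Lemma ideal_null x : (forall Y, I Y -> Y *m x = 0) -> x = 0.
Proof.
move=> Yx; apply: contrapT => /eqP x0; have [Y IY Y0] := I_neq0.
have Yz z : Y *m z = 0.
  apply: (@rotation_stable _ _ _ J_unit J_sym n_gt2 (fun z => forall Y, I Y -> Y *m z = 0) x) => //.
    by move=> c y w Hy Hw Z IZ; rewrite mulmxDr -scalemxAr Hy// Hw// scaler0 addr0.
  move=> a d y Hy Z IZ; have := Hy _ (I_rot a d IZ).
  by rewrite /lie mulmxBl -!mulmxA (Hy Z IZ) mulmx0 sub0r => /eqP; rewrite oppr_eq0 => /eqP.
move/eqP: Y0; apply; apply/matrixP => i j.
by have /matrixP/(_ i 0) := Yz (delta_mx j 0); rewrite -colE !mxE.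
Qed.

Lemma ideal_orthogonal x : (forall Y y, I Y -> q x (Y *m y) = 0) -> x = 0.
Proof.
move=> xY; apply: ideal_null => Y IY; apply: (form_nondeg J_unit) => y.
by rewrite formC// skew_form ?xY ?oppr0//; exact: I_skew.
Qed.

Variable f : 'cV[L]_n.
Hypothesis f_neq0 : f != 0.
Let orth x := forall Y, I Y -> q x (Y *m f) = 0.

Let skew0 Y x : I Y -> q x (Y *m x) = 0.
Proof. by move=> IY; apply: (skew_form0 two J_unit J_sym); exact: I_skew. Qed.

(** The condition on x, read on the bracket of Y with the rotation in the plane of f and y. It
    settles the case where f is anisotropic and starts the isotropic one. *)
Let orth_rot Y y x : I Y -> orth x -> q (Y *m y) f * q x f = q f f * q x (Y *m y).
Proof.
move=> IY ox; have := ox _ (I_rot f y IY); rewrite -lieN (lie_rotation_skew J_unit) => [|]; last exact: I_skew.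
rewrite mulNmx formNr mulmxDl !rotation_mul formDr !formBr !formZr ox//.
rewrite (formC J_sym (Y *m f) f) skew0// mulr0 mul0r subrr add0r => /eqP.
by rewrite oppr_eq0 subr_eq0 => /eqP.
Qed.

Let orthL c x y : orth x -> orth y -> orth (c *: x + y).
Proof. by move=> ox oy Y IY; rewrite (formDl J_sym) (formZl J_sym) ox// oy// mulr0 addr0. Qed.

Let orthf : orth f. Proof. by move=> Y IY; rewrite skew0. Qed.

Let orth_nonisotropic x : q f f != 0 -> orth x -> exists c, x = c *: f.
Proof.
move=> ff ox; exists (q x f / q f f).
suff E : q f f *: x - q x f *: f = 0.
  by rewrite mulrC -scalerA -(subr0_eq E) scalerA mulVf// scale1r.
apply: ideal_orthogonal => Y y IY.
by rewrite (formBl J_sym) !(formZl J_sym) -(orth_rot _ IY ox) (formC J_sym f) mulrC subrr.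
Qed.

Section Isotropic.
Hypothesis ff : q f f = 0.

Let orth_perp x : orth x -> q x f = 0.
Proof.
move=> ox; apply: contrapT => /eqP xf; move/eqP: f_neq0; apply.
apply: ideal_orthogonal => Y y IY; rewrite (formC J_sym).
by have /eqP := orth_rot y IY ox; rewrite ff mul0r mulf_eq0 (negbTE xf) orbF => /eqP.
Qed.

Let orth_stable a d x : q a f = 0 -> q d f = 0 -> orth x -> orth (q d x *: a - q a x *: d).
Proof.
move=> af df ox Y IY; rewrite -rotation_mul.
have gf : g a d *m f = 0 by rewrite rotation_mul af df !scale0r subrr.
rewrite (skew_form J_unit); last exact: rotation_skew.
have := ox _ (I_rot a d IY); rewrite /lie mulmxBl -!mulmxA gf mulmx0 subr0 => ->.
by rewrite oppr0.
Qed.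

(** If all Y f were multiples c f, a rotation moving f to x would give c q(x, x) = 0, so I would
    kill f. *)
Let fperp_anisotropic x : q x f = 0 -> q x x != 0 -> exists2 Y, I Y & forall c, Y *m f != c *: f.
Proof.
move=> xf xx; apply: contrapT => H.
have lam Y : I Y -> exists c, Y *m f = c *: f.
  move=> IY; apply: contrapT => /forallNP Hc; apply: H; exists Y => // c.
  by apply/eqP => E; apply: (Hc c).
have [b bf] := form_dual J_unit J_sym f_neq0.
have gf : g x b *m f = x by rewrite rotation_mul xf bf scale1r scale0r subr0.
move/eqP: f_neq0; apply; apply: ideal_null => Y IY; have [c E] := lam Y IY.
have [c' E'] := lam _ (I_rot x b IY).
move: E'; rewrite /lie mulmxBl -!mulmxA E -scalemxAr gf => E'.
have := congr1 (q x) E'; rewrite formBr !formZr skew0// xf mulr0 subr0 => /eqP.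
by rewrite mulf_eq0 (negbTE xx) orbF => /eqP ->; rewrite scale0r.
Qed.

(** An anisotropic x, moved by the rotations that kill f, would generate all of the hyperplane
    orthogonal to f. Then every Y f would be proportional to f. *)
Let orth_isotropic x : orth x -> q x x = 0.
Proof.
move=> ox; apply: contrapT => /eqP xx; have xf := orth_perp ox.
have [Y IY Yf] := fperp_anisotropic xf xx.
have od d : q d f = 0 -> orth d.
  move=> df; have E : d = (q x x)^-1 *: (q d x *: x - (q d x *: x - q x x *: d)).
    by rewrite opprB addrCA subrr addr0 scalerA mulVf// scale1r.
  have H := orth_stable xf df ox.
  rewrite E; have := orthL (q x x)^-1 (orthL (-1) H (orthL (q d x) ox (orthL (-1) ox ox))) (orthL (-1) ox ox).
  by rewrite !scaleN1r !addNr !addr0 addrC.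
have [b bf] := form_dual J_unit J_sym f_neq0.
move/eqP: (Yf (q b (Y *m f))); apply; apply/eqP; rewrite -subr_eq0; apply/eqP.
apply: (form_nondeg J_unit) => z.
have := od (z - q z f *: b); rewrite (formBl J_sym) (formZl J_sym) bf mulr1 subrr => /(_ erefl _ IY).
rewrite (formBl J_sym) (formZl J_sym) formBr formZr => <-.
by rewrite [in RHS]mulrC.
Qed.

Let orth_isotropic2 x y : orth x -> orth y -> q x y = 0.
Proof.
move=> ox oy; have := orth_isotropic (orthL 1 ox oy).
rewrite scale1r (formDl J_sym) !formDr !orth_isotropic// addr0 add0r (formC J_sym y x) -mulr2n -mulr_natl => /eqP.
by rewrite mulf_eq0 (negbTE two) => /eqP.
Qed.

(* When n = 4, the orbit of an isotropic vector under one of the two factors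
   of so_4 is a totally isotropic plane. *)
Lemma orth_plane h : orth h -> (forall c, h != c *: f) ->
  [/\ n = 4, forall x, orth x <-> q x f = 0 /\ q x h = 0 &
      forall x, orth x -> exists c c', x = c *: f + c' *: h].
Proof.
move=> oh hf.
have [a af ah] : exists2 a, q a f = 0 & q a h = 1.
  have [b bf] := form_dual J_unit J_sym f_neq0.
  have : h - q b h *: f != 0 by rewrite subr_eq0 hf.
  move=> /(form_dual J_unit J_sym)[y]; rewrite formBr formZr => yE.
  exists (y - q y f *: b); rewrite (formBl J_sym) (formZl J_sym); first by rewrite bf mulr1 subrr.
  by rewrite [_ * q b h]mulrC.
have orthE x : orth x <-> q x f = 0 /\ q x h = 0.
  split=> [ox|[xf xh]]; first by split; exact: orth_isotropic2.
  have := orthL (-1) (orth_stable af xf oh) (orthL (-1) oh oh).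
  by rewrite xh ah scale0r scale1r sub0r !scaleN1r opprK addNr addr0.
pose M := row_mx f h; pose N := kermx (J *m M).
have comb (u : 'rV_(1 + 1)) : (u *m M^T)^T = lsubmx u 0 0 *: f + rsubmx u 0 0 *: h.
  rewrite /M tr_row_mx -{1}[u]hsubmxK mul_row_col.
  by rewrite {1}[lsubmx u]mx11_scalar {1}[rsubmx u]mx11_scalar !mul_scalar_mx linearD !linearZ /= !trmxK.
have rM : \rank M = 2.
  rewrite -mxrank_tr; apply/eqP; apply/inj_row_free => u uM.
  have := comb u; rewrite uM trmx0 => E.
  have t0 : rsubmx u 0 0 = 0.
    apply: contrapT => /eqP t0; move/eqP: (hf (- ((rsubmx u 0 0)^-1 * lsubmx u 0 0))); apply.
    move/esym/addr0_eq: E => E.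
    by rewrite scaleNr -scalerA -scalerN E scalerA mulVf// scale1r.
  move/esym/eqP: E; rewrite t0 scale0r addr0 scaler_eq0 (negbTE f_neq0) orbF => /eqP s0.
  by rewrite -[u]hsubmxK [lsubmx u]mx11_scalar [rsubmx u]mx11_scalar t0 s0 !raddf0 row_mx0.
have rJ m (X : 'M[L]_(n, m)) : \rank (J *m X) = \rank X.
  by rewrite -mxrank_tr trmx_mul mxrankMfree ?mxrank_tr// row_free_unit unitmx_tr.
have row_orth i : orth (row i N)^T.
  have : row i N *m (J *m M) = 0 by rewrite -row_mul mulmx_ker row0.
  rewrite /M mul_mx_row mul_mx_row -[0]row_mx0 => /eq_row_mx[E1 E2].
  by apply/orthE; rewrite /form trmxK -!mulmxA E1 E2 mxE.
have NN : N *m (J *m N^T) = 0.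
  apply/matrixP => i j; rewrite [RHS]mxE -[RHS](orth_isotropic2 (row_orth i) (row_orth j)).
  transitivity ((row i (N *m (J *m N^T)) *m delta_mx j (0 : 'I_1)) 0 0); first by rewrite -colE 2![RHS]mxE.
  by rewrite /form trmxK tr_row colE row_mul -!mulmxA.
have qM x1 : q x1 f = 0 -> q x1 h = 0 -> x1^T *m (J *m M) = 0.
  have H0 w : q x1 w = 0 -> x1^T *m J *m w = 0 by move=> E; rewrite (mul_rv_cv _ w) -/(q x1 w) E raddf0.
  by move=> /H0 E1 /H0 E2; rewrite /M !mul_mx_row !mulmxA E1 E2 row_mx0.
have MM : M^T *m (J *m M) = 0.
  rewrite {1}/M tr_row_mx mul_col_mx !qM ?col_mx0//; try exact: orth_isotropic2.
have rN : \rank N = (n - 2)%N by rewrite mxrank_ker rJ rM.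
(* The orthogonal of the plane of f and h is totally isotropic of dimension n - 2, which gives n <=
   4; the plane is itself totally isotropic, which gives n >= 4. *)
have n4 : n = 4.
  have := mulmx0_rank_max NN; rewrite rJ mxrank_tr rN.
  have := mulmx0_rank_max MM; rewrite rJ mxrank_tr rM; lia.
have MN : (M^T <= N)%MS by apply/sub_kermxP.
have NM : (N <= M^T)%MS by rewrite -(geq_leqif (mxrank_leqif_sup MN)) mxrank_tr rN rM n4.
split=> // x ox; have xN : (x^T <= N)%MS.
  by apply/sub_kermxP; have [H1 H2] := (orthE x).1 ox; exact: qM.
have /submxP[D xD] := submx_trans xN NM.
by exists (lsubmx D 0 0), (rsubmx D 0 0); rewrite -comb -xD trmxK.
Qed.
End Isotropic.

Lemma ideal_orbit_dichotomy :
  (forall x, (forall Y, I Y -> q x (Y *m f) = 0) -> exists c, x = c *: f) \/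
  exists h, [/\ n = 4, (forall c, h != c *: f) /\ q f f = 0,
    forall x, (forall Y, I Y -> q x (Y *m f) = 0) <-> q x f = 0 /\ q x h = 0,
    forall x, (forall Y, I Y -> q x (Y *m f) = 0) -> exists c c', x = c *: f + c' *: h &
    forall Y, I Y -> q h (Y *m f) = 0].
Proof.
have [ff|ff] := eqVneq (q f f) 0; last by left=> x; exact: orth_nonisotropic.
have [[h [oh hf]]|H] := pselect (exists h, orth h /\ forall c, h != c *: f).
  by right; exists h; have [n4 E S] := orth_plane ff oh hf.
left=> x ox; apply: contrapT => /forallNP xf; apply: H; exists x; split=> // c.
by apply/eqP; exact: xf.
Qed.

End IdealOrbit.

Lemma lie_jacobi (V : comNzRingType) n (X Y Z : 'M[V]_n) : lie X (lie Y Z) = lie (lie X Y) Z + lie Y (lie X Z).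
Proof.
rewrite /lie !(mulmxBl, mulmxBr) !mulmxA.
move: (_ *m X *m Y) (_ *m Y *m X) (_ *m X *m Z) (_ *m Z *m X) (_ *m Y *m Z) (_ *m Z *m Y).
by move=> P1 P2 P3 P4 P5 P6; apply/matrixP => i j; rewrite !mxE; ring.
Qed.

Lemma orbit_frame (K L : fieldType) (io : {rmorphism K -> L}) n r (rn : (r <= n)%N) (f : 'I_n -> L)
    (G : 'M[K]_n -> Prop) :
  (forall phi : 'I_r -> L, (forall Y, G Y ->
      \sum_i phi i * (\sum_k io (Y (widen_ord rn i) k) * f k) = 0) -> forall i, phi i = 0) ->
  exists Ys : 'I_r -> 'M[K]_n, (forall s, G (Ys s)) /\
    \det (\matrix_(s, i) \sum_k io (Ys s (widen_ord rn i) k) * f k) != 0.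
Proof.
move=> H.
have [|Ys [GY dY]] := @spanning_frame L r _ G (fun Y => \row_i \sum_k io (Y (widen_ord rn i) k) * f k).
  move=> phi Hphi; apply/colP => i; rewrite [RHS]mxE; apply: (H (fun i => phi i 0)) => Y GY.
  have /matrixP/(_ 0 0) := Hphi Y GY; rewrite !mxE => E; apply: etrans E.
  by apply: eq_bigr => j _; rewrite mxE mulrC.
exists Ys; split=> //; move: dY; congr (\det _ != 0).
by apply/matrixP => s i; rewrite !mxE.
Qed.

(** The Casimir of Y is a sum of brackets in T, and it is a nonzero multiple of Y. *)
Lemma casimir_perfect (K : fieldType) n (pr : {linear 'M[K]_n -> 'M[K]_n}) (T : 'M[K]_n -> Prop) (s : K) :
  (forall X, T (pr X)) -> (forall X Y, T X -> T Y -> T (lie X Y)) ->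
  s != 0 -> (forall Y, T Y -> casimir pr Y = s *: Y) ->
  forall M : 'M[K]_n -> Prop, M 0 ->
  (forall a Y Z, M Y -> M Z -> M (a *: Y + Z)) ->
  (forall Y Z, T Y -> T Z -> M (Y *m Z - Z *m Y)) -> forall Y, T Y -> M Y.
Proof.
move=> Tpr Tlie s0 sY M M0 ML MT Y TY.
have MD X Z : M X -> M Z -> M (X + Z) by move=> ? ?; rewrite -[X]scale1r; exact: ML.
have -> : Y = s^-1 *: casimir pr Y + 0 by rewrite sY// scalerA mulVf// scale1r addr0.
apply: (ML) => //; rewrite /casimir; apply: big_ind => // a _; apply: big_ind => // b _.
by apply: MT => //; apply: Tlie.
Qed.

(** For N = 1 every matrix thus lies in [kk], against the first conclusion of [relation_cocycle]:
    this is the algebraic independence of the coordinates. *)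
Lemma jder1_weight0 n (K : fieldType) (Y : 'M[K]_n) (p : mpoly #|{: 'I_n * 'I_1}| K) : jder 1 Y p = 0.
Proof.
by rewrite jderE /der big1// => v _; rewrite (ord1 (enum_val v).2) ffact0n mulr0n mul0r.
Qed.

Lemma osculating_connection_lin n N (K L : fieldType) (io : {rmorphism K -> L}) (f : 'I_n -> L)
    (T : 'M[K]_n -> Prop) (Np : mpoly #|{: 'I_n * 'I_N}| K -> Prop) a B B' :
  (forall p, Np p -> osculating io f T (jder 1 B p)) ->
  (forall p, Np p -> osculating io f T (jder 1 B' p)) ->
  forall p, Np p -> osculating io f T (jder 1 (a *: B + B') p).
Proof. by move=> H H' p Npp; rewrite jderD jderZ; apply: osculating_lin; [exact: H|exact: H']. Qed.

(** * Invariant spaces for the special linear and symplectic algebras *)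

Lemma special_linear_ideal (K : fieldType) n (V : 'M[K]_n -> Prop) B : (2 : K) != 0 ->
  (forall a X Y, V X -> V Y -> V (a *: X + Y)) ->
  (forall X Y, \tr X = 0 -> V Y -> V (lie X Y)) ->
  V B -> ~ (exists a, B = a%:M) -> forall Y, \tr Y = 0 -> V Y.
Proof.
move=> two VL Vlie VB Bn.
have V0 : V 0 by rewrite -(subrr B) -scaleN1r addrC; exact: VL.
have VZ a X : V X -> V (a *: X) by move=> VX; rewrite -[_ *: _]addr0; exact: VL.
have VZu a X : a != 0 -> V (a *: X) -> V X.
  by move=> a0 /(VZ a^-1); rewrite scalerA mulVf// scale1r.
have VN X : V X -> V (- X) by rewrite -scaleN1r; exact: VZ.
pose E (i j : 'I_n) : 'M[K]_n := delta_mx i j.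
have trE i j : i != j -> \tr (E i j) = 0.
  by move=> ij; rewrite /mxtrace big1// => l _; rewrite mxE; case: eqP => // ->; rewrite (negbTE ij).
have EM i j k l : E i j *m E k l = (j == k)%:R *: E i l.
  have [->|jk] := eqVneq j k; first by rewrite mul_delta_mx scale1r.
  by rewrite mul_delta_mx_0// scale0r.
(* Since E_ij has square zero, ad(E_ij)^2 X is -2 E_ij X E_ij, which retains the single entry
   X_ji. *)
have flip i j X : i != j -> V X -> X j i != 0 -> V (E i j).
  move=> ij VX Xij; apply: (VZu (-2 * X j i)); first by rewrite mulf_neq0// oppr_eq0.
  have := Vlie _ _ (trE _ _ ij) (Vlie _ _ (trE _ _ ij) VX).
  have -> : lie (E i j) (lie (E i j) X) = (-2 * X j i) *: E i j => //.
  have EXE : E i j *m X *m E i j = X j i *: E i j by exact: delta_sandwich.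
  rewrite /lie mulmxBr mulmxBl !mulmxA EXE -(mulmxA X) EM [j == i]eq_sym (negbTE ij) !scale0r mul0mx mulmx0 sub0r subr0.
  by rewrite -scaleNr -scalerDl; congr (_ *: _); ring.
have [a [b [ab Vab]]] : exists a b, a != b /\ V (E a b).
  have [i [j [ij [Bij|Bij]]]] := nonscalar_entries Bn.
    by exists j, i; rewrite eq_sym; split=> //; apply: (flip _ _ B) => //; rewrite eq_sym.
  have [Bij0|Bij0] := eqVneq (B i j) 0; last first.
    by exists j, i; rewrite eq_sym; split=> //; apply: (flip _ _ B) => //; rewrite eq_sym.
  exists i, j; split=> //; apply: (flip _ _ (lie (E j i) B)); rewrite 1?trE// 1?eq_sym//.
    by apply: Vlie => //; rewrite trE// eq_sym.
  rewrite /lie mxE [X in _ + X]mxE mul_delta_mx_l mul_mx_delta !eqxx mul1r mulr1.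
  by rewrite eq_sym.
have row c i j : V (E i j) -> i != j -> j != c -> i != c -> V (E i c).
  move=> Vij ij jc ic; have := Vlie _ _ (trE _ _ jc) Vij; rewrite /lie !EM eqxx eq_sym (negbTE ic).
  by rewrite scale0r sub0r scale1r => /VN; rewrite opprK.
have col c i j : V (E i j) -> i != j -> c != i -> c != j -> V (E c j).
  move=> Vij ij ci cj; have := Vlie _ _ (trE _ _ ci) Vij; rewrite /lie !EM eqxx eq_sym (negbTE cj).
  by rewrite scale0r subr0 scale1r.
have sym i j : V (E i j) -> i != j -> V (E j i).
  by move=> Vij ij; apply: (flip _ _ (E i j)) => //; [rewrite eq_sym|rewrite mxE !eqxx oner_neq0].
have all c d : c != d -> V (E c d).
  move=> cd; have Vad : a != d -> V (E a d).
    by have [<-//|bd] := eqVneq b d; move=> ad; apply: row (Vab) _ _ _.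
  have [ad|ad] := eqVneq a d.
    have Vba := sym _ _ Vab ab; subst d.
    by have [->//|cb] := eqVneq c b; apply: col Vba _ _ _; rewrite // eq_sym.
  by have [->|ca] := eqVneq c a; [exact: Vad|apply: col (Vad ad) _ _ _].
move=> Y trY; have -> : Y = \sum_i \sum_j Y i j *: (if i == j then E i i - E a a else E i j).
  rewrite {1}[Y]matrix_sum_delta.
  have -> : \sum_(i < n) \sum_(j < n) Y i j *: (if i == j then E i i - E a a else E i j) =
      \sum_i \sum_j Y i j *: E i j - \sum_i \sum_j Y i j *: (if i == j then E a a else 0).
    rewrite -sumrB; apply: eq_bigr => i _; rewrite -sumrB; apply: eq_bigr => j _.
    by rewrite -scalerBr; case: eqP => [->|]; rewrite ?subr0.
  have -> : \sum_i \sum_j Y i j *: (if i == j then E a a else 0) = \tr Y *: E a a.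
    rewrite /mxtrace scaler_suml; apply: eq_bigr => i _.
    rewrite (bigD1 i)//= eqxx big1 ?addr0// => j ji; rewrite eq_sym (negbTE ji) scaler0.
    by [].
  by rewrite trY scale0r subr0.
have VD X Z : V X -> V Z -> V (X + Z) by move=> VX VZ'; rewrite -[X]scale1r; exact: VL.
apply: big_ind => // i _; apply: big_ind => // j _; apply: VZ.
case: eqP => [_|/eqP]; last exact: all.
have [->|ia] := eqVneq i a; first by rewrite subrr.
have := Vlie _ _ (trE _ _ ia) (all a i _); rewrite eq_sym => /(_ ia).
by rewrite /lie !EM !eqxx !scale1r.
Qed.

Section SymplecticIdeal.
Variables (K : fieldType) (n : nat) (J : 'M[K]_n).
Hypothesis two : (2 : K) != 0.
Hypothesis J_unit : J \in unitmx.
Hypothesis J_alt : J^T = - J.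
Variable I : 'M[K]_n -> Prop.
Hypothesis IL : forall a X Y, I X -> I Y -> I (a *: X + Y).
Hypothesis I_skew : forall X, I X -> skew J X.
Hypothesis I_lie : forall X Y, skew J X -> I Y -> I (lie X Y).
Local Notation b := (pairing J).
Local Notation rk := (rank_one J).
Implicit Types (v w x z : 'cV[K]_n).

Let inner (r : 'rV[K]_n) (x : 'cV[K]_n) : r *m x = ((r *m x) 0 0)%:M.
Proof. exact: mul_rv_cv. Qed.

Let bC v w : b v w = - b w v.
Proof.
have -> : b v w = ((v^T *m J *m w)^T) 0 0 by rewrite mxE.
by rewrite !trmx_mul J_alt trmxK mulNmx mulmxN mulmxA mxE.
Qed.

Let bvv v : b v v = 0.
Proof.
have /eqP := bC v v; rewrite -subr_eq0 opprK -mulr2n -mulr_natl mulf_eq0 (negbTE two) /=.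
by move/eqP.
Qed.

Let rkX v w X x z : rk v w *m X *m rk x z = (w^T *m J *m X *m x) 0 0 *: rk v z.
Proof.
transitivity (v *m (w^T *m J *m X *m x) *m (z^T *m J)); first by rewrite /rk !mulmxA.
by rewrite [w^T *m J *m X *m x in X in X = _]inner mul_mx_scalar -scalemxAl mulmxA.
Qed.

Let rkM v w x z : rk v w *m rk x z = b w x *: rk v z.
Proof. by rewrite -[rk v w]mulmx1 rkX mulmx1. Qed.

Let s v w : 'M[K]_n := rk v w + rk w v.

Let s_skew v w : skew J (s v w).
Proof.
apply/(skewE J_unit); rewrite /s /rk linearD /= !trmx_mul !trmxK J_alt mulmxDl mulmxDr !mulNmx !mulmxA.
by rewrite [X in _ + X]addrC addrACA !addNr addr0.
Qed.

Let e_skew v : skew J (rk v v).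
Proof.
have -> : rk v v = 2^-1 *: s v v + 0; last first.
  apply: skew_lin; first exact: s_skew.
  by rewrite /skew /adjoint trmx0 mulmx0 mul0mx oppr0.
by rewrite addr0 /s scalerDr -scalerDl -mulr2n -[2^-1 *+ 2]mulr_natr mulVf// scale1r.
Qed.

Let I0 Y : I Y -> I 0.
Proof. by move=> IY; rewrite -(subrr Y) -scaleN1r addrC; exact: IL. Qed.

Let IZ a X : I X -> I (a *: X).
Proof. by move=> IX; rewrite -[_ *: _]addr0; apply: (IL) => //; exact: I0 IX. Qed.

Let IZu a X : a != 0 -> I (a *: X) -> I X.
Proof. by move=> a0 /(IZ a^-1); rewrite scalerA mulVf// scale1r. Qed.

Let ID X Y : I X -> I Y -> I (X + Y).
Proof. by move=> IX; rewrite -[X]scale1r; exact: IL. Qed.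

Let exists_e X : I X -> X != 0 -> exists v, v != 0 /\ I (rk v v).
Proof.
move=> IX X0.
pose S := J *m X.
have SC i j : S i j = S j i.
  have : S^T = S.
    have /(skewE J_unit)/eqP := I_skew IX; rewrite addr_eq0 => /eqP E.
    by rewrite /S trmx_mul J_alt mulmxN E opprK.
  by move/matrixP/(_ j i); rewrite mxE.
have SE i j : ((delta_mx i 0 : 'cV_n)^T *m S *m (delta_mx j 0 : 'cV_n)) 0 0 = S i j.
  by rewrite trmx_delta -rowE -colE !mxE.
have [i [j Sij]] : exists i j, S i j != 0.
  have : S != 0 by apply: contraNneq X0 => S0; rewrite -[X](mulKmx J_unit) -/S S0 mulmx0.
  by move/matrix0Pn.
have [v Sv] : exists v, (v^T *m S *m v) 0 0 != 0.
  have [Sii|Sii] := eqVneq (S i i) 0; last by exists (delta_mx i 0); rewrite SE.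
  have [Sjj|Sjj] := eqVneq (S j j) 0; last by exists (delta_mx j 0); rewrite SE.
  exists (delta_mx i 0 + delta_mx j 0); rewrite [(_ + _)^T]linearD /= !mulmxDl !mulmxDr.
  have mxD (P Q : 'M[K]_1) : (P + Q) 0 0 = P 0 0 + Q 0 0 by rewrite mxE.
  by rewrite !mxD !SE Sii Sjj add0r addr0 (SC j i) -mulr2n -mulr_natl mulf_neq0.
rewrite /S !mulmxA in Sv.
exists v; split; first by apply: contraNneq Sv => ->; rewrite mulmx0 mxE.
apply: (IZu (a := - 2 * (v^T *m J *m X *m v) 0 0)); first by rewrite mulf_neq0// oppr_eq0.
have := I_lie (e_skew v) (I_lie (e_skew v) IX).
have -> // : lie (rk v v) (lie (rk v v) X) = (- 2 * (v^T *m J *m X *m v) 0 0) *: rk v v.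
have ee : rk v v *m rk v v = 0 by rewrite rkM bvv scale0r.
move: (rk v v) ee (rkX v v X v v) => e ee eXe.
rewrite /lie mulmxBr mulmxBl !mulmxA eXe -(mulmxA X) ee mul0mx mulmx0 sub0r subr0.
by rewrite -scaleNr -scalerDl; congr (_ *: _); ring.
Qed.

(** Two brackets with the transvection of w move v to w when the two pair nontrivially. Any two
    nonzero vectors are then linked through a third that pairs with both. *)
Let spread v w : I (rk v v) -> b w v != 0 -> I (rk w w).
Proof.
move=> Iv wv; have := I_lie (e_skew w) Iv.
have -> : lie (rk w w) (rk v v) = b w v *: s v w.
  by rewrite /lie !rkM (bC v w) /s scaleNr opprK -scalerDr addrC.
move/(IZu wv)/(I_lie (e_skew w)).
have -> : lie (rk w w) (s v w) = (2 * b w v) *: rk w w.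
  rewrite /lie /s mulmxDr mulmxDl !rkM bvv !scale0r addr0 add0r (bC v w) -scaleNr opprK -scalerDl.
  by congr (_ *: _); ring.
by apply: IZu; rewrite mulf_neq0.
Qed.

Let b_dual w : w != 0 -> exists u, b u w != 0.
Proof.
move=> w0; apply: contrapT => /forallNP H; move/eqP: w0; apply.
suff Jw : J *m w = 0 by rewrite -[w](mulKmx J_unit) Jw mulmx0.
apply/colP => i; rewrite [RHS]mxE; have /negP := H (delta_mx i 0); rewrite negbK => /eqP <-.
by rewrite /pairing trmx_delta -mulmxA -rowE !mxE.
Qed.

Let bD u u' w : b (u + u') w = b u w + b u' w.
Proof. by rewrite /pairing linearD /= !mulmxDl mxE. Qed.

Theorem symplectic_ideal X : I X -> X != 0 -> forall Y, skew J Y -> I Y.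
Proof.
move=> IX X0 Y sY; have [v [v0 Iv]] := exists_e IX X0.
have Ie w : I (rk w w).
  have [->|w0] := eqVneq w 0; first by rewrite /rk mul0mx mul0mx; exact: I0 IX.
  have [u uv uw] : exists2 u, b u v != 0 & b u w != 0.
    have [u1 uv] := b_dual v0; have [u2 uw] := b_dual w0.
    have [u1w|u1w] := eqVneq (b u1 w) 0; last by exists u1.
    have [u2v|u2v] := eqVneq (b u2 v) 0; last by exists u2.
    by exists (u1 + u2); rewrite bD ?u2v ?u1w ?addr0 ?add0r.
  by apply: spread (spread Iv uv) _; rewrite bC oppr_eq0.
have Is v' w : I (s v' w).
  have -> : s v' w = (-1) *: rk v' v' + ((-1) *: rk w w + rk (v' + w) (v' + w)).
    rewrite /s /rk [(_ + _)^T]linearD /= mulmxDl !mulmxDr !mulmxDl !scaleN1r.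
    move: (v' *m _ *m J) (v' *m _ *m J) (w *m _ *m J) (w *m _ *m J) => X1 X2 X3 X4.
    by apply/matrixP => i j; rewrite !mxE; ring.
  by do 2 (apply: IL; first exact: Ie).
pose M := Y *m invmx J.
have MT : M^T = M.
  move/(skewE J_unit)/eqP: sY; rewrite addr_eq0 => /eqP sY.
  have JiT : (invmx J)^T = - invmx J.
    by rewrite (@invJ_sym _ _ J (-1) J_unit) ?scaleN1r// mulrNN mulr1.
  by rewrite /M trmx_mul JiT mulNmx -[Y^T](mulmxK J_unit) sY mulNmx mulmxN opprK -mulmxA mulKmx.
have -> : Y = 2^-1 *: \sum_i \sum_j M i j *: s (delta_mx i 0) (delta_mx j 0).
  have sE i j : s (delta_mx i 0) (delta_mx j 0) = (delta_mx i j + delta_mx j i) *m J.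
    by rewrite /s /rk !trmx_delta !mul_delta_mx mulmxDl.
  have -> : \sum_i \sum_j M i j *: s (delta_mx i 0) (delta_mx j 0) = (M + M^T) *m J.
    have -> : M + M^T = \sum_i \sum_j M i j *: (delta_mx i j + delta_mx j i).
      rewrite {1}[M]matrix_sum_delta [X in _ + X^T]matrix_sum_delta linear_sum -big_split /=.
      apply: eq_bigr => i _; rewrite linear_sum -big_split; apply: eq_bigr => j _ /=.
      by rewrite linearZ /= trmx_delta scalerDr.
    rewrite mulmx_suml; apply: eq_bigr => i _; rewrite mulmx_suml; apply: eq_bigr => j _.
    by rewrite sE -scalemxAl.
  by rewrite MT -mulr2n -scaler_nat -scalemxAl scalerA mulVf// scale1r mulmxKV.
apply: IZ; apply: (big_ind I); [exact: I0 IX|move=> ? ?; exact: ID|move=> i _].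
apply: (big_ind I); [exact: I0 IX|move=> ? ?; exact: ID|move=> j _; exact: IZ].
Qed.

End SymplecticIdeal.

(** * Independence of the jets of a cyclic solution *)

Section CyclicSolution.
Variables (K L : fieldType) (io : {rmorphism K -> L}).
Variables (sK : {rmorphism K -> K}) (sKi : K -> K) (sL : {rmorphism L -> L}).
Variables (dK : {additive K -> K}) (dL : {additive L -> L}).
Hypothesis dLM : forall x y, dL (x * y) = dL x * y + x * dL y.
Hypothesis sKK : forall x, sK (sKi x) = x.
Hypothesis io_s : forall x, sL (io x) = io (sK x).
Hypothesis io_d : forall x, dL (io x) = io (dK x).
Hypothesis sd : forall x, sL (dL x) = dL (sL x).
Hypothesis char0 : forall k, k.+1%:R != 0 :> K.
Variable rt : {rmorphism rat -> L}.
Hypothesis log_dec : forall al : L, al != 0 -> exists d u, exists m : rat,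
  [/\ d != 0, u != 0, dL u = rt m * u & al * d = u * sL d].
Hypothesis dL_eq0 : forall u, dL u = 0 -> exists c, u = io c.
Hypothesis sL_fixed : forall u, sL u = u -> dL u = 0.
Hypothesis sL_coboundary : forall u (r : rat), sL u - u = rt r -> r = 0.
Hypothesis stable_closed : forall s : seq L,
  (forall y, y \in s -> kspan io s (sL y) /\ kspan io s (dL y)) ->
  exists e : seq L, (forall x y, x \in e -> y \in e -> kspan io e (x * y)) /\
    forall y, y \in s -> kspan io e y.

Section ScalarCocycle.
Variable n : nat.
Variables (A Ai : 'M[K]_n) (f : 'I_n -> L).
Hypothesis AAi : A *m Ai = 1%:M.
Hypothesis AiA : Ai *m A = 1%:M.
Hypothesis sf : forall i, sL (f i) = \sum_j io (A i j) * f j.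
Local Notation c := (Ai *m map_mx dK A).
Local Notation mtau := (@mtau n K sK A Ai).
Variable r : nat.
Hypothesis indep : forall p : mpoly #|{: 'I_n * 'I_1}| K,
  ev_at io (jets dL f) p = 0 -> no_rows r p -> p = 0.

(** A stable space lies in a finite K-algebra, so a linear relation over it has a norm, a nonzero
    polynomial over K vanishing at f; this contradicts algebraic independence. *)
Lemma stable_relation (s : seq L) (w : 'I_n -> L) (i0 : 'I_n) :
  (forall y, y \in s -> kspan io s (sL y) /\ kspan io s (dL y)) ->
  (forall i, kspan io s (w i)) -> \sum_(i < n | (i < r)%N) w i * f i = 0 ->
  (i0 < r)%N -> w i0 = 0.
Proof.
move=> /stable_closed[e [eM se]] ws wf ir; apply: contrapT => /eqP w0.
have we i : kspan io e (w i).
  apply: (@kspan_ind_sub _ _ io s (fun y => kspan io e y)) (ws i) => //; first exact: kspan0.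
  by move=> a y z ey ez; apply: kspanD => //; exact: kspanZ.
have [p [p0 pr pe]] := rational_relation eM we wf ir w0.
by move/eqP: p0; apply; apply: indep => //; exact: pe.
Qed.

(** The equation for B says that delta - B commutes with v |-> A^-1 sigma(v) up to lam, and f is
    fixed by the latter. So a multiple d f lies in a stable space, where f_i0 f_i1 - f_i1 f_i0 = 0
    is a forbidden relation. *)
Theorem scalar_cocycle (B : 'M[K]_n) (lam al : K) (M : nat) (i0 i1 : 'I_n) :
  mtau B - B = c - lam%:M -> io lam *+ M.+1 = dL (io al) / io al -> al != 0 ->
  i0 != i1 -> (i0 < r)%N -> (i1 < r)%N -> f i0 != 0 -> f i1 != 0 -> False.
Proof.
move=> BE lam_al al0 i01 r0 r1 f0 f1.
pose tau (v : 'cV[L]_n) : 'cV[L]_n := map_mx io Ai *m map_mx sL v.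
pose nabla (v : 'cV[L]_n) : 'cV[L]_n := map_mx dL v - map_mx io B *m v.
have dLmx (X : 'M[L]_n) (Y : 'cV[L]_n) : map_mx dL (X *m Y) = map_mx dL X *m Y + X *m map_mx dL Y.
  apply/matrixP => i j; rewrite !mxE raddf_sum -big_split; apply: eq_bigr => k _.
  by rewrite !mxE dLM.
have dio (X : 'M[K]_n) : map_mx dL (map_mx io X) = map_mx io (map_mx dK X).
  by apply/matrixP => i j; rewrite !mxE io_d.
have sio (X : 'M[K]_n) : map_mx sL (map_mx io X) = map_mx io (map_mx sK X).
  by apply/matrixP => i j; rewrite !mxE io_s.
have dKmx (X Y : 'M[K]_n) : map_mx dK (X *m Y) = map_mx dK X *m Y + X *m map_mx dK Y.
  apply/matrixP => i j; rewrite !mxE raddf_sum -big_split; apply: eq_bigr => k _.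
  rewrite !mxE; apply: (fmorph_inj io); rewrite -io_d !rmorphM dLM !io_d rmorphD !rmorphM.
  by [].
have dAi : map_mx dK Ai = - (c *m Ai).
  have := dKmx Ai A; rewrite AiA.
  have -> : map_mx dK (1%:M : 'M[K]_n) = 0.
    apply/matrixP => i j; rewrite !mxE; apply: (fmorph_inj io).
    rewrite -io_d rmorph_nat rmorph0; case: (_ == _); last by rewrite raddf0.
    by apply: (addrI (dL 1)); rewrite addr0 -{3}[1]mulr1 dLM mulr1 mul1r.
  move/esym/eqP; rewrite addr_eq0 => /eqP H.
  by rewrite -[LHS]mulmx1 -AAi mulmxA H mulNmx.
pose V := 'cV[L]_n.
have [|||||||||||||d d0 [s [ss ds]]] := @rational_direction K L io sL dL dLM sd rt log_dec
  dL_eq0 sL_fixed sL_coboundary V tau nabla _ _ _ _ 'I_n (fun i v => v i 0)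
  (fun i k => A i k) (fun i k => B i k) _ _ _ _ (fun=> True) _ _ M lam al 1 (\col_i f i)
  _ lam_al al0 (oner_neq0 _) I _ i0 _.
- by move=> u v; rewrite /tau map_mxD mulmxDr.
- by move=> a v; rewrite /tau map_mxZ -scalemxAr.
- by move=> u v; rewrite /nabla map_mxD mulmxDr opprD addrACA.
- move=> a v; rewrite /nabla -scalemxAr scalerBr addrA; congr (_ - _).
  by apply/matrixP => i j; rewrite !mxE dLM.
- by move=> i u v; rewrite mxE.
- by move=> i a v; rewrite mxE.
- move=> i v; have -> : sL (v i 0) = (map_mx io A *m tau v) i 0.
    by rewrite /tau mulmxA -map_mxM AAi map_mx1 mul1mx mxE.
  by rewrite mxE; apply: eq_bigr => k _; rewrite mxE.
- move=> i v; rewrite /nabla mxE [X in X + _ + _]mxE [X in _ + X + _]mxE [X in _ - X + _]mxE.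
  rewrite [X in _ = _ + X](_ : _ = \sum_j map_mx io B i j * v j 0) ?subrK//.
  by apply: eq_bigr => k _; rewrite mxE.
- by [].
- by [].
- move=> v _; rewrite /nabla /tau.
  rewrite raddfB /= map_mxM sio !mulmxBr !mulmxA dLmx dio dAi map_mxN map_mxM.
  have -> : map_mx sL (map_mx dL v) = map_mx dL (map_mx sL v).
    by apply/matrixP => i j; rewrite !mxE sd.
  have mB : Ai *m map_mx sK B = (B + c - lam%:M) *m Ai.
    rewrite -[LHS]mulmx1 -AAi mulmxA -/(mtau B); congr (_ *m _).
    by rewrite -[LHS](subrK B) BE addrC addrA.
  have -> : map_mx io Ai *m map_mx io (map_mx sK B) =
      map_mx io B *m map_mx io Ai + map_mx io c *m map_mx io Ai - io lam *: map_mx io Ai.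
    by rewrite -(map_mxM io Ai) mB map_mxM map_mxB map_mxD map_scalar_mx mulmxBl mulmxDl mul_scalar_mx.
  rewrite mulmxBl mulmxDl mulNmx -scalemxAl.
  move: (_ *m map_mx dL _) (map_mx io B *m _ *m _) (map_mx io c *m _ *m _) (_ *: _).
  by move=> X1 X2 X3 X4; apply/matrixP => i j; rewrite !mxE; ring.
- rewrite scale1r; apply/matrixP => i j; rewrite /tau mxE.
  have -> : map_mx sL (\col_i f i) = map_mx io A *m \col_i f i.
    by apply/matrixP => i' j'; rewrite !mxE sf; apply: eq_bigr => k _; rewrite !mxE.
  transitivity ((map_mx io Ai *m (map_mx io A *m \col_i f i)) i j); first by rewrite mxE.
  by rewrite mulmxA -map_mxM AiA map_mx1 mul1mx.
- by rewrite mxE.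
have {}ds i : d * f i \in s by have := ds i; rewrite mxE.
pose w i := if i == i0 then d * f i1 else if i == i1 then - (d * f i0) else 0.
have : w i0 = 0.
  apply: (stable_relation (s := s)) (r0) => // [i|].
    rewrite /w; case: ifP => _; first exact: kspan_gen.
    case: ifP => _; last exact: kspan0.
    by rewrite -mulN1r -(rmorphN1 io); apply: kspanZ; exact: kspan_gen.
  rewrite (bigD1 i0)//= (bigD1 i1)/= ?r1 1?eq_sym// big1 ?addr0.
    by rewrite /w eqxx eq_sym (negbTE i01) eqxx; ring.
  by move=> i /andP[/andP[_ h0] h1]; rewrite /w (negbTE h0) (negbTE h1) mul0r.
by rewrite /w eqxx => /eqP; rewrite mulf_eq0 (negbTE d0) (negbTE f1).
Qed.

End ScalarCocycle.

Section IsotropicPlane.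
Variable n' : nat.
Local Notation n := n'.+1.
Variables (A Ai : 'M[K]_n) (fv : 'I_n -> L).
Hypothesis AAi : A *m Ai = 1%:M.
Hypothesis AiA : Ai *m A = 1%:M.
Hypothesis sf : forall i, sL (fv i) = \sum_j io (A i j) * fv j.
Local Notation c := (Ai *m map_mx dK A).
Local Notation mtau := (@mtau n K sK A Ai).
Hypothesis indep : forall p : mpoly #|{: 'I_n * 'I_1}| K,
  ev_at io (jets dL fv) p = 0 -> no_rows n' p -> p = 0.
Hypothesis two : (2 : L) != 0.
Variables (J : 'M[K]_n) (kappa : K).
Hypothesis J_unit : J \in unitmx.
Hypothesis J_sym : J^T = J.
Hypothesis kappa0 : kappa != 0.
Hypothesis J_kappa : A^T *m map_mx sK J *m A = kappa *: J.
Variable I : 'M[K]_n -> Prop.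
Hypothesis I_skew : forall X, I X -> skew J X.
Hypothesis I_tau : forall Y, I Y -> exists2 Y', I Y' & mtau Y' = Y.
Hypothesis I_perfect : forall M : 'M[K]_n -> Prop, M 0 ->
  (forall a Y Z, M Y -> M Z -> M (a *: Y + Z)) ->
  (forall Y Z, I Y -> I Z -> M (lie Y Z)) -> forall Y, I Y -> M Y.
Variables (B e : 'M[K]_n) (lam : K).
Hypothesis B_tau : mtau B - B = c + e - lam%:M.
Hypothesis I_e : I e.
Hypothesis I_nabla : forall Y, I Y -> I (map_mx dK Y - lie B Y).
Local Notation mio := (map_mx io).
Local Notation q := (form (mio J)).
Local Notation g := (infinitesimal_rotation (mio J)).
Local Notation f := (\col_i fv i).
Hypothesis Jf_last : \sum_k io (J ord_max k) * fv k != 0.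
Variable h : 'cV[L]_n.
Let orth x := forall Y, I Y -> q x (mio Y *m f) = 0.
Hypothesis hf : forall a, h != a *: f.
Hypothesis ff : q f f = 0.
Hypothesis orthE : forall x, orth x <-> q x f = 0 /\ q x h = 0.
Hypothesis orth_span : forall x, orth x -> exists a b, x = a *: f + b *: h.
Hypothesis oh : orth h.
Hypothesis n4 : n = 4.

Let f_neq0 : f != 0.
Proof.
apply: contraNneq Jf_last => f0; apply/eqP; apply: big1 => k _.
by have /colP/(_ k) := f0; rewrite !mxE => ->; rewrite mulr0.
Qed.

Let JL_unit : mio J \in unitmx. Proof. by rewrite map_unitmx. Qed.
Let JL_sym : (mio J)^T = mio J. Proof. by rewrite map_trmx J_sym. Qed.

Let skew_io Y : I Y -> skew (mio J) (mio Y).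
Proof.
move=> /I_skew/(skewE J_unit) E; apply/(skewE JL_unit).
by rewrite map_trmx -!map_mxM -map_mxD E map_mx0.
Qed.

Let sio (X : 'M[K]_n) : map_mx sL (mio X) = mio (map_mx sK X).
Proof. by apply/matrixP => i j; rewrite !mxE io_s. Qed.

Let dio (X : 'M[K]_n) : map_mx dL (mio X) = mio (map_mx dK X).
Proof. by apply/matrixP => i j; rewrite !mxE io_d. Qed.

Let dLmx (X Y : 'M[L]_n) : map_mx dL (X *m Y) = map_mx dL X *m Y + X *m map_mx dL Y.
Proof.
apply/matrixP => i j; rewrite !mxE raddf_sum -big_split; apply: eq_bigr => k _.
by rewrite !mxE dLM.
Qed.

Let dL_lie (X Y : 'M[L]_n) : map_mx dL (lie X Y) = lie (map_mx dL X) Y + lie X (map_mx dL Y).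
Proof.
rewrite /lie raddfB /= !dLmx.
move: (_ *m _) (_ *m _) (_ *m _) (_ *m _) => X1 X2 X3 X4.
by apply/matrixP => i j; rewrite !mxE; ring.
Qed.

Let sf_col : map_mx sL f = mio A *m f.
Proof. by apply/colP => i; rewrite !mxE sf; apply: eq_bigr => k _; rewrite !mxE. Qed.

Let io_lie (X Y : 'M[K]_n) : mio (lie X Y) = lie (mio X) (mio Y).
Proof. by rewrite /lie map_mxB !map_mxM. Qed.

(** The bivector of the plane of f and h, as a skew matrix. The plane is determined up to sigma, h
    alone is not, so the descent argument is run with [x0] in the space of matrices. *)
Let x0 := g f h.
Let h' := mio Ai *m map_mx sL h.
Let tau (X : 'M[L]_n) := mio Ai *m map_mx sL X *m mio A.
Let nabla (X : 'M[L]_n) := map_mx dL X - lie (mio B) X.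
(** [tau] and [nabla] commute only up to the bracket with an element of I, so they are restricted to
    the centralizer of I. *)
Let S (X : 'M[L]_n) := forall Y, I Y -> lie (mio Y) X = 0.

Let JkL : (mio A)^T *m map_mx sL (mio J) *m mio A = io kappa *: mio J.
Proof. by rewrite sio map_trmx -!map_mxM J_kappa map_mxZ. Qed.

Let sh : map_mx sL h = mio A *m h'.
Proof. by rewrite /h' mulmxA -map_mxM AAi map_mx1 mul1mx. Qed.

Let orth_h' : orth h'.
Proof.
move=> Y IY; have [Y' IY' <-] := I_tau IY.
have : io kappa * q h' (mio (mtau Y') *m f) = 0.
  transitivity ((h'^T *m (io kappa *: mio J) *m (mio (mtau Y') *m f)) 0 0).
    by rewrite -scalemxAr -scalemxAl [RHS]mxE.
  rewrite -JkL /mtau !map_mxM -!mulmxA -sf_col (mulmxA (mio A) (mio Ai)) -map_mxM AAi map_mx1 mul1mx.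
  rewrite !mulmxA -trmx_mul -sh -sio map_trmx -!map_mxM mxE.
  by have := oh IY'; rewrite /form mulmxA => ->; rewrite rmorph0.
by move/eqP; rewrite mulf_eq0 fmorph_eq0 (negbTE kappa0) => /eqP.
Qed.

Let rotation_self : g f f = 0. Proof. exact: subrr. Qed.

Let rotationDr a b d : g a (b + d) = g a b + g a d.
Proof.
rewrite /g linearD /= mulmxDr !mulmxDl.
move: (_ *m mio J) (_ *m mio J) (_ *m mio J) (_ *m mio J) => X1 X2 X3 X4.
by apply/matrixP => i j; rewrite !mxE; ring.
Qed.

Let rotationZr a s b : g a (s *: b) = s *: g a b.
Proof. by rewrite /g linearZ /= -scalemxAr -!scalemxAl scalerBr. Qed.

Let rotationN a b : g a b = - g b a. Proof. by rewrite /g opprB. Qed.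

Let x0_neq0 : x0 != 0.
Proof.
apply/eqP => E; have h0 : h != 0 by have := hf 0; rewrite scale0r.
have [b bh] := form_dual JL_unit JL_sym h0.
have := congr1 (mulmx^~ b) E; rewrite mul0mx rotation_mul (formC JL_sym h) bh scale1r => /eqP.
rewrite subr_eq0 => /eqP fE; have [fb|fb] := eqVneq (q f b) 0.
  by move: f_neq0; rewrite fE fb scale0r eqxx.
by move/eqP: (hf (q f b)^-1); apply; rewrite {2}fE scalerA mulVf// scale1r.
Qed.

Let tau_x0 : exists2 rho, rho != 0 & tau x0 = rho *: x0.
Proof.
have [a [b hE]] := orth_span orth_h'.
have E : tau x0 = (io kappa * b) *: x0.
  transitivity (io kappa *: g f h'); last first.
    by rewrite hE rotationDr !rotationZr rotation_self scaler0 add0r scalerA.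
  rewrite /tau /x0 /g map_mxB !map_mxM -!map_trmx sf_col sh !(trmx_mul (mio A)).
  have aux x y : mio Ai *m (mio A *m x *m (y^T *m (mio A)^T) *m map_mx sL (mio J)) *m mio A =
      io kappa *: (x *m y^T *m mio J).
    rewrite !mulmxA -map_mxM AiA map_mx1 mul1mx scalemxAr -JkL -!mulmxA.
    by [].
  by rewrite mulmxBr mulmxBl !aux -scalerBr.
exists (io kappa * b) => //; apply: contraNneq x0_neq0 => rho0.
have : map_mx sL x0 = 0.
  have -> : map_mx sL x0 = mio A *m tau x0 *m mio Ai.
    rewrite /tau !mulmxA -map_mxM AAi map_mx1 mul1mx -mulmxA -map_mxM AAi map_mx1 mulmx1.
    by [].
  by rewrite E rho0 scale0r mulmx0 mul0mx.
by move/eqP; rewrite map_mx_eq0.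
Qed.

(** I preserves the plane, so it acts on the bivector by scalars; scalars commute and I is perfect,
    so it acts by zero. *)
Let S_x0 : S x0.
Proof.
have lamP Y : I Y -> exists a, lie (mio Y) x0 = a *: x0.
  move=> IY; have sY := skew_io IY.
  have Yf : orth (mio Y *m f).
    apply/orthE; rewrite (skew_form JL_unit)// (skew_form0 two JL_unit JL_sym)// oppr0.
    by split=> //; rewrite (formC JL_sym); exact: oh.
  have Yh : orth (mio Y *m h).
    apply/orthE; rewrite (skew_form JL_unit)// oh// oppr0; split=> //.
    by rewrite (formC JL_sym) (skew_form0 two JL_unit JL_sym).
  have [a [b E1]] := orth_span Yf; have [a' [b' E2]] := orth_span Yh.
  exists (a + b'); rewrite (lie_rotation_skew JL_unit)// E1 E2.
  rewrite (rotationN _ h) !rotationDr !rotationZr (rotationN h f) /x0 !rotation_self.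
  have -> : g h h = 0 by exact: subrr.
  by rewrite !scaler0 addr0 add0r scalerN opprK -scalerDl.
apply: I_perfect => [|a Y Z HY HZ|Y Z IY IZ].
- by rewrite map_mx0 /lie mul0mx mulmx0 subrr.
- by rewrite map_mxD map_mxZ lieDl lieZl HY HZ scaler0 addr0.
have [a aY] := lamP Y IY; have [b bZ] := lamP Z IZ.
have := lie_jacobi (mio Y) (mio Z) x0; rewrite bZ lieZr aY lieZr bZ !scalerA => E.
by rewrite io_lie; apply: (addIr ((a * b) *: x0)); rewrite add0r -E mulrC.
Qed.

Let S_nabla X : S X -> S (nabla X).
Proof.
move=> SX Y IY.
have dX : lie (mio Y) (map_mx dL X) = - lie (mio (map_mx dK Y)) X.
  have := dL_lie (mio Y) X; rewrite SX// dio.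
  have -> : map_mx dL (0 : 'M[L]_n) = 0 by apply/matrixP => i j; rewrite !mxE raddf0.
  by move/esym/addr0_eq.
have := SX _ (I_nabla IY); rewrite map_mxB io_lie lieDl.
have -> : lie (- lie (mio B) (mio Y)) X = - lie (lie (mio B) (mio Y)) X.
  by rewrite -scaleN1r lieZl scaleN1r.
move=> E; rewrite /nabla lieDr dX.
have -> : lie (mio Y) (- lie (mio B) X) = - lie (mio Y) (lie (mio B) X).
  by rewrite -scaleN1r lieZr scaleN1r.
rewrite lie_jacobi (SX Y IY).
have -> : lie (mio B) 0 = 0 by rewrite /lie mulmx0 mul0mx subrr.
rewrite addr0 -opprD -(lieN (mio B)).
have -> : lie (- lie (mio B) (mio Y)) X = - lie (lie (mio B) (mio Y)) X.
  by rewrite -scaleN1r lieZl scaleN1r.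
by rewrite E oppr0.
Qed.

Let comm X : S X -> tau (nabla X) = nabla (tau X) + io 0 *: tau X.
Proof.
move=> SX; have [e' Ie' ee'] := I_tau I_e.
have tau_lie (Y : 'M[L]_n) Z : tau (lie Y Z) = lie (tau Y) (tau Z).
  have tauM Y' Z' : tau (Y' *m Z') = tau Y' *m tau Z'.
    rewrite /tau map_mxM !mulmxA -(mulmxA _ (mio A) (mio Ai)) -map_mxM AAi map_mx1 mulmx1.
    by [].
  rewrite /lie -!tauM /tau map_mxB mulmxBr mulmxBl.
  by [].
have etau : lie (mio e) (tau X) = 0.
  have := tau_lie (mio e') X; rewrite SX// /tau raddf0 mulmx0 mul0mx sio -!map_mxM -/(mtau e') ee'.
  by [].
have dAi : map_mx dL (mio Ai) = - (mio c *m mio Ai).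
  have := dLmx (mio Ai) (mio A); rewrite -map_mxM AiA dio.
  have -> : map_mx dK (1%:M : 'M[K]_n) = 0.
    apply/matrixP => i j; rewrite !mxE; apply: (fmorph_inj io).
    rewrite -io_d rmorph_nat rmorph0; case: (_ == _); last by rewrite raddf0.
    by apply: (addrI (dL 1)); rewrite addr0 -{3}[1]mulr1 dLM mulr1 mul1r.
  rewrite map_mx0 => /esym/eqP; rewrite addr_eq0 => /eqP H.
  rewrite -[LHS]mulmx1 -(map_mx1 io) -AAi map_mxM mulmxA H mulNmx dio -map_mxM.
  by [].
have dtau : map_mx dL (tau X) = tau (map_mx dL X) - lie (mio c) (tau X).
  rewrite {1}/tau !dLmx dAi dio.
  have -> : map_mx dL (map_mx sL X) = map_mx sL (map_mx dL X).
    by apply/matrixP => i j; rewrite !mxE sd.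
  have -> : mio (map_mx dK A) = mio A *m mio c by rewrite -map_mxM mulmxA AAi mul1mx.
  rewrite mulmxDl /lie /tau !mulmxA !mulNmx.
  by rewrite opprB addrA [RHS]addrAC [X in X + _ = _]addrC.
rewrite raddf0 scale0r addr0 /nabla.
have -> : tau (map_mx dL X - lie (mio B) X) = tau (map_mx dL X) - tau (lie (mio B) X).
  by rewrite /tau map_mxB mulmxBr mulmxBl.
have -> : tau (lie (mio B) X) = lie (mio (B + (c + e - lam%:M))) (tau X).
  by rewrite tau_lie /tau sio -!map_mxM -/(mtau B) -B_tau addrC subrK.
rewrite dtau map_mxD map_mxB (map_mxD io c e) map_scalar_mx !lieDl etau.
have -> : lie (- (io lam)%:M) (tau X) = 0.
  by rewrite /lie mulNmx mulmxN mul_scalar_mx mul_mx_scalar subrr.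
by rewrite !addr0 opprD addrA addrAC.
Qed.

Let x0_rational : exists2 d : L, d != 0 & exists s : seq L,
  (forall y, y \in s -> kspan io s (sL y) /\ kspan io s (dL y)) /\ forall i j, d * x0 i j \in s.
Proof.
have [rho rho0 tx0] := tau_x0; have /matrix0Pn[i0 [j0 x00]] := x0_neq0.
have [||||||||||d d0 [s [ss ds]]] := @rational_direction K L io sL dL dLM sd rt log_dec
  dL_eq0 sL_fixed sL_coboundary 'M[L]_n tau nabla _ _ _ _ ('I_n * 'I_n)%type (fun ij X => X ij.1 ij.2)
  (fun ij kl => A ij.1 kl.1 * Ai kl.2 ij.2)
  (fun ij kl => B ij.1 kl.1 * (kl.2 == ij.2)%:R - (ij.1 == kl.1)%:R * B kl.2 ij.2)
  _ _ _ _ S _ S_nabla 0%N 0 1 rho x0 comm _ (oner_neq0 _) rho0 S_x0 tx0 (i0, j0) x00.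
- by move=> X Y; rewrite /tau map_mxD mulmxDr mulmxDl.
- by move=> a X; rewrite /tau map_mxZ -scalemxAr -scalemxAl.
- by move=> X Y; rewrite /nabla map_mxD lieDr opprD addrACA.
- move=> a X; rewrite /nabla lieZr (scalerBr a (map_mx dL X)) addrA; congr (_ - _).
  by apply/matrixP => i j; rewrite !mxE dLM.
- by move=> [i j] X Y /=; rewrite mxE.
- by move=> [i j] a X /=; rewrite mxE.
- move=> [i j] X /=.
  have -> : sL (X i j) = (mio A *m tau X *m mio Ai) i j.
    by rewrite /tau !mulmxA -map_mxM AAi map_mx1 mul1mx -mulmxA -map_mxM AAi map_mx1 mulmx1 mxE.
  rewrite mxE; under [X in X = _]eq_bigr do rewrite [X in X * _]mxE mulr_suml.
  rewrite exchange_big pair_big /=; apply: eq_bigr => -[k l] _ /=.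
  by rewrite !mxE rmorphM mulrAC.
- move=> [i j] X /=.
  have -> : dL (X i j) = nabla X i j + lie (mio B) X i j by rewrite /nabla mxE mxE [X in _ + X + _]mxE subrK.
  congr (_ + _); rewrite /lie mxE [X in _ + X]mxE !mxE.
  have -> : \sum_l mio B i l * X l j = \sum_(kl : 'I_n * 'I_n) io (B i kl.1) * (kl.2 == j)%:R * X kl.1 kl.2.
    rewrite -(pair_big xpredT xpredT (fun k l => io (B i k) * (l == j)%:R * X k l)) /=.
    apply: eq_bigr => k _; rewrite (bigD1 j)//= eqxx mulr1 big1 ?addr0 ?mxE// => l lj.
    by rewrite (negbTE lj) mulr0 mul0r.
  have -> : \sum_l X i l * mio B l j = \sum_(kl : 'I_n * 'I_n) (i == kl.1)%:R * io (B kl.2 j) * X kl.1 kl.2.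
    rewrite -(pair_big xpredT xpredT (fun k l => (i == k)%:R * io (B l j) * X k l)) /=.
    rewrite [RHS](bigD1 i)//= eqxx [X in _ = _ + X]big1 ?addr0 => [|k ki].
      by apply: eq_bigr => l _; rewrite mul1r mxE mulrC.
    by apply: big1 => l _; rewrite eq_sym (negbTE ki) !mul0r.
  rewrite -sumrB; apply: eq_bigr => -[k l] _ /=.
  by rewrite rmorphB !rmorphM !rmorph_nat mulrBl.
- by move=> a X Y SX SY Z IZ; rewrite lieDr lieZr SX// SY// scaler0 addr0.
- by rewrite mulr1n rmorph0 rmorph1 (dL1 dLM) mul0r.
exists d => //; exists s; split=> // i j; exact: (ds (i, j)).
Qed.

(** The Pluecker coordinates of the plane: [x0] with J removed. *)
Let P i j : L := fv i * h j 0 - h i 0 * fv j.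

Let P_anti i j : P i j = - P j i.
Proof. by rewrite /P opprB mulrC [h i 0 * _]mulrC. Qed.

Let P_x0 i j : P i j = \sum_l io (invmx J l j) * x0 i l.
Proof.
transitivity ((x0 *m mio (invmx J)) i j); last by rewrite mxE; apply: eq_bigr => l _; rewrite mulrC [mio _ l j]mxE.
rewrite /x0 /g mulmxBl -!mulmxA -map_mxM mulmxV// map_mx1 !mulmx1.
by rewrite /P !mxE !big_ord1 !mxE.
Qed.

Theorem isotropic_plane_absurd : False.
Proof.
have [d d0 [s [ss ds]]] := x0_rational.
have Ps i j : kspan io s (d * P i j).
  rewrite P_x0 mulr_sumr; apply: kspan_sum => l _.
  by rewrite mulrCA; apply: kspanZ; exact: kspan_gen.
(* Independence concerns only the first n - 1 coordinates. If all these P vanished, contracting with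
   J f, whose last entry is nonzero, would kill the remaining ones, since f and h are orthogonal to
   f. *)
have [i0 [j0 [i0n j0n P0]]] : exists i0 j0 : 'I_n, [/\ (i0 < n')%N, (j0 < n')%N & P i0 j0 != 0].
  apply: contrapT => H.
  have Plt (i j : 'I_n) : (i < n')%N -> (j < n')%N -> P i j = 0.
    move=> ilt jlt; apply: contrapT => /eqP Pij; apply: H; by exists i, j.
  have lastP (i : 'I_n) : (i < n')%N \/ i = ord_max.
    have [->|il] := eqVneq i ord_max; [by right|left].
    by have := ltn_ord i; rewrite ltnS leq_eqVlt => /orP[/eqP E|//]; move/eqP: il; case; apply: ord_inj.
  have Pll i : P i i = 0 by rewrite /P mulrC subrr.
  have qE (x : 'cV[L]_n) : q x h = q h x by exact: formC.
  have Jcontr (x : 'cV[L]_n) : \sum_j (\sum_k io (J j k) * fv k) * x j 0 = q x f.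
    rewrite /form -mulmxA mxE; apply: eq_bigr => j _; rewrite !mxE mulrC; congr (_ * _).
    by apply: eq_bigr => k _; rewrite !mxE.
  have Pi_last (i : 'I_n) : (i < n')%N -> P i ord_max = 0.
    move=> ilt; have : \sum_j (\sum_k io (J j k) * fv k) * P i j = 0.
      transitivity (fv i * q h f - h i 0 * q f f).
        rewrite -!Jcontr !mulr_sumr -sumrB; apply: eq_bigr => j _.
        by rewrite /P !mxE mulrBr mulrCA [_ * (h i 0 * _)]mulrCA.
      have [hf0 _] := (orthE h).1 oh.
      by rewrite ff hf0 !mulr0 subr0.
    rewrite (bigD1 ord_max)//= [X in _ + X = _]big1 ?addr0 => [/eqP|j jl].
      by rewrite mulf_eq0 (negbTE Jf_last) => /eqP.
    have [jlt|jm] := lastP j; first by rewrite Plt// mulr0.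
    by rewrite jm eqxx in jl.
  have P00 i j : P i j = 0.
    have [ilt|->] := lastP i; have [jlt|->] := lastP j; [exact: Plt|exact: Pi_last| |exact: Pll].
    by rewrite P_anti Pi_last// oppr0.
  move/eqP: x0_neq0; apply; apply/matrixP => i j; rewrite [RHS]mxE.
  transitivity (\sum_l io (J l j) * P i l).
    transitivity (((x0 *m mio (invmx J)) *m mio J) i j).
      by rewrite -mulmxA -map_mxM mulVmx// map_mx1 mulmx1.
    rewrite mxE; apply: eq_bigr => l _; rewrite P_x0 mulrC [mio J l j]mxE; congr (_ * _).
    by rewrite mxE; apply: eq_bigr => l' _; rewrite mulrC [mio _ l' l]mxE.
  by rewrite big1// => l _; rewrite P00 mulr0.
have [k [kn ki kj]] : exists k : 'I_n, [/\ (k < n')%N, k != i0 & k != j0].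
  have n'3 : n' = 3 by case: n4.
  have k3 m : (m < 3)%N -> exists k : 'I_n, nat_of_ord k = m.
    by move=> m3; have mn : (m < n)%N by [rewrite n4 ltnW]; exists (Ordinal mn).
  have [[k0 E0] [[k1 E1] [k2 E2]]] := (k3 0%N erefl, (k3 1%N erefl, k3 2%N erefl)).
  apply: contrapT => H.
  have {}H (k : 'I_n) m : nat_of_ord k = m -> (m < 3)%N -> m == i0 \/ m == j0.
    move=> <- m3; have [->|ki] := eqVneq k i0; [by left|right].
    have [->//|kj] := eqVneq k j0; case: H; exists k; split=> //; by apply: leq_trans m3 _; rewrite n'3.
  by case: (H _ _ E0 isT) => /eqP H0; case: (H _ _ E1 isT) => /eqP H1; case: (H _ _ E2 isT) => /eqP H2; lia.
have i0j0 : i0 != j0 by apply: contraNneq P0 => ->; rewrite /P mulrC subrr.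
(* The expansion of the vanishing determinant with columns f, f, h along its first column, on the
   rows k, i0, j0. *)
pose w i := if i == k then d * P i0 j0 else if i == i0 then d * P j0 k else if i == j0 then d * P k i0 else 0.
have : w k = 0.
  apply: (stable_relation indep ss) (kn) => [i|].
    by rewrite /w; do 3 (case: ifP => _; first exact: Ps); exact: kspan0.
  rewrite (bigD1 k)//= (bigD1 i0) /=; last by rewrite i0n eq_sym ki.
  rewrite (bigD1 j0) /=; last by rewrite j0n [j0 == k]eq_sym kj eq_sym i0j0.
  rewrite big1 ?addr0.
    rewrite /w !eqxx [i0 == k]eq_sym [j0 == k]eq_sym (negbTE ki) (negbTE kj).
    by rewrite [j0 == i0]eq_sym (negbTE i0j0) /P; ring.
  move=> i /andP[/andP[/andP[_ h0] h1] h2].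
  by rewrite /w (negbTE h0) (negbTE h1) (negbTE h2) mul0r.
by rewrite /w eqxx => /eqP; rewrite mulf_eq0 (negbTE d0) (negbTE P0).
Qed.

End IsotropicPlane.

(** * The special linear case *)

Section SpecialLinear.
Variable n : nat.
Variables (A Ai : 'M[K]_n) (f : 'I_n -> L).
Hypothesis AAi : A *m Ai = 1%:M.
Hypothesis AiA : Ai *m A = 1%:M.
Hypothesis sf : forall i, sL (f i) = \sum_j io (A i j) * f j.
Local Notation c := (Ai *m map_mx dK A).
Local Notation mtau := (@mtau n K sK A Ai).
Hypothesis f_neq0 : forall i, f i != 0.
Hypothesis n_gt1 : (1 < n)%N.
Variable al : K.
Hypothesis al_neq0 : al != 0.
Hypothesis tr_c : io (\tr c) = dL (io al) / io al.
Let T (Y : 'M[K]_n) := \tr Y = 0.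
Hypothesis T_lift : forall N, connection_lifting N sK A c T.

Let n_neq0 : (n%:R : K) != 0.
Proof. by case: n n_gt1 => // m _; exact: char0. Qed.

Let pr_fun (X : 'M[K]_n) := X - (\tr X / n%:R)%:M.
Let pr_linear : linear pr_fun.
Proof.
move=> a X Y; rewrite /pr_fun linearD linearZ /= mulrDl -mulrA raddfD /=.
by rewrite scalerBr opprD addrACA scale_scalar_mx.
Qed.
Let pr : {linear 'M[K]_n -> 'M[K]_n} := HB.pack pr_fun (GRing.isLinear.Build K _ _ _ _ pr_linear).

Let T_pr X : T (pr X).
Proof. by rewrite /T /= /pr_fun raddfB /= mxtrace_scalar -[_ *+ n]mulr_natr divfK// subrr. Qed.

Let pr_id X : T X -> pr X = X.
Proof. by rewrite /T /= /pr_fun => ->; rewrite mul0r raddf0 subr0. Qed.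

Let tr_mtau X : \tr (mtau X) = sK (\tr X).
Proof.
rewrite /mtau mxtrace_mulC mulmxA AAi mul1mx rmorph_sum; apply: eq_bigr => i _.
by rewrite mxE.
Qed.

Let mtau_scalar (a : K) : mtau a%:M = (sK a)%:M.
Proof. by rewrite /mtau map_scalar_mx mul_mx_scalar -scalemxAl AiA scalemx1. Qed.

Let pr_tau X : pr (mtau X) = mtau (pr X).
Proof. by rewrite /= /pr_fun mtauB mtau_scalar tr_mtau fmorph_div rmorph_nat. Qed.

Let T_tau Y : T Y -> T (mtau Y).
Proof. by rewrite /T tr_mtau => ->; rewrite rmorph0. Qed.

Let T_tau_surj Y : T Y -> exists2 Y', T Y' & mtau Y' = Y.
Proof.
move=> TY; have [Y' E] := mtau_surj sKK AiA Y; exists Y' => //.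
by apply: (fmorph_inj sK); rewrite -tr_mtau E TY rmorph0.
Qed.

Let TL a Y Z : T Y -> T Z -> T (a *: Y + Z).
Proof. by rewrite /T linearD linearZ /= => -> ->; rewrite mulr0 addr0. Qed.

Let T_lie X Y : T (lie X Y).
Proof. by rewrite /T /lie raddfB /= mxtrace_mulC subrr. Qed.

Let casimirE X : casimir pr X = (2 * n%:R) *: X - (2 * \tr X)%:M.
Proof.
have lie_pr Y Z : lie (pr Y) Z = lie Y Z.
  by rewrite /lie /= /pr_fun mulmxBl mulmxBr mul_scalar_mx mul_mx_scalar opprB addrA subrK.
rewrite /casimir; under eq_bigr do under eq_bigr do rewrite !lie_pr.
rewrite (casimir_sum (fun a b => delta_mx a b)) sum_delta_sandwich.
have -> : \sum_(a < n) \sum_(b < n) (delta_mx a b *m delta_mx b a : 'M[K]_n) = (n%:R)%:M.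
  rewrite -(mxtrace1 K n) -sum_delta_sandwich.
  by apply: eq_bigr => a _; apply: eq_bigr => b _; rewrite mulmx1.
rewrite mul_scalar_mx mul_mx_scalar; move: (\tr X) => t.
by apply/matrixP => i j; rewrite !mxE; case: (i == j); rewrite ?mulr1n ?mulr0n; ring.
Qed.

Let T_perfect := @casimir_perfect K n pr T (2 * n%:R) T_pr (fun X Y _ _ => T_lie X Y)
  (mulf_neq0 (char0 1) n_neq0).

Let frame : exists Ys : 'I_n -> 'M[K]_n, (forall s, T (Ys s)) /\
  \det (\matrix_(s, i) \sum_k io (Ys s (widen_ord (leqnn n) i) k) * f k) != 0.
Proof.
apply: orbit_frame => phi H i.
have [j ji] : exists j : 'I_n, j != i.
  have [i0|i0] := eqVneq (i : nat) 0%N; [exists (Ordinal n_gt1)|exists (Ordinal (ltnW n_gt1))].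
    by rewrite -val_eqE /= i0.
  by rewrite -val_eqE /= eq_sym.
have Tij : T (delta_mx i j).
  rewrite /T /mxtrace big1// => l _; rewrite mxE; case: eqP => // ->.
  by rewrite eq_sym (negbTE ji).
have := H _ Tij; rewrite (bigD1 i)//= (bigD1 j)//= big1 ?addr0 => [|k kj]; last first.
  by rewrite mxE (negbTE kj) andbF rmorph0 mul0r.
rewrite big1 ?addr0 => [|k ki]; last first.
  rewrite big1 ?mulr0// => l _; rewrite mxE.
  have -> : widen_ord (leqnn n) k = k by apply: ord_inj.
  by rewrite (negbTE ki) rmorph0 mul0r.
have -> : widen_ord (leqnn n) i = i by apply: ord_inj.
by rewrite mxE !eqxx rmorph1 mul1r => /eqP; rewrite mulf_eq0 (negbTE (f_neq0 j)) orbF => /eqP.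
Qed.

(** If the cocycle defect were not scalar, [kk] would contain sl_n, against the minimal choice. So B
    / (2n), made traceless, solves the scalar equation, and its trace identifies the scalar with
    tr(c) / n, where tr(c) is the logarithmic derivative of al. *)
Theorem special_linear_independent N (p : mpoly #|{: 'I_n * 'I_N}| K) : (0 < N)%N ->
  ev_at io (jets dL f) p = 0 -> p = 0.
Proof.
have [Ys [TYs dYs]] := frame.
have Tp : forall M : 'M[K]_n -> Prop, M 0 ->
  (forall a Y Z, M Y -> M Z -> M (a *: Y + Z)) ->
  (forall Y Z, T Y -> T Z -> M (Y *m Z - Z *m Y)) -> forall Y, T Y -> M Y.
  by apply: T_perfect => Y; rewrite /T => tY; rewrite casimirE tY mulr0 raddf0 subr0.
have nr M' (p' : mpoly #|{: 'I_n * 'I_M'}| K) : no_rows n p'.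
  by move=> k v _; rewrite leqNgt ltn_ord.
have rc M' := @relation_cocycle n M' K L io sK sKi sL dK dL dLM sKK io_s io_d sd char0 A Ai f AAi AiA sf
  T T_tau T_tau_surj Tp (@T_lift M') pr T_pr pr_id pr_tau n (leqnn n) Ys.
have indep (p' : mpoly #|{: 'I_n * 'I_1}| K) : ev_at io (jets dL f) p' = 0 -> no_rows n p' -> p' = 0.
  move=> ev0 nrp; apply: contrapT => /eqP p'0.
  have [Np [[Y TY nY] _ _ _]] := rc 1%N p' isT TYs dYs ev0 nrp p'0.
  by apply: nY => p1 _; rewrite jder1_weight0; exact: osculating0.
move=> N0 ev0; apply: contrapT => /eqP p0.
have [Np [[Y0 TY0 nY0] kk_lie _ [B kkB]]] := rc N p N0 TYs dYs ev0 (nr _ p) p0.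
pose kk B := forall p', Np p' -> osculating io f T (jder 1 B p').
have [s Es] : exists s, mtau B - B - casimir pr c = s%:M.
  apply: contrapT => ns; apply: nY0.
  apply: (special_linear_ideal (V := kk) (char0 1) _ kk_lie kkB ns) => // a X X' kX kX'.
  exact: osculating_connection_lin.
pose i0 : 'I_n := Ordinal (ltnW n_gt1); pose i1 : 'I_n := Ordinal n_gt1.
pose B1 := (2 * n%:R)^-1 *: B; pose B2 := B1 - (\tr B1 / n%:R)%:M.
have n2 : (2 * n%:R : K) != 0 by rewrite mulf_neq0// (char0 1).
have [s' Es'] : exists s', mtau B1 - B1 = c + s'%:M.
  exists ((2 * n%:R)^-1 * (s - 2 * \tr c)).
  rewrite /B1 mtauZ fmorphV rmorphM !rmorph_nat -scalerBr -[mtau B - B](subrK (casimir pr c)) Es casimirE.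
  rewrite addrCA scalerDr scalerA mulVf// scale1r -raddfB /= scale_scalar_mx.
  by [].
have [s2 Es2] : exists s2, mtau B2 - B2 = c - s2%:M.
  exists ((sK (\tr B1 / n%:R) - \tr B1 / n%:R) - s').
  rewrite /B2 mtauB mtau_scalar; move: (\tr B1 / n%:R) => t.
  have -> : mtau B1 = c + s'%:M + B1 by rewrite -Es' subrK.
  by apply/matrixP => i j; rewrite !mxE; case: (i == j); rewrite ?mulr1n ?mulr0n; ring.
have trs : s2 *+ n = \tr c.
  have key X : \tr X = 0 -> mtau X - X = c - s2%:M -> s2 *+ n = \tr c.
    move=> trX /(congr1 mxtrace); rewrite !raddfB /= tr_mtau trX rmorph0 subrr mxtrace_scalar => /esym/eqP.
    by rewrite subr_eq0 => /eqP.
  by apply: key Es2; exact: T_pr B1.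
apply: (@scalar_cocycle n A Ai f AAi AiA sf n indep B2 s2 al n.-1 i0 i1) => //.
by rewrite prednK ?(ltnW n_gt1)// -tr_c -trs rmorphMn.
Qed.

End SpecialLinear.

(** * The cocycle in the presence of an invariant form *)

Section FormCocycle.
Variable n : nat.
Variables (A Ai : 'M[K]_n) (f : 'I_n -> L).
Hypothesis AAi : A *m Ai = 1%:M.
Hypothesis AiA : Ai *m A = 1%:M.
Hypothesis sf : forall i, sL (f i) = \sum_j io (A i j) * f j.
Local Notation c := (Ai *m map_mx dK A).
Local Notation mtau := (@mtau n K sK A Ai).
Variables (J : 'M[K]_n) (eta kappa : K).
Hypothesis J_unit : J \in unitmx.
Hypothesis J_sym : J^T = eta *: J.
Hypothesis eta2 : eta * eta = 1.
Hypothesis kappa0 : kappa != 0.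
Hypothesis J_kappa : A^T *m map_mx sK J *m A = kappa *: J.
Hypothesis n_eta : n%:R - 2 * eta != 0.
Hypothesis eta_n : eta * n%:R - 2 != 0.
Local Notation T := (skew J).
Hypothesis T_lift : forall N, connection_lifting N sK A c T.
Local Notation th := (adjoint J).

Let two : (2 : K) != 0. Proof. exact: (char0 1). Qed.

Let pr : {linear 'M[K]_n -> 'M[K]_n} := HB.pack (skew_part J) (GRing.isLinear.Build K _ _ _ _ (skew_part_is_linear J)).

Let eta_cases : eta = 1 \/ eta = -1.
Proof.
have /eqP : (eta - 1) * (eta + 1) = 0 by rewrite -subr_sqr expr1n expr2 eta2 subrr.
by rewrite mulf_eq0 subr_eq0 addr_eq0 => /orP[/eqP ->|/eqP ->]; [left|right].
Qed.

Let invJ_A : invmx J *m A^T = kappa *: (Ai *m invmx (map_mx sK J)).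
Proof.
have sJ : map_mx sK J \in unitmx by rewrite map_unitmx.
rewrite -[LHS]mulmx1 -(mulmxV sJ) !mulmxA scalemxAl; congr (_ *m _).
rewrite -[LHS]mulmx1 -AAi !mulmxA -2!(mulmxA (invmx J)) J_kappa -scalemxAr mulVmx// -scalemxAl mul1mx.
by [].
Qed.

Let sJ_A : map_mx sK J *m A = kappa *: (Ai^T *m J).
Proof. by rewrite scalemxAr -J_kappa !mulmxA -trmx_mul AAi trmx1 mul1mx. Qed.

Let th_tau X : th (mtau X) = mtau (th X).
Proof.
rewrite /adjoint /mtau !trmx_mul !map_mxM !mulmxA invJ_A -!scalemxAl -!mulmxA.
by rewrite sJ_A -!scalemxAr map_invmx map_trmx.
Qed.

Let T_pr X : T (pr X). Proof. exact: skew_part_skew eta2 X. Qed.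
Let pr_id X : T X -> pr X = X. Proof. exact: skew_part_id. Qed.
Let pr_tau X : pr (mtau X) = mtau (pr X).
Proof. by rewrite /= /skew_part th_tau -mtauB mtauZ fmorphV rmorph_nat. Qed.

Let T_tau Y : T Y -> T (mtau Y).
Proof. by rewrite /skew th_tau => ->; rewrite -scaleN1r mtauZ rmorphN1 scaleN1r. Qed.

Lemma mtau_inj : injective mtau.
Proof.
move=> X Y E; apply: (map_mx_inj (f := sK)).
have K' Z : map_mx sK Z = A *m mtau Z *m Ai.
  by rewrite /mtau !mulmxA AAi mul1mx -mulmxA AAi mulmx1.
by rewrite !K' E.
Qed.

Let T_tau_surj Y : T Y -> exists2 Y', T Y' & mtau Y' = Y.
Proof.
move=> TY; have [Y' E] := mtau_surj sKK AiA Y; exists Y' => //.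
by apply: mtau_inj; rewrite -th_tau E TY -scaleN1r -[- Y']scaleN1r mtauZ rmorphN1 E.
Qed.

Let T_perfect := @casimir_perfect K n pr T (n%:R - 2 * eta) T_pr (@skew_lie _ _ _ J_unit)
  n_eta (fun Y => @casimir_skew K n char0 J eta J_unit J_sym eta2 pr Y (fun X => erefl)).

Let dK0 : dK 1 = 0.
Proof.
apply: (fmorph_inj io); rewrite -io_d rmorph1 rmorph0.
by apply: (addrI (dL 1)); rewrite addr0 -{3}[1]mulr1 dLM mulr1 mul1r.
Qed.

Let dKM x y : dK (x * y) = dK x * y + x * dK y.
Proof. by apply: (fmorph_inj io); rewrite -io_d rmorphM dLM !io_d rmorphD !rmorphM. Qed.

Let dKmx m p l (X : 'M[K]_(m, p)) (Y : 'M[K]_(p, l)) : map_mx dK (X *m Y) = map_mx dK X *m Y + X *m map_mx dK Y.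
Proof.
apply/matrixP => i j; rewrite !mxE raddf_sum -big_split; apply: eq_bigr => k _.
by rewrite !mxE dKM.
Qed.

Let dsK x : dK (sK x) = sK (dK x).
Proof. by apply: (fmorph_inj io); rewrite -io_d -io_s -sd io_d io_s. Qed.

Definition form_connection := invmx J *m map_mx dK J.
Local Notation beta := form_connection.
Let lam := dK kappa / (2 * kappa).

(** delta applied to A^T sigma(J) A = kappa J, then divided by kappa J. It shows that c is skew up
    to half the coboundary of J^-1 delta(J) and a scalar. *)
Let d_kappa : th c + mtau beta + c = (dK kappa / kappa)%:M + beta.
Proof.
have dtr (X : 'M[K]_n) : map_mx dK X^T = (map_mx dK X)^T by rewrite map_trmx.
have dsJ : map_mx dK (map_mx sK J) = map_mx sK (map_mx dK J).
  by apply/matrixP => i j; rewrite !mxE dsK.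
have := congr1 (fun X => kappa^-1 *: (invmx J *m map_mx dK X)) J_kappa.
rewrite !dKmx dtr dsJ !mulmxDl !mulmxDr !scalerDr.
have -> : kappa^-1 *: (invmx J *m ((map_mx dK A)^T *m map_mx sK J *m A)) = th c.
  rewrite -(mulmxA _ _ A) sJ_A -!scalemxAr scalerA mulVf// scale1r /adjoint trmx_mul !mulmxA.
  by [].
have -> : kappa^-1 *: (invmx J *m (A^T *m map_mx sK (map_mx dK J) *m A)) = mtau beta.
  rewrite !mulmxA invJ_A -!scalemxAl scalerA mulVf// scale1r /mtau /beta map_mxM map_invmx !mulmxA.
  by [].
have -> : kappa^-1 *: (invmx J *m (A^T *m map_mx sK J *m map_mx dK A)) = c.
  by rewrite !mulmxA invJ_A -!scalemxAl scalerA mulVf// scale1r mulmxKV// map_unitmx.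
move=> ->; have -> : map_mx dK (kappa *: J) = dK kappa *: J + kappa *: map_mx dK J.
  by apply/matrixP => i j; rewrite !mxE dKM.
rewrite mulmxDr -!scalemxAr mulVmx// scalerDr !scalerA mulVf// scale1r [_^-1 * _]mulrC.
by rewrite scalemx1.
Qed.

Let skew_part_c : skew_part J c = c + 2^-1 *: (mtau beta - beta) - lam%:M.
Proof.
rewrite /skew_part; have -> : th c = (dK kappa / kappa)%:M + beta - mtau beta - c.
  by rewrite -d_kappa addrAC !addrK.
have -> : lam%:M = 2^-1 *: (dK kappa / kappa)%:M :> 'M[K]_n.
  by rewrite scale_scalar_mx /lam invfM mulrCA.
move: (_ / kappa)%:M (mtau beta) beta c => X1 X2 X3 X4.
by apply/matrixP => i j; rewrite !mxE; field.
Qed.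

Let d_eta : map_mx dK J^T = eta *: map_mx dK J.
Proof.
rewrite J_sym; case: eta_cases => ->; first by rewrite !scale1r.
by apply/matrixP => i j; rewrite !mxE !mulN1r raddfN.
Qed.

(** J is parallel for the connection delta + beta / 2, so its bracket action preserves matrices skew
    for J. *)
Lemma skew_connection B0 Y : T B0 -> T Y -> T (map_mx dK Y - lie (B0 - 2^-1 *: beta) Y).
Proof.
move=> TB TY; have -> : map_mx dK Y - lie (B0 - 2^-1 *: beta) Y =
    (-1) *: lie B0 Y + (map_mx dK Y + 2^-1 *: lie beta Y).
  by rewrite lieDl -scaleNr lieZl opprD scaleNr opprK scaleN1r addrCA.
apply: skew_lin; first exact: (skew_lie J_unit).
have Jb : J *m beta = map_mx dK J by rewrite mulKVmx.
have bJ : beta^T *m J = map_mx dK J.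
  rewrite /beta trmx_mul (invJ_sym J_unit J_sym eta2) map_trmx d_eta -scalemxAr -!scalemxAl scalerA eta2 scale1r.
  by rewrite mulmxKV.
move/(skewE J_unit): TY => TY; apply/(skewE J_unit).
have := congr1 (map_mx dK) TY; rewrite map_mxD !dKmx -(map_trmx dK).
have -> : map_mx dK (0 : 'M[K]_n) = 0 by apply/matrixP => i j; rewrite !mxE raddf0.
move/eqP: TY; rewrite addr_eq0 => /eqP TY.
have trD (X Z : 'M[K]_n) a : (X + a *: Z)^T = X^T + a *: Z^T by rewrite linearD linearZ.
move: beta Jb bJ => b Jb bJ.
rewrite trD mulmxDl mulmxDr -scalemxAl -scalemxAr /lie linearB /= !trmx_mul mulmxBl mulmxBr.
rewrite -(mulmxA Y^T) bJ -(mulmxA _ Y^T) TY mulmxN mulmxA bJ !mulmxA Jb.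
have -> : J *m Y *m b = - (Y^T *m map_mx dK J) by rewrite -[J *m Y]opprK -TY mulNmx -mulmxA Jb.
rewrite !opprK.
move: ((map_mx dK Y)^T *m J) (Y^T *m map_mx dK J) (map_mx dK J *m Y) (J *m map_mx dK Y) => X1 X2 X3 X4 H.
by rewrite -[RHS]H; apply/matrixP => i j; rewrite !mxE; field.
Qed.

Section Ideal.
Variable kk : 'M[K]_n -> Prop.
Hypothesis kkL : forall a X Y, kk X -> kk Y -> kk (a *: X + Y).
Hypothesis kk_lie : forall X Y, T X -> kk Y -> kk (lie X Y).

(** The Casimir separates the skew, traceless self-adjoint and scalar parts. Applying it twice
    recovers th E, after division by 2 - eta n. *)
Lemma skew_part_ideal E : kk E -> kk (skew_part J E).
Proof.
move=> kE.
have kk0 : kk 0 by rewrite -(subrr E) -scaleN1r addrC; exact: kkL.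
have kkZ a X : kk X -> kk (a *: X) by move=> kX; rewrite -[_ *: _]addr0; exact: kkL.
have kkD X Y : kk X -> kk Y -> kk (X + Y) by move=> kX; rewrite -[X]scale1r; exact: kkL.
have kkB X Y : kk X -> kk Y -> kk (X - Y) by move=> kX kY; rewrite -scaleN1r; apply: (kkD) => //; exact: (kkZ).
have kkC X : kk X -> kk (casimir pr X).
  move=> kX; apply: big_ind => // a _; apply: big_ind => // b _.
  by do 2 (apply: kk_lie; first exact: T_pr).
have casE := fun X => @casimir_form K n char0 J eta J_unit J_sym eta2 pr X (fun X => erefl).
pose D := (\tr E)%:M - eta *: th E.
have kD : kk D.
  have -> : D = (n%:R - eta) *: E - casimir pr E by rewrite casE opprB addrC subrK.
  by apply: kkB; [apply: (kkZ)|exact: kkC].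
have thscalar (a : K) : th a%:M = a%:M by rewrite -scalemx1 adjointZ (adjoint1 J_unit).
have thD : th D = (\tr E)%:M - eta *: E.
  by rewrite /D adjointD adjointN adjointZ thscalar (adjointK J_unit J_sym eta2).
have trD : \tr D = n%:R * \tr E - eta * \tr E.
  by rewrite /D raddfB /= mxtrace_scalar mxtraceZ (trace_adjoint J_unit) mulr_natl.
have kthE : kk (th E).
  have -> : th E = (2 - eta * n%:R)^-1 *: (casimir pr D - eta *: D + E).
    rewrite casE thD trD /D; apply: (scalerI (a := 2 - eta * n%:R)).
      by rewrite -opprB oppr_eq0.
    rewrite scalerA mulfV ?scale1r; last by rewrite -opprB oppr_eq0.
    move: (\tr E) (th E) => t X; apply/matrixP => i j; rewrite !mxE.
    case: (i == j); rewrite ?mulr1n ?mulr0n; case: eta_cases => ->; ring.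
  by apply: (kkZ); apply: kkD => //; apply: kkB; [exact: kkC|exact: (kkZ)].
by apply: kkZ; exact: kkB.
Qed.

End Ideal.

Section Frame.
Variables (r : nat) (rn : (r <= n)%N) (Ys : 'I_r -> 'M[K]_n).
Hypothesis TYs : forall s, T (Ys s).
Hypothesis dYs : \det (\matrix_(s, i) \sum_k io (Ys s (widen_ord rn i) k) * f k) != 0.

Let rc N := @relation_cocycle n N K L io sK sKi sL dK dL dLM sKK io_s io_d sd char0 A Ai f AAi AiA sf
  T T_tau T_tau_surj T_perfect (@T_lift N) pr T_pr pr_id pr_tau r rn Ys.

Lemma form_algebraic_independent (p : mpoly #|{: 'I_n * 'I_1}| K) :
  ev_at io (jets dL f) p = 0 -> no_rows r p -> p = 0.
Proof.
move=> ev0 nrp; apply: contrapT => /eqP p0.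
have [Np [[Y TY nY] _ _ _]] := @rc 1%N p isT TYs dYs ev0 nrp p0.
by apply: nY => p1 _; rewrite jder1_weight0; exact: osculating0.
Qed.

(** The Casimir is n - 2 eta on the skew part of c. Dividing by it and shifting by -beta / 2 turns
    the cocycle relation into the equation for c itself, up to e in I and the scalar lam. *)
Theorem form_cocycle N (p : mpoly #|{: 'I_n * 'I_N}| K) : (0 < N)%N ->
  ev_at io (jets dL f) p = 0 -> no_rows r p -> p != 0 ->
  exists Np : mpoly #|{: 'I_n * 'I_N}| K -> Prop,
    let I Y := skew J Y /\ forall p, Np p -> osculating io f T (jder 1 Y p) in
    [/\ (exists2 Y, T Y & ~ I Y),
        (forall a X Y, I X -> I Y -> I (a *: X + Y)) /\ (forall X Y, T X -> I Y -> I (lie X Y)),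
        forall Y, I Y -> exists2 Y', I Y' & mtau Y' = Y &
        exists B0 e, [/\ T B0, I e & mtau (B0 - 2^-1 *: beta) - (B0 - 2^-1 *: beta) = c + e - lam%:M]].
Proof.
move=> N0 ev0 nrp p0; have [Np [[Y0 TY0 nY0] kk_lie kk_tau [B kkB]]] := rc N0 TYs dYs ev0 nrp p0.
exists Np; pose kk B := forall p', Np p' -> osculating io f T (jder 1 B p'); split.
- by exists Y0 => // -[_ H]; exact: nY0.
- split=> [a X Y [sX kX] [sY kY]|X Y TX [sY kY]]; split; first exact: skew_lin.
  + exact: osculating_connection_lin.
  + exact: (skew_lie J_unit).
  + exact: kk_lie.
- move=> Y [TY kY]; have [Y' TY' E] := T_tau_surj TY; exists Y' => //; split=> //.
  by apply: kk_tau; rewrite E.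
pose s := n%:R - 2 * eta.
have kkL a X Y : kk X -> kk Y -> kk (a *: X + Y) by exact: osculating_connection_lin.
have := skew_part_ideal kkL kk_lie kkB; set E := skew_part J _ => kE.
exists (s^-1 *: skew_part J B), (s^-1 *: E); split.
- by rewrite -[_ *: _]addr0; apply: skew_lin; [exact: T_pr|rewrite /skew -{1}(subrr J) /adjoint subrr trmx0 mulmx0 mul0mx oppr0].
- have skew0 : skew J 0 by rewrite /skew /adjoint trmx0 mulmx0 mul0mx oppr0.
  have kk0 : kk 0 by rewrite -(subrr E) -scaleN1r addrC; exact: kkL.
  rewrite -[_ *: _]addr0; split; first by apply: skew_lin => //; exact: T_pr.
  exact: kkL.
have casE := fun X => @casimir_form K n char0 J eta J_unit J_sym eta2 pr X (fun X => erefl).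
have EE : E = mtau (skew_part J B) - skew_part J B - s *: skew_part J c.
  have prB X Y : skew_part J (X - Y) = skew_part J X - skew_part J Y by exact: (raddfB pr).
  have prc (a : K) : skew_part J a%:M = 0.
    by rewrite /skew_part -scalemx1 adjointZ (adjoint1 J_unit) subrr scaler0.
  have prth X : skew_part J (th X) = - skew_part J X.
    by rewrite /skew_part (adjointK J_unit J_sym eta2) -opprB scalerN.
  have prZ a X : skew_part J (a *: X) = a *: skew_part J X by exact: (linearZZ pr).
  rewrite /E casE !prB -[skew_part J (mtau B)]/(pr (mtau B)) pr_tau !prZ prc prth sub0r scalerN opprK.
  congr (_ - _); rewrite -scaleNr -scalerDl; congr (_ *: _); rewrite /s; ring.
have s0 : sK s = s.
  by rewrite /s rmorphB rmorphM !rmorph_nat; case: eta_cases => ->; rewrite ?rmorphN1 ?rmorph1.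
move: (skew_part J B) EE => S EE; rewrite mtauB !mtauZ fmorphV s0 fmorphV rmorph_nat.
have -> : mtau S = E + s *: skew_part J c + S by rewrite EE addrNK subrK.
rewrite skew_part_c !scalerDr !scalerA mulVf// !scale1r.
move: (s^-1 *: E) (s^-1 *: S) (mtau beta) beta c => X1 X2 X3 X4 X5.
by apply/matrixP => i j; rewrite !mxE; ring.
Qed.

End Frame.
End FormCocycle.

(** * The orthogonal and symplectic cases *)

Section FormIndependence.
Variable n' : nat.
Local Notation n := n'.+1.
Variables (A Ai : 'M[K]_n) (f : 'I_n -> L).
Hypothesis AAi : A *m Ai = 1%:M.
Hypothesis AiA : Ai *m A = 1%:M.
Hypothesis sf : forall i, sL (f i) = \sum_j io (A i j) * f j.
Hypothesis f_neq0 : forall i, f i != 0.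
Local Notation c := (Ai *m map_mx dK A).
Variables (J : 'M[K]_n) (eta kappa : K).
Hypothesis J_unit : J \in unitmx.
Hypothesis J_sym : J^T = eta *: J.
Hypothesis kappa0 : kappa != 0.
Hypothesis J_kappa : A^T *m map_mx sK J *m A = kappa *: J.
Local Notation T := (skew J).
Hypothesis T_lift : forall N, connection_lifting N sK A c T.

Let two : (2 : K) != 0. Proof. exact: (char0 1). Qed.

Let Jf b := \sum_k io (J b k) * f k.

Let dKM x y : dK (x * y) = dK x * y + x * dK y.
Proof. by apply: (fmorph_inj io); rewrite -io_d rmorphM dLM !io_d rmorphD !rmorphM. Qed.

Let dKmx (X Y : 'M[K]_n) : map_mx dK (X *m Y) = map_mx dK X *m Y + X *m map_mx dK Y.
Proof.
apply/matrixP => i j; rewrite !mxE raddf_sum -big_split; apply: eq_bigr => k _.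
by rewrite !mxE dKM.
Qed.

Let kappa_log : io (dK kappa / (2 * kappa)) *+ 2 = dL (io kappa) / io kappa.
Proof.
rewrite -rmorphMn -[_ *+ 2]mulr_natl io_d -fmorph_div; congr (io _).
by field; rewrite kappa0 two.
Qed.

Let skew0 : T 0. Proof. by rewrite /skew /adjoint trmx0 mulmx0 mul0mx oppr0. Qed.

Let skew_delta (eta2 : eta * eta = 1) a b : T ((delta_mx a b - eta *: delta_mx b a) *m J).
Proof.
have -> : (delta_mx a b - eta *: delta_mx b a) *m J = 2 *: skew_part J (delta_mx a b *m J) + 0.
  rewrite addr0 /skew_part scalerA mulfV// scale1r /adjoint trmx_mul trmx_delta J_sym.
  by rewrite -!scalemxAl -scalemxAr mulKmx// mulmxBl -!scalemxAl.
by apply: skew_lin => //; exact: skew_part_skew eta2 _.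
Qed.

Let delta_orbit eta' a b i : \sum_k io (((delta_mx a b - eta' *: delta_mx b a) *m J) i k) * f k =
  (i == a)%:R * Jf b - io eta' * (i == b)%:R * Jf a.
Proof.
rewrite /Jf !mulr_sumr -sumrB; apply: eq_bigr => k _.
rewrite mulmxBl mxE [X in _ + X]mxE -scalemxAl [X in _ - X]mxE !mul_delta_mx_l.
by rewrite rmorphB !rmorphM !rmorph_nat; ring.
Qed.

Let frame_ext r (rn : (r <= n)%N) (G : 'M[K]_n -> Prop) :
  (forall psi : 'I_n -> L, (forall i : 'I_n, (r <= i)%N -> psi i = 0) ->
    (forall Y, G Y -> \sum_i psi i * (\sum_k io (Y i k) * f k) = 0) -> forall i, psi i = 0) ->
  exists Ys : 'I_r -> 'M[K]_n, (forall s, G (Ys s)) /\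
    \det (\matrix_(s, i) \sum_k io (Ys s (widen_ord rn i) k) * f k) != 0.
Proof.
move=> GH; apply: orbit_frame => phi H.
pose psi (i : 'I_n) : L := if insub (i : nat) is Some j then phi j else 0.
have psiE i : psi (widen_ord rn i) = phi i.
  by rewrite /psi; case: insubP => [j _ ji|/negP[]]; [congr phi; exact: ord_inj|exact: (ltn_ord i)].
have psi_ge (i : 'I_n) : (r <= i)%N -> psi i = 0 by move=> ri; rewrite /psi insubN// -leqNgt.
move=> i; rewrite -psiE; apply: GH => // Y GY; rewrite -[RHS](H Y GY).
rewrite (bigID (fun i : 'I_n => (i < r)%N)) /= [X in _ + X]big1 ?addr0; last first.
  by move=> j; rewrite -leqNgt => /psi_ge ->; rewrite mul0r.
by rewrite (big_ord_narrow rn); apply: eq_bigr => j _; rewrite psiE.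
Qed.

(** A form psi orthogonal to T f is proportional to J f. It vanishes because its coordinate b0 does:
    by the restriction on rows in the symmetric case, by alternation in the other. *)
Lemma form_frame r (rn : (r <= n)%N) b0 : eta * eta = 1 -> Jf b0 != 0 -> (r <= b0)%N \/ eta = -1 ->
  exists Ys : 'I_r -> 'M[K]_n, (forall s, T (Ys s)) /\
    \det (\matrix_(s, i) \sum_k io (Ys s (widen_ord rn i) k) * f k) != 0.
Proof.
move=> eta2 b00 b0r; apply: frame_ext => psi psi_ge H.
have rel a b : psi a * Jf b = io eta * psi b * Jf a.
  have := H _ (skew_delta eta2 a b).
  under eq_bigr do rewrite delta_orbit mulrBr.
  rewrite sumrB (bigD1 a)//= eqxx big1 ?addr0 => [|i ia]; last by rewrite (negbTE ia) mul0r mulr0.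
  rewrite (bigD1 b)//= eqxx big1 ?addr0 => [|i ib]; last by rewrite (negbTE ib) mulr0 mul0r mulr0.
  by rewrite mul1r mulr1 => /eqP; rewrite subr_eq0 => /eqP ->; rewrite mulrCA mulrA.
have psib0 : psi b0 = 0.
  case: b0r => [/psi_ge//|em]; have /eqP := rel b0 b0.
  rewrite em rmorphN1 mulN1r mulNr -subr_eq0 opprK -mulr2n -mulr_natl !mulf_eq0 (negbTE b00) orbF.
  by rewrite -(rmorph_nat io) fmorph_eq0 (negbTE two) => /eqP.
move=> i; have /eqP := rel i b0; rewrite psib0 mulr0 mul0r mulf_eq0.
by rewrite (negbTE b00) orbF => /eqP.
Qed.

(** The linear forms over K vanishing at f are stable under [tau], hence under T by the lifting. As
    so_n acts irreducibly, one nonzero such form would force f = 0. *)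
Lemma form_orbit_neq0 : eta = 1 -> (2 < n)%N -> forall b, Jf b != 0.
Proof.
move=> eta1 n3 b; apply/eqP => Jfb.
have J_sym1 : J^T = J by rewrite J_sym eta1 scale1r.
pose e0 := ev_at (N := 1) io (fun i j => if j == 0%N then f i else 0).
pose lin (v : 'cV[K]_n) : mpoly #|{: 'I_n * 'I_1}| K := \sum_k v k 0 *: jX 1 K k 0.
have linL a v w : lin (a *: v + w) = a *: lin v + lin w.
  by rewrite /lin scaler_sumr -big_split; apply: eq_bigr => k _; rewrite !mxE scalerDl scalerA.
have lin0 : lin 0 = 0 by rewrite /lin big1// => k _; rewrite mxE scale0r.
have e0_lin v : e0 (lin v) = \sum_k io (v k 0) * f k.
  by rewrite /e0 /lin raddf_sum; apply: eq_bigr => k _; rewrite /= ev_atZ ev_at_jX.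
have lin_mul (B : 'M[K]_n) v : lin (B^T *m v) = \sum_k v k 0 *: jY 1 B k 0.
  rewrite /lin /jY; under eq_bigr do rewrite mxE scaler_suml.
  rewrite exchange_big; apply: eq_bigr => k _; rewrite scaler_sumr; apply: eq_bigr => l _.
  by rewrite mxE scalerA mulrC.
have tau_lin v : jsub sK A (lin v) = lin (A^T *m map_mx sK v).
  rewrite lin_mul /lin raddf_sum; apply: eq_bigr => k _.
  by rewrite /= jsubZ jsub_jX mxE.
pose M (p : mpoly #|{: 'I_n * 'I_1}| K) := exists v, p = lin v /\ e0 p = 0.
have M0 : M 0 by exists 0; rewrite lin0 /e0 raddf0.
have ML a p p' : M p -> M p' -> M (a *: p + p').
  move=> [v [-> v0]] [w [-> w0]]; exists (a *: v + w); rewrite linL; split=> //.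
  by rewrite /e0 raddfD /= ev_atZ -!/e0 v0 w0 mulr0 addr0.
have M_jder Y : T Y -> forall p, M p -> M (jder 0 Y p).
  move=> TY; have [|||B H] := @T_lift 1%N (fun p _ => M p) M0 _ _ _ Y TY.
  - by move=> a p _ p' _; exact: ML.
  - move=> p _ [v [-> v0]]; exists (A^T *m map_mx sK v); split; first exact: tau_lin.
    by rewrite /e0 (e0_tau io_s sf)// -/e0 v0 rmorph0.
  - have [|t tM Mt] := @subspace_generators K _ [seq jX 1 K k 0 | k : 'I_n] M M0 ML.
      move=> p [v [-> _]]; apply: span_sum => k _; apply: spanZ; apply: span_gen.
      by apply/mapP; exists k; rewrite // mem_enum.
    by exists t => [p /tM Mp|p _ /Mt]; first by exists 0.
  - by move=> p Mp; exact: (H p 0 Mp).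
have all : forall z, e0 (lin (J *m z)) = 0.
  apply: (@rotation_stable K n J J_unit J_sym1 n3 _ (delta_mx b 0)).
  - move=> a y z Vy Vz; rewrite mulmxDr -scalemxAr linL /e0 raddfD /= ev_atZ -!/e0 Vy Vz.
    by rewrite mulr0 addr0.
  - move=> a d y Vy; set Y := infinitesimal_rotation J a d.
    have TY : T Y by exact: rotation_skew.
    have [v [E v0]] : M (jder 0 Y (lin (J *m y))) by apply: M_jder => //; exists (J *m y).
    have jder_lin w : jder 0 Y (lin w) = lin (Y^T *m w).
      rewrite lin_mul /lin raddf_sum; apply: eq_bigr => k _.
      by rewrite /= linearZ /= jder_jX// ffactn0 mulr1n.
    move: v0; rewrite jder_lin; have /(skewE J_unit)/eqP := TY; rewrite addr_eq0 => /eqP YJ.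
    rewrite !mulmxA YJ mulNmx -mulmxA.
    have -> : lin (- (J *m (Y *m y))) = - lin (J *m (Y *m y)).
      by rewrite -[- _]addr0 -scaleN1r linL lin0 addr0 scaleN1r.
    by rewrite /e0 raddfN /= -/e0 => /eqP; rewrite oppr_eq0 => /eqP.
  - rewrite e0_lin -[RHS]Jfb; apply: eq_bigr => k _; rewrite -colE mxE.
    by rewrite -{1}J_sym1 mxE.
  - by apply/eqP => /matrixP/(_ b 0)/eqP; rewrite !mxE !eqxx oner_eq0.
have /eqP := all (invmx J *m delta_mx ord0 0); rewrite mulKVmx// e0_lin (bigD1 ord0)//= big1 ?addr0.
  by rewrite mxE !eqxx rmorph1 mul1r (negbTE (f_neq0 _)).
by move=> k k0; rewrite mxE (negbTE k0) rmorph0 mul0r.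
Qed.

Theorem symplectic_independent N (p : mpoly #|{: 'I_n * 'I_N}| K) : eta = -1 -> (1 < n)%N -> (0 < N)%N ->
  ev_at io (jets dL f) p = 0 -> p = 0.
Proof.
move=> em n2 N0 ev0; apply: contrapT => /eqP p0.
have eta2 : eta * eta = 1 by rewrite em mulrNN mulr1.
have [b Jfb] : exists b, Jf b != 0.
  apply: contrapT => /forallNP H.
  have Jf0 : map_mx io J *m \col_i f i = 0.
    apply/colP => b; rewrite !mxE; apply: etrans (etrans _ (erefl 0)); last exact/eqP/negPn/negP/(H b).
    by apply: eq_bigr => k _; rewrite !mxE.
  have JL : map_mx io J \in unitmx by rewrite map_unitmx.
  have /colP/(_ ord0) := mulKmx JL (\col_i f i); rewrite Jf0 mulmx0 !mxE => /esym/eqP.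
  by rewrite (negbTE (f_neq0 _)).
have [Ys [TYs dYs]] := form_frame (leqnn n) eta2 Jfb (or_intror em).
have n_eta : n%:R - 2 * eta != 0 by rewrite em mulrN mulr1 opprK -natrD addn2 char0.
have eta_n : eta * n%:R - 2 != 0.
  by rewrite em mulN1r -opprD oppr_eq0 -natrD addn2 char0.
have nr M' (p' : mpoly #|{: 'I_n * 'I_M'}| K) : no_rows n p'.
  by move=> k v _; rewrite leqNgt ltn_ord.
have indep := @form_algebraic_independent n A Ai f AAi AiA sf J eta kappa J_unit J_sym eta2 J_kappa n_eta
  T_lift n (leqnn n) Ys TYs dYs.
have [Np [[Y0 TY0 nY0] [IL I_lie] _ [B0 [e [TB0 Ie BE]]]]] :=
  @form_cocycle n A Ai f AAi AiA sf J eta kappa J_unit J_sym eta2 kappa0 J_kappa n_eta eta_n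
  T_lift n (leqnn n) Ys TYs dYs N p N0 ev0 (nr _ p) p0.
have J_alt : J^T = - J by rewrite J_sym em scaleN1r.
have e0 : e = 0.
  apply: contrapT => /eqP e0; apply: nY0; apply: (symplectic_ideal two J_unit J_alt IL _ I_lie Ie e0) => //.
  by move=> X [].
rewrite e0 addr0 in BE.
apply: (@scalar_cocycle n A Ai f AAi AiA sf n indep _ _ kappa 1%N ord0 (Ordinal n2) BE) => //.
Qed.

(** I is the ideal of T acting invisibly on leading parts. If I = 0, the scalar cocycle concludes.
    If I f contains a frame, the gradient argument puts all of T in I, a contradiction. Otherwise n
    = 4 and f lies in an isotropic plane. *)
Theorem orthogonal_independent N (p : mpoly #|{: 'I_n * 'I_N}| K) : eta = 1 -> (2 < n)%N -> (0 < N)%N ->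
  ev_at io (jets dL f) p = 0 -> no_rows n' p -> p = 0.
Proof.
move=> eta1 n3 N0 ev0 nrp; apply: contrapT => /eqP p0.
have eta2 : eta * eta = 1 by rewrite eta1 mulr1.
have J_sym1 : J^T = J by rewrite J_sym eta1 scale1r.
have J_symZ : J^T = 1 *: J by rewrite J_sym eta1.
have Jf_last : Jf ord_max != 0 by exact: form_orbit_neq0.
have [Ys [TYs dYs]] := form_frame (leqnSn n') eta2 Jf_last (or_introl (leqnn n')).
have n2 : (n%:R - 2 : K) != 0.
  rewrite -natrB; last exact: ltnW.
  by move: n3; rewrite /= !ltnS subSS; case: n' => [|[|m]]// _; rewrite subSS subn0 char0.
have n_eta : n%:R - 2 * eta != 0 by rewrite eta1 mulr1.
have eta_n : eta * n%:R - 2 != 0 by rewrite eta1 mul1r.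
have indep := @form_algebraic_independent n A Ai f AAi AiA sf J eta kappa J_unit J_sym eta2 J_kappa n_eta
  T_lift n' (leqnSn n') Ys TYs dYs.
have :=
  @form_cocycle n A Ai f AAi AiA sf J eta kappa J_unit J_sym eta2 kappa0 J_kappa n_eta eta_n
  T_lift n' (leqnSn n') Ys TYs dYs N p N0 ev0 nrp p0.
move=> [Np]; set I := fun Y : 'M[K]_n => _ /\ _ => -[[Y0 TY0 nY0] [IL I_lie] I_tau [B0 [e [TB0 Ie BE]]]].
have I_skew Y : I Y -> T Y by case.
have T_perfect := ideal_perfect (I := T) char0 J_unit J_symZ n3 (@skew_lin _ _ J) (fun _ => id) (@skew_lie _ _ J J_unit).
have I_perfect := ideal_perfect char0 J_unit J_symZ n3 IL I_skew I_lie.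
have [[Y1 IY1 Y10]|Ieq0] := pselect (exists2 Y, I Y & Y != 0); last first.
  have e0 : e = 0 by apply: contrapT => /eqP e0; apply: Ieq0; exists e.
  rewrite e0 addr0 in BE.
  pose i0 : 'I_n := ord0; pose i1 : 'I_n := Ordinal (ltnW n3).
  apply: (@scalar_cocycle n A Ai f AAi AiA sf n' indep _ _ kappa 1%N i0 i1 BE) => //.
  exact: ltnW.
have I0 : I 0 by rewrite -(subrr Y1) -scaleN1r addrC; exact: IL.
have f0 : (\col_i f i : 'cV[L]_n) != 0.
  by apply/eqP => /colP/(_ ord0)/eqP; rewrite !mxE (negbTE (f_neq0 _)).
have JL_unit : map_mx io J \in unitmx by rewrite map_unitmx.
have JL_sym : (map_mx io J)^T = map_mx io J by rewrite map_trmx J_sym1.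
have twoL : (2 : L) != 0 by rewrite -(rmorph_nat io) fmorph_eq0.
(* The dichotomy for orbits concerns f, so it is applied to the ideal generated by I over L. *)
pose IL' := span (fun X => exists2 Y, I Y & X = map_mx io Y).
have IL'_gen Y : I Y -> IL' (map_mx io Y) by move=> IY; apply: span_gen; exists Y.
have IL'_skew X : IL' X -> skew (map_mx io J) X.
  apply: span_ind_sub => [|a X' Z' sX sZ|_ [Y IY ->]].
  - by rewrite /skew /adjoint trmx0 mulmx0 mul0mx oppr0.
  - exact: skew_lin.
  apply/(skewE JL_unit); have /(skewE J_unit) E := I_skew _ IY.
  by rewrite map_trmx -!map_mxM -map_mxD E map_mx0.
have io_lie (X Y : 'M[K]_n) : map_mx io (lie X Y) = lie (map_mx io X) (map_mx io Y).
  by rewrite /lie map_mxB !map_mxM.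
have IL'_lie X Z : skew (map_mx io J) X -> IL' Z -> IL' (lie X Z).
  move=> sX; apply: (@span_ind_sub _ _ _ (fun Z => IL' (lie X Z))) => [|a P Q HP HQ|_ [Y IY ->]].
  - by rewrite /lie mulmx0 mul0mx subrr; exact: span_zero.
  - by rewrite lieDr lieZr; apply: spanD => //; exact: spanZ.
  have XE : X = \sum_i \sum_j X i j *: map_mx io (skew_part J (delta_mx i j)).
    have skew_io W : skew_part (map_mx io J) (map_mx io W) = map_mx io (skew_part J W).
      by rewrite /skew_part map_mxZ map_mxB fmorphV rmorph_nat /adjoint !map_mxM map_invmx map_trmx.
    rewrite -{1}(skew_part_id _ sX) => [|k]; last by rewrite -(rmorph_nat io) fmorph_eq0.
    rewrite {1}[X]matrix_sum_delta.
    pose prL : {linear 'M[L]_n -> 'M[L]_n} := HB.pack (skew_part (map_mx io J))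
      (GRing.isLinear.Build L _ _ _ _ (skew_part_is_linear (map_mx io J))).
    rewrite -[skew_part _]/(prL : _ -> _) linear_sum; apply: eq_bigr => i _.
    rewrite linear_sum; apply: eq_bigr => j _.
    by rewrite linearZ /= -(map_delta_mx io) skew_io.
  rewrite XE; pose Q W := IL' (lie W (map_mx io Y)).
  have Q0 : Q 0 by rewrite /Q /lie mul0mx mulmx0 subrr; exact: span_zero.
  have QD W W' : Q W -> Q W' -> Q (W + W') by rewrite /Q lieDl; exact: spanD.
  apply: (big_ind Q) => // i _; apply: (big_ind Q) => // j _.
  rewrite /Q lieZl -io_lie; apply: spanZ; apply: IL'_gen.
  by apply: I_lie => //; exact: skew_part_skew eta2 _.
have orthP x : (forall Y, IL' Y -> form (map_mx io J) x (Y *m \col_i f i) = 0) <->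
    (forall Y, I Y -> form (map_mx io J) x (map_mx io Y *m \col_i f i) = 0).
  split=> [H Y IY|H Y]; first exact/H/IL'_gen.
  apply: (@span_ind_sub _ _ _ (fun Y => form (map_mx io J) x (Y *m \col_i f i) = 0)) => [|a X Z HX HZ|_ [Y' IY' ->]]; last exact: H.
    by rewrite mul0mx form0r.
  by rewrite mulmxDl -scalemxAl formDr formZr HX HZ mulr0 addr0.
have IL'_neq0 : exists2 Y, IL' Y & Y != 0.
  by exists (map_mx io Y1); [exact: IL'_gen|rewrite map_mx_eq0].
have IL'L a X Y : IL' X -> IL' Y -> IL' (a *: X + Y).
  by move=> IX IY; apply: spanD => //; exact: spanZ.
have [D|[h [n4 [hf ff] orthE orth_span oh]]] :=
  ideal_orbit_dichotomy twoL JL_unit JL_sym n3 IL'_skew IL'_lie IL'_neq0 f0.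
- have [Zs [IZs dZs]] : exists Zs : 'I_n' -> 'M[K]_n, (forall s, I (Zs s)) /\
    \det (\matrix_(s, i) \sum_k io (Zs s (widen_ord (leqnSn n') i) k) * f k) != 0.
    apply: frame_ext => psi psi_ge H.
    have JJi : map_mx io J *m map_mx io (invmx J) = 1%:M by rewrite -map_mxM mulmxV// map_mx1.
    have [a xE] : exists a, map_mx io (invmx J) *m \col_i psi i = a *: \col_i f i.
      apply: D; apply/orthP => Y IY.
      have JiT : (map_mx io (invmx J))^T *m map_mx io J = 1%:M.
        by rewrite map_trmx (invJ_sym J_unit J_symZ) ?mulr1// scale1r -map_mxM mulVmx// map_mx1.
      rewrite /form trmx_mul -(mulmxA _ _ (map_mx io J)) JiT mulmx1 mxE -[RHS](H Y IY).
      apply: eq_bigr => i _; rewrite !mxE; congr (_ * _).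
      by apply: eq_bigr => k _; rewrite !mxE.
    have psiE i : psi i = a * Jf i.
      have /colP/(_ i) := congr1 (mulmx (map_mx io J)) xE.
      rewrite mulmxA JJi mul1mx -scalemxAr !mxE => ->; congr (_ * _).
      by apply: eq_bigr => k _; rewrite !mxE.
    have a0 : a = 0.
      have /esym/eqP := psiE ord_max; rewrite psi_ge// mulf_eq0 (negbTE Jf_last) orbF.
      by move/eqP.
    by move=> i; rewrite psiE a0 mul0r.
  apply: nY0; split=> // p' Npp'.
  apply: (orthogonal_gradient char0 T_perfect J_sym1 _ Jf_last N0 _ dZs) => //.
  + by move=> Y /(skewE J_unit).
  + by move=> s; exact: I_skew.
  (* Members of I act invisibly at order 1 by definition; orders h >= 2 follow by brackets, because
     I is perfect. *)
  move=> h s; case: h => // h _; move: (Zs s) (IZs s) p' Npp'.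
  elim: h => [|h IH] Y IY; first by case: IY.
  apply: (I_perfect (fun Y => forall p', Np p' -> osculating io f T (jder h.+2 Y p'))) IY => //.
  + by move=> p' _; rewrite jder0; exact: osculating0.
  + by move=> a X Z HX HZ p' Npp'; rewrite jderD jderZ; apply: osculating_lin; [exact: HX|exact: HZ].
  move=> X Z IX IZ p' Npp'.
  have := jder_comm h.+1 1 Z X p'; rewrite addn1 => <-.
  apply: osculatingB.
  + by apply: (osculating_jder T_perfect); [exact: I_skew|exact: IX.2].
  + by apply: osculating_jder1 => //; [exact: I_skew|exact: IH].
pose B := B0 - 2^-1 *: form_connection J.
have nablaT Y : T Y -> T (map_mx dK Y - lie B Y).
  exact: (skew_connection J_unit J_sym eta2 TB0).
pose nabla Y := map_mx dK Y - lie B Y.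
have I_nabla Y : I Y -> I (nabla Y).
  move=> IY; suff [] : I Y /\ I (nabla Y) by [].
  apply: (I_perfect (fun Y => I Y /\ I (nabla Y))) IY => [|a X Z [IX nX] [IZ nZ]|X Z IX IZ].
  - split=> //; suff -> : nabla 0 = 0 by [].
    by rewrite /nabla /lie mulmx0 mul0mx !subrr subr0; apply/matrixP => i j; rewrite !mxE raddf0.
  - split; first exact: IL.
    have -> : nabla (a *: X + Z) = dK a *: X + (a *: nabla X + nabla Z).
      rewrite /nabla lieDr lieZr map_mxD (scalerBr a (map_mx dK X)).
      have -> : map_mx dK (a *: X) = dK a *: X + a *: map_mx dK X.
        by apply/matrixP => i j; rewrite !mxE dKM.
      move: (lie B X) (lie B Z) (map_mx dK X) (map_mx dK Z) => X1 X2 X3 X4.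
      by apply/matrixP => i j; rewrite !mxE; ring.
    by apply: (IL) => //; exact: IL.
  have sZ := I_skew _ IZ; have sX := I_skew _ IX.
  split; first exact: I_lie.
  have -> : nabla (lie X Z) = lie (nabla X) Z + lie X (nabla Z).
    rewrite /nabla (lie_jacobi B) (lieDl (map_mx dK X)) (lieDr X (map_mx dK Z)).
    have -> : map_mx dK (lie X Z) = lie (map_mx dK X) Z + lie X (map_mx dK Z).
      rewrite /lie raddfB /= !dKmx; move: (_ *m _) (_ *m _) (_ *m _) (_ *m _) => X1 X2 X3 X4.
      by rewrite opprD addrACA [X3 + _]addrC; apply/matrixP => i j; rewrite !mxE; ring.
    have -> : lie (- lie B X) Z = - lie (lie B X) Z by rewrite -scaleN1r lieZl scaleN1r.
    have -> : lie X (- lie B Z) = - lie X (lie B Z) by rewrite -scaleN1r lieZr scaleN1r.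
    by rewrite opprD addrACA.
  rewrite -[lie (nabla X) Z]scale1r; apply: (IL).
    by apply: I_lie => //; exact: nablaT.
  by rewrite -lieN -scaleN1r -[_ *: _]addr0; apply: (IL) => //; apply: I_lie => //; exact: nablaT.
apply: (isotropic_plane_absurd AAi AiA sf indep twoL J_unit J_sym1 kappa0 J_kappa I_skew I_tau I_perfect
  BE Ie I_nabla Jf_last hf ff) => //.
- by move=> x; rewrite -orthP.
- by move=> x /orthP; exact: orth_span.
- exact/orthP.
Qed.

End FormIndependence.

End CyclicSolution.

(** * Unipotent generators of the classical groups *)

Section NilpotentExponential.
Variables (F : fieldType) (n : nat).
Hypothesis two : (2 : F) != 0.
Variable E : 'M[F]_n.
Hypothesis E3 : E *m E *m E = 0.
Local Notation C t := (1%:M + t *: E + (t ^+ 2 / 2) *: (E *m E)).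

Lemma nilpotent_expD s t : C s *m C t = C (s + t).
Proof.
have E3' : E *m (E *m E) = 0 by rewrite mulmxA.
have E4 : E *m E *m (E *m E) = 0 by rewrite mulmxA E3 mul0mx.
rewrite !mulmxDl !mulmxDr !mul1mx !mulmx1 -!scalemxAl -!scalemxAr E3 E3' E4 !scaler0 !addr0.
move: (E *m E) => X; apply/matrixP => i j; rewrite !mxE; field.
by [].
Qed.

Variables (J : 'M[F]_n).
Hypothesis EJ : E^T *m J + J *m E = 0.

Lemma nilpotent_exp_form t : (C t)^T *m J *m C t = J.
Proof.
have -> : (C t)^T *m J = J *m C (- t).
  move/eqP: EJ; rewrite addr_eq0 => /eqP E1.
  have E2 : (E *m E)^T *m J = J *m (E *m E) by rewrite trmx_mul -mulmxA E1 mulmxN (mulmxA _ J) E1 mulNmx opprK mulmxA.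
  rewrite !linearD /= !linearZ /= trmx1 !mulmxDl mul1mx mulmx1 -!scalemxAl E1 E2 sqrrN.
  by rewrite scalerN scaleNr.
rewrite -mulmxA nilpotent_expD addNr expr0n /= mul0r !scale0r !addr0.
by rewrite mulmx1.
Qed.

(** Invariance of J gives determinant 1 up to sign; writing C(t) as the square of C(t/2) removes the
    sign. *)
Lemma nilpotent_exp_det t : J \in unitmx -> \det (C t) = 1.
Proof.
move=> Ju; have -> : t = t / 2 + t / 2 by rewrite -mulr2n -[_ *+ 2]mulr_natr divfK.
rewrite -nilpotent_expD det_mulmx.
have := congr1 determinant (nilpotent_exp_form (t / 2)); rewrite !det_mulmx det_tr mulrAC.
by rewrite -{2}[\det J]mul1r => /mulIf; apply; rewrite -unitfE -unitmxE.
Qed.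

End NilpotentExponential.

Lemma det_transvection (F : fieldType) n (a b : 'I_n) (t : F) : a != b -> \det (1%:M + t *: delta_mx a b) = 1.
Proof.
move=> ab; pose B : 'M[F]_n := \matrix_(i, j) (if i == a then (j == b)%:R else (j == i)%:R).
have -> : \det (1%:M + t *: delta_mx a b) = 1 * \det (1%:M : 'M[F]_n) + t * \det B.
  have la i : (lift a i == a) = false by rewrite eq_sym (negbTE (neq_lift _ _)).
  apply: (determinant_multilinear (i0 := a)).
  - by apply/rowP => j; rewrite !mxE !eqxx /= mul1r.
  - by apply/matrixP => i j; rewrite !mxE la mulr0 addr0.
  - by apply/matrixP => i j; rewrite !mxE la mulr0 addr0 eq_sym.
rewrite det1 mulr1 (determinant_alternate ab) ?mulr0 ?addr0// => j.
by rewrite !mxE eqxx [b == a]eq_sym (negbTE ab).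
Qed.

Section SymplecticForm.
Variables (F : fieldType) (n : nat).
Hypothesis n_even : ~~ odd n.
Local Notation J := (@symplectic_form F n).

Lemma symplectic_form_tr : J^T = - J.
Proof. by apply/matrixP => i j; rewrite !mxE opprB. Qed.

Lemma symplectic_form_sqr : J *m J = - 1%:M.
Proof.
have nE : (n = n./2 + n./2)%N by rewrite addnn -[LHS]odd_double_half (negbTE n_even).
set h := n./2 in nE.
have lo (i : 'I_n) : (i < h)%N -> exists2 k : 'I_n, (k : nat) = (i + h)%N & forall j, J i j = (j == k)%:R.
  move=> ih; have kn : (i + h < n)%N by lia.
  exists (Ordinal kn) => // j; rewrite !mxE -val_eqE /=.
  have -> : (i == j + h :> nat)%N = false by apply/negP => /eqP; lia.
  by rewrite subr0.
have hi (i : 'I_n) : (h <= i)%N -> exists2 k : 'I_n, (k + h)%N = i & forall j, J i j = - (j == k)%:R.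
  move=> ih; have kn : (i - h < n)%N by have := ltn_ord i; lia.
  exists (Ordinal kn) => /= [|j]; first by rewrite subnK.
  rewrite !mxE -val_eqE /=.
  have -> : (j == i + h :> nat)%N = false by apply/negP => /eqP; have := ltn_ord j; lia.
  have -> : (i == j + h :> nat)%N = (j == i - h :> nat)%N by apply/eqP/eqP; lia.
  by rewrite sub0r.
apply/matrixP => i l; rewrite mxE.
have pick (k : 'I_n) (s : F) : (forall j, J i j = s * (j == k)%:R) -> \sum_j J i j * J j l = s * J k l.
  move=> Jk; rewrite (bigD1 k)//= big1 ?addr0 => [|j jk]; first by rewrite Jk eqxx mulr1.
  by rewrite Jk (negbTE jk) mulr0 mul0r.
have [ih|ih] := ltnP i h.
  have [k kE Jk] := lo i ih; rewrite (pick k 1) => [|j]; last by rewrite Jk mul1r.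
  have [|k' k'E ->] := hi k; first by rewrite kE leq_addl.
  have -> : k' = i by apply: ord_inj; lia.
  by rewrite !mxE mul1r eq_sym.
have [k kE Jk] := hi i ih; rewrite (pick k (-1)) => [|j]; last by rewrite Jk mulN1r.
have [|k' k'E ->] := lo k; first by have := ltn_ord i; lia.
have -> : k' = i by apply: ord_inj; lia.
by rewrite !mxE mulN1r eq_sym.
Qed.

End SymplecticForm.

Definition base_change (F S : nzRingType) (cst : {rmorphism F -> S}) n (P : 'M[F]_n -> Prop) (X : 'M[S]_n) : Prop :=
  exists2 E, P E & X = map_mx cst E.

Section TangentGenerators.
Variables (F : fieldType) (S : comUnitRingType) (cst : {rmorphism F -> S}) (n : nat).
Hypothesis two : (2 : F) != 0.
Local Notation mc := (map_mx cst).
Local Notation bc := (base_change cst).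

Let two_unit : (2 : S) \is a GRing.unit.
Proof. by rewrite -(rmorph_nat cst) fmorph_unit. Qed.

Section Orthogonal.
Hypothesis n_gt2 : (2 < n)%N.
Variable im : F.
Hypothesis im2 : im * im = -1.

Lemma ord_third (a b : 'I_n) : exists d : 'I_n, d != a /\ d != b.
Proof.
apply: contrapT => H.
have {}H m : (m < 3)%N -> m == a \/ m == b.
  move=> m3; pose d := Ordinal (leq_trans m3 n_gt2).
  have [ma|ma] := eqVneq d a; first by left; rewrite -ma.
  have [mb|mb] := eqVneq d b; first by right; rewrite -mb.
  by case: H; exists d.
by case: (H 0%N isT) => /eqP H0; case: (H 1%N isT) => /eqP H1; case: (H 2%N isT) => /eqP H2; lia.
Qed.

(* u e_b^T - e_b u^T with u = e_a + s e_d isotropic *)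
Definition isotropic_rotation (a b d : 'I_n) (s : F) : 'M[F]_n := rotation F a b + s *: rotation F d b.

Let isotropicE a b d s : isotropic_rotation a b d s =
  (delta_mx a 0 + s *: delta_mx d 0 : 'cV_n) *m (delta_mx b 0 : 'cV_n)^T
  - (delta_mx b 0 : 'cV_n) *m (delta_mx a 0 + s *: delta_mx d 0 : 'cV_n)^T.
Proof.
rewrite [(_ + _)^T]linearD /= linearZ /= !trmx_delta mulmxDl mulmxDr -scalemxAl -scalemxAr !mul_delta_mx.
by rewrite /isotropic_rotation /rotation scalerBr opprD addrACA.
Qed.

Let dot (i j : 'I_n) : (delta_mx i 0 : 'cV[F]_n)^T *m (delta_mx j 0 : 'cV[F]_n) = (i == j)%:R%:M.
Proof.
rewrite trmx_delta; have [->|ij] := eqVneq i j; last by rewrite mul_delta_mx_0// raddf0.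
by rewrite mul_delta_mx; apply/matrixP => x y; rewrite !ord1 !mxE !eqxx.
Qed.

(** As u is isotropic and orthogonal to e_b, the square of E is - u u^T, and E kills u. *)
Lemma isotropic_rotation_nilpotent a b d s : s * s = -1 -> a != b -> d != a -> d != b ->
  let E := isotropic_rotation a b d s in E *m E *m E = 0.
Proof.
move=> s2 ab da db E; rewrite /E isotropicE.
set u := (delta_mx a 0 + s *: delta_mx d 0 : 'cV[F]_n); set w := delta_mx b 0 : 'cV[F]_n.
have uu : u^T *m u = 0.
  rewrite /u [(_ + _)^T]linearD /= linearZ /= !mulmxDl !mulmxDr -!scalemxAl -!scalemxAr !dot !eqxx.
  rewrite [a == d]eq_sym (negbTE da) !raddf0 ?scaler0 ?addr0 ?add0r scalerA s2.
  by rewrite scaleN1r subrr.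
have uw : u^T *m w = 0.
  by rewrite /u [(_ + _)^T]linearD /= linearZ /= mulmxDl -scalemxAl !dot (negbTE ab) (negbTE db) !raddf0 addr0.
have wu : w^T *m u = 0 by rewrite -[LHS]trmxK trmx_mul trmxK uw trmx0.
have Eu : (u *m w^T - w *m u^T) *m u = 0 by rewrite mulmxBl -!mulmxA wu uu !mulmx0 subrr.
have ww : w^T *m w = 1%:M by rewrite dot eqxx.
have Ew : (u *m w^T - w *m u^T) *m w = u by rewrite mulmxBl -!mulmxA uw ww mulmx0 subr0 mulmx1.
have EE : (u *m w^T - w *m u^T) *m (u *m w^T - w *m u^T) = - (u *m u^T).
  by rewrite mulmxBr !(mulmxA (_ - _)) Eu Ew mul0mx sub0r.
by rewrite -mulmxA EE mulmxN mulmxA Eu mul0mx oppr0.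
Qed.

Lemma isotropic_rotation_skew a b d s : (isotropic_rotation a b d s)^T = - isotropic_rotation a b d s.
Proof.
have rT i j : (rotation F i j)^T = - rotation F i j by rewrite /rotation linearB /= !trmx_delta opprB.
by rewrite /isotropic_rotation [(_ + _)^T]linearD /= linearZ /= !rT scalerN -opprD.
Qed.

Definition isotropic_rotations (E : 'M[F]_n) : Prop := exists a b d s,
  [/\ [/\ a != b, d != a & d != b], s * s = -1 & E = isotropic_rotation a b d s].

(** The choices s = i and s = -i cancel the contribution of the third index, so plane rotations are
    recovered from nilpotent elements. *)
Let rotation_sum a b : a != b -> exists X Y, [/\ bc isotropic_rotations X, bc isotropic_rotations Y &
  2 *: rotation S a b = X + Y].
Proof.
move=> ab; have [d [da db]] := ord_third a b.
exists (mc (isotropic_rotation a b d im)), (mc (isotropic_rotation a b d (- im))); split.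
- by exists (isotropic_rotation a b d im) => //; exists a, b, d, im.
- by exists (isotropic_rotation a b d (- im)) => //; exists a, b, d, (- im); rewrite mulrNN.
rewrite -map_mxD /isotropic_rotation scaleNr addrACA subrr addr0 -mulr2n -scaler_nat map_mxZ rmorph_nat.
by rewrite /rotation map_mxB !map_delta_mx.
Qed.

Lemma isotropic_rotations_orthogonal (X : 'M[S]_n) :
  (forall E, bc isotropic_rotations E -> \tr (X *m E) = 0) -> X^T = X.
Proof.
move=> XE; apply/matrixP => a b; rewrite mxE.
have [->//|ab] := eqVneq a b.
have [P [Q [HP HQ E]]] := rotation_sum ab.
have : \tr (X *m (2 *: rotation S a b)) = 0 by rewrite E mulmxDr mxtraceD !XE// addr0.
have trX i j : \tr (X *m delta_mx i j) = X j i.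
  rewrite /mxtrace (bigD1 j)//= big1 ?addr0 => [|k kj]; rewrite mul_mx_delta ?eqxx ?mulr1//.
  by rewrite (negbTE kj) mulr0.
rewrite -scalemxAr mxtraceZ /rotation mulmxBr raddfB /= !trX => H.
by apply/eqP; rewrite -subr_eq0 -[_ - _](mulKr two_unit) H mulr0.
Qed.

Lemma isotropic_rotations_span (V : 'M[S]_n -> Prop) x a b :
  (forall c x y, V x -> V y -> V (c *: x + y)) ->
  (forall x E, V x -> bc isotropic_rotations E -> V (lie x E)) ->
  V x -> a != b -> V (lie x (rotation S a b)).
Proof.
move=> VL Vlie Vx ab; have [P [Q [HP HQ E]]] := rotation_sum ab.
have -> : rotation S a b = 2^-1 *: (P + Q) by rewrite -E scalerA mulVr// scale1r.
have V0 : V 0 by rewrite -(subrr x) -scaleN1r addrC; exact: VL.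
rewrite lieZr lieDr -[_ *: _]addr0; apply: (VL) => //.
by rewrite -[lie x P]scale1r; apply: VL; exact: Vlie.
Qed.

End Orthogonal.

Section Symplectic.
Variable J : 'M[F]_n.
Hypothesis J_alt : J^T = - J.

Definition symplectic_transvections (E : 'M[F]_n) : Prop := exists v : 'cV[F]_n, E = rank_one J v v.

Let mc_rank v w : mc (rank_one J v w) = rank_one (mc J) (mc v) (mc w).
Proof. by rewrite /rank_one !map_mxM map_trmx. Qed.

Let polar (v w : 'cV[F]_n) : exists X Y Z, [/\ bc symplectic_transvections X, bc symplectic_transvections Y,
  bc symplectic_transvections Z & mc (rank_one J v w + rank_one J w v) = X - Y - Z].
Proof.
exists (mc (rank_one J (v + w) (v + w))), (mc (rank_one J v v)), (mc (rank_one J w w)).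
have gen u : bc symplectic_transvections (mc (rank_one J u u)) by exists (rank_one J u u) => //; exists u.
split; [exact: gen|exact: gen|exact: gen|].
rewrite -!map_mxB; congr (mc _); rewrite /rank_one [(_ + _)^T]linearD /= mulmxDl !mulmxDr !mulmxDl.
move: (v *m _ *m J) (v *m _ *m J) (w *m _ *m J) (w *m _ *m J) => X1 X2 X3 X4.
by apply/matrixP => i j; rewrite !mxE; ring.
Qed.

Lemma transvection_nilpotent v : rank_one J v v *m rank_one J v v = 0.
Proof.
have bvv : v^T *m J *m v = 0.
  apply/matrixP => i j; rewrite !ord1 [RHS]mxE.
  have /matrixP/(_ 0 0) : (v^T *m J *m v)^T = - (v^T *m J *m v).
    by rewrite !trmx_mul trmxK J_alt mulNmx mulmxN mulmxA.
  rewrite mxE [RHS]mxE => /eqP; rewrite -subr_eq0 opprK -mulr2n -mulr_natl mulf_eq0 (negbTE two) /=.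
  by move/eqP.
transitivity (v *m (v^T *m J *m v) *m (v^T *m J)); first by rewrite /rank_one !mulmxA.
by rewrite bvv mulmx0 mul0mx.
Qed.

Lemma transvection_skew v : (rank_one J v v)^T *m J + J *m rank_one J v v = 0.
Proof. by rewrite /rank_one !trmx_mul trmxK J_alt !mulNmx -!mulmxA addNr. Qed.

Lemma symplectic_transvections_orthogonal (X : 'M[S]_n) :
  (forall E, bc symplectic_transvections E -> \tr (X *m E) = 0) -> X^T *m mc J = mc J *m X.
Proof.
move=> XE; pose B := mc J *m X.
have Bvw (v w : 'cV[F]_n) : ((mc w)^T *m B *m mc v) 0 0 + ((mc v)^T *m B *m mc w) 0 0 = 0.
  have trB (x y : 'cV[F]_n) : \tr (X *m mc (rank_one J x y)) = ((mc y)^T *m B *m mc x) 0 0.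
    rewrite mc_rank /rank_one mxtrace_mulC -!mulmxA mxtrace_mulC /mxtrace big_ord1 !mulmxA.
    by [].
  have [P [Q [Z [HP HQ HZ E]]]] := polar v w.
  rewrite -!trB -mxtraceD -mulmxDr -map_mxD addrC [X in mc X]addrC in E *.
  by rewrite E !mulmxBr !raddfB /= !XE// !subr0.
have BT : B^T = - B.
  apply/matrixP => i j; rewrite !mxE.
  have := Bvw (delta_mx i 0) (delta_mx j 0); rewrite !map_delta_mx !trmx_delta -!rowE -!colE !mxE.
  by move/eqP; rewrite addr_eq0 => /eqP ->.
move: BT; rewrite /B trmx_mul map_trmx J_alt map_mxN mulmxN.
by move/oppr_inj.
Qed.

Lemma symplectic_transvections_span (V : 'M[S]_n -> Prop) x (v w : 'cV[S]_n) :
  (forall c x y, V x -> V y -> V (c *: x + y)) ->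
  (forall x E, V x -> bc symplectic_transvections E -> V (lie x E)) ->
  V x -> V (lie x (rank_one (mc J) v w + rank_one (mc J) w v)).
Proof.
move=> VL Vlie Vx.
have V0 : V 0 by rewrite -(subrr x) -scaleN1r addrC; exact: VL.
have VZ c y : V y -> V (c *: y) by move=> Vy; rewrite -[_ *: _]addr0; exact: VL.
have VD y z : V y -> V z -> V (y + z) by move=> Vy; rewrite -[y]scale1r; exact: VL.
pose M := v *m w^T.
have -> : rank_one (mc J) v w + rank_one (mc J) w v = \sum_i \sum_j M i j *:
    mc (rank_one J (delta_mx i 0) (delta_mx j 0) + rank_one J (delta_mx j 0) (delta_mx i 0)).
  have -> : rank_one (mc J) v w + rank_one (mc J) w v = (M + M^T) *m mc J.
    by rewrite /M trmx_mul trmxK mulmxDl.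
  have -> : M + M^T = \sum_i \sum_j M i j *: (delta_mx i j + delta_mx j i).
    rewrite {1}[M]matrix_sum_delta [X in _ + X^T]matrix_sum_delta linear_sum -big_split /=.
    apply: eq_bigr => i _; rewrite linear_sum -big_split; apply: eq_bigr => j _ /=.
    by rewrite linearZ /= trmx_delta scalerDr.
  rewrite mulmx_suml; apply: eq_bigr => i _; rewrite mulmx_suml; apply: eq_bigr => j _.
  rewrite -scalemxAl; congr (_ *: _).
  by rewrite /rank_one !trmx_delta !mul_delta_mx -mulmxDl map_mxM map_mxD !map_delta_mx.
pose Q Z := V (lie x Z).
have Q0 : Q 0 by rewrite /Q /lie mulmx0 mul0mx subrr.
have QD Z Z' : Q Z -> Q Z' -> Q (Z + Z') by rewrite /Q lieDr; exact: VD.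
apply: (big_ind Q) => // i _; apply: (big_ind Q) => // j _.
rewrite /Q lieZr; apply: (VZ).
have [P [P' [P'' [HP HP' HP'' ->]]]] := polar (delta_mx i 0) (delta_mx j 0).
have QN Z : bc symplectic_transvections Z -> Q (- Z).
  by move=> HZ; rewrite /Q -scaleN1r lieZr; apply: VZ; exact: Vlie.
by rewrite !lieDr; apply: (VD); [apply: (VD); [exact: Vlie|exact: QN]|exact: QN].
Qed.

End Symplectic.
End TangentGenerators.

(** * Puiseux series as an instance of the abstract setting *)

Lemma rmorphism_of (S S' : pzRingType) (phi : S -> S') : zmod_morphism phi -> monoid_morphism phi ->
  exists psi : {rmorphism S -> S'}, psi =1 phi.
Proof.
move=> zm mm; pose M1 := GRing.isZmodMorphism.Build S S' phi zm.
pose M2 := GRing.isMonoidMorphism.Build S S' phi mm.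
pose psi : {rmorphism S -> S'} := HB.pack phi M1 M2.
by exists psi.
Qed.

Lemma additive_of (S S' : zmodType) (phi : S -> S') : zmod_morphism phi ->
  exists psi : {additive S -> S'}, psi =1 phi.
Proof.
move=> zm; pose M1 := GRing.isZmodMorphism.Build S S' phi zm.
pose psi : {additive S -> S'} := HB.pack phi M1.
by exists psi.
Qed.

Lemma rmorphism_inverse (S S' : pzRingType) (phi : {rmorphism S -> S'}) : bijective phi ->
  exists psi : {rmorphism S' -> S}, cancel phi psi /\ cancel psi phi.
Proof.
move=> [psi phiK psiK].
have [||psi' psiE] := @rmorphism_of S' S psi.
- by move=> x y; apply: (can_inj phiK); rewrite psiK rmorphB !psiK.
- by split=> [|x y]; apply: (can_inj phiK); rewrite psiK ?rmorph1 ?rmorphM ?psiK.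
by exists psi'; split=> x; rewrite psiE.
Qed.

Section PuiseuxSetting.
Variables (R : realType) (q : R[i]) (qs : nat -> R[i]).
Hypothesis q_neq0 : q != 0.
Hypothesis q_norm : `|q| != 1.
Hypothesis qs_root : forall j, (0 < j)%N -> qs j ^+ j = q.
Hypothesis qs_compat : forall k l, (0 < k)%N -> (0 < l)%N -> qs (l * k)%N ^+ l = qs k.
Local Notation C := R[i].
Local Notation K := {fraction {poly C}}.
Local Notation L := (puiseux C).
Local Notation io := (@puiseux_of_frac C).
Local Notation sL := (puiseux_sigma qs).
Local Notation dL := (@puiseux_delta C).

Lemma normc_q : ComplexField.Normc.normc q != 1.
Proof.
apply: contraNneq q_norm => q1.
by rewrite normc_def; move: q1; case: (q) => a b /= ->.
Qed.

Lemma char0_complex k : k.+1%:R != 0 :> C.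
Proof. by rewrite pnatr_eq0. Qed.

Lemma char0_rational k : k.+1%:R != 0 :> K.
Proof. by rewrite -(rmorph_nat (@FracField.tofrac {poly C})) tofrac_eq0 -polyC_natr polyC_eq0 pnatr_eq0. Qed.

Lemma frac_sigma_rmorphism : exists sK : {rmorphism K -> K}, sK =1 frac_sigma q.
Proof.
have sE x : io (frac_sigma q x) = sL (io x) by rewrite (puiseux_sigma_frac q_neq0 qs_root qs_compat).
have zm := @puiseux_sigma_zmod_morphism C qs.
have mm := puiseux_sigma_monoid_morphism q_neq0 qs_root qs_compat.
have ioB x y : io (x - y) = io x - io y by exact: (rmorphB io).
have ioM x y : io (x * y) = io x * io y by exact: (rmorphM io).
have io1 : io 1 = 1 by exact: (rmorph1 io).
have io_inj : injective io by exact: fmorph_inj.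
apply: rmorphism_of => [x y|].
  by apply: io_inj; rewrite ioB !sE ioB zm.
split=> [|x y]; apply: io_inj; last by rewrite (ioM (frac_sigma q x)) !sE (ioM x) mm.2.
by rewrite sE io1; exact: mm.1.
Qed.

Lemma rational_delta : exists dK : {additive K -> K}, forall x, dL (io x) = io (dK x).
Proof.
have [dK dKE] := choice (@puiseux_delta_frac R).
have io_inj : injective io by exact: fmorph_inj.
have ioB x y : io (x - y) = io x - io y by exact: (rmorphB io).
have [|dK' dK'E] := @additive_of K K dK.
  by move=> x y; apply: io_inj; rewrite ioB -!dKE ioB raddfB.
by exists dK' => x; rewrite dK'E.
Qed.

Lemma rational_embedding : exists rt : {rmorphism rat -> L}, rt =1 ratr.
Proof.
pose rt : {rmorphism rat -> L} := [the {rmorphism rat -> L} of io \o (@FracField.tofrac {poly C} \o (@polyC C \o ratr))].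
by exists rt => x; exact: (fmorph_eq_rat rt x).
Qed.

Lemma sigma_delta x : sL (dL x) = dL (sL x).
Proof. by apply: puiseux_ext; apply/funext => r /=; rewrite mulrCA. Qed.

(** The members of s are rational in some z^(1/j) with one common j, and the powers of z^(1/j) span
    an algebra. *)
Lemma stable_rational_closed (s : seq L) :
  (forall y, y \in s -> kspan io s (sL y) /\ kspan io s (dL y)) ->
  exists e : seq L, (forall x y, x \in e -> y \in e -> kspan io e (x * y)) /\
    forall y, y \in s -> kspan io e y.
Proof.
move=> ss.
have sj y : y \in s -> exists2 j, (0 < j)%N & forall l, (0 < l)%N -> kspan io (tbasis R (l * j)) y.
  move=> ys; apply: rational_kspan q_neq0 normc_q _ _.
  exact: (stable_rational q_neq0 normc_q qs_root qs_compat ss) (kspan_gen _ ys).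
have [j j0 js] : exists2 j, (0 < j)%N & forall y, y \in s -> kspan io (tbasis R j) y.
  have : forall t : seq L, {subset t <= s} ->
      exists2 j, (0 < j)%N & forall l y, (0 < l)%N -> y \in t -> kspan io (tbasis R (l * j)) y.
    elim=> [|x t IH] ts; first by exists 1%N.
    have [j j0 tj] : exists2 j, (0 < j)%N & forall l y, (0 < l)%N -> y \in t -> kspan io (tbasis R (l * j)) y.
      by apply: IH => y yt; apply: ts; rewrite inE yt orbT.
    have [j' j'0 xj] := sj x (ts x (mem_head x t)).
    exists (j * j')%N => [|l y l0]; first by rewrite muln_gt0 j0.
    rewrite inE => /orP[/eqP ->|yt]; first by rewrite mulnA; apply: xj; rewrite muln_gt0 l0.
    by rewrite [(j * j')%N]mulnC mulnA; apply: tj; rewrite // muln_gt0 l0.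
  move=> /(_ s (fun _ => id))[j j0 js]; exists j => // y ys.
  by rewrite -[j]mul1n; exact: js.
exists (tbasis R j); split=> // x y /mapP[k _ ->] /mapP[l _ ->].
rewrite pmonomialM -mulrDl -natrD mulr1.
have -> : (k + l)%:R / j%:R = (k + l)%:Z%:~R / j%:R :> rat by [].
by rewrite -[X in tbasis R X]mul1n; exact: pmonomial_kspan.
Qed.

End PuiseuxSetting.

Lemma mpoly_substitution m (S S' : comNzRingType) (h : {rmorphism S -> S'}) (u : 'I_m -> S') :
  exists phi : {rmorphism mpoly m S -> S'}, [/\ phi =1 mmap h u, forall c, phi (mpolyC m c) = h c &
    forall v, phi (mpolyX S (mnm1 v)) = u v].
Proof.
have [||phi phiE] := @rmorphism_of (mpoly m S) S' (mmap h u); [exact: rmorphB| |].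
  by split; [exact: rmorph1|exact: rmorphM].
by exists phi; split=> // [c|v]; rewrite phiE ?mmapC// mmapX mmap1U.
Qed.

Section Transfer.
Variables (R : realType) (n r : nat) (f : 'I_n -> puiseux R[i]).
Hypothesis rn : (r <= n)%N.
Local Notation K := {fraction {poly R[i]}}.
Local Notation io := (@puiseux_of_frac R[i]).
Local Notation dL := (@puiseux_delta R[i]).

Lemma delta_independent_rows :
  (forall N (p : mpoly #|{: 'I_n * 'I_N}| K), (0 < N)%N ->
     ev_at io (jets dL f) p = 0 -> no_rows r p -> p = 0) ->
  delta_alg_independent (fun i : 'I_r => f (widen_ord rn i)).
Proof.
move=> H N P P0.
(* One more order of derivation than in P, so that the positivity required by the hypothesis also
   covers N = 0. *)
pose m := #|{: 'I_r * 'I_N}|; pose m' := #|{: 'I_n * 'I_N.+1}|.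
pose X (v : 'I_m) : mpoly m K := mpolyX K (mnm1 v); pose X' (v : 'I_m') : mpoly m' K := mpolyX K (mnm1 v).
pose em (v : 'I_m) : 'I_m' :=
  enum_rank (widen_ord rn (enum_val v).1, widen_ord (leqnSn N) (enum_val v).2).
pose back (v : 'I_m') : mpoly m K :=
  if insub ((enum_val v).1 : nat) is Some i then if insub ((enum_val v).2 : nat) is Some j
    then X (enum_rank (i, j)) else 0 else 0.
have [phi [_ phiC phiX]] := mpoly_substitution (@mpolyC m' K) (fun v => X' (em v)).
have [psi [_ psiC psiX]] := mpoly_substitution (@mpolyC m K) back.
have backK v : back (em v) = X v.
  rewrite /back /em enum_rankK /=.
  rewrite (insubT (fun i => i < r)%N (ltn_ord (enum_val v).1)) (insubT (fun i => i < N)%N (ltn_ord (enum_val v).2)).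
  congr (X _); rewrite -[RHS]enum_valK; congr enum_rank.
  by case: (enum_val v) => i j /=; congr (_, _); apply: ord_inj.
have phiK p : psi (phi p) = p.
  pattern p; apply: mpoly_ring_ind => [c|v|p1 p2 E E'|p1 p2 E E'].
  - by rewrite phiC psiC.
  - by rewrite phiX psiX backK.
  - rewrite !rmorphD E E'; reflexivity.
  - rewrite !rmorphM E E'; reflexivity.
have [ev0 [ev0E ev0C ev0X]] := mpoly_substitution io
  (fun l : 'I_m => iter (enum_val l).2 dL (f (widen_ord rn (enum_val l).1))).
have evE p : ev_at io (jets dL f) (phi p) = ev0 p.
  pattern p; apply: mpoly_ring_ind => [c|v|p1 p2 E E'|p1 p2 E E'].
  - by rewrite phiC ev_atC ev0C.
  - by rewrite phiX ev0X ev_atE mmapX mmap1U /em enum_rankK.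
  - rewrite !rmorphD /= E E'; reflexivity.
  - rewrite !rmorphM /= E E'; reflexivity.
suff phi0 : phi P = 0 by rewrite -[P]phiK phi0 rmorph0.
apply: (H N.+1) => //.
  by rewrite evE ev0E.
pose wt (v : 'I_m') := nat_of_bool (r <= (enum_val v).1)%N.
have wP : wsupp wt leq 0 0 (phi P).
  pattern P; apply: mpoly_ring_ind => [c|v|p p' E E'|p p' E E'].
  - by rewrite phiC; apply: wsuppC; exact: leqnn.
  - rewrite phiX.
    have wv : wt (em v) = 0%N by rewrite /wt /em enum_rankK /= leqNgt ltn_ord.
    by have := @wsuppX _ K wt leq leqnn (em v); rewrite wv.
  - rewrite rmorphD; exact: wsuppD.
  - rewrite rmorphM; apply: (wsuppM _ E E') => *; exact: leq_add.
move=> k v kP rv; have := wP k kP.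
rewrite /mwt (bigD1 v)//= /wt rv muln1 !addn0 leqn0 addn_eq0 => /andP[/eqP -> _].
by [].
Qed.

End Transfer.

(** delta(A) is supported on the last row and the last column of A^-1 on the first row, so a single
    product survives in the trace. *)
Lemma companion_trace n' (K : fieldType) (dK : {additive K -> K}) (A Ai : 'M[K]_n'.+1) :
  (forall i j : 'I_n'.+1, i.+1 != n'.+1 -> A i j = (j == i.+1 :> nat)%:R) ->
  A *m Ai = 1%:M -> A ord_max ord0 != 0 -> (forall b : bool, dK b%:R = 0) ->
  \tr (Ai *m map_mx dK A) = dK (A ord_max ord0) / A ord_max ord0.
Proof.
move=> AE AAi al_neq0 dK_nat; set al := A ord_max ord0.
have lastP (k : 'I_n'.+1) : k != ord_max -> k.+1 != n'.+1.
  by move=> kl; apply: contraNneq kl => -[kn]; apply/eqP/ord_inj.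
have colE (k j : 'I_n'.+1) (jk : (j : nat) = k.+1) : Ai j ord_max = (k == ord_max)%:R.
  have kn : k.+1 != n'.+1 by rewrite -jk ltn_eqF.
  have /matrixP/(_ k ord_max) := AAi; rewrite !mxE => <-.
  rewrite (bigD1 j)//= AE// jk eqxx mul1r big1 ?addr0// => l lj.
  by rewrite AE// -jk (negbTE lj : (nat_of_ord l == j) = false) mul0r.
have col0 (j : 'I_n'.+1) : j != ord0 -> Ai j ord_max = 0.
  move=> j0; have jS : (j.-1 < n'.+1)%N by apply: leq_ltn_trans (ltn_ord j); exact: leq_pred.
  have jE : (j : nat) = (Ordinal jS).+1 by rewrite /= prednK// lt0n.
  rewrite (colE _ _ jE); case: eqP => // /(congr1 (@nat_of_ord _)) /= jm.
  by have := ltn_ord j; rewrite jE /= jm ltnn.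
have Ai0 : Ai ord0 ord_max = al^-1.
  apply: (mulfI al_neq0); rewrite mulfV//.
  have /matrixP/(_ ord_max ord_max) := AAi; rewrite !mxE eqxx (bigD1 ord0)//= big1 ?addr0//.
  by move=> k k0; rewrite col0// mulr0.
rewrite /mxtrace (bigD1 ord0)//= big1 ?addr0 => [|i i0].
  rewrite mxE (bigD1 ord_max)//= Ai0 mxE mulrC big1 ?addr0// => k kl.
  by rewrite [X in _ * X]mxE (AE _ _ (lastP _ kl)) dK_nat mulr0.
rewrite mxE big1 => [//|k _]; have [->|kl] := eqVneq k ord_max; first by rewrite col0// mul0r.
by rewrite [X in _ * X]mxE (AE _ _ (lastP _ kl)) dK_nat mulr0.
Qed.

(** The inverse is the operator attached to q^-1 with the inverse roots; both compositions are
    checked on Puiseux series. *)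
Lemma frac_sigma_iso (R : realType) (q : R[i]) (qs : nat -> R[i]) : q != 0 ->
  (forall j, (0 < j)%N -> qs j ^+ j = q) ->
  (forall k l, (0 < k)%N -> (0 < l)%N -> qs (l * k)%N ^+ l = qs k) ->
  exists sK sKi : {rmorphism {fraction {poly R[i]}} -> {fraction {poly R[i]}}},
    sK =1 frac_sigma q /\ cancel sKi sK.
Proof.
move=> q0 qr qc; have [sK sKE] := frac_sigma_rmorphism q0 qr qc.
pose qs' j := (qs j)^-1; have q'0 : q^-1 != 0 by rewrite invr_eq0.
have qr' j : (0 < j)%N -> qs' j ^+ j = q^-1 by move=> j0; rewrite /qs' exprVn qr.
have qc' k l : (0 < k)%N -> (0 < l)%N -> qs' (l * k)%N ^+ l = qs' k.
  by move=> k0 l0; rewrite /qs' exprVn qc.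
have qp r : qpow qs' r = (qpow qs r)^-1 by rewrite /qpow exprz_inv invr_expz.
have qp0 r : qpow qs r != 0 by exact: (qpow_neq0 q0 qr).
have io_inj : injective (@puiseux_of_frac R[i]) by exact: fmorph_inj.
have K1 x : frac_sigma q (frac_sigma q^-1 x) = x.
  apply: io_inj; rewrite -(puiseux_sigma_frac q0 qr qc) -(puiseux_sigma_frac q'0 qr' qc').
  by apply: puiseux_ext; apply/funext => r /=; rewrite qp mulVKf.
have K2 x : frac_sigma q^-1 (frac_sigma q x) = x.
  apply: io_inj; rewrite -(puiseux_sigma_frac q'0 qr' qc') -(puiseux_sigma_frac q0 qr qc).
  by apply: puiseux_ext; apply/funext => r /=; rewrite qp mulKf.
have [|sKi [_ sKK]] := @rmorphism_inverse _ _ sK.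
  by exists (frac_sigma q^-1) => x; rewrite sKE ?K1 ?K2.
by exists sK, sKi.
Qed.

(** * Linear q-difference equations *)

Section QDifferenceEquation.
Variables (R : realType) (q : R[i]) (qs : nat -> R[i]).
Hypothesis q_neq0 : q != 0.
Hypothesis q_norm : `|q| != 1.
Hypothesis qs_root : forall j, (0 < j)%N -> qs j ^+ j = q.
Hypothesis qs_compat : forall k l, (0 < k)%N -> (0 < l)%N -> qs (l * k)%N ^+ l = qs k.
Variable n' : nat.
Local Notation n := n'.+1.
Local Notation C := R[i].
Local Notation K := {fraction {poly C}}.
Local Notation L := (puiseux C).
Local Notation io := (@puiseux_of_frac C).
Local Notation dL := (@puiseux_delta C).
Variable a : 'I_n.+1 -> K.
Hypothesis a_neq0 : a ord0 * a ord_max != 0.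
Local Notation A := (companion_mx a).
Variables (V : PicardVessiot q A) (Q : total_quotient_ring V).
Variable g : L.
Hypothesis g_neq0 : g != 0.
Hypothesis g_sol : \sum_(i < n.+1) io (a i) * iter i (puiseux_sigma qs) g = 0.
Variables (sK sKi : {rmorphism K -> K}) (sL : {rmorphism L -> L}) (dK : {additive K -> K}) (rt : {rmorphism rat -> L}).
Hypothesis sLE : sL =1 puiseux_sigma qs.
Hypothesis rtE : rt =1 ratr.
Hypothesis sKE : sK =1 frac_sigma q.
Hypothesis sKK : cancel sKi sK.
Hypothesis io_d : forall x, dL (io x) = io (dK x).
Let sR : {rmorphism V -> V} := pv_sigma V.
Variable sRi : {rmorphism V -> V}.
Hypothesis sRiK : cancel sR sRi.
Let inc : {rmorphism K -> V} := in_alg V.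
Local Notation U := (pv_sol V).
Local Notation Ai := (invmx A).
Local Notation Ui := (invmx U).
Local Notation G := (galois_group Q).

Definition solution_shift (i : 'I_n) : L := iter i (puiseux_sigma qs) g.
Local Notation f := solution_shift.

Let an0 : a ord_max != 0.
Proof. by move: a_neq0; rewrite mulf_eq0 negb_or => /andP[_ an]; exact: an. Qed.
Let a00 : a ord0 != 0.
Proof. by move: a_neq0; rewrite mulf_eq0 negb_or => /andP[a0 _]; exact: a0. Qed.

Let dLM x y : dL (x * y) = dL x * y + x * dL y. Proof. exact: puiseux_deltaM. Qed.

Let io_s x : sL (io x) = io (sK x).
Proof. by rewrite sKE -(puiseux_sigma_frac q_neq0 qs_root qs_compat) sLE. Qed.

Let sd x : sL (dL x) = dL (sL x). Proof. by rewrite !sLE; exact: sigma_delta. Qed.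

Let log_dec (al : L) : al != 0 -> exists d u, exists m : rat,
  [/\ d != 0, u != 0, dL u = rt m * u & al * d = u * sL d].
Proof.
move=> /(log_decomposition (normc_q q_norm) qs_root qs_compat)[d [u [m [d0 u0 du alE]]]].
by exists d, u, m; rewrite rtE sLE.
Qed.

Let dL_eq0 u : dL u = 0 -> exists c, u = io c. Proof. exact: delta_eq0. Qed.

Let sL_fixed u : sL u = u -> dL u = 0.
Proof. by rewrite sLE; exact: (sigma_fixed_delta (normc_q q_norm) qs_root qs_compat). Qed.

Let sL_coboundary u r : sL u - u = rt r -> r = 0.
Proof. by rewrite sLE rtE; exact: sigma_coboundary_rat. Qed.

Let stable_closed (s : seq L) : (forall y, y \in s -> kspan io s (sL y) /\ kspan io s (dL y)) ->
  exists e : seq L, (forall x y, x \in e -> y \in e -> kspan io e (x * y)) /\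
    forall y, y \in s -> kspan io e y.
Proof.
move=> ss; apply: (stable_rational_closed q_neq0 q_norm qs_root qs_compat) => y ys.
by rewrite -sLE; exact: ss.
Qed.

Let UUi : U *m Ui = 1%:M. Proof. exact: mulmxV (pv_sol_unit V). Qed.
Let UiU : Ui *m U = 1%:M. Proof. exact: mulVmx (pv_sol_unit V). Qed.
Let sU : map_mx sR U = map_mx inc A *m U. Proof. exact: pv_solE. Qed.
Let sR_inc x : sR (inc x) = inc (sK x). Proof. by rewrite sKE; exact: pv_sigma_ext. Qed.

Let A_unit : A \in unitmx.
Proof.
have dU : \det U \is a GRing.unit by rewrite -unitmxE; exact: pv_sol_unit.
rewrite unitmxE unitfE; apply/eqP => dA0.
have := congr1 determinant sU; rewrite det_mulmx !det_map_mx dA0 rmorph0 mul0r => /eqP.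
by move: (rmorph_unit sR dU) => /[swap] /eqP ->; rewrite unitr0.
Qed.

Let AAi : A *m Ai = 1%:M. Proof. exact: mulmxV A_unit. Qed.
Let AiA : Ai *m A = 1%:M. Proof. exact: mulVmx A_unit. Qed.

Let f_neq0 i : f i != 0.
Proof. by rewrite /f; elim: (i : nat) => //= m IH; rewrite -sLE fmorph_eq0. Qed.

Let sf i : sL (f i) = \sum_j io (A i j) * f j.
Proof.
have ioM x y : io (x * y) = io x * io y by exact: (rmorphM io).
have [il|il] := eqVneq i.+1 n.
  have := g_sol; rewrite big_ord_recr /= => /eqP; rewrite addrC addr_eq0 => /eqP E.
  have io_eq0 x : (io x == 0) = (x == 0) by exact: (fmorph_eq0 io).
  have an : io (a ord_max) != 0 by rewrite io_eq0; exact: an0.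
  apply: (mulfI an); rewrite sLE -[puiseux_sigma qs (f i)]/(iter i.+1 (puiseux_sigma qs) g) il E mulr_sumr -sumrN.
  have ioN x : io (- x) = - io x by exact: (raddfN io).
  have aA j : a ord_max * A i j = - a (widen_ord (leqnSn n) j).
    by rewrite mxE il eqxx mulrN [a ord_max * _]mulrC (divfK an0).
  apply: eq_bigr => j _; rewrite mulrA -(ioM (a ord_max)) aA ioN mulNr; reflexivity.
have iln : (i.+1 < n)%N by rewrite ltn_neqAle il ltn_ord.
rewrite (bigD1 (Ordinal iln))//= mxE (negbTE il) eqxx rmorph1 mul1r big1 ?addr0// => j ji.
by rewrite mxE (negbTE il) -[(j == i.+1 :> nat)]/(j == Ordinal iln) (negbTE ji) rmorph0 mul0r.
Qed.

Local Notation c := (Ai *m map_mx dK A).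
Let al := A ord_max ord0.

Let al_neq0 : al != 0.
Proof.
have -> : al = - (a ord0 / a ord_max).
  rewrite /al mxE eqxx; congr (- (a _ / _)); exact: ord_inj.
rewrite oppr_eq0 mulf_eq0 invr_eq0 negb_or; apply/andP; exact: (conj a00 an0).
Qed.

Let A_shift (i j : 'I_n) : i.+1 != n -> A i j = (j == i.+1 :> nat)%:R.
Proof. by move=> il; rewrite mxE (negbTE il). Qed.

Let dK_nat (b : bool) : dK b%:R = 0.
Proof.
have io_inj : injective io by exact: fmorph_inj.
have io_nat k : io k%:R = k%:R by exact: (rmorph_nat io).
apply: io_inj; rewrite -io_d io_nat -(mulr0n 1) io_nat; case: b; last by rewrite raddf0.
by apply: (addrI (dL 1)); rewrite addr0 -{3}[1]mulr1 dLM mulr1 mul1r.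
Qed.

Let tr_c : io (\tr c) = dL (io al) / io al.
Proof.
have ioM x y : io (x / y) = io x / io y by exact: (fmorph_div io).
by rewrite (companion_trace A_shift AAi al_neq0 dK_nat) io_d ioM.
Qed.

Section Tangent.
Variable EE : 'M[C]_n -> Prop.
Local Notation EEV := (base_change (constant V) EE).
Hypothesis EE_group : forall E t, EE E -> G (1%:M + t *: E + (t ^+ 2 / 2) *: (E *m E)).
Hypothesis EE_det : forall E t, EE E -> \det (1%:M + t *: E + (t ^+ 2 / 2) *: (E *m E)) = 1.

Let EEV_fixed X : EEV X -> map_mx sR X = X.
Proof. by move=> [E _ ->]; apply/matrixP => i j; rewrite !mxE; exact: pv_sigma_constant. Qed.

Let EEV_der X : EEV X -> exists D : {additive V -> V},
  [/\ forall x y, D (x * y) = D x * y + x * D y, forall c, D (inc c) = 0,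
      forall x, sR x = x -> D x = 0 & map_mx D U = U *m X].
Proof.
move=> [E EE_E ->]; have [||D [DM Dc DsR DU]] := @galois_derivation C q q_neq0 n A V Q E (@char0_complex R).
- by move=> t; exact: EE_group.
- by move=> t; exact: EE_det.
by exists D.
Qed.

Local Notation T := (tangent inc U Ui EEV).

Let T_lift := @tangent_lift n K V sK sR inc (@pv_sigma_simple _ _ _ _ V) sR_inc A Ai U Ui AAi UUi UiU sU EEV EEV_der.

Lemma full_tangent_criterion :
  (forall y, annihilator_span inc U Ui EEV y -> map_mx sR y = y -> exists a, y = a%:M) ->
  forall Y, \tr Y = 0 -> T Y.
Proof.
exact: (@tangent_full n K V sK sR inc (@pv_sigma_simple _ _ _ _ V) sR_inc A Ai U Ui AAi UUi UiU sU EEV EEV_fixed).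
Qed.

Lemma full_tangent_lie y E : annihilator_span inc U Ui EEV y -> EEV E ->
  annihilator_span inc U Ui EEV (lie y E).
Proof.
exact: (@annihilator_span_lie n K V sK sR inc (@pv_sigma_simple _ _ _ _ V) sR_inc A Ai U Ui AAi UUi UiU sU EEV EEV_fixed EEV_der).
Qed.

Lemma full_tangent_independent : (forall Y, \tr Y = 0 -> T Y) -> (1 < n)%N ->
  forall N (p : mpoly #|{: 'I_n * 'I_N}| K), (0 < N)%N -> ev_at io (jets dL f) p = 0 -> p = 0.
Proof.
move=> TH n1 N p.
pose lift M PP P0 PL Pt Pf Y (tY : \tr Y = 0) := @T_lift M c PP P0 PL Pt Pf Y (TH Y tY).
exact: (@special_linear_independent K L io sK sKi sL dK dL dLM sKK io_s io_d sd (@char0_rational R) rt log_dec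
  dL_eq0 sL_fixed sL_coboundary stable_closed n A Ai f AAi AiA sf f_neq0 n1 al al_neq0 tr_c lift).
Qed.

Lemma form_tangent_independent (eta : K) (J : 'M[K]_n) (kappa : K) :
  J \in unitmx -> J^T = eta *: J -> kappa != 0 -> A^T *m map_mx sK J *m A = kappa *: J ->
  (forall Y, T Y <-> Y^T *m J + J *m Y = 0) ->
  (eta = 1 -> (2 < n)%N -> forall N (p : mpoly #|{: 'I_n * 'I_N}| K), (0 < N)%N ->
     ev_at io (jets dL f) p = 0 -> no_rows n' p -> p = 0) /\
  (eta = -1 -> (1 < n)%N -> forall N (p : mpoly #|{: 'I_n * 'I_N}| K), (0 < N)%N ->
     ev_at io (jets dL f) p = 0 -> p = 0).
Proof.
move=> Ju Js k0 Jk TJ.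
pose lift M PP P0 PL Pt Pf Y (sY : skew J Y) := @T_lift M c PP P0 PL Pt Pf Y ((TJ Y).2 (iffLR (skewE Ju _) sY)).
split=> eE n1 N p.
  exact: (@orthogonal_independent K L io sK sKi sL dK dL dLM sKK io_s io_d sd (@char0_rational R)
    rt log_dec dL_eq0 sL_fixed sL_coboundary stable_closed n' A Ai f AAi AiA sf f_neq0 J eta kappa Ju Js k0 Jk
    lift N p eE n1).
exact: (@symplectic_independent K L io sK sKi sL dK dL dLM sKK io_s io_d sd (@char0_rational R)
  rt log_dec dL_eq0 sL_fixed sL_coboundary stable_closed n' A Ai f AAi AiA sf f_neq0 J eta kappa Ju Js k0 Jk
  lift N p eE n1).
Qed.

Section Dichotomy.
Variables (J0 J0i : 'M[C]_n) (eta : C).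
Hypothesis J0J0i : J0 *m J0i = 1%:M.
Hypothesis J0iJ0 : J0i *m J0 = 1%:M.
Hypothesis J0_tr : J0^T = eta *: J0.
Hypothesis EE_skew : forall E, EE E -> E^T *m J0 + J0 *m E = 0.
Local Notation J0V := (map_mx (constant V) J0).
Hypothesis EE_sym : forall X : 'M[V]_n, (forall E, EEV E -> \tr (X *m E) = 0) -> X^T *m J0V = J0V *m X.
Hypothesis EE_generates : forall W : 'M[V]_n -> Prop,
  (forall c x y, W x -> W y -> W (c *: x + y)) ->
  (forall x E, W x -> EEV E -> W (lie x E)) ->
  forall y, W y -> map_mx sR y = y -> y^T *m J0V = J0V *m y -> ~ (exists a, y = a%:M) ->
  forall p, (forall w, W w -> p *m w = w *m p) -> exists a, p = a%:M.

Lemma tangent_cases : (forall Y, \tr Y = 0 -> T Y) \/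
  exists (J : 'M[K]_n) (kappa : K), [/\ J \in unitmx, J^T = (FracField.tofrac eta%:P) *: J, kappa != 0,
    A^T *m map_mx sK J *m A = kappa *: J & forall Y, T Y <-> Y^T *m J + J *m Y = 0].
Proof.
have J0V_tr : J0V^T = inc (FracField.tofrac eta%:P) *: J0V.
  rewrite map_trmx J0_tr; exact: (map_mxZ (constant V) eta J0).
apply: (@tangent_dichotomy n K V sK sR sRi inc sRiK (@pv_sigma_simple _ _ _ _ V) sR_inc A Ai U Ui AAi AiA UUi UiU
  sU EEV EEV_fixed EEV_der _ J0V (map_mx (constant V) J0i) (@char0_rational R 1) isT _ _ _ _ _ EE_sym EE_generates).
- by rewrite -map_mxM J0J0i map_mx1.
- by rewrite -map_mxM J0iJ0 map_mx1.
- by apply/matrixP => i j; rewrite !mxE; exact: pv_sigma_constant.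
- exact: J0V_tr.
- by move=> _ [E EE_E ->]; rewrite map_trmx -!map_mxM -map_mxD EE_skew// map_mx0.
Qed.

End Dichotomy.
End Tangent.

Let nat_unit k : (k.+1%:R : V) \is a GRing.unit.
Proof.
have -> : k.+1%:R = constant V k.+1%:R by rewrite rmorph_nat.
by rewrite rmorph_unit// unitfE char0_complex.
Qed.

Let fixed_unit (x : V) : sR x = x -> x != 0 -> x \is a GRing.unit.
Proof. exact: sigma_fixed_unit (@pv_sigma_simple _ _ _ _ V). Qed.

Let V_in_G C0 : derived_subgroup (neutral_component G) C0 -> G C0.
Proof. by apply: derived_subgroup_sub; exact: galois_group_subgroup. Qed.

Local Notation Gder := (derived_subgroup (neutral_component G)).
Local Notation independent r := (forall N (p : mpoly #|{: 'I_n * 'I_N}| K), (0 < N)%N ->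
     ev_at io (jets dL f) p = 0 -> no_rows r p -> p = 0).

(** Transvections generate enough: orthogonality to all E_xy makes the annihilator diagonal, and its
    stability under brackets with E_x0 makes it scalar. *)
Lemma SL_independent : (1 < n)%N -> Gder = SL C n -> independent n.
Proof.
move=> n1 GE; pose EE (E : 'M[C]_n) := exists x y : 'I_n, x != y /\ E = delta_mx x y.
have E2 (x y : 'I_n) (t : C) : x != y ->
    1%:M + t *: delta_mx x y + (t ^+ 2 / 2) *: (delta_mx x y *m delta_mx x y) = 1%:M + t *: delta_mx x y.
  by move=> xy; rewrite mul_delta_mx_0 ?scaler0 ?addr0// eq_sym.
have EE_det E t : EE E -> \det (1%:M + t *: E + (t ^+ 2 / 2) *: (E *m E)) = 1.
  by move=> [x [y [xy ->]]]; rewrite E2// det_transvection.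
have EE_group E t : EE E -> G (1%:M + t *: E + (t ^+ 2 / 2) *: (E *m E)).
  by move=> EE_E; apply: V_in_G; rewrite GE; exact: EE_det.
move=> N p N0 ev0 _; apply: (full_tangent_independent EE_group EE_det _ n1 N0 ev0).
apply: full_tangent_criterion => y Wy _.
have tr0 Z x x' : annihilator_span inc U Ui (base_change (constant V) EE) Z -> x != x' -> Z x' x = 0.
  move=> WZ xx'; transitivity (\tr (Z *m delta_mx x x')).
    rewrite /mxtrace (bigD1 x')//= big1 ?addr0 => [|k kx]; rewrite mul_mx_delta ?eqxx ?mulr1//.
    by rewrite (negbTE kx) mulr0.
  move: WZ; apply: (@span_ind_sub _ _ _ (fun Z => \tr (Z *m delta_mx x x') = 0)).
  - by rewrite mul0mx mxtrace0.
  - by move=> s X Y X0 Y0; rewrite mulmxDl -scalemxAl mxtraceD mxtraceZ X0 Y0 mulr0 addr0.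
  move=> _ [M annM ->]; apply: annM; exists (delta_mx x x'); first by exists x, x'.
  by rewrite map_delta_mx.
exists (y ord0 ord0); apply/matrixP => x x'; rewrite mxE; case: eqVneq => [<-|xx']; last first.
  by rewrite mulr0n; apply: tr0 => //; rewrite eq_sym.
rewrite mulr1n; have [->//|x0] := eqVneq x ord0.
have Ex : base_change (constant V) EE (delta_mx x ord0).
  by exists (delta_mx x ord0); [exists x, ord0|rewrite map_delta_mx].
have := tr0 _ ord0 x (full_tangent_lie EE_group EE_det Wy Ex); rewrite eq_sym => /(_ x0).
rewrite /lie mxE [X in _ + X]mxE mul_mx_delta mul_delta_mx_l !eqxx mulr1 mul1r.
by move/eqP; rewrite subr_eq0 => /eqP.
Qed.

Let exp_form (E J0 : 'M[C]_n) t : E *m E *m E = 0 -> E^T *m J0 + J0 *m E = 0 -> J0 \in unitmx ->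
  let X := 1%:M + t *: E + (t ^+ 2 / 2) *: (E *m E) in X^T *m J0 *m X = J0 /\ \det X = 1.
Proof.
move=> E3 EJ Ju; split; first exact: (nilpotent_exp_form (char0_complex R 1) E3 EJ).
exact: (nilpotent_exp_det (char0_complex R 1) E3 EJ).
Qed.

Let tofracN1 : FracField.tofrac (-1 : C)%:P = -1 :> K.
Proof. by rewrite polyCN tofracN polyC1 tofrac1. Qed.

Lemma SO_independent : (2 < n)%N -> Gder = SO C n -> independent n'.
Proof.
move=> n2 GE; pose EE := @isotropic_rotations C n.
have im2 : 'i * 'i = -1 :> C by rewrite -expr2 sqrCi.
have EEs E : EE E -> E^T *m 1%:M + 1%:M *m E = 0.
  by move=> [x [y [d [s [_ _ ->]]]]]; rewrite mulmx1 mul1mx isotropic_rotation_skew addNr.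
have expE E t : EE E -> let X := 1%:M + t *: E + (t ^+ 2 / 2) *: (E *m E) in X^T *m 1%:M *m X = 1%:M /\ \det X = 1.
  move=> EE_E; apply: exp_form; [|exact: EEs|exact: unitmx1].
  by case: EE_E => x [y [d [s [[xy dx dy] s2 ->]]]]; exact: isotropic_rotation_nilpotent.
have EE_det E t : EE E -> \det (1%:M + t *: E + (t ^+ 2 / 2) *: (E *m E)) = 1.
  by move=> /(expE _ t)[].
have EE_group E t : EE E -> G (1%:M + t *: E + (t ^+ 2 / 2) *: (E *m E)).
  move=> EE_E; apply: V_in_G; rewrite GE; split; first exact: EE_det.
  by have [] := expE _ t EE_E; rewrite mulmx1.
have two := char0_complex R 1.
have [||||||H|[J [kappa [Ju Js k0 Jk TJ]]]] := tangent_cases EE_group EE_det (J0 := 1%:M) (J0i := 1%:M) (eta := 1).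
- exact: mulmx1.
- exact: mulmx1.
- by rewrite trmx1 scale1r.
- exact: EEs.
- by move=> X XE; rewrite map_mx1 mulmx1 mul1mx; exact: (isotropic_rotations_orthogonal two n2 im2 XE).
- move=> W WL Wlie y Wy sy; rewrite map_mx1 mulmx1 mul1mx => ys ny.
  apply: (orthogonal_generates fixed_unit nat_unit WL Wy sy ny n2) => // x b d Wx bd.
  exact: (isotropic_rotations_span two n2 im2 WL Wlie Wx bd).
- move=> N p N0 ev0 _; exact: (full_tangent_independent EE_group EE_det H (ltnW n2) N0 ev0).
have [ind _] := form_tangent_independent EE_group EE_det Ju Js k0 Jk TJ.
by apply: ind => //; rewrite polyC1 tofrac1.
Qed.

Lemma Sp_independent : ~~ odd n -> Gder = Sp C n -> independent n.
Proof.
move=> n_even GE; pose J0 := @symplectic_form C n; pose EE := symplectic_transvections J0.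
have J0_tr : J0^T = - J0 by exact: symplectic_form_tr.
have J0J0 : J0 *m - J0 = 1%:M by rewrite mulmxN symplectic_form_sqr// opprK.
have J0J0' : - J0 *m J0 = 1%:M by rewrite mulNmx symplectic_form_sqr// opprK.
have J0u : J0 \in unitmx by case: (mulmx1_unit J0J0).
have two := char0_complex R 1.
have EEs E : EE E -> E^T *m J0 + J0 *m E = 0 by move=> [v ->]; exact: transvection_skew.
have expE E t : EE E -> let X := 1%:M + t *: E + (t ^+ 2 / 2) *: (E *m E) in X^T *m J0 *m X = J0 /\ \det X = 1.
  move=> EE_E; apply: exp_form => //; last exact: EEs.
  by case: EE_E => v ->; rewrite transvection_nilpotent// mul0mx.
have EE_det E t : EE E -> \det (1%:M + t *: E + (t ^+ 2 / 2) *: (E *m E)) = 1.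
  by move=> /(expE _ t)[].
have EE_group E t : EE E -> G (1%:M + t *: E + (t ^+ 2 / 2) *: (E *m E)).
  move=> EE_E; apply: V_in_G; rewrite GE; have [fE dE] := expE _ t EE_E; split=> //.
  by rewrite /= unitmxE dE unitr1.
have n1 : (1 < n)%N by case: (n') n_even.
have J0V_tr : (map_mx (constant V) J0)^T = - map_mx (constant V) J0 by rewrite map_trmx J0_tr map_mxN.
have [||||||H|[J [kappa [Ju Js k0 Jk TJ]]]] := tangent_cases EE_group EE_det (J0 := J0) (J0i := - J0) (eta := -1).
- exact: J0J0.
- exact: J0J0'.
- by rewrite scaleN1r.
- exact: EEs.
- by move=> X XE; exact: (symplectic_transvections_orthogonal J0_tr XE).
- move=> W WL Wlie y Wy sy ys ny p pW.
  apply: (symplectic_generates fixed_unit nat_unit WL Wy sy ny (J := map_mx (constant V) J0)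
    (Ji := map_mx (constant V) (- J0)) _ _ J0V_tr _ _ ys pW).
  + by rewrite -map_mxM J0J0 map_mx1.
  + by rewrite -map_mxM J0J0' map_mx1.
  + by apply/matrixP => i j; rewrite !mxE; exact: pv_sigma_constant.
  + by move=> x v w Wx; exact: (symplectic_transvections_span v w WL Wlie Wx).
- move=> N p N0 ev0 _; exact: (full_tangent_independent EE_group EE_det H n1 N0 ev0).
have [_ ind] := form_tangent_independent EE_group EE_det Ju Js k0 Jk TJ.
by move=> N p N0 ev0 _; apply: ind => //; rewrite tofracN1.
Qed.

End QDifferenceEquation.

Theorem corollary3p2 (R : realType) (q : R[i]) (qs : nat -> R[i])
  (q_neq0 : q != 0) (q_norm : `|q| != 1)
  (qs_root : forall j, (0 < j)%N -> qs j ^+ j = q)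
  (qs_compat : forall k l, (0 < k)%N -> (0 < l)%N -> qs (l * k)%N ^+ l = qs k)
  (n : nat) (n_ge1 : (1 <= n)%N) (a : 'I_n.+1 -> {fraction {poly R[i]}})
  (a_neq0 : a ord0 * a ord_max != 0)
  (V : PicardVessiot q (companion_mx a)) (Q : total_quotient_ring V)
  (g : puiseux R[i]) (g_neq0 : g != 0)
  (g_sol : \sum_(i < n.+1)
     puiseux_of_frac (a i) * iter i (puiseux_sigma qs) g = 0) :
  let G := galois_group Q in
  let Gder := derived_subgroup (neutral_component G) in
  [/\ (2 <= n)%N -> Gder = SL R[i] n ->
        delta_alg_independent (fun i : 'I_n => iter i (puiseux_sigma qs) g),
      (3 <= n)%N -> Gder = SO R[i] n ->
        delta_alg_independent (fun i : 'I_n.-1 => iter i (puiseux_sigma qs) g) &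
      ~~ odd n -> Gder = Sp R[i] n ->
        delta_alg_independent (fun i : 'I_n => iter i (puiseux_sigma qs) g)].
Proof.
have [sK [sKi [sKE sKK]]] := frac_sigma_iso q_neq0 qs_root qs_compat.
have [dK io_d] := rational_delta R.
have [rt rtE] := rational_embedding R.
have [sRi [sRiK _]] := rmorphism_inverse (pv_sigma_bij V).
pose sL := sigmaL q_neq0 qs_root qs_compat.
have sLE : sL =1 puiseux_sigma qs by [].
(* The companion matrix is indexed by n'.+1, so that n - 1, the number of independent functions in
   the orthogonal case, becomes n'. *)
case: n n_ge1 a a_neq0 V Q g_sol sRi sRiK => // n' _ a' a'0 V' Q' g_sol' sRi' sRiK'.
have rows r (rn : (r <= n'.+1)%N) := @delta_independent_rows R n'.+1 r (solution_shift qs g) rn.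
move=> G Gder; split=> [n2|n3|n_even] GE.
- have ind := @SL_independent R q qs q_neq0 q_norm qs_root qs_compat n' a' a'0 V' Q' g g_neq0 g_sol'
    sK sKi sL dK rt sLE rtE sKE sKK io_d n2 GE.
  exact: (rows _ (leqnn _) ind).
- have ind := SO_independent q_neq0 q_norm qs_root qs_compat a'0 g_neq0 g_sol' sLE rtE sKE sKK io_d sRiK' n3 GE.
  exact: (rows _ (leqnSn n') ind).
- have ind := Sp_independent q_neq0 q_norm qs_root qs_compat a'0 g_neq0 g_sol' sLE rtE sKE sKK io_d sRiK' n_even GE.
  exact: (rows _ (leqnn _) ind).
Qed.
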